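(* Let $m_0\ge 4$ be an integer and suppose that the solution $(\psi,\phi)$ of the periodic Klein-Gordon-Schrödinger problem on $\Omega=(a,b)$ described in the context satisfies the regularity assumption (A) of the context on $[0,T]$, with bounds uniform in $\varepsilon\in(0,1]$. Let $\Phi^n,\dot\Phi^n,\Psi^n$ be the numerical solution produced by the MTI-FP scheme of the context with time step $\tau$ and mesh size $h=(b-a)/N$, and set $\phi_I^n=I_N\Phi^n$, $\dot\phi_I^n=I_N\dot\Phi^n$, $\psi_I^n=I_N\Psi^n$, and $$e_\phi^n=\phi(\cdot,t_n)-\phi_I^n,\qquad e_\psi^n=\psi(\cdot,t_n)-\psi_I^n,\qquad \dot e_\phi^n=\partial_t\phi(\cdot,t_n)-\dot\phi_I^n .$$ Then there exist constants $0<h_0\le 1$ and $0<\tau_0\le 1$, sufficiently small and independent of $\varepsilon$, and a constant $C>0$ independent of $\varepsilon,\tau,h,n$, such that for every $0<\varepsilon\le 1$, whenever $0<h\le h_0$ and $0<\tau\le\tau_0$, for all integers $0\le n\le T/\tau$: $$\|e_\phi^n\|_{H^2}+\|e_\psi^n\|_{H^2}+\varepsilon^2\|\dot e_\phi^n\|_{H^2}\le C\Big(h^{m_0}+\frac{\tau^2}{\varepsilon^2}\Big),$$ $$\|e_\phi^n\|_{H^2}+\|e_\psi^n\|_{H^2}+\varepsilon^2\|\dot e_\phi^n\|_{H^2}\le C\big(h^{m_0}+\varepsilon^2\big),$$ $$\|\phi_I^n\|_{H^2}\le C_\phi+1,\qquad \|\psi_I^n\|_{H^2}\le C_\psi+1,\qquad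 \|\dot\phi_I^n\|_{H^2}\le\frac{C_\phi+1}{\varepsilon^2}.$$ Consequently, uniformly in $\varepsilon\in(0,1]$ and for $0\le n\le T/\tau$, $$\|e_\phi^n\|_{H^2}+\|e_\psi^n\|_{H^2}+\varepsilon^2\|\dot e_\phi^n\|_{H^2}\le C\Big(h^{m_0}+\min\Big\{\frac{\tau^2}{\varepsilon^2},\varepsilon^2\Big\}\Big)\le C\,(h^{m_0}+\tau).$$
   Context: **Problem.** For $0<\varepsilon\le1$ and $\Omega=(a,b)$, $(\psi,\phi)$ (depending on $\varepsilon$; $\psi$ complex-valued, $\phi$ real-valued) solves, with periodic boundary conditions at $a,b$, $$i\partial_t\psi+\partial_{xx}\psi+\phi\psi=0,\qquad \varepsilon^2\partial_{tt}\phi-\partial_{xx}\phi+\tfrac1{\varepsilon^2}\phi=|\psi|^2,\qquad x\in\Omega,\ t>0,$$ $$\psi(x,0)=\psi_0(x),\quad \phi(x,0)=\phi_0(x),\quad \partial_t\phi(x,0)=\phi_1(x)/\varepsilon^2,$$ with $\psi_0$ complex-valued, $\phi_0,\phi_1$ real-valued, all independent of $\varepsilon$. Here $0<T<T^*$, where $T^*$ is the maximal existence time of the solution. **Assumption (A).** With $H^m_p(\Omega)=\{f\in H^m(\Omega): f^{(k)}(a)=f^{(k)}(b),\ 0\le k\le m-1\}$: $\phi\in C^1([0,T];H_p^{m_0+4})$, $\psi\in C([0,T];H_p^{m_0+2})\cap C^1([0,T];H_p^{m_0})\cap C^2([0,T];H_p^{m_0-2})$, and, with a bound independent of $\varepsilon\in(0,1]$,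 $$\|\phi\|_{L^\infty([0,T];H^{m_0+4})}+\varepsilon^2\|\partial_t\phi\|_{L^\infty([0,T];H^{m_0+4})}\lesssim1,$$ $$\|\psi\|_{L^\infty([0,T];H^{m_0+2})}+\|\partial_t\psi\|_{L^\infty([0,T];H^{m_0})}+\varepsilon^2\|\partial_{tt}\psi\|_{L^\infty([0,T];H^{m_0-2})}\lesssim1.$$ Set $C_\phi=\sup_{0<\varepsilon\le1}\max\{\|\phi\|_{L^\infty([0,T];H^{m_0+4})},\varepsilon^2\|\partial_t\phi\|_{L^\infty([0,T];H^{m_0+4})}\}$ and $C_\psi=\sup_{0<\varepsilon\le1}\|\psi\|_{L^\infty([0,T];H^{m_0+2})}$. **Spectral notation.** $N$ is an even positive integer, $h=(b-a)/N$, $x_j=a+jh$ ($0\le j\le N$), $\mu_l=2\pi l/(b-a)$, $\tau>0$, $t_n=n\tau$. $Y_N=\{v=(v_0,\dots,v_N)\in\mathbb C^{N+1}:v_0=v_N\}$. For $v\in Y_N$, $\widetilde v_l=\frac1N\sum_{j=0}^{N-1}v_je^{-i\mu_l(x_j-a)}$ and $(I_Nv)(x)=\sum_{l=-N/2}^{N/2-1}\widetilde v_l e^{i\mu_l(x-a)}$. A vector in $Y_N$ is identified with its coefficients via $v_j=\sum_{l=-N/2}^{N/2-1}\widetilde v_le^{i\mu_l(x_j-a)}$; products, conjugates, real parts and $|\cdot|^2$ of vectors are componentwise. **Coefficients.** $\omega_l=\varepsilon^{-2}\sqrt{1+\mu_l^2\varepsilon^2}$, $\lambda_l^\pm=-\varepsilon^{-2}(1\pm\sqrt{1+\mu_l^2\varepsilon^2})$,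 $$a_l(s)=\frac{\lambda_l^+e^{is\lambda_l^-}-\lambda_l^-e^{is\lambda_l^+}}{\lambda_l^+-\lambda_l^-},\qquad b_l(s)=i\frac{e^{is\lambda_l^+}-e^{is\lambda_l^-}}{\varepsilon^2(\lambda_l^--\lambda_l^+)},$$ with $a_l',b_l'$ their derivatives in $s$, and $$p_l(s)=\int_0^s\frac{\sin(\omega_l(s-\theta))}{\varepsilon^2\omega_l}d\theta,\quad p_l'(s)=\int_0^s\frac{\cos(\omega_l(s-\theta))}{\varepsilon^2}d\theta,$$ $$q_l(s)=\int_0^s\frac{\sin(\omega_l(s-\theta))}{\varepsilon^2\omega_l}\theta\,d\theta,\quad q_l'(s)=\int_0^s\frac{\cos(\omega_l(s-\theta))}{\varepsilon^2}\theta\,d\theta,$$ $$c_l^\pm(s)=ie^{-i\mu_l^2s}\int_0^se^{i(\mu_l^2\pm\varepsilon^{-2})\theta}d\theta,\quad d_l^\pm(s)=ie^{-i\mu_l^2s}\int_0^se^{i(\mu_l^2\pm\varepsilon^{-2})\theta}\theta\,d\theta.$$ **MTI-FP scheme.** $\Phi^0_j=\phi_0(x_j)$, $\dot\Phi^0_j=\phi_1(x_j)/\varepsilon^2$, $\Psi^0_j=\psi_0(x_j)$. Given $\Phi^n,\dot\Phi^n,\Psi^n\in Y_N$, define (for $-N/2\le l\le N/2-1$; the auxiliary $Z^0,\dot Z^0,\dot R^0$ are recomputed at each $n$) $$\widetilde{(Z^0)}_l=\tfrac12\big[\widetilde{(\Phi^n)}_l-i\varepsilon^2\widetilde{(\dot\Phi^n)}_l\big],\quad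 \widetilde{(\dot Z^0)}_l=\tfrac{i\sin(\mu_l^2\tau)}{2\tau}\widetilde{(Z^0)}_l,\quad \widetilde{(\dot R^0)}_l=-\widetilde{(\dot Z^0)}_l-\widetilde{(\overline{\dot Z^0})}_l,$$ $$\widetilde{(\dot\Psi^n)}_l=-\tfrac{i\sin(\mu_l^2\tau)}{\tau}\widetilde{(\Psi^n)}_l+i\widetilde{(\Phi^n\Psi^n)}_l,$$ $$\widetilde{(Z^{n+1})}_l=a_l(\tau)\widetilde{(Z^0)}_l+\varepsilon^2b_l(\tau)\widetilde{(\dot Z^0)}_l,\quad \widetilde{(\dot Z^{n+1})}_l=a_l'(\tau)\widetilde{(Z^0)}_l+\varepsilon^2b_l'(\tau)\widetilde{(\dot Z^0)}_l,$$ $$\widetilde{(R^{n+1})}_l=\tfrac{\sin(\omega_l\tau)}{\omega_l}\widetilde{(\dot R^0)}_l+p_l(\tau)\widetilde{(|\Psi^n|^2)}_l+2q_l(\tau)\widetilde{(\mathrm{Re}\{\overline{\Psi^n}\dot\Psi^n\})}_l,$$ $$\widetilde{(\dot R^{n+1})}_l=\cos(\omega_l\tau)\widetilde{(\dot R^0)}_l+p_l'(\tau)\widetilde{(|\Psi^n|^2)}_l+2q_l'(\tau)\widetilde{(\mathrm{Re}\{\overline{\Psi^n}\dot\Psi^n\})}_l,$$ $$\widetilde{(\Psi^{n+1})}_l=e^{-i\mu_l^2\tau}\widetilde{(\Psi^n)}_l+c_l^+(\tau)\widetilde{(Z^0\Psi^n)}_l+d_l^+(\tau)\big[\widetilde{(\dot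 Z^0\Psi^n)}_l+\widetilde{(Z^0\dot\Psi^n)}_l\big]+c_l^-(\tau)\widetilde{(\overline{Z^0}\Psi^n)}_l$$ $$\qquad+d_l^-(\tau)\big[\widetilde{(\overline{\dot Z^0}\Psi^n)}_l+\widetilde{(\overline{Z^0}\dot\Psi^n)}_l\big]+\tfrac{i\tau}2\widetilde{(R^{n+1}\Psi^n)}_l+\tfrac{i\tau^2}2\widetilde{(R^{n+1}\dot\Psi^n)}_l,$$ and, for $0\le j\le N$, $$\Phi_j^{n+1}=e^{i\tau/\varepsilon^2}Z_j^{n+1}+e^{-i\tau/\varepsilon^2}\overline{Z_j^{n+1}}+R_j^{n+1},$$ $$\dot\Phi_j^{n+1}=e^{i\tau/\varepsilon^2}\big(\dot Z_j^{n+1}+\tfrac i{\varepsilon^2}Z_j^{n+1}\big)+e^{-i\tau/\varepsilon^2}\big(\overline{\dot Z_j^{n+1}}-\tfrac i{\varepsilon^2}\overline{Z_j^{n+1}}\big)+\dot R_j^{n+1}.$$ *)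

(* Defs.v *)
From HB Require Import structures.
From mathcomp Require Import all_boot all_order all_algebra.
From mathcomp Require Import all_classical all_reals all_analysis.
From mathcomp.real_closed Require Import complex.

Set Implicit Arguments.
Unset Strict Implicit.
Unset Printing Implicit Defensive.

Import Order.TTheory GRing.Theory Num.Theory.
Import numFieldNormedType.Exports.

Local Open Scope classical_set_scope.
Local Open Scope ring_scope.

Section complex_calculus.
Context {R : realType}.

Definition expi (t : R) : R[i] := Complex (cos t) (sin t).

Definition cnorm (z : R[i]) : R := Num.sqrt (complex.Re z ^+ 2 + complex.Im z ^+ 2).

Definition cint (D : set R) (f : R -> R[i]) : R[i] :=
  Complex (\int[lebesgue_measure]_(x in D) complex.Re (f x))
          (\int[lebesgue_measure]_(x in D) complex.Im (f x)).

Definition cderive1 (f : R -> R[i]) (t : R) : R[i] :=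
  Complex ((fun s => complex.Re (f s))^`()%classic t)
          ((fun s => complex.Im (f s))^`()%classic t).

Definition ccontinuous_on (D : set R) (f : R -> R[i]) : Prop :=
  {within D, continuous (fun x => complex.Re (f x))} /\
  {within D, continuous (fun x => complex.Im (f x))}.

Definition ofreal (f : R -> R -> R) : R -> R -> R[i] :=
  fun t x => (f t x)%:C%C.

End complex_calculus.

Section sobolev.
Context {R : realType} (a b : R).

Definition test_function (eta : R -> R) : Prop :=
  (forall k x, derivable (eta^`(k)%classic) x 1) /\
  exists c d, [/\ a < c, d < b & forall x, ~~ (c <= x <= d) -> eta x = 0].

Definition L2norm (f : R -> R[i]) : \bar R :=
  'N[lebesgue_measure]_2%:E [EFin \o ((fun x => cnorm (f x)) \_ `]a, b[)]%E.

Definition in_L2 (f : R -> R[i]) : Prop :=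
  [/\ measurable_fun `]a, b[ (fun x => complex.Re (f x)),
      measurable_fun `]a, b[ (fun x => complex.Im (f x)) &
      (L2norm f < +oo)%E].

(* g is the k-th weak derivative of f; k = 0 says that f = g a.e. *)
Definition weak_deriv (k : nat) (f g : R -> R[i]) : Prop :=
  [/\ in_L2 f, in_L2 g &
      forall eta, test_function eta ->
        cint `]a, b[ (fun x => f x * (eta^`(k)%classic x)%:C%C) =
        (-1) ^+ k * cint `]a, b[ (fun x => g x * (eta x)%:C%C)].

Definition weak_derivs (m : nat) (f : R -> R[i]) (g : nat -> R -> R[i]) : Prop :=
  forall k, (k <= m)%N -> weak_deriv k f (g k).

Definition in_H (m : nat) (f : R -> R[i]) : Prop :=
  exists g, weak_derivs m f g.

(* Weak derivatives are unique a.e., so for f in H^m the infimum ranges over a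
   single value; outside H^m it is the infimum of the empty set, +oo. *)
Definition Hnorm (m : nat) (f : R -> R[i]) : \bar R :=
  ereal_inf [set ((\sum_(k < m.+1) L2norm (g k) ^+ 2) `^ (2^-1))%E
            | g in weak_derivs m f].

(* The boundary values f^(k)(a), f^(k)(b), k < m, are those of the continuous
   representative of f^(k) on [a, b].  For m > 0 the function f itself is
   required to be the continuous representative of its class, so that point
   values of f are meaningful. *)
Definition in_Hp (m : nat) (f : R -> R[i]) : Prop :=
  in_H m f /\
  exists g : nat -> R -> R[i], forall k, (k < m)%N ->
    [/\ k = 0%N -> {in `[a, b], g k =1 f},
        ccontinuous_on `[a, b] (g k),
        weak_deriv k f (g k) & g k a = g k b].

Definition timeC (S : R) (m : nat) (u : R -> R -> R[i]) : Prop :=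
  forall t, 0 <= t <= S ->
    in_Hp m (u t) /\
    Hnorm m (fun x => u s x - u t x) @[s --> within `[0, S] (nbhs t)] --> 0%E.

(* The time derivative u' is a limit in the H^m norm, one-sided at t = 0 and
   t = S. *)
Definition timeC1 (S : R) (m : nat) (u u' : R -> R -> R[i]) : Prop :=
  [/\ timeC S m u, timeC S m u' &
      forall t, 0 <= t <= S ->
        Hnorm m (fun x => ((s - t)^-1)%:C%C * (u s x - u t x) - u' t x)
          @[s --> within `[0, S] t^'] --> 0%E].

Definition timeC2 (S : R) (m : nat) (u u' u'' : R -> R -> R[i]) : Prop :=
  timeC1 S m u u' /\ timeC1 S m u' u''.

Definition LinfH (S : R) (m : nat) (u : R -> R -> R[i]) : \bar R :=
  'N[lebesgue_measure]_+oo [(fun t => Hnorm m (u t)) \_ `[0%R, S]]%E.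

End sobolev.

Section klein_gordon_schroedinger.
Context {R : realType} (a b : R) (psi0 : R -> R[i]) (phi0 phi1 : R -> R).

(* Strong solution on [0, S]: dxxpsi and dxxphi are weak derivatives, with
   representatives chosen so that the equations hold at every x; membership in
   H^2_p carries the periodic boundary conditions.  dpsi, dphi, ddphi are time
   derivatives. *)
Definition kgs_solution (eps S : R)
    (psi dpsi : R -> R -> R[i]) (phi dphi ddphi : R -> R -> R) : Prop :=
  [/\ timeC a b S 2 psi /\ timeC1 a b S 0 psi dpsi,
      [/\ timeC a b S 2 (ofreal phi),
          timeC1 a b S 1 (ofreal phi) (ofreal dphi) &
          timeC2 a b S 0 (ofreal phi) (ofreal dphi) (ofreal ddphi)],
      exists (dxxpsi : R -> R -> R[i]) (dxxphi : R -> R -> R),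
        forall t, 0 < t <= S ->
        [/\ weak_deriv a b 2 (psi t) (dxxpsi t),
            weak_deriv a b 2 (ofreal phi t) (ofreal dxxphi t) &
            forall x, a < x < b ->
              'i%C * dpsi t x + dxxpsi t x + (phi t x)%:C%C * psi t x = 0 /\
              eps ^+ 2 * ddphi t x - dxxphi t x + eps ^- 2 * phi t x
                = cnorm (psi t x) ^+ 2] &
      forall x, a <= x <= b ->
        [/\ psi 0 x = psi0 x, phi 0 x = phi0 x & dphi 0 x = phi1 x / eps ^+ 2]].

Definition max_existence_time (eps : R) : \bar R :=
  ereal_sup [set S%:E | S in [set S : R | 0 < S /\
    exists psi dpsi phi dphi ddphi,
      kgs_solution eps S psi dpsi phi dphi ddphi]].

End klein_gordon_schroedinger.

Section assumption.
Context {R : realType} (a b T : R) (m0 : nat).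
(* The first argument is eps, then t and x. *)
Variables (psi dpsi ddpsi : R -> R -> R -> R[i]) (phi dphi : R -> R -> R -> R).

Definition assumption_A : Prop :=
  (forall eps, 0 < eps <= 1 ->
    [/\ timeC1 a b T (m0 + 4) (ofreal (phi eps)) (ofreal (dphi eps)),
        timeC a b T (m0 + 2) (psi eps),
        timeC1 a b T m0 (psi eps) (dpsi eps) &
        timeC2 a b T (m0 - 2) (psi eps) (dpsi eps) (ddpsi eps)]) /\
  exists M : R, forall eps, 0 < eps <= 1 ->
    (LinfH a b T (m0 + 4) (ofreal (phi eps))
      + (eps ^+ 2)%:E * LinfH a b T (m0 + 4) (ofreal (dphi eps)) <= M%:E)%E /\
    (LinfH a b T (m0 + 2) (psi eps)
      + LinfH a b T m0 (dpsi eps)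
      + (eps ^+ 2)%:E * LinfH a b T (m0 - 2) (ddpsi eps) <= M%:E)%E.

Definition C_phi : \bar R :=
  ereal_sup [set maxe (LinfH a b T (m0 + 4) (ofreal (phi eps)))
                  ((eps ^+ 2)%:E * LinfH a b T (m0 + 4) (ofreal (dphi eps)))%E
            | eps in [set eps : R | 0 < eps <= 1]].

Definition C_psi : \bar R :=
  ereal_sup [set LinfH a b T (m0 + 2) (psi eps)
            | eps in [set eps : R | 0 < eps <= 1]].

End assumption.

Section spectral.
Context {R : realType} (a b : R) (N : nat).

Definition mesh : R := (b - a) / N%:R.
Definition node (j : nat) : R := a + j%:R * mesh.
Definition mu (l : int) : R := 2 * pi * l%:~R / (b - a).

(* Grid vectors (v_0, ..., v_N); v_N never enters the coefficients, and
   v_0 = v_N holds for every vector the scheme produces. *)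
Definition vec : Type := 'I_N.+1 -> R[i].

(* k = 0, ..., N - 1 enumerates the frequencies l = -N/2, ..., N/2 - 1 *)
Definition freq (k : nat) : int := k%:Z - (N./2)%:Z.

Definition dft (v : vec) (l : int) : R[i] :=
  N%:R^-1 * \sum_(j < N) v (inord j) * expi (- (mu l * (node j - a))).

Definition trig (c : int -> R[i]) (x : R) : R[i] :=
  \sum_(k < N) c (freq k) * expi (mu (freq k) * (x - a)).

Definition interp (v : vec) : R -> R[i] := trig (dft v).

Definition of_coef (c : int -> R[i]) : vec := fun j => trig c (node j).

Definition vmul (u v : vec) : vec := fun j => u j * v j.
Definition vconj (v : vec) : vec := fun j => conjc (v j).
Definition vRe (v : vec) : vec := fun j => (complex.Re (v j))%:C%C.
Definition vsqnorm (v : vec) : vec := fun j => (cnorm (v j) ^+ 2)%:C%C.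

End spectral.

Section coefficients.
Context {R : realType} (a b eps : R) (l : int).

Let m2 : R := mu a b l ^+ 2.

Definition omega : R := eps ^- 2 * Num.sqrt (1 + m2 * eps ^+ 2).
Definition lambda_p : R := - (eps ^- 2 * (1 + Num.sqrt (1 + m2 * eps ^+ 2))).
Definition lambda_m : R := - (eps ^- 2 * (1 - Num.sqrt (1 + m2 * eps ^+ 2))).

Definition acoef (s : R) : R[i] :=
  (lambda_p%:C%C * expi (s * lambda_m) - lambda_m%:C%C * expi (s * lambda_p))
    / (lambda_p - lambda_m)%:C%C.

Definition bcoef (s : R) : R[i] :=
  'i%C * ((expi (s * lambda_p) - expi (s * lambda_m))
            / (eps ^+ 2 * (lambda_m - lambda_p))%:C%C).

Definition pcoef (s : R) : R :=
  \int[lebesgue_measure]_(theta in `[0, s])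
    (sin (omega * (s - theta)) / (eps ^+ 2 * omega)).
Definition dpcoef (s : R) : R :=
  \int[lebesgue_measure]_(theta in `[0, s])
    (cos (omega * (s - theta)) / eps ^+ 2).
Definition qcoef (s : R) : R :=
  \int[lebesgue_measure]_(theta in `[0, s])
    (sin (omega * (s - theta)) / (eps ^+ 2 * omega) * theta).
Definition dqcoef (s : R) : R :=
  \int[lebesgue_measure]_(theta in `[0, s])
    (cos (omega * (s - theta)) / eps ^+ 2 * theta).

(* c_l^{+-}, d_l^{+-}: the sign is sg = 1 or sg = -1 *)
Definition ccoef (sg s : R) : R[i] :=
  'i%C * expi (- (m2 * s)) *
  cint `[0, s] (fun theta => expi ((m2 + sg * eps ^- 2) * theta)).
Definition dcoef (sg s : R) : R[i] :=
  'i%C * expi (- (m2 * s)) *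
  cint `[0, s] (fun theta =>
    expi ((m2 + sg * eps ^- 2) * theta) * theta%:C%C).

End coefficients.

Section scheme.
Context {R : realType} (a b : R) (psi0 : R -> R[i]) (phi0 phi1 : R -> R).
Variables (eps tau : R) (N : nat).

Record state := State {
  Phi : @vec R N; dPhi : @vec R N; Psi : @vec R N }.

Definition mti_init : state :=
  State (fun j => (phi0 (node a b N j))%:C%C)
        (fun j => (phi1 (node a b N j) / eps ^+ 2)%:C%C)
        (fun j => psi0 (node a b N j)).

Definition mti_step (st : state) : state :=
  let F v := dft a b v in
  let V c : @vec R N := of_coef a b c in
  let P := Phi st in let P' := dPhi st in let Q := Psi st in
  let sinc l : R := sin (mu a b l ^+ 2 * tau) / tau in
  let Z0 := V (fun l => 2^-1 * (F P l - 'i%C * (eps ^+ 2)%:C%C * F P' l)) in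
  let Z0' := V (fun l => 'i%C * (sinc l / 2)%:C%C * F Z0 l) in
  let R0' := V (fun l => - F Z0' l - F (vconj Z0') l) in
  let Q' := V (fun l => - ('i%C * (sinc l)%:C%C * F Q l)
                        + 'i%C * F (vmul P Q) l) in
  let ReQ := vRe (vmul (vconj Q) Q') in
  let Z := V (fun l => acoef a b eps l tau * F Z0 l
      + (eps ^+ 2)%:C%C * bcoef a b eps l tau * F Z0' l) in
  let Z' := V (fun l => cderive1 (acoef a b eps l) tau * F Z0 l
      + (eps ^+ 2)%:C%C * cderive1 (bcoef a b eps l) tau * F Z0' l) in
  let Rn := V (fun l =>
      (sin (omega a b eps l * tau) / omega a b eps l)%:C%C * F R0' l
      + (pcoef a b eps l tau)%:C%C * F (vsqnorm Q) l
      + 2 * (qcoef a b eps l tau)%:C%C * F ReQ l) in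
  let Rn' := V (fun l =>
      (cos (omega a b eps l * tau))%:C%C * F R0' l
      + (dpcoef a b eps l tau)%:C%C * F (vsqnorm Q) l
      + 2 * (dqcoef a b eps l tau)%:C%C * F ReQ l) in
  let Qn := V (fun l =>
      expi (- (mu a b l ^+ 2 * tau)) * F Q l
      + ccoef a b eps l 1 tau * F (vmul Z0 Q) l
      + dcoef a b eps l 1 tau * (F (vmul Z0' Q) l + F (vmul Z0 Q') l)
      + ccoef a b eps l (-1) tau * F (vmul (vconj Z0) Q) l
      + dcoef a b eps l (-1) tau *
          (F (vmul (vconj Z0') Q) l + F (vmul (vconj Z0) Q') l)
      + 'i%C * (tau / 2)%:C%C * F (vmul Rn Q) l
      + 'i%C * (tau ^+ 2 / 2)%:C%C * F (vmul Rn Q') l) in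
  let e := expi (tau / eps ^+ 2) in
  let e' := expi (- (tau / eps ^+ 2)) in
  let ie : R[i] := 'i%C * (eps ^- 2)%:C%C in
  State (fun j => e * Z j + e' * conjc (Z j) + Rn j)
        (fun j => e * (Z' j + ie * Z j)
                  + e' * (conjc (Z' j) - ie * conjc (Z j)) + Rn' j)
        Qn.

Definition mti_fp (n : nat) : state := iter n mti_step mti_init.

Definition phiI (n : nat) : R -> R[i] := interp a b (Phi (mti_fp n)).
Definition dphiI (n : nat) : R -> R[i] := interp a b (dPhi (mti_fp n)).
Definition psiI (n : nat) : R -> R[i] := interp a b (Psi (mti_fp n)).

Definition mti_error (psi : R -> R -> R[i]) (phi dphi : R -> R -> R)
    (n : nat) : \bar R :=
  let t := n%:R * tau in
  (Hnorm a b 2 (fun x => (phi t x)%:C%C - phiI n x)%R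
   + Hnorm a b 2 (fun x => psi t x - psiI n x)%R
   + (eps ^+ 2)%:E * Hnorm a b 2 (fun x => (dphi t x)%:C%C - dphiI n x)%R)%E.

End scheme.

(* Main.v *)
(* Everything is done on Fourier coefficients.  Put X = h^m0.

   In Fourier variables one step of the scheme is exact for the linear part, so
   the numerical and the exact solution differ by quadrature errors of the
   nonlinear terms, by aliasing and by truncation; the last two are O(X) in H^2
   because m0 + 2 derivatives are bounded.  The unknown phi is measured through
   the two half-waves eps^2 dphi +- i sqrt(1 + mu^2 eps^2) phi, on which the
   linear Klein-Gordon flow acts by multiplication with a number of modulus 1.

   The local error of one step is bounded in two ways.  Taylor expansion in time,
   where each time derivative of the slow parts is bounded and of the fast ones
   costs eps^-2, gives tau (tau^2 / eps^2 + X).  Splitting phi as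
   e^(i t/eps^2) z + e^(-i t/eps^2) conj z + r with r = O(eps^2), which follows by
   integrating by parts against the oscillating phase, gives tau (eps^2 + X).
   The scheme is Lipschitz in H^2 on bounded sets with constant 1 + C tau, and the
   errors stay below 1 by the induction itself, so a discrete Gronwall argument
   gives the two global bounds.  Finally min(tau^2/eps^2, eps^2) <= tau.

   The Sobolev norms of the statement are tied to the coefficients by testing the
   weak derivatives against cut-off exponentials (whence the coefficients of the
   k-th derivative are (i mu)^k times those of f) and by Bessel's inequality; the
   converse estimate uses that f is the uniform limit of its Fourier series. *)

Require Import Defs.
From mathcomp Require Import all_boot all_order all_algebra.
From mathcomp Require Import all_classical all_reals all_analysis.
From mathcomp Require Import measurable_realfun ess_sup_inf.
From mathcomp.real_closed Require Import complex.
From mathcomp Require Import ring lra zify.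

Set Implicit Arguments.
Unset Strict Implicit.
Unset Printing Implicit Defensive.

Import Order.TTheory GRing.Theory Num.Theory.
Import numFieldNormedType.Exports.

Local Open Scope classical_set_scope.
Local Open Scope ring_scope.

(** * Complex norms, differentiable curves, weighted l2 norms *)

(** All constants must be uniform in eps, tau, N and the step number at once. Estimates are
    therefore stated for families over an arbitrary index type, with one constant per family. In the
    final induction the index type is the set of pairs (parameters, step) at which the current error
    is at most 1: the induction hypothesis sits in the index, so no constant can depend on n. Errors
    propagate in the l2 norm with weight 1 + mu^2. Exact coefficients are bounded with weight powers
    4 (phi, m0 + 4 >= 8), 3 (psi, m0 + 2 >= 6) and 2 (the time derivative of psi, m0 >= 4), and
    freezing a multiplier spends such powers; hence m0 >= 4. The numerical solution has none to
    spend, so for it the filter sin(mu^2 tau)/tau is bounded by 1/tau instead of mu^2. The delicate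
    point is that the envelope z of phi must start with the filtered slope of the scheme, not with
    its own. It is built from the two exact characteristic exponentials, with a fast component of
    size eps^2 that corrects the slope; r absorbs the change. *)

Section complex_norm.
Context {R : realType}.
Implicit Types (z w : R[i]) (t : R).

Lemma cnormE z : cnorm z = Normc.normc z.
Proof. by case: z. Qed.

Lemma cnorm_ge0 z : 0 <= cnorm z.
Proof. exact: sqrtr_ge0. Qed.

Lemma cnorm_sq z : cnorm z ^+ 2 = complex.Re z ^+ 2 + complex.Im z ^+ 2.
Proof. by rewrite sqr_sqrtr // addr_ge0 ?sqr_ge0. Qed.

Lemma cnorm0 : cnorm (0 : R[i]) = 0.
Proof. by rewrite cnormE Normc.normc0. Qed.

Lemma cnormM z w : cnorm (z * w) = cnorm z * cnorm w.
Proof. by rewrite !cnormE Normc.normcM. Qed.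

Lemma cnormV z : cnorm z^-1 = (cnorm z)^-1.
Proof. by rewrite !cnormE Normc.normcV. Qed.

Lemma cnormD z w : cnorm (z + w) <= cnorm z + cnorm w.
Proof. by rewrite !cnormE le_normcD. Qed.

Lemma cnormN z : cnorm (- z) = cnorm z.
Proof. by rewrite !cnormE normcN. Qed.

Lemma cnormB z w : cnorm (z - w) <= cnorm z + cnorm w.
Proof. by rewrite -(cnormN w) cnormD. Qed.

Lemma cnorm_conj z : cnorm (conjc z) = cnorm z.
Proof. by case: z => x y; rewrite /cnorm /= sqrrN. Qed.

Lemma cnorm_real t : cnorm (t%:C)%C = `|t|.
Proof. by rewrite /cnorm /= expr0n addr0 sqrtr_sqr. Qed.

Lemma cnorm_i : cnorm ('i%C : R[i]) = 1.
Proof. by rewrite /cnorm /= expr0n add0r expr1n sqrtr1. Qed.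

Lemma cnorm_eq0 z : cnorm z = 0 -> z = 0.
Proof. by rewrite cnormE; case: z => x y /Normc.eq0_normc. Qed.

Lemma cnorm_sum (I : Type) (r : seq I) (P : pred I) (F : I -> R[i]) :
  cnorm (\sum_(i <- r | P i) F i) <= \sum_(i <- r | P i) cnorm (F i).
Proof.
elim/big_ind2 : _ => [|x1 x2 y1 y2 h1 h2|//]; first by rewrite cnorm0.
by apply: le_trans (cnormD _ _) (lerD _ _).
Qed.

Lemma Re_le_cnorm z : `|complex.Re z| <= cnorm z.
Proof.
by rewrite -sqrtr_sqr ler_wsqrtr // lerDl sqr_ge0.
Qed.

Lemma Im_le_cnorm z : `|complex.Im z| <= cnorm z.
Proof.
by rewrite -sqrtr_sqr ler_wsqrtr // lerDr sqr_ge0.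
Qed.

Lemma cnorm_le_ReIm z : cnorm z <= `|complex.Re z| + `|complex.Im z|.
Proof.
rewrite -[leRHS]ger0_norm ?addr_ge0 // -sqrtr_sqr ler_wsqrtr //.
rewrite -(real_normK (num_real (complex.Re z))) -(real_normK (num_real (complex.Im z))).
have := normr_ge0 (complex.Re z); have := normr_ge0 (complex.Im z); nra.
Qed.

Lemma ReD z w : complex.Re (z + w) = complex.Re z + complex.Re w.
Proof. by case: z w => ? ? []. Qed.
Lemma ImD z w : complex.Im (z + w) = complex.Im z + complex.Im w.
Proof. by case: z w => ? ? []. Qed.
Lemma ReN z : complex.Re (- z) = - complex.Re z.
Proof. by case: z. Qed.
Lemma ImN z : complex.Im (- z) = - complex.Im z.
Proof. by case: z. Qed.
Lemma ReM z w : complex.Re (z * w) =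
  complex.Re z * complex.Re w - complex.Im z * complex.Im w.
Proof. by case: z w => ? ? []. Qed.
Lemma ImM z w : complex.Im (z * w) =
  complex.Re z * complex.Im w + complex.Im z * complex.Re w.
Proof. by case: z w => ? ? []. Qed.
Lemma Re_conj z : complex.Re (conjc z) = complex.Re z.
Proof. by case: z. Qed.
Lemma Im_conj z : complex.Im (conjc z) = - complex.Im z.
Proof. by case: z. Qed.
Lemma Re_sum (I : Type) (r : seq I) (P : pred I) (F : I -> R[i]) :
  complex.Re (\sum_(i <- r | P i) F i) = \sum_(i <- r | P i) complex.Re (F i).
Proof. by apply: (big_morph _ ReD). Qed.
Lemma Im_sum (I : Type) (r : seq I) (P : pred I) (F : I -> R[i]) :
  complex.Im (\sum_(i <- r | P i) F i) = \sum_(i <- r | P i) complex.Im (F i).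
Proof. by apply: (big_morph _ ImD). Qed.

Lemma complex_ext z w : complex.Re z = complex.Re w ->
  complex.Im z = complex.Im w -> z = w.
Proof. by case: z w => ? ? [? ?] /= -> ->. Qed.

Lemma Re_le t z : cnorm z <= t -> complex.Re z <= t.
Proof. by move=> h; apply: le_trans (ler_norm _) (le_trans (Re_le_cnorm _) h). Qed.

Lemma expi0 : expi (0 : R) = 1.
Proof. by rewrite /expi cos0 sin0. Qed.

Lemma expiD (s t : R) : expi (s + t) = expi s * expi t.
Proof.
apply: complex_ext; rewrite ?ReM ?ImM /expi /= ?cosD ?sinD //.
by rewrite addrC (mulrC (sin s)); ring.
Qed.

Lemma expiN (t : R) : expi (- t) = conjc (expi t).
Proof. by rewrite /expi cosN sinN. Qed.

Lemma cnorm_expi (t : R) : cnorm (expi t) = 1.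
Proof. by rewrite /cnorm /= cos2Dsin2 sqrtr1. Qed.

Lemma expiNM (t : R) : expi (- t) * expi t = 1.
Proof. by rewrite -expiD addNr expi0. Qed.

Lemma expi_period (l : int) : expi (2 * pi * l%:~R : R) = 1.
Proof.
have h (n : nat) : expi (2 * pi * n%:R : R) = 1.
  elim: n => [|n ih]; first by rewrite mulr0 expi0.
  rewrite -[n.+1]addn1 natrD mulrDr expiD ih mul1r mulr1.
  rewrite /expi mulrC -[pi * 2]add0r mulr_natr cosD2pi sinD2pi.
  by rewrite cos0 sin0.
case: l => n; first exact: h.
by rewrite NegzE mulrNz mulrN expiN h conjc1.
Qed.

Lemma conjcD z w : conjc (z + w) = conjc z + conjc w.
Proof. exact: rmorphD. Qed.
Lemma conjcM z w : conjc (z * w) = conjc z * conjc w.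
Proof. exact: rmorphM. Qed.
Lemma conjc_sum (I : Type) (r : seq I) (P : pred I) (F : I -> R[i]) :
  conjc (\sum_(i <- r | P i) F i) = \sum_(i <- r | P i) conjc (F i).
Proof. exact: rmorph_sum. Qed.

End complex_norm.
#[global] Hint Extern 0 (is_true (0 <= cnorm _)) => exact: cnorm_ge0 : core.

Section real_c1.
Context {R : realType} (A B : R).
Implicit Types f g : R -> R.

(** Continuity on the closed interval and a derivative inside it are exactly what the mean value
    theorem consumes; at the end points of a time interval only one-sided information exists. *)
Definition rC1 f (f' : R -> R) : Prop :=
  {within `[A, B]%classic, continuous f} /\
  forall x, x \in `]A, B[%R -> is_derive x 1 f (f' x).

Lemma rC1_cst (c : R) : rC1 (fun=> c) (fun=> 0).
Proof. by split=> [|x _]; [move=> ?; exact: cvg_cst|exact: is_derive_cst]. Qed.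

Lemma rC1D f f' g g' : rC1 f f' -> rC1 g g' ->
  rC1 (fun x => f x + g x) (fun x => f' x + g' x).
Proof.
move=> [cf df] [cg dg]; split=> [x|x xAB].
  by apply: cvgD; [exact: cf|exact: cg].
by apply: is_deriveD; [exact: df|exact: dg].
Qed.

Lemma rC1N f f' : rC1 f f' -> rC1 (fun x => - f x) (fun x => - f' x).
Proof.
move=> [cf df]; split=> [x|x xAB]; first by apply: cvgN; exact: cf.
by apply: is_deriveN; exact: df.
Qed.

Lemma rC1M f f' g g' : rC1 f f' -> rC1 g g' ->
  rC1 (fun x => f x * g x) (fun x => f' x * g x + f x * g' x).
Proof.
move=> [cf df] [cg dg]; split=> [x|x xAB].
  by apply: cvgM; [exact: cf|exact: cg].
have h := @is_deriveM _ _ f g x 1 _ _ (df _ xAB) (dg _ xAB).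
by apply: (is_derive_eq h); rewrite /GRing.scale /= addrC [g x * _]mulrC.
Qed.

Lemma rC1_sum (I : Type) (r : seq I) (F F' : I -> R -> R) :
  (forall i, rC1 (F i) (F' i)) ->
  rC1 (fun x => \sum_(i <- r) F i x) (fun x => \sum_(i <- r) F' i x).
Proof.
move=> h; elim: r => [|i r ih].
  under [X in rC1 X]eq_fun do rewrite big_nil.
  by under [X in rC1 _ X]eq_fun do rewrite big_nil; exact: rC1_cst.
under [X in rC1 X]eq_fun do rewrite big_cons.
by under [X in rC1 _ X]eq_fun do rewrite big_cons; exact: rC1D.
Qed.

Lemma rC1_smooth f f' : (forall x : R, is_derive x 1 f (f' x)) -> rC1 f f'.
Proof.
move=> df; split=> [|x _]; last exact: df.
apply: continuous_subspaceT => x; apply: differentiable_continuous.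
by apply/derivable1_diffP; case: (df x).
Qed.

Lemma rC1_id : rC1 id (fun=> 1).
Proof. by apply: rC1_smooth => x; exact: is_derive_id. Qed.

Lemma rC1_cos (c : R) : rC1 (fun s => cos (c * s)) (fun s => - c * sin (c * s)).
Proof.
apply: rC1_smooth => x.
have h : is_derive x 1 (fun s : R => c * s) c.
  by apply: is_derive_eq; rewrite /GRing.scale /= mulr1.
have := @is_derive1_comp _ cos (fun s : R => c * s) x _ _ (is_derive_cos _) h.
by move=> h'; apply: (is_derive_eq h'); rewrite /GRing.scale /= mulrC mulNr mulrN.
Qed.

Lemma rC1_sin (c : R) : rC1 (fun s => sin (c * s)) (fun s => c * cos (c * s)).
Proof.
apply: rC1_smooth => x.
have h : is_derive x 1 (fun s : R => c * s) c.
  by apply: is_derive_eq; rewrite /GRing.scale /= mulr1.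
have := @is_derive1_comp _ sin (fun s : R => c * s) x _ _ (is_derive_sin _) h.
by move=> h'; apply: (is_derive_eq h'); rewrite /GRing.scale /= mulrC.
Qed.

Lemma rC1_ext f f' g g' : rC1 f f' -> (forall x, f x = g x) ->
  (forall x, x \in `]A, B[%R -> f' x = g' x) -> rC1 g g'.
Proof.
move=> [cf df] /funext <- h; split=> // x xAB.
by apply: (is_derive_eq (df _ xAB)); exact: h.
Qed.

End real_c1.

Section complex_c1.
Context {R : realType} (A B : R).
Implicit Types f g : R -> R[i].

Definition C1on f f' : Prop :=
  rC1 A B (fun s => complex.Re (f s)) (fun s => complex.Re (f' s)) /\
  rC1 A B (fun s => complex.Im (f s)) (fun s => complex.Im (f' s)).

Lemma C1on_ext f f' g g' : C1on f f' -> (forall x, f x = g x) ->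
  (forall x, x \in `]A, B[%R -> f' x = g' x) -> C1on g g'.
Proof.
by move=> [h1 h2] fg fg'; split; [apply: (rC1_ext h1)|apply: (rC1_ext h2)];
  move=> x *; rewrite ?fg ?fg'.
Qed.

Lemma C1on_cst (c : R[i]) : C1on (fun=> c) (fun=> 0).
Proof. by split; exact: rC1_cst. Qed.

Lemma C1onD f f' g g' : C1on f f' -> C1on g g' ->
  C1on (fun s => f s + g s) (fun s => f' s + g' s).
Proof.
move=> [h1 h2] [k1 k2]; split.
  by apply: (rC1_ext (rC1D h1 k1)) => x *; rewrite ReD.
by apply: (rC1_ext (rC1D h2 k2)) => x *; rewrite ImD.
Qed.

Lemma C1onN f f' : C1on f f' -> C1on (fun s => - f s) (fun s => - f' s).
Proof.
move=> [h1 h2]; split.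
  by apply: (rC1_ext (rC1N h1)) => x *; rewrite ReN.
by apply: (rC1_ext (rC1N h2)) => x *; rewrite ImN.
Qed.

Lemma C1onB f f' g g' : C1on f f' -> C1on g g' ->
  C1on (fun s => f s - g s) (fun s => f' s - g' s).
Proof. by move=> hf hg; apply: C1onD => //; exact: C1onN. Qed.

Lemma C1onM f f' g g' : C1on f f' -> C1on g g' ->
  C1on (fun s => f s * g s) (fun s => f' s * g s + f s * g' s).
Proof.
move=> [h1 h2] [k1 k2]; split.
  apply: (rC1_ext (rC1D (rC1M h1 k1) (rC1N (rC1M h2 k2)))) => x *.
    by rewrite ReM.
  by rewrite ReD !ReM; ring.
apply: (rC1_ext (rC1D (rC1M h1 k2) (rC1M h2 k1))) => x *; first by rewrite ImM.
by rewrite ImD !ImM; ring.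
Qed.

Lemma C1onZ (c : R[i]) f f' : C1on f f' -> C1on (fun s => c * f s) (fun s => c * f' s).
Proof.
move=> hf; apply: (C1on_ext (C1onM (C1on_cst c) hf)) => x *; first by [].
by rewrite mul0r add0r.
Qed.

Lemma C1on_conj f f' : C1on f f' ->
  C1on (fun s => conjc (f s)) (fun s => conjc (f' s)).
Proof.
move=> [h1 h2]; split.
  by apply: (rC1_ext h1) => x *; rewrite Re_conj.
by apply: (rC1_ext (rC1N h2)) => x *; rewrite Im_conj.
Qed.

Lemma C1on_sum (I : Type) (r : seq I) (F F' : I -> R -> R[i]) :
  (forall i, C1on (F i) (F' i)) ->
  C1on (fun x => \sum_(i <- r) F i x) (fun x => \sum_(i <- r) F' i x).
Proof.
move=> h; split.
  by apply: (rC1_ext (rC1_sum r (fun i => (h i).1))) => x *; rewrite Re_sum.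
by apply: (rC1_ext (rC1_sum r (fun i => (h i).2))) => x *; rewrite Im_sum.
Qed.

Lemma C1on_real (f f' : R -> R) : rC1 A B f f' ->
  C1on (fun s => (f s)%:C%C) (fun s => (f' s)%:C%C).
Proof. by move=> h; split=> //; exact: rC1_cst. Qed.

Lemma C1on_expi (c : R) :
  C1on (fun s => expi (c * s)) (fun s => 'i%C * c%:C%C * expi (c * s)).
Proof.
split.
  apply: (rC1_ext (rC1_cos A B c)) => x *; first by [].
  by rewrite !(ReM, ImM) /=; ring.
apply: (rC1_ext (rC1_sin A B c)) => x *; first by [].
by rewrite !(ReM, ImM) /=; ring.
Qed.

End complex_c1.

Section l2norm.
Context {R : realType} {I : Type}.
Implicit Types (r : seq I) (x y : I -> R).

Definition l2 r x : R := Num.sqrt (\sum_(i <- r) x i ^+ 2).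

Lemma l2_ge0 r x : 0 <= l2 r x.
Proof. exact: sqrtr_ge0. Qed.

Lemma l2_sq r x : l2 r x ^+ 2 = \sum_(i <- r) x i ^+ 2.
Proof. by rewrite sqr_sqrtr // sumr_ge0 // => *; rewrite sqr_ge0. Qed.

(** Induction on the sequence. The step needs [2 S x y <= X y^2 + Y x^2], which after squaring
    follows from the inductive bound [S^2 <= X Y] and from [(X y^2 - Y x^2)^2 >= 0]. *)
Lemma cauchy_schwarz r x y :
  \sum_(i <- r) x i * y i <= l2 r x * l2 r y.
Proof.
have [h|h] := leP (\sum_(i <- r) x i * y i) 0.
  by apply: le_trans h _; rewrite mulr_ge0 ?l2_ge0.
rewrite -ler_sqr ?nnegrE ?mulr_ge0 ?l2_ge0 ?(ltW h) // exprMn !l2_sq.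
clear h; elim: r => [|i r]; first by rewrite !big_nil expr0n mulr0.
rewrite !big_cons.
set S := \sum_(_ <- r) _; set X := \sum_(_ <- r) _; set Y := \sum_(_ <- r) _.
move=> ih.
have X0 : 0 <= X by apply: sumr_ge0 => *; rewrite sqr_ge0.
have Y0 : 0 <= Y by apply: sumr_ge0 => *; rewrite sqr_ge0.
suff : 2 * S * (x i * y i) <= X * y i ^+ 2 + Y * x i ^+ 2 by nra.
apply: le_trans (ler_norm _) _.
have h1 : 0 <= X * y i ^+ 2 + Y * x i ^+ 2.
  by apply: addr_ge0; apply: mulr_ge0 => //; exact: sqr_ge0.
rewrite -ler_sqr ?nnegrE //.
rewrite real_normK ?num_real //.
have : (S ^+ 2) * (x i * y i) ^+ 2 <= (X * Y) * (x i * y i) ^+ 2.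
  by rewrite ler_wpM2r ?sqr_ge0.
have : 0 <= (X * y i ^+ 2 - Y * x i ^+ 2) ^+ 2 by rewrite sqr_ge0.
nra.
Qed.

Lemma l2_le r x y : (forall i, 0 <= x i) -> (forall i, x i <= y i) -> l2 r x <= l2 r y.
Proof.
move=> x0 xy; apply/ler_wsqrtr/ler_sum => i _.
by rewrite ler_sqr ?nnegrE // (le_trans (x0 i)).
Qed.

Lemma l2D r x y : l2 r (fun i => x i + y i) <= l2 r x + l2 r y.
Proof.
rewrite -ler_sqr ?nnegrE ?addr_ge0 ?l2_ge0 // sqrrD !l2_sq.
have -> : \sum_(i <- r) (x i + y i) ^+ 2 = \sum_(i <- r) x i ^+ 2
    + (\sum_(i <- r) x i * y i) *+ 2 + \sum_(i <- r) y i ^+ 2.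
  by rewrite -sumrMnl -!big_split /=; apply: eq_bigr => i _; rewrite sqrrD.
by rewrite lerD2r lerD2l lerMn2r cauchy_schwarz orbT.
Qed.

Lemma l2Z r x (c : R) : 0 <= c -> l2 r (fun i => c * x i) = c * l2 r x.
Proof.
move=> c0; rewrite /l2; under eq_bigr do rewrite exprMn.
by rewrite -mulr_sumr sqrtrM ?sqr_ge0 // sqrtr_sqr ger0_norm.
Qed.

End l2norm.

Section weighted_norm.
Context {R : realType} (N : nat).
Implicit Types (W : int -> R) (c d : int -> R[i]).

(** The weight is arbitrary because two families occur: powers of [1 + mu^2] in the evolution
    estimates and powers of [1 + |l|] in the aliasing estimates, where integer arithmetic is
    convenient. *)
Definition wn W c : R := l2 (index_iota 0 N) (fun k => W (freq N k) * cnorm (c (freq N k))).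

Lemma wn_ge0 W c : 0 <= wn W c.
Proof. exact: l2_ge0. Qed.

Lemma wn_le W W' c d : (forall l, 0 <= W l) ->
  (forall k, (k < N)%N ->
     W (freq N k) * cnorm (c (freq N k)) <= W' (freq N k) * cnorm (d (freq N k))) ->
  wn W c <= wn W' d.
Proof.
move=> W0 h; rewrite /wn /l2; apply: ler_wsqrtr.
rewrite big_seq [leRHS]big_seq; apply: ler_sum => k.
rewrite mem_index_iota => /andP[_ kN].
have h0 : 0 <= W (freq N k) * cnorm (c (freq N k)) by rewrite mulr_ge0 ?W0.
have h1 := h _ kN.
by apply: lerXn2r; rewrite ?nnegrE // (le_trans h0).
Qed.

Lemma wn_eq W c d : (forall k, (k < N)%N -> c (freq N k) = d (freq N k)) -> wn W c = wn W d.
Proof.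
move=> h; rewrite /wn /l2; congr Num.sqrt; rewrite big_seq [RHS]big_seq.
by apply: eq_bigr => k; rewrite mem_index_iota => /andP[_ kN]; rewrite h.
Qed.

Lemma wnD W c d : (forall l, 0 <= W l) ->
  wn W (fun l => c l + d l) <= wn W c + wn W d.
Proof.
move=> W0; apply: le_trans (l2D _ _ _); apply: l2_le => k; rewrite ?mulr_ge0 ?W0 //.
by rewrite -mulrDr ler_wpM2l ?W0 // cnormD.
Qed.

Lemma wnN W c : wn W (fun l => - c l) = wn W c.
Proof. by rewrite /wn /l2; under eq_bigr do rewrite cnormN. Qed.

Lemma wnB W c d : (forall l, 0 <= W l) ->
  wn W (fun l => c l - d l) <= wn W c + wn W d.
Proof. by move=> W0; rewrite -(wnN W d) wnD. Qed.

Lemma wnZ W (a : R[i]) c : wn W (fun l => a * c l) = cnorm a * wn W c.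
Proof.
rewrite /wn -l2Z //; congr Num.sqrt; apply: eq_bigr => k _.
by rewrite cnormM mulrCA.
Qed.

(* Duality: the real-valued mean value theorem is applied to the pairing of F
   with its own increment. *)
Lemma wn_mvt W (F F' : R -> int -> R[i]) (A B M : R) :
  A <= B ->
  (forall k, (k < N)%N ->
    C1on A B (fun s => F s (freq N k)) (fun s => F' s (freq N k))) ->
  (forall s, A < s < B -> wn W (F' s) <= M) ->
  wn W (fun l => F B l - F A l) <= M * (B - A).
Proof.
move=> AB hF hM.
have [->|AB'] := eqVneq A B.
  rewrite subrr mulr0 /wn /l2 big1 ?sqrtr0 // => k _.
  by rewrite subrr cnorm0 mulr0 expr0n.
have {AB AB'} AB : A < B by rewrite lt_neqAle AB'.
pose d l : R[i] := F B l - F A l.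
pose g (s : R) := \sum_(i < N)
  W (freq N i) ^+ 2 * complex.Re (conjc (d (freq N i)) * F s (freq N i)).
pose g' (s : R) := \sum_(i < N)
  W (freq N i) ^+ 2 * complex.Re (conjc (d (freq N i)) * F' s (freq N i)).
have [cg dg] : rC1 A B g g'.
  rewrite /g /g'; apply: rC1_sum => i.
  have [h _] := C1onZ (conjc (d (freq N i))) (hF i (ltn_ord i)).
  apply: (rC1_ext (rC1M (rC1_cst A B (W (freq N i) ^+ 2)) h)) => x * //.
  by rewrite mul0r add0r.
have [c cAB hc] := MVT AB dg cg.
have dd : g B - g A = wn W d ^+ 2.
  rewrite l2_sq -sumrB big_mkord; apply: eq_bigr => i _.
  rewrite exprMn cnorm_sq -mulrBr; congr (_ * _).
  by rewrite /d !(ReM, ImM, Re_conj, Im_conj, ReD, ImD, ReN, ImN); ring.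
have dc : g' c <= wn W d * wn W (F' c).
  apply: le_trans (cauchy_schwarz _ _ _).
  rewrite big_mkord; apply: ler_sum => k _.
  rewrite -[leRHS]mulrACA -expr2 ler_wpM2l ?sqr_ge0 //; apply: Re_le.
  by rewrite cnormM cnorm_conj.
have hMc := hM c cAB.
have [->|d0] := eqVneq (wn W d) 0.
  by rewrite mulr_ge0 ?subr_ge0 ?(ltW AB) // (le_trans (wn_ge0 _ _) hMc).
have {}d0 : 0 < wn W d by rewrite lt_neqAle eq_sym d0 wn_ge0.
rewrite -(ler_pM2l d0) -expr2 -dd hc mulrA ler_wpM2r ?subr_ge0 ?(ltW AB) //.
by apply: le_trans dc _; rewrite ler_wpM2l ?wn_ge0.
Qed.

End weighted_norm.

(** * Grid sums and the discrete Fourier transform *)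

Section int_sums.
Context {R : realType}.

(* The symmetric range -K, ..., K. *)
Fixpoint zr (K : nat) : seq int :=
  if K is K'.+1 then Posz K :: Negz K' :: zr K' else [:: 0].

Lemma mem_zr K l : (l \in zr K) = (`|l| <= K)%N.
Proof.
elim: K => [|K ih] /=; first by rewrite inE; lia.
by rewrite !inE ih; lia.
Qed.

Lemma zr_uniq K : uniq (zr K).
Proof. by elim: K => [//|K ih] /=; rewrite !inE !mem_zr ih; lia. Qed.

Lemma zr_sup (s : seq int) K : exists2 M, (K <= M)%N & {subset s <= zr M}.
Proof.
exists (K + \sum_(l <- s) `|l|)%N; first exact: leq_addr.
move=> l ls; rewrite mem_zr (big_rem l ls) /=; lia.
Qed.

Lemma sum_subset (I : eqType) (s t : seq I) (F : I -> R) :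
  uniq s -> {subset s <= t} -> (forall i, 0 <= F i) ->
  \sum_(i <- s) F i <= \sum_(i <- t) F i.
Proof.
move=> us st F0; elim: s t us st => [|i s ih] t /=.
  by move=> *; rewrite big_nil sumr_ge0.
move=> /andP[nis us] st; rewrite big_cons.
have it : i \in t by apply: st; rewrite inE eqxx.
rewrite [leRHS](big_rem i it) /= lerD2l; apply: ih => // j js.
have ji : j != i by apply: contraNneq nis => <-.
have : j \in t by apply: st; rewrite inE js orbT.
by rewrite (perm_mem (perm_to_rem it)) inE (negPf ji).
Qed.

Definition gw (l : int) : R := 1 + (`|l|%N)%:R.

Lemma gw_ge1 l : 1 <= gw l.
Proof. by rewrite lerDl. Qed.

Lemma gw_gt0 l : 0 < gw l.
Proof. exact: lt_le_trans (gw_ge1 l). Qed.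

Lemma sum_gw (s : seq int) : uniq s -> \sum_(l <- s) gw l ^- 2 <= 4.
Proof.
move=> us; have [K _ sK] := zr_sup s 0.
apply: le_trans (sum_subset us sK _) _ => [l|].
  by rewrite invr_ge0 exprn_ge0 // ltW ?gw_gt0.
(* Telescoping majorant: passing to [K + 1] adds two terms [(K + 2)^-2], each at most
   [1/(K + 1) - 1/(K + 2)]. *)
suff : \sum_(l <- zr K) gw l ^- 2 <= 4 - 2 / K.+1%:R.
  move/le_trans; apply; rewrite gerBl divr_ge0 //.
elim: K {sK} => [|K ih] /=.
  by rewrite big_seq1 /gw /= addr0 expr1n invr1; lra.
rewrite !big_cons.
have -> : gw (Posz K.+1) = K.+2%:R by rewrite /gw /= -[in RHS]natr1 addrC.
have -> : gw (Negz K) = K.+2%:R by rewrite /gw NegzE abszN /= -[in RHS]natr1 addrC.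
apply: le_trans (_ : K.+2%:R ^- 2 + (K.+2%:R ^- 2 + (4 - 2 / K.+1%:R)) <= _).
  by rewrite !lerD2l.
have h : 0 < (K.+1%:R : R) by rewrite ltr0n.
have -> : (K.+2%:R : R) = K.+1%:R + 1 by rewrite natr1.
set x : R := K.+1%:R in h *.
have : (x + 1) ^- 2 <= x^-1 - (x + 1)^-1.
  have -> : x^-1 - (x + 1)^-1 = x^-1 * (x + 1)^-1.
    by field; apply/andP; split; apply/eqP; lra.
  rewrite expr2 invfM ler_pM2r ?invr_gt0; last lra.
  by rewrite lef_pV2 ?posrE; lra.
by move: ((x + 1) ^- 2) (x^-1) ((x + 1)^-1) => *; lra.
Qed.

Lemma l2_sum (I J : Type) (r : seq I) (s : seq J) (a : J -> R) (y : J -> I -> R) :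
  (forall j, 0 <= a j) ->
  l2 r (fun i => \sum_(j <- s) a j * y j i) <= \sum_(j <- s) a j * l2 r (y j).
Proof.
move=> a0; elim: s => [|j s ih].
  by rewrite big_nil /l2 big1 ?sqrtr0 // => *; rewrite big_nil expr0n.
rewrite big_cons; apply: le_trans (_ : l2 r (fun i => a j * y j i)
    + l2 r (fun i => \sum_(j <- s) a j * y j i) <= _).
  by rewrite /l2; under eq_bigr do rewrite big_cons; exact: l2D.
by rewrite l2Z // lerD.
Qed.

(** Discrete Young inequality with an aliasing shift [q]. For fixed [j] the map [l -> l + q - j] is
    injective, so the inner norm is at most that of [y]; Minkowski's inequality then sums over
    [j]. *)
Lemma young (J K L : seq int) (x y : int -> R) (q : int) :
  uniq K -> uniq L -> (forall j, 0 <= x j) -> (forall j, 0 <= y j) ->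
  l2 L (fun l => \sum_(j <- J) \sum_(k <- K) x j * y k * (j + k == l + q)%:R)
  <= (\sum_(j <- J) x j) * l2 K y.
Proof.
move=> uK uL x0 y0; rewrite /l2.
under eq_bigr do under eq_bigr do
  (under eq_bigr do rewrite -mulrA; rewrite -mulr_sumr).
apply: le_trans (l2_sum L J (fun j l => \sum_(k <- K) y k * (j + k == l + q)%:R) x0) _.
rewrite mulr_suml; apply: ler_sum => j _; rewrite ler_wpM2l // ler_wsqrtr //.
have h l : \sum_(k <- K) y k * (j + k == l + q)%:R =
    if l + q - j \in K then y (l + q - j) else 0.
  have e k : (j + k == l + q) = (k == l + q - j) by rewrite [RHS]eq_sym subr_eq addrC eq_sym.
  case: ifP => hl.
    rewrite (bigD1_seq _ hl uK) /= e eqxx mulr1 big1 ?addr0 // => k kl.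
    by rewrite e (negPf kl) mulr0.
  rewrite big_seq big1 // => k kK; rewrite e; case: eqVneq => [kl|]; rewrite ?mulr0 //.
  by rewrite kl hl in kK.
under eq_bigr do rewrite h.
apply: le_trans (_ : \sum_(k <- [seq l + q - j | l <- L & l + q - j \in K]) y k ^+ 2 <= _).
  rewrite big_map big_filter [leRHS]big_mkcond; apply: ler_sum => l _.
  by case: ifP; rewrite ?expr0n.
apply: sum_subset => [| |k]; last by rewrite sqr_ge0.
  rewrite map_inj_uniq ?filter_uniq // => k1 k2 /(congr1 (fun t => t + j - q)).
  by rewrite !subrK !addrK.
by move=> k /mapP[l]; rewrite mem_filter => /andP[h' _] ->.
Qed.

End int_sums.

(** * Frequencies modulo N *)

Section frequencies.
Implicit Types (N : nat) (l : int).

Lemma freq_dvd N k k' : (k < N)%N -> (k' < N)%N ->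
  (N %| freq N k - freq N k')%Z = (k == k').
Proof.
move=> kN kN'; rewrite /freq; apply/idP/eqP => [|->]; last by rewrite subrr dvdz0.
move=> /dvdzP[q]; case: q => [[|q]|q]; [lia| |]; rewrite ?NegzE => h; nia.
Qed.

Lemma dvdz_small (N : nat) (m : int) : (N %| m)%Z -> (`|m| < 2 * N)%N ->
  [\/ m = 0, m = Posz N | m = - Posz N].
Proof.
case/dvdzP=> -[[|[|q]]|[|q]] -> h.
- by apply: Or31; rewrite mul0r.
- by apply: Or32; rewrite mul1r.
- by exfalso; move: h; rewrite abszM; nia.
- by apply: Or33; rewrite NegzE mulN1r.
- by exfalso; move: h; rewrite abszM; nia.
Qed.

(** A sum of two frequencies differs from a third by less than [2 N] in absolute value, so aliasing
    in a product can only shift by [0], [N] or [- N]. *)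
Lemma freq_sum_dvd N i j k : (i < N)%N -> (j < N)%N -> (k < N)%N ->
  (N %| freq N i + freq N j - freq N k)%Z ->
  [\/ freq N i + freq N j = freq N k, freq N i + freq N j = freq N k + Posz N |
     freq N i + freq N j = freq N k + - Posz N].
Proof.
move=> iN jN kN /dvdz_small h.
have /h : (`|(freq N i + freq N j - freq N k)%R| < 2 * N)%N by rewrite /freq; lia.
by case=> e; [apply: Or31|apply: Or32|apply: Or33];
  rewrite -(subrK (freq N k) (_ + _)) e ?add0r // addrC.
Qed.

Definition freqs N : seq int := map (freq N) (iota 0 N).

Lemma freq_inj N : injective (freq N).
Proof. by move=> k k'; rewrite /freq; lia. Qed.

Lemma freqs_uniq N : uniq (freqs N).
Proof. by rewrite map_inj_uniq ?iota_uniq //; exact: freq_inj. Qed.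

Lemma freqs_small_even N l : ~~ odd N -> l \in freqs N -> (`|l| * 2 <= N)%N.
Proof. by move=> No /mapP[k]; rewrite mem_iota /freq => h ->; lia. Qed.

Lemma mem_freqs N l : (`|l| * 2 < N)%N -> l \in freqs N.
Proof.
move=> h; apply/mapP; exists (`|(l + (N./2)%:Z)%R|)%N; rewrite ?mem_iota /freq; lia.
Qed.

Lemma freqsP N l : l \in freqs N -> exists2 k, (k < N)%N & l = freq N k.
Proof. by move=> /mapP[k]; rewrite mem_iota => /andP[_ kN] ->; exists k. Qed.

End frequencies.

Section dft.
Context {R : realType} (a b : R) (hab : a < b).
Implicit Types (c d : int -> R[i]) (N : nat).

Local Notation mu := (mu a b).

Lemma muD (l m : int) : mu (l + m) = mu l + mu m.
Proof. by rewrite /Defs.mu intrD mulrDr mulrDl. Qed.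
Lemma muN (l : int) : mu (- l) = - mu l.
Proof. by rewrite /Defs.mu intrN mulrN mulNr. Qed.
Lemma mu0 : mu 0 = 0.
Proof. by rewrite /Defs.mu mulr0 mul0r. Qed.
Lemma mu_sqN (l : int) : mu (- l) ^+ 2 = mu l ^+ 2.
Proof. by rewrite muN sqrrN. Qed.

Lemma mu_node N (l : int) j : (0 < N)%N ->
  mu l * (node a b N j - a) = 2 * pi * (l%:~R * j%:R) / N%:R.
Proof.
move=> N0; rewrite /Defs.mu /node /mesh [a + _]addrC addrK.
have N0' : N%:R != 0 :> R by rewrite pnatr_eq0; lia.
have ba : b - a != 0 by rewrite subr_eq0 gt_eqF.
by field; rewrite N0' ba.
Qed.

Lemma expi_muMn (t : R) n : expi (n%:R * t) = expi t ^+ n.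
Proof.
elim: n => [|n ih]; first by rewrite mul0r expi0 expr0.
by rewrite -natr1 mulrDl mul1r expiD ih exprSr.
Qed.

(** Reduction modulo [N] leaves an angle [t = 2 pi r / N] with [0 <= r < N]. If [r > 0], then
    [t / 2] lies strictly between 0 and [pi], so [sin (t / 2) > 0] and [cos t < 1]. *)
Lemma expi_eq1_dvd N (m : int) : (0 < N)%N ->
  (expi (2 * pi * m%:~R / N%:R : R) == 1) = (N %| m)%Z.
Proof.
move=> N0; have N0' : (N%:R : R) != 0 by rewrite pnatr_eq0; lia.
apply/idP/idP => [/eqP h|/dvdzP[q ->]]; last first.
  by rewrite intrM -[N%:~R]/(N%:R) mulrA mulfK // expi_period.
have e := divz_eq m N.
have : expi (2 * pi * (m %% N)%Z%:~R / N%:R : R) = 1.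
  have e' : m%:~R = (m %/ N)%Z%:~R * N%:R + (m %% N)%Z%:~R :> R.
    by rewrite {1}e intrD intrM.
  by move: h; rewrite e' mulrDr mulrDl expiD mulrA mulfK // expi_period mul1r.
have r0 : (0 <= m %% N)%Z by rewrite modz_ge0 //; lia.
have rN : (m %% N < N)%Z by rewrite ltz_pmod //; lia.
move=> h'; apply/dvdz_mod0P; move: (m %% N)%Z r0 rN h' => [r|//] _ rN.
case: r rN => // r rN h'; exfalso.
have {}h' := congr1 (@complex.Re R) h'; move: h' => /=.
set t : R := _ / _; have -> : t = t / 2 *+ 2 by rewrite mulr2n; lra.
rewrite cos_mulr2n => h'.
have : 0 < sin (t / 2).
  have p0 := @pi_gt0 R.
  have rN' : (r.+1%:R : R) < N%:R by rewrite ltr_nat; lia.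
  have r0 : 0 < (r.+1%:R : R) by rewrite ltr0n.
  have N0'' : 0 < (N%:R : R) by rewrite ltr0n.
  have te : t / 2 = pi * (r.+1%:R / N%:R) by rewrite /t -[r.+1%:~R]/(r.+1%:R); field.
  apply: sin_gt0_pi; rewrite te; apply/andP; split.
    by rewrite mulr_gt0 // divr_gt0.
  by rewrite gtr_pMr // ltr_pdivrMr // mul1r.
have := cos2Dsin2 (t / 2); nra.
Qed.

(** Geometric sum of an [N]-th root of unity: [N] if the root is 1, and 0 otherwise. *)
Lemma sum_expi_node N (m : int) : (0 < N)%N ->
  \sum_(j < N) expi (mu m * (node a b N j - a)) = (N%:R * (N %| m)%Z%:R : R[i]).
Proof.
move=> N0.
have h (j : 'I_N) : true -> expi (mu m * (node a b N j - a))
    = expi (2 * pi * m%:~R / N%:R) ^+ j.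
  by move=> _; rewrite mu_node // -expi_muMn; congr expi; ring.
rewrite (eq_bigr _ h) {h}.
rewrite -expi_eq1_dvd //; set z := expi _.
case: eqVneq => [->|z1]; first by rewrite (eq_bigr (fun=> 1)) ?sumr_const ?card_ord ?mulr1 // => i _; rewrite expr1n.
have : (z - 1) * \sum_(i < N) z ^+ i = 0.
  rewrite -subrX1 -expi_muMn mulrC divfK ?expi_period ?subrr // pnatr_eq0; lia.
by move/eqP; rewrite mulf_eq0 subr_eq0 (negPf z1) mulr0 => /eqP.
Qed.

Lemma dftE N (v : @vec R N) l :
  dft a b v l = N%:R^-1 * \sum_(j < N) v (inord j) * expi (mu (- l) * (node a b N j - a)).
Proof. by rewrite /dft; congr (_ * _); apply: eq_bigr => j _; rewrite muN mulNr. Qed.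

Lemma trig_node_mul N c d j :
  trig a b N c (node a b N j) * trig a b N d (node a b N j) =
  \sum_(k < N) \sum_(k' < N) c (freq N k) * d (freq N k') *
     expi (mu (freq N k + freq N k') * (node a b N j - a)).
Proof.
rewrite /trig big_distrl; apply: eq_bigr => k _; rewrite big_distrr /=.
by apply: eq_bigr => k' _; rewrite mulrACA -expiD muD mulrDl.
Qed.

Lemma inord_lt N (j : 'I_N) : nat_of_ord (inord j : 'I_N.+1) = j.
Proof. by rewrite inordK // ltnS ltnW. Qed.

Lemma dft_ext N (u v : @vec R N) l :
  (forall j : 'I_N, u (inord j) = v (inord j)) -> dft a b u l = dft a b v l.
Proof. by move=> h; rewrite /dft; congr (_ * _); apply: eq_bigr => j _; rewrite h. Qed.

Lemma dft_of_coef N c k : (k < N)%N ->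
  dft a b (of_coef a b c : @vec R N) (freq N k) = c (freq N k).
Proof.
move=> kN; have N0 : (0 < N)%N by lia.
rewrite dftE /of_coef.
under eq_bigr => j _.
  rewrite inord_lt /trig big_distrl /=.
  under eq_bigr => k' _ do rewrite -mulrA -expiD -mulrDl -muD.
  over.
rewrite exchange_big /=.
under eq_bigr => k' _ do rewrite -mulr_sumr sum_expi_node // freq_dvd //.
rewrite (bigD1 (Ordinal kN)) //= eqxx big1 => [|k' kk'].
  by rewrite addr0 mulr1 mulrCA mulVf ?mulr1 // pnatr_eq0; lia.
by rewrite (_ : (k' == k :> nat) = false) ?mulr0 //; apply: contra_neqF kk' => /eqP ?; exact: val_inj.
Qed.

Lemma dft_mul N c d l : (0 < N)%N ->
  dft a b (vmul (of_coef a b c) (of_coef a b d) : @vec R N) l =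
  \sum_(k < N) \sum_(k' < N) c (freq N k) * d (freq N k') *
     (N %| freq N k + freq N k' - l)%Z%:R.
Proof.
move=> N0; rewrite dftE /vmul /of_coef.
under eq_bigr => j _.
  rewrite inord_lt trig_node_mul big_distrl /=.
  under eq_bigr => k _.
    rewrite big_distrl /=.
    under eq_bigr => k' _ do rewrite -mulrA -expiD -mulrDl -muD.
    over.
  over.
rewrite exchange_big mulr_sumr /=; apply: eq_bigr => k _.
rewrite exchange_big mulr_sumr /=; apply: eq_bigr => k' _.
rewrite -mulr_sumr sum_expi_node // mulrCA; congr (_ * _).
by rewrite mulrA mulVf ?mul1r // pnatr_eq0; lia.
Qed.

Lemma of_coef_dft N (v : @vec R N) (j : 'I_N) :
  of_coef a b (dft a b v) (inord j : 'I_N.+1) = v (inord j).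
Proof.
have N0 : (0 < N)%N by case: N v j => // v [].
rewrite /of_coef inord_lt /trig.
under eq_bigr => k _.
  rewrite dftE -mulrA big_distrl /=.
  under eq_bigr => i _.
    rewrite -mulrA -expiD (_ : _ + _ = 2 * pi * (freq N k)%:~R * (j%:R - i%:R) / N%:R);
      last by rewrite !mu_node // intrN; field; rewrite pnatr_eq0; lia.
    (* The common offset [- N/2] of the frequencies is split off as a factor independent of [k];
       what is left is the orthogonality relation with nodes and frequencies exchanged. *)
    rewrite /freq (_ : 2 * pi * _ * _ / _ = 2 * pi * (- (N./2)%:Z)%:~R * (j%:R - i%:R) / N%:R
        + 2 * pi * (k%:Z * (j%:Z - i%:Z))%:~R / N%:R); last first.
      rewrite !intrM !intrD !intrN; field; rewrite pnatr_eq0; lia.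
    rewrite expiD mulrA.
    over.
  over.
rewrite -mulr_sumr exchange_big /=.
under eq_bigr => i _.
  rewrite -mulr_sumr.
  rewrite (eq_bigr (fun k : 'I_N => expi (mu (j%:Z - i%:Z) * (node a b N k - a)))); last first.
    by move=> k _; rewrite mu_node // !intrM /= [k%:~R * _]mulrC.
  rewrite sum_expi_node // (_ : (N %| _)%Z = (j == i)); last first.
    by rewrite -val_eqE /= -(freq_dvd (ltn_ord j) (ltn_ord i)) /freq; congr (_ %| _)%Z; lia.
  over.
rewrite (bigD1 j) //= eqxx big1 => [|i ij].
  rewrite subrr mulr0 mul0r expi0 !mulr1 addr0 mulrCA mulVf ?mulr1 //.
  rewrite pnatr_eq0; lia.
by rewrite eq_sym (negPf ij) !mulr0.
Qed.

(** Convolution modulo [N]: the coefficients of a product formed on the grid, aliasing included. It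
    sees [c] and [d] only at the [N] frequencies of the grid. *)
Definition cconv N c d : int -> R[i] :=
  dft a b (vmul (of_coef a b c) (of_coef a b d) : @vec R N).

Lemma dft_vmul N (u v : @vec R N) l :
  dft a b (vmul u v) l = cconv N (dft a b u) (dft a b v) l.
Proof. by apply: dft_ext => j; rewrite /vmul !of_coef_dft. Qed.

(** The congruence modulo [N] is replaced by three equalities with shifts [0], [N], [- N], to which
    plain convolution estimates apply. *)
Lemma conv_bound N c d k : (k < N)%N ->
  cnorm (cconv N c d (freq N k)) <=
  \sum_(q <- [:: 0; Posz N; - Posz N]) \sum_(j <- map (freq N) (iota 0 N))
    \sum_(k' <- map (freq N) (iota 0 N))
      cnorm (c j) * cnorm (d k') * (j + k' == freq N k + q)%:R.
Proof.
move=> kN; rewrite /cconv dft_mul; last lia.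
rewrite -(big_mkord xpredT (fun j => \sum_(k' < N) c (freq N j) * d (freq N k') *
     (N %| freq N j + freq N k' - freq N k)%Z%:R)) /=.
apply: le_trans (cnorm_sum _ _ _) _.
rewrite exchange_big /= big_map /index_iota subn0 big_seq [leRHS]big_seq.
apply: ler_sum => j; rewrite mem_iota => /andP[_ jN].
rewrite exchange_big /= big_map.
rewrite -(big_mkord xpredT (fun k' => c (freq N j) * d (freq N k') *
     (N %| freq N j + freq N k' - freq N k)%Z%:R)) /=.
apply: le_trans (cnorm_sum _ _ _) _.
rewrite /index_iota subn0 big_seq [leRHS]big_seq.
apply: ler_sum => k'; rewrite mem_iota => /andP[_ k'N].
rewrite !cnormM -mulr_sumr ler_wpM2l ?mulr_ge0 //.
have -> : cnorm (((N %| freq N j + freq N k' - freq N k)%Z)%:R : R[i]) = ((N %| freq N j + freq N k' - freq N k)%Z)%:R.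
  by case: (N %| _)%Z; rewrite ?cnorm0 // cnormE Normc.normc1.
rewrite -natr_sum ler_nat !big_cons big_nil addn0.
by case: (boolP (N %| _)%Z) => //= /(freq_sum_dvd jN k'N kN) [] ->; rewrite ?eqxx ?addr0 ?eqxx; lia.
Qed.

End dft.

(** * Weighted norms of grid products, and aliasing of products *)

Section fourier_algebra.
Context {R : realType} (a b : R) (hab : a < b).
Implicit Types (c d : int -> R[i]) (N : nat).

Local Notation mu := (mu a b).

Definition bw (l : int) : R := 1 + mu l ^+ 2.

Lemma bw_ge1 l : 1 <= bw l.
Proof. by rewrite lerDl sqr_ge0. Qed.

Lemma bw_gt0 l : 0 < bw l.
Proof. exact: lt_le_trans (bw_ge1 l). Qed.

Lemma bwX_ge0 k l : 0 <= bw l ^+ k.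
Proof. by rewrite exprn_ge0 // ltW // bw_gt0. Qed.

(* The H^(2k) norm of a trigonometric polynomial, up to equivalence. *)
Definition nrm N k c : R := wn N (fun l => bw l ^+ k) c.

Lemma l2_le_in (I : eqType) (r : seq I) (x y : I -> R) :
  (forall i, i \in r -> 0 <= x i) -> (forall i, i \in r -> x i <= y i) ->
  l2 r x <= l2 r y.
Proof.
move=> x0 xy; apply: ler_wsqrtr; rewrite big_seq [leRHS]big_seq.
apply: ler_sum => i ir; rewrite ler_sqr ?nnegrE ?x0 ?xy //.
exact: le_trans (x0 _ ir) (xy _ ir).
Qed.

Lemma wn_freqs N W c : wn N W c = l2 (freqs N) (fun l => W l * cnorm (c l)).
Proof. by rewrite /wn /l2 /freqs big_map /index_iota subn0. Qed.

Lemma gw_bw l : gw l ^+ 2 <= (2 * (1 + (mu 1) ^- 2)) * bw l.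
Proof.
have p0 := @pi_gt0 R; have ba : 0 < b - a by rewrite subr_gt0.
have m1 : 0 < mu 1 by rewrite /Defs.mu mulr1 divr_gt0 // mulr_gt0.
have e : mu l = mu 1 * l%:~R by rewrite /Defs.mu; field; lra.
have e2 : (l%:~R : R) ^+ 2 = (`|l|%N)%:R ^+ 2.
  by clear e; case: l => // n; rewrite [in LHS]NegzE mulrNz sqrrN.
rewrite /gw /bw e [(mu 1 * _) ^+ 2]exprMn e2.
have h : mu 1 ^- 2 * mu 1 ^+ 2 = 1 by rewrite mulVf // expf_neq0 // gt_eqF.
set x : R := _%:R; set p := mu 1 ^- 2 in h *; set q := mu 1 ^+ 2 in h *.
have p0' : 0 < p by rewrite invr_gt0 exprn_gt0.
have q0' : 0 < q by rewrite exprn_gt0.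
have : 0 <= (x - 1) ^+ 2 by rewrite sqr_ge0.
have : 0 <= q * x ^+ 2 by rewrite mulr_ge0 ?sqr_ge0 ?ltW.
have : p * (q * x ^+ 2) = x ^+ 2 by rewrite mulrA h mul1r.
nra.
Qed.

Lemma bw_gw l : bw l <= (1 + mu 1 ^+ 2) * gw l ^+ 2.
Proof.
have ba : b - a != 0 by rewrite subr_eq0 gt_eqF.
have e : mu l = mu 1 * l%:~R by rewrite /Defs.mu; field.
have e2 : (l%:~R : R) ^+ 2 = (`|l|%N)%:R ^+ 2.
  by clear e; case: l => // n; rewrite [in LHS]NegzE mulrNz sqrrN.
rewrite /gw /bw e [(mu 1 * _) ^+ 2]exprMn e2.
set x : R := _%:R; have x0 : 0 <= x by [].
have : 0 <= mu 1 ^+ 2 by rewrite sqr_ge0.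
move: (mu 1 ^+ 2) => q q0; nra.
Qed.

Lemma bw_le l m : (`|l| <= `|m|)%N -> bw l <= bw m.
Proof.
move=> h; rewrite lerD2l -!(real_normK (num_real (mu _))) lerXn2r ?nnegrE //.
rewrite /Defs.mu !normrM !ler_wpM2r // ler_wpM2l //.
by rewrite -!intr_norm ler_int; lia.
Qed.

Lemma bwD l m : bw (l + m) <= 2 * (bw l + bw m).
Proof.
rewrite /bw muD; have : 0 <= (mu l - mu m) ^+ 2 by rewrite sqr_ge0.
by nra.
Qed.

(** [bw] is subadditive up to a factor 2, so four times the larger weight on the right dominates. In
    a product all derivatives may thus be put on one factor. *)
Lemma bwXD k l j m : (`|l| <= `|(j + m)%R|)%N ->
  bw l ^+ k <= 4 ^+ k * bw j ^+ k + 4 ^+ k * bw m ^+ k.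
Proof.
move=> h; have hl := le_trans (bw_le h) (bwD j m).
have [[j0 m0] l0] := (bw_gt0 j, bw_gt0 m, bw_gt0 l).
have [jm|mj] := leP (bw j) (bw m).
  apply: le_trans (_ : (4 * bw m) ^+ k <= _).
    by rewrite lerXn2r ?nnegrE //; lra.
  by rewrite exprMn lerDr mulr_ge0 ?exprn_ge0 // ltW.
apply: le_trans (_ : (4 * bw j) ^+ k <= _).
  by rewrite lerXn2r ?nnegrE //; lra.
by rewrite exprMn lerDl mulr_ge0 ?exprn_ge0 // ltW.
Qed.

Definition l1 (s : seq int) c : R := \sum_(l <- s) cnorm (c l).

(** Sobolev embedding of H^2 into absolutely convergent series: Cauchy-Schwarz against [1 / bw],
    whose squares are summable since [1 / bw <= D / gw^2]. *)
Lemma l1_bw : exists2 C, 0 <= C &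
  forall s c, uniq s -> l1 s c <= C * l2 s (fun l => bw l * cnorm (c l)).
Proof.
set D := 2 * (1 + mu 1 ^- 2).
have D0 : 0 <= D by rewrite mulr_ge0 // addr_ge0 // invr_ge0 sqr_ge0.
exists (Num.sqrt (D * 4)) => [|s c us]; first exact: sqrtr_ge0.
have -> : l1 s c = \sum_(l <- s) (bw l)^-1 * (bw l * cnorm (c l)).
  by apply: eq_bigr => l _; rewrite mulrA mulVf ?mul1r // gt_eqF ?bw_gt0.
apply: le_trans (cauchy_schwarz _ _ _) _; rewrite ler_wpM2r ?l2_ge0 //.
apply: ler_wsqrtr; apply: le_trans (_ : D * \sum_(l <- s) gw l ^- 2 <= _); last first.
  by rewrite ler_wpM2l // sum_gw.
rewrite mulr_sumr; apply: ler_sum => l _.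
rewrite exprVn ler_pdivlMr ?exprn_gt0 ?gw_gt0 //.
rewrite mulrC ler_pdivrMr ?exprn_gt0 ?bw_gt0 //.
apply: le_trans (gw_bw l) _; rewrite ler_wpM2l // expr2 ler_peMl ?bw_ge1 //.
by rewrite ltW // bw_gt0.
Qed.

Lemma l2_conv N (J L : seq int) (x y : int -> R) : uniq J -> uniq L ->
  (forall j, 0 <= x j) -> (forall j, 0 <= y j) ->
  l2 L (fun l => \sum_(q <- [:: 0; Posz N; - Posz N]) \sum_(j <- J) \sum_(k <- J)
         x j * y k * (j + k == l + q)%:R)
  <= 3 * (\sum_(j <- J) x j) * l2 J y.
Proof.
move=> uJ uL x0 y0.
apply: le_trans (_ : \sum_(q <- [:: 0; Posz N; - Posz N]) 1 * l2 L (fun l =>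
   \sum_(j <- J) \sum_(k <- J) x j * y k * (j + k == l + q)%:R) <= _).
  apply: le_trans (l2_sum _ _ _ _) => [|//].
  by rewrite /l2; under eq_bigr do under eq_bigr do rewrite -[\sum_(_ <- J) _]mul1r.
have h q := young J q uJ uL x0 y0.
rewrite !big_cons big_nil addr0 !mul1r -mulrA.
have := h 0; have := h (Posz N); have := h (- Posz N); lra.
Qed.

Lemma l2_conv' N (J L : seq int) (x y : int -> R) : uniq J -> uniq L ->
  (forall j, 0 <= x j) -> (forall j, 0 <= y j) ->
  l2 L (fun l => \sum_(q <- [:: 0; Posz N; - Posz N]) \sum_(j <- J) \sum_(k <- J)
         x j * y k * (j + k == l + q)%:R)
  <= 3 * (\sum_(j <- J) y j) * l2 J x.
Proof.
move=> uJ uL x0 y0; apply: le_trans (l2_conv N uJ uL y0 x0).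
rewrite /l2 le_eqVlt; apply/orP; left; apply/eqP; congr Num.sqrt; apply: eq_bigr => l _.
congr (_ ^+ 2); apply: eq_bigr => q _; rewrite exchange_big; apply: eq_bigr => j _ /=.
by apply: eq_bigr => k _; rewrite (addrC k) (mulrC (x k)).
Qed.

(** Algebra property, uniform in [N]: the weight goes to one factor by [bwXD], Young's inequality
    handles each shift, and the other factor is summed by [l1_bw]. For even [N] folding never raises
    a frequency, as [|l| <= N/2 <= |l + q|] for [q = N] or [q = - N]. *)
Lemma conv_nrm k : exists2 K, 0 <= K & forall N c d, ~~ odd N -> (0 < k)%N ->
  nrm N k (cconv a b N c d) <= K * (nrm N k c * nrm N k d).
Proof.
have [C C0 hC] := l1_bw.
exists (6 * 4 ^+ k * C) => [|N c d No k0].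
  by rewrite mulr_ge0 // mulr_ge0 // exprn_ge0.
have l1nrm e : l1 (freqs N) e <= C * nrm N k e.
  apply: le_trans (hC _ _ (freqs_uniq N)) _; rewrite ler_wpM2l // /nrm wn_freqs.
  apply: l2_le => l; first by rewrite mulr_ge0 // ltW // bw_gt0.
  by rewrite ler_wpM2r // -[leLHS]expr1 ler_weXn2l ?bw_ge1.
have cn0 (e : int -> R[i]) j : 0 <= cnorm (e j) by [].
have wcn0 e j : 0 <= 4 ^+ k * bw j ^+ k * cnorm (e j :> R[i]).
  by rewrite !mulr_ge0 ?bwX_ge0.
rewrite {1}/nrm wn_freqs.
apply: le_trans (_ : l2 (freqs N) (fun l =>
   \sum_(q <- [:: 0; Posz N; - Posz N]) \sum_(j <- freqs N) \sum_(m <- freqs N)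
     (4 ^+ k * bw j ^+ k * cnorm (c j)) * cnorm (d m) * (j + m == l + q)%:R
  + \sum_(q <- [:: 0; Posz N; - Posz N]) \sum_(j <- freqs N) \sum_(m <- freqs N)
     cnorm (c j) * (4 ^+ k * bw m ^+ k * cnorm (d m)) * (j + m == l + q)%:R) <= _).
  apply: l2_le_in => l lN; first by rewrite mulr_ge0 ?bwX_ge0.
  have [i iN le] := freqsP lN.
  apply: le_trans (_ : bw l ^+ k * \sum_(q <- [:: 0; Posz N; - Posz N])
     \sum_(j <- freqs N) \sum_(m <- freqs N)
      cnorm (c j) * cnorm (d m) * (j + m == l + q)%:R <= _).
    by rewrite ler_wpM2l ?bwX_ge0 // {1 2}le conv_bound.
  rewrite mulr_sumr -big_split big_seq [leRHS]big_seq /=; apply: ler_sum => q qQ.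
  rewrite mulr_sumr -big_split; apply: ler_sum => j _ /=.
  rewrite mulr_sumr -big_split; apply: ler_sum => m _ /=.
  case: eqP => [e|_]; last by rewrite !mulr0 addr0.
  have h : (`|l| <= `|(j + m)%R|)%N.
    rewrite e; have := freqs_small_even No lN; move: qQ; rewrite !inE.
    by case/or3P=> /eqP ->; lia.
  rewrite !mulr1 [leRHS](_ : _ = (4 ^+ k * bw j ^+ k + 4 ^+ k * bw m ^+ k)
    * (cnorm (c j) * cnorm (d m))); last by ring.
  by rewrite ler_wpM2r ?mulr_ge0 // bwXD.
apply: le_trans (l2D _ _ _) _.
have c1 := l1nrm c; have d1 := l1nrm d.
have nc : l2 (freqs N) (fun j => 4 ^+ k * bw j ^+ k * cnorm (c j)) = 4 ^+ k * nrm N k c.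
  rewrite /nrm wn_freqs -l2Z ?exprn_ge0 // /l2; congr Num.sqrt; apply: eq_bigr => j _.
  by rewrite mulrA.
have nd : l2 (freqs N) (fun j => 4 ^+ k * bw j ^+ k * cnorm (d j)) = 4 ^+ k * nrm N k d.
  rewrite /nrm wn_freqs -l2Z ?exprn_ge0 // /l2; congr Num.sqrt; apply: eq_bigr => j _.
  by rewrite mulrA.
have := l2_conv' N (freqs_uniq N) (freqs_uniq N) (wcn0 c) (cn0 d).
have := l2_conv N (freqs_uniq N) (freqs_uniq N) (cn0 c) (wcn0 d).
rewrite nc nd -!/(l1 _ _) => h1 h2; apply: le_trans (lerD h2 h1) _.
have n0 e : 0 <= nrm N k e by exact: wn_ge0.
have p0 : 0 <= (4 : R) ^+ k by rewrite exprn_ge0.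
apply: le_trans (_ : 3 * (C * nrm N k d) * (4 ^+ k * nrm N k c)
   + 3 * (C * nrm N k c) * (4 ^+ k * nrm N k d) <= _); last by rewrite le_eqVlt; apply/orP; left; apply/eqP; ring.
by apply: lerD; rewrite ler_wpM2r ?mulr_ge0 // ler_wpM2l.
Qed.

(** The inequality is strict: the unpaired frequency [- N/2] is dropped, which makes truncation
    commute with complex conjugation. *)
Definition tr N c l : R[i] := if (`|l| * 2 < N)%N then c l else 0.

Lemma sum_freq_zr N K (F : int -> R[i]) : (N <= K)%N ->
  (forall l, (N <= `|l| * 2)%N -> F l = 0) ->
  \sum_(k < N) F (freq N k) = \sum_(l <- zr K) F l.
Proof.
move=> NK F0; rewrite -(big_mkord xpredT (fun k => F (freq N k))) /index_iota subn0.
rewrite -(big_map (freq N) xpredT F).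
have e (s : seq int) : \sum_(l <- s) F l = \sum_(l <- s | (`|l| * 2 < N)%N) F l.
  rewrite [RHS]big_mkcond; apply: eq_bigr => l _; case: ltnP => // h; exact: F0.
rewrite !e -!(big_filter _ (fun l : int => (`|l| * 2 < N)%N)); apply: perm_big.
apply: uniq_perm; rewrite ?filter_uniq ?freqs_uniq ?zr_uniq // => l.
rewrite !mem_filter; case: ltnP => //= h; rewrite (mem_freqs h) mem_zr; lia.
Qed.

Definition zconv K c d l : R[i] :=
  \sum_(j <- zr K) \sum_(m <- zr K) c j * d m * (j + m == l)%:R.

(** If [|j|] and [|m|] are both below [N/4], then [|j + m| < N/2], truncation and folding do
    nothing, and the two sums agree on that pair. Only pairs with a large index contribute, at one
    of the three shifts. *)
Lemma alias_pointwise N K c d l : ~~ odd N -> (0 < N)%N -> (N <= K)%N -> l \in freqs N ->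
  cnorm (tr N (zconv K c d) l - cconv a b N (tr N c) (tr N d) l) <=
  \sum_(q <- [:: 0; Posz N; - Posz N]) \sum_(j <- zr K) \sum_(m <- zr K)
     cnorm (c j) * cnorm (d m) *
       ((N <= 4 * maxn `|j| `|m|)%N && (j + m == l + q))%:R.
Proof.
move=> No N0 NK lN; rewrite /cconv dft_mul //.
have -> : \sum_(k < N) \sum_(k' < N) tr N c (freq N k) * tr N d (freq N k') *
     (N %| freq N k + freq N k' - l)%Z%:R =
   \sum_(j <- zr K) \sum_(m <- zr K) tr N c j * tr N d m * (N %| j + m - l)%Z%:R.
  rewrite -(@sum_freq_zr N K (fun j => \sum_(m <- zr K) tr N c j * tr N d m * (N %| j + m - l)%Z%:R)) //.
    apply: eq_bigr => k _.
    rewrite (@sum_freq_zr N K (fun m => tr N c (freq N k) * tr N d m * (N %| freq N k + m - l)%Z%:R)) //.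
    by move=> m h; rewrite {2}/tr ltnNge h /= mulr0 mul0r.
  by move=> j h; rewrite big1 // => m _; rewrite {1}/tr ltnNge h /= !mul0r.
have -> : tr N (zconv K c d) l = \sum_(j <- zr K) \sum_(m <- zr K)
    c j * d m * ((`|l| * 2 < N)%N && (j + m == l))%:R.
  rewrite /tr; case: ifP => _ //.
  by rewrite big1 // => j _; rewrite big1 // => m _; rewrite mulr0.
rewrite -sumrB exchange_big; apply: le_trans (cnorm_sum _ _ _) _; apply: ler_sum => j _ /=.
rewrite -sumrB exchange_big; apply: le_trans (cnorm_sum _ _ _) _; apply: ler_sum => m _ /=.
rewrite -mulr_sumr.
have -> : c j * d m * ((`|l| * 2 < N)%N && (j + m == l))%:R -
    tr N c j * tr N d m * (N %| j + m - l)%Z%:R =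
  c j * d m * (((`|l| * 2 < N)%N && (j + m == l))%:R -
    [&& (`|j| * 2 < N)%N, (`|m| * 2 < N)%N & (N %| j + m - l)%Z]%:R).
  rewrite mulrBr; congr (_ - _); rewrite /tr.
  case: (ltnP (`|j| * 2) N) => _; last by rewrite !mul0r mulr0.
  by case: (ltnP (`|m| * 2) N) => _; rewrite ?mulr0 ?mul0r ?mulr0.
rewrite !cnormM ler_wpM2l ?mulr_ge0 // -natr_sum !big_cons big_nil addn0.
have nat_cn (n : nat) : (n%:R : R[i]) = (n%:R%:C)%C by rewrite rmorph_nat.
rewrite !nat_cn -rmorphB cnorm_real.
set X := _ && _; set Y := [&& _, _ & _].
(* Two indicators differ by at most 1, so it is enough that some term on the right equals 1 whenever
   they differ. *)
suff : X != Y -> (0 < ((N <= 4 * maxn `|j| `|m|) && ((j + m)%R == (l + 0)%R)) +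
   (((N <= 4 * maxn `|j| `|m|) && ((j + m)%R == (l + Posz N)%R)) +
    ((N <= 4 * maxn `|j| `|m|) && ((j + m)%R == (l + - Posz N)%R))))%N.
  case: eqVneq => [-> _|XY /(_ isT) h]; first by rewrite subrr normr0.
  apply: le_trans (_ : 1 <= _); last by rewrite ler1n.
  by case: (X) (Y) => -[]; rewrite ?subrr ?subr0 ?sub0r ?normrN ?normr0 ?normr1.
have hl := freqs_small_even No lN.
have [/andP[/andP[hj hm] hd]|hY] := boolP ((`|j| * 2 < N)%N && (`|m| * 2 < N)%N && (N %| j + m - l)%Z).
  have hs : (`|(j + m - l)%R| < 2 * N)%N by lia.
  case: (dvdz_small hd hs) => e; rewrite /X /Y hj hm hd /=.
  - have jml : j + m = l by apply/eqP; rewrite -subr_eq0 e.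
    rewrite jml eqxx addr0 andbT; case: ltnP => // lN' _.
    rewrite eqxx /= andbT; suff -> : (N <= 4 * maxn `|j| `|m|)%N by [].
    clear -jml lN'; lia.
  - have jml : j + m = l + Posz N by rewrite -e; ring.
    move=> _; rewrite jml eqxx andbT; suff -> : (N <= 4 * maxn `|j| `|m|)%N by rewrite addn_gt0 orbT.
    lia.
  - have jml : j + m = l + - Posz N by rewrite -e; ring.
    move=> _; rewrite jml eqxx andbT; suff -> : (N <= 4 * maxn `|j| `|m|)%N by rewrite !addn_gt0 !orbT.
    lia.
have -> : Y = false by rewrite /Y andbA; exact: negbTE.
rewrite /X; case: (j + m =P l) => [jml|]; last by rewrite andbF.
case: ltnP => // lN' _; rewrite addr0 jml eqxx andbT.
suff -> : (N <= 4 * maxn `|j| `|m|)%N by [].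
have : ~~ ((`|j| * 2 < N)%N && (`|m| * 2 < N)%N).
  by apply: contra hY => ->; rewrite jml subrr dvdz0.
by clear; lia.
Qed.

(** An H^s bound expressed on all finite sets of frequencies, so that no infinite sum has to be
    given a meaning. *)
Definition hbound (s : nat) (B : R) c : Prop :=
  forall r : seq int, uniq r -> l2 r (fun l => gw l ^+ s * cnorm (c l)) <= B.

Lemma l1_gw r c B s : (0 < s)%N -> uniq r -> hbound s B c -> l1 r c <= 2 * B.
Proof.
move=> s0 ur hB.
have -> : l1 r c = \sum_(l <- r) (gw l)^-1 * (gw l * cnorm (c l)).
  by apply: eq_bigr => l _; rewrite mulrA mulVf ?mul1r // gt_eqF ?gw_gt0.
apply: le_trans (cauchy_schwarz _ _ _) _.
have h1 : l2 r (fun l => (gw l)^-1 : R) <= 2.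
  rewrite /l2; under eq_bigr do rewrite exprVn.
  have -> : (2 : R) = Num.sqrt (2 ^+ 2) by rewrite sqrtr_sqr ger0_norm.
  apply: ler_wsqrtr; apply: le_trans (sum_gw ur) _; lra.
have h2 : l2 r (fun l => gw l * cnorm (c l)) <= B.
  apply: le_trans (hB _ ur); apply: l2_le => l.
    by rewrite mulr_ge0 // ltW // gw_gt0.
  by rewrite ler_wpM2r // -[leLHS]expr1 ler_weXn2l ?gw_ge1.
by apply: ler_pM; rewrite ?l2_ge0.
Qed.

(** With [M] the larger of the two weights, [gw l <= 2 M] and [N <= 4 M]. Multiplying [(2 M)^2] by
    [(4 M / N)^m >= 1] converts [m] excess derivatives into [N^-m]. *)
Lemma gw_alias N (m : nat) (l j k : int) : (0 < N)%N -> (`|l| <= `|(j + k)%R|)%N ->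
  (N <= 4 * maxn `|j| `|k|)%N ->
  (gw l ^+ 2 : R) <= 4 ^+ m.+1 / N%:R ^+ m * gw j ^+ (m + 2) +
                    4 ^+ m.+1 / N%:R ^+ m * gw k ^+ (m + 2).
Proof.
move=> N0 h1 h2; set M : R := Num.max (gw j) (gw k).
have N0' : 0 < N%:R :> R by rewrite ltr0n.
have M1 : gw l <= 2 * M.
  have h : gw l <= gw j + gw k :> R.
    have : ((`|l|%N)%:R : R) <= (`|j|%N)%:R + (`|k|%N)%:R by rewrite -natrD ler_nat; lia.
    by rewrite /gw; lra.
  by apply: le_trans h _; rewrite mulr2n mulrDl mul1r lerD // le_max lexx ?orbT.
have M2 : N%:R <= 4 * M.
  apply: le_trans (_ : 4 * (maxn `|j| `|k|)%:R <= _); first by rewrite -natrM ler_nat.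
  rewrite ler_wpM2l // natr_max; apply: le_trans (_ : Num.max (gw j) (gw k) <= _) => //.
  by rewrite ge_max !le_max /gw !lerDr ler01 orbT.
have M0 : 0 < M by rewrite lt_max gw_gt0.
apply: le_trans (_ : 4 ^+ m.+1 / N%:R ^+ m * M ^+ (m + 2) <= _); last first.
  rewrite /M; case: (leP (gw j) (gw k)) => _.
    by rewrite lerDr !mulr_ge0 ?invr_ge0 ?exprn_ge0 // ltW // gw_gt0.
  by rewrite lerDl !mulr_ge0 ?invr_ge0 ?exprn_ge0 // ltW // gw_gt0.
apply: le_trans (_ : (2 * M) ^+ 2 <= _).
  by rewrite lerXn2r ?nnegrE // ltW ?gw_gt0 // mulr_gt0.
have -> : 4 ^+ m.+1 / N%:R ^+ m * M ^+ (m + 2) = (2 * M) ^+ 2 * ((4 * M) / N%:R) ^+ m.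
  rewrite exprD !exprMn exprVn exprS; field; rewrite expf_neq0 // gt_eqF //.
rewrite ler_peMr ?sqr_ge0 // exprn_ege1 // ler_pdivlMr // mul1r //.
Qed.

(** [gw_alias] puts [m + 2] derivatives on one factor and the other is summed by [l1_gw]. The
    constant 12 is 3 shifts, times 2 from the summation, times the 2 choices of the factor. *)
Lemma alias m : exists2 C, 0 <= C & forall B N K c d,
  ~~ odd N -> (0 < N)%N -> (N <= K)%N -> hbound (m + 2) B c -> hbound (m + 2) B d ->
  nrm N 1 (fun l => tr N (zconv K c d) l - cconv a b N (tr N c) (tr N d) l)
    <= C * B ^+ 2 / N%:R ^+ m.
Proof.
set D := 1 + mu 1 ^+ 2; have D0 : 0 <= D by rewrite addr_ge0 ?sqr_ge0.
exists (D * 4 ^+ m.+1 * 12) => [|B N K c d No N0 NK hc hd].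
  by rewrite !mulr_ge0 // exprn_ge0.
set E : R := 4 ^+ m.+1 / N%:R ^+ m.
have E0 : 0 <= E by rewrite divr_ge0 ?exprn_ge0.
have cn0 (e : int -> R[i]) j : 0 <= cnorm (e j) by [].
have wcn0 e j : 0 <= D * E * gw j ^+ (m + 2) * cnorm (e j :> R[i]).
  by rewrite !mulr_ge0 ?exprn_ge0 // ltW // gw_gt0.
have B0 : 0 <= B by apply: le_trans (hc [::] isT); rewrite l2_ge0.
rewrite /nrm wn_freqs.
apply: le_trans (_ : l2 (freqs N) (fun l =>
   \sum_(q <- [:: 0; Posz N; - Posz N]) \sum_(j <- zr K) \sum_(k <- zr K)
     (D * E * gw j ^+ (m + 2) * cnorm (c j)) * cnorm (d k) * (j + k == l + q)%:R
  + \sum_(q <- [:: 0; Posz N; - Posz N]) \sum_(j <- zr K) \sum_(k <- zr K)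
     cnorm (c j) * (D * E * gw k ^+ (m + 2) * cnorm (d k)) * (j + k == l + q)%:R) <= _).
  apply: l2_le_in => l lN; first by rewrite mulr_ge0 ?bwX_ge0.
  apply: le_trans (ler_wpM2l (bwX_ge0 1 l) (alias_pointwise c d No N0 NK lN)) _.
  rewrite mulr_sumr -big_split big_seq [leRHS]big_seq /=; apply: ler_sum => q qQ.
  rewrite mulr_sumr -big_split; apply: ler_sum => j _ /=.
  rewrite mulr_sumr -big_split; apply: ler_sum => k _ /=.
  case: (eqVneq (j + k) (l + q)) => [e|_]; last by rewrite andbF !mulr0 addr0.
  have h : (`|l| <= `|(j + k)%R|)%N.
    rewrite e; have := freqs_small_even No lN; move: qQ; rewrite !inE.
    by case/or3P=> /eqP ->; lia.
  rewrite andbT; case: leqP => [hN|_]; last first.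
    by rewrite !mulr0 !mulr1; apply: addr_ge0; apply: mulr_ge0.
  rewrite !mulr1 expr1.
  rewrite [leRHS](_ : _ = (D * (E * gw j ^+ (m + 2) + E * gw k ^+ (m + 2))) * (cnorm (c j) * cnorm (d k))); last by ring.
  rewrite ler_wpM2r ?mulr_ge0 //; apply: le_trans (bw_gw l) _.
  by rewrite ler_wpM2l // gw_alias.
apply: le_trans (l2D _ _ _) _.
have c1 := l1_gw (ltn_addl m (isT : 0 < 2)%N) (zr_uniq K) hc.
have d1 := l1_gw (ltn_addl m (isT : 0 < 2)%N) (zr_uniq K) hd.
have nz e : hbound (m + 2) B e ->
   l2 (zr K) (fun j => D * E * gw j ^+ (m + 2) * cnorm (e j)) <= D * E * B.
  move=> he; apply: le_trans (ler_wpM2l (mulr_ge0 D0 E0) (he _ (zr_uniq K))).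
  rewrite -l2Z ?mulr_ge0 // le_eqVlt; apply/orP; left; apply/eqP.
  by rewrite /l2; congr Num.sqrt; apply: eq_bigr => j _; rewrite !mulrA.
have h1 := l2_conv' N (zr_uniq K) (freqs_uniq N) (wcn0 c) (cn0 d).
have h2 := l2_conv N (zr_uniq K) (freqs_uniq N) (cn0 c) (wcn0 d).
apply: le_trans (lerD h1 h2) _; rewrite -!/(l1 _ _).
apply: le_trans (_ : 3 * (2 * B) * (D * E * B) + 3 * (2 * B) * (D * E * B) <= _); last first.
  rewrite /E le_eqVlt; apply/orP; left; apply/eqP; ring.
have l0 e : 0 <= l1 (zr K) e by apply: sumr_ge0.
by apply: lerD; apply: ler_pM; rewrite ?l2_ge0 ?mulr_ge0 ?ler_wpM2l ?nz ?c1 ?d1 //; lia.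
Qed.

End fourier_algebra.

(** * Convolution and conjugation of coefficients *)

Section vector_algebra.
Context {R : realType} (a b : R).
Implicit Types (c d : int -> R[i]) (N : nat).

Local Notation mu := (mu a b).

(** Grid conjugation on coefficients: [l] goes to [- l] modulo [N], with [- N/2] its own mirror
    image. It is defined through the grid so that the scheme rewrites to it directly; [cjE] is the
    explicit form. *)
Definition cj N c : int -> R[i] := dft a b (vconj (of_coef a b c : @vec R N)).

Context (hab : a < b).

Lemma cconvE N c d l : (0 < N)%N -> cconv a b N c d l =
  \sum_(k < N) \sum_(k' < N) c (freq N k) * d (freq N k') *
     (N %| freq N k + freq N k' - l)%Z%:R.
Proof. exact: dft_mul. Qed.

Lemma cconv_ext N c c' d d' l : (0 < N)%N ->
  (forall k, (k < N)%N -> c (freq N k) = c' (freq N k)) ->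
  (forall k, (k < N)%N -> d (freq N k) = d' (freq N k)) ->
  cconv a b N c d l = cconv a b N c' d' l.
Proof.
move=> N0 h h'; rewrite !cconvE //; apply: eq_bigr => k _; apply: eq_bigr => k' _.
by rewrite h ?h'.
Qed.

Lemma cconvC N c d l : (0 < N)%N -> cconv a b N c d l = cconv a b N d c l.
Proof. by move=> N0; apply: dft_ext => j; rewrite /vmul mulrC. Qed.

Lemma cconvDl N c c' d l : (0 < N)%N ->
  cconv a b N (fun l => c l + c' l) d l = cconv a b N c d l + cconv a b N c' d l.
Proof.
move=> N0; rewrite !cconvE // -big_split; apply: eq_bigr => k _ /=.
by rewrite -big_split; apply: eq_bigr => k' _ /=; rewrite !mulrDl.
Qed.

Lemma cconvZl N (x : R[i]) c d l : (0 < N)%N ->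
  cconv a b N (fun l => x * c l) d l = x * cconv a b N c d l.
Proof.
move=> N0; rewrite !cconvE // mulr_sumr; apply: eq_bigr => k _ /=.
by rewrite mulr_sumr; apply: eq_bigr => k' _ /=; rewrite !mulrA.
Qed.

Lemma cconvNl N c d l : (0 < N)%N ->
  cconv a b N (fun l => - c l) d l = - cconv a b N c d l.
Proof.
move=> N0; rewrite -mulN1r -cconvZl //; apply: cconv_ext => // k _.
by rewrite mulN1r.
Qed.

Lemma cconvBl N c c' d l : (0 < N)%N ->
  cconv a b N (fun l => c l - c' l) d l = cconv a b N c d l - cconv a b N c' d l.
Proof. by move=> N0; rewrite cconvDl // cconvNl. Qed.

Lemma cconvZr N (x : R[i]) c d l : (0 < N)%N ->
  cconv a b N c (fun l => x * d l) l = x * cconv a b N c d l.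
Proof. by move=> N0; rewrite cconvC // cconvZl // cconvC. Qed.

Lemma cconvBr N c d d' l : (0 < N)%N ->
  cconv a b N c (fun l => d l - d' l) l = cconv a b N c d l - cconv a b N c d' l.
Proof. by move=> N0; rewrite cconvC // cconvBl // !(cconvC c). Qed.

Lemma cconvB N c c' d d' l : (0 < N)%N ->
  cconv a b N c d l - cconv a b N c' d' l =
  cconv a b N (fun l => c l - c' l) d l + cconv a b N c' (fun l => d l - d' l) l.
Proof. by move=> N0; rewrite cconvBl // cconvBr // addrA subrK. Qed.

Lemma C1on_cconv N (A B : R) (c c' d d' : R -> int -> R[i]) l : (0 < N)%N ->
  (forall k, (k < N)%N -> C1on A B (fun s => c s (freq N k)) (fun s => c' s (freq N k))) ->
  (forall k, (k < N)%N -> C1on A B (fun s => d s (freq N k)) (fun s => d' s (freq N k))) ->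
  C1on A B (fun s => cconv a b N (c s) (d s) l)
    (fun s => cconv a b N (c' s) (d s) l + cconv a b N (c s) (d' s) l).
Proof.
move=> N0 hc hd.
have h : C1on A B (fun s => \sum_(k <- index_enum 'I_N) \sum_(k' <- index_enum 'I_N)
     (N %| freq N k + freq N k' - l)%Z%:R * (c s (freq N k) * d s (freq N k')))
   (fun s => \sum_(k <- index_enum 'I_N) \sum_(k' <- index_enum 'I_N)
     (N %| freq N k + freq N k' - l)%Z%:R *
     (c' s (freq N k) * d s (freq N k') + c s (freq N k) * d' s (freq N k'))).
  by apply: C1on_sum => k; apply: C1on_sum => k'; apply: C1onZ; apply: C1onM; [exact: hc|exact: hd].
apply: (C1on_ext h) => x *; rewrite !cconvE // -?big_split; apply: eq_bigr => k _;
  rewrite -?big_split; apply: eq_bigr => k' _ /=; ring.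
Qed.

(** Position of the frequency opposite to [freq N k] modulo [N]. Position 0 carries [- N/2], which
    for even [N] is congruent to its opposite. *)
Definition refl N k : nat := if k is 0%N then 0%N else (N - k)%N.

Lemma reflK N k : (k < N)%N -> refl N (refl N k) = k.
Proof. by clear; case: k => [|k] kN //=; rewrite /refl; case e: (N - k.+1)%N => [|m]; lia. Qed.

Lemma refl_lt N k : (k < N)%N -> (refl N k < N)%N.
Proof. by clear; case: k => [|k] /=; lia. Qed.

Lemma freq_refl N k : ~~ odd N -> (k < N)%N ->
  freq N (refl N k) = freq N k \/ freq N (refl N k) = - freq N k.
Proof. by clear; case: k => [|k] No kN /=; rewrite /freq; [left|right; lia]. Qed.

Lemma freq_add_dvd N k k' : ~~ odd N -> (k < N)%N -> (k' < N)%N ->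
  (N %| freq N k + freq N k')%Z = (k' == refl N k).
Proof.
clear; move=> No kN k'N.
have -> : freq N k + freq N k' = (k + k')%N%:Z - N%:Z by rewrite /freq; lia.
apply/idP/eqP => [/dvdzP[q]|->].
  case: k kN => [|k] kN; case: q => [[|[|q]]|[|q]]; rewrite ?NegzE /= => h; nia.
by apply/dvdzP; case: k kN => [|k] kN /=; [exists (-1)|exists 0]; lia.
Qed.

Lemma cjE N c k : ~~ odd N -> (k < N)%N ->
  cj N c (freq N k) = conjc (c (freq N (refl N k))).
Proof.
move=> No kN; have N0 : (0 < N)%N by clear -kN; lia.
rewrite /cj dftE /vconj /of_coef.
under eq_bigr => j _.
  rewrite (inord_lt j) /trig conjc_sum big_distrl /=.
  under eq_bigr => k' _.
    rewrite conjcM -expiN -mulrA -expiD -mulNr -mulrDl -muN -muD.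
    over.
  over.
rewrite exchange_big /=.
under eq_bigr => k' _.
  rewrite -mulr_sumr sum_expi_node // -opprD dvdzE abszN -dvdzE addrC freq_add_dvd //.
  over.
rewrite (bigD1 (Ordinal (refl_lt kN))) //= eqxx big1 => [|k' kk'].
  by rewrite addr0 mulr1 mulrCA mulVf ?mulr1 // pnatr_eq0 -lt0n.
rewrite (_ : (k' == refl N k :> nat) = false) ?mulr0 //.
by apply: contra_neqF kk' => /eqP ?; exact: val_inj.
Qed.

(** Even multipliers survive the reflection, also at [- N/2] where the index keeps its sign. The
    multipliers of the scheme are even because they depend on [mu^2] only. *)
Lemma cjM N (m : int -> R[i]) c k : ~~ odd N -> (k < N)%N ->
  (forall l, m (- l) = m l) ->
  cj N (fun l => m l * c l) (freq N k) = conjc (m (freq N k)) * cj N c (freq N k).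
Proof.
move=> No kN hm; rewrite !cjE // conjcM; congr (conjc _ * _).
by case: (freq_refl No kN) => ->.
Qed.

Lemma cjD N c d k : ~~ odd N -> (k < N)%N ->
  cj N (fun l => c l + d l) (freq N k) = cj N c (freq N k) + cj N d (freq N k).
Proof. by move=> No kN; rewrite !cjE // conjcD. Qed.

Lemma cjN N c k : ~~ odd N -> (k < N)%N ->
  cj N (fun l => - c l) (freq N k) = - cj N c (freq N k).
Proof. by move=> No kN; rewrite !cjE // rmorphN. Qed.

Lemma cjB N c d k : ~~ odd N -> (k < N)%N ->
  cj N (fun l => c l - d l) (freq N k) = cj N c (freq N k) - cj N d (freq N k).
Proof. by move=> No kN; rewrite cjD // cjN. Qed.

Lemma cjK N c k : ~~ odd N -> (k < N)%N -> cj N (cj N c) (freq N k) = c (freq N k).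
Proof. by move=> No kN; rewrite !cjE ?refl_lt // reflK // conjcK. Qed.

Lemma cj_ext N c d k : (forall k, (k < N)%N -> c (freq N k) = d (freq N k)) ->
  ~~ odd N -> (k < N)%N -> cj N c (freq N k) = cj N d (freq N k).
Proof. by move=> h No kN; rewrite !cjE // h // refl_lt. Qed.

Lemma C1on_cj N (A B : R) (c c' : R -> int -> R[i]) k : ~~ odd N -> (k < N)%N ->
  (forall k, (k < N)%N -> C1on A B (fun s => c s (freq N k)) (fun s => c' s (freq N k))) ->
  C1on A B (fun s => cj N (c s) (freq N k)) (fun s => cj N (c' s) (freq N k)).
Proof.
by move=> No kN h; apply: (C1on_ext (C1on_conj (h _ (refl_lt kN)))) => x *; rewrite cjE.
Qed.

Lemma bwN l : bw a b (- l) = bw a b l.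
Proof. by rewrite /bw mu_sqN. Qed.

Lemma nrm_cj N k c : ~~ odd N -> nrm a b N k (cj N c) = nrm a b N k c.
Proof.
move=> No; rewrite /nrm /wn /l2 !big_mkord; congr Num.sqrt.
pose h (i : 'I_N) := Ordinal (refl_lt (ltn_ord i)).
have hK : involutive h by move=> i; apply: val_inj; rewrite /= reflK.
rewrite [RHS](reindex_inj (inv_inj hK)) /=; apply: eq_bigr => i _.
rewrite cjE ?cnorm_conj //; congr ((_ * _) ^+ 2).
by case: (freq_refl No (ltn_ord i)) => ->; rewrite ?bwN.
Qed.

Lemma dft_vconj N (v : @vec R N) l : dft a b (vconj v) l = cj N (dft a b v) l.
Proof. by apply: dft_ext => j; rewrite /vconj of_coef_dft. Qed.

Lemma conj_of_coef N c (j : 'I_N) :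
  conjc (of_coef a b c (inord j : 'I_N.+1)) = of_coef a b (cj N c) (inord j : 'I_N.+1).
Proof. by rewrite /cj of_coef_dft. Qed.

Lemma trig_ext N c d x : (forall k, (k < N)%N -> c (freq N k) = d (freq N k)) ->
  trig a b N c x = trig a b N d x.
Proof. by move=> h; rewrite /trig; apply: eq_bigr => k _; rewrite h. Qed.

Lemma dftD N (u v : @vec R N) l :
  dft a b (fun j => u j + v j : R[i]) l = dft a b u l + dft a b v l.
Proof.
rewrite /dft -mulrDr -big_split; congr (_ * _); apply: eq_bigr => j _ /=.
by rewrite mulrDl.
Qed.

Lemma dftZ N (x : R[i]) (v : @vec R N) l :
  dft a b (fun j => x * v j : R[i]) l = x * dft a b v l.
Proof.
rewrite /dft mulrCA; congr (_ * _); rewrite mulr_sumr; apply: eq_bigr => j _ /=.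
by rewrite mulrA.
Qed.

Definition real_vec N (v : @vec R N) : Prop :=
  forall j : 'I_N, conjc (v (inord j)) = v (inord j).

Definition real_coef N c : Prop :=
  forall k, (k < N)%N -> cj N c (freq N k) = c (freq N k).

Lemma real_vec_dft N (v : @vec R N) : real_vec v -> real_coef N (dft a b v).
Proof. by move=> h k kN; rewrite -dft_vconj; apply: dft_ext => j; rewrite /vconj h. Qed.

Lemma real_coef_vec N c : real_coef N c -> real_vec (of_coef a b c : @vec R N).
Proof. by move=> h j; rewrite conj_of_coef; apply: trig_ext. Qed.

Lemma real_coefM N (m : int -> R) c : ~~ odd N -> (forall l, m (- l) = m l) ->
  real_coef N c -> real_coef N (fun l => (m l)%:C%C * c l).
Proof.
move=> No hm hc k kN; rewrite (@cjM N (fun l => (m l)%:C%C)) ?conjc_real ?hc //.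
by move=> l; rewrite hm.
Qed.

Lemma real_coefD N c d : ~~ odd N -> real_coef N c -> real_coef N d ->
  real_coef N (fun l => c l + d l).
Proof. by move=> No hc hd k kN; rewrite cjD // hc ?hd. Qed.

End vector_algebra.

Section scalar_calculus.
Context {R : realType}.

Lemma cderive1E (f f' : R -> R[i]) (A B t : R) : C1on A B f f' -> A < t < B ->
  cderive1 f t = f' t.
Proof.
move=> [[_ h1] [_ h2]] tAB; rewrite /cderive1 !derive1E.
have {}h1 := h1 t tAB; have {}h2 := h2 t tAB.
by rewrite (@derive_val _ _ _ _ _ _ _ h1) (@derive_val _ _ _ _ _ _ _ h2); case: (f' t).
Qed.

(** The weighted mean value inequality with a single frequency and weight 1. *)
Lemma cmvt (f f' : R -> R[i]) (A B M : R) : A <= B -> C1on A B f f' ->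
  (forall s, A < s < B -> cnorm (f' s) <= M) -> cnorm (f B - f A) <= M * (B - A).
Proof.
move=> AB hf hM.
have one (x : R[i]) : wn 1 (fun=> 1) (fun=> x) = cnorm x.
  by rewrite /wn /l2 big_nat1 mul1r sqrtr_sqr ger0_norm.
rewrite -one; apply: (@wn_mvt R 1 (fun=> 1) (fun s _ => f s) (fun s _ => f' s)) => // s sAB.
by rewrite one hM.
Qed.

End scalar_calculus.

(** * The coefficients of the scheme *)

Section fundamental.
Context {R : realType}.

Lemma mul_ii : 'i%C * 'i%C = -1 :> R[i].
Proof. by apply: complex_ext => /=; ring. Qed.

Lemma expiE (t : R) : expi t = (cos t)%:C%C + 'i%C * (sin t)%:C%C.
Proof. by apply: complex_ext => /=; ring. Qed.

Lemma conj_expiE (t : R) : conjc (expi t) = (cos t)%:C%C - 'i%C * (sin t)%:C%C.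
Proof. by apply: complex_ext => /=; ring. Qed.

Lemma ftc2_rC1 (f F : R -> R) (s : R) : 0 <= s ->
  rC1 0 s F f -> {within `[0, s]%classic, continuous f} ->
  \int[lebesgue_measure]_(x in `[0, s]) f x = F s - F 0.
Proof.
move=> s0 [cF dF] cf; have [<-|s0'] := eqVneq 0 s.
  by rewrite set_itv1 Rintegral_set1 subrr.
have {s0 s0'} s0 : 0 < s by rewrite lt_neqAle s0'.
have [_ c0 c1] := (continuous_within_itvP _ s0).1 cF.
rewrite /Rintegral (continuous_FTC2 s0 cf (F := F)) //.
  by split=> // x xs; case: (dF x xs).
by move=> x xs; rewrite derive1E (@derive_val _ _ _ _ _ _ _ (dF x xs)).
Qed.

Lemma ftc2_C1on (f f' F : R -> R[i]) (s : R) : 0 <= s ->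
  C1on 0 s F f -> C1on 0 s f f' -> cint `[0, s] f = F s - F 0.
Proof.
move=> s0 [F1 F2] [f1 f2]; rewrite /cint (ftc2_rC1 s0 F1 f1.1) (ftc2_rC1 s0 F2 f2.1).
by apply: complex_ext; rewrite ?ReD ?ImD ?ReN ?ImN.
Qed.

Lemma rmvt (f f' : R -> R) (A B M : R) : A <= B -> rC1 A B f f' ->
  (forall s, A < s < B -> `|f' s| <= M) -> `|f B - f A| <= M * (B - A).
Proof.
move=> AB h hM; have := cmvt AB (C1on_real h); rewrite -rmorphB cnorm_real; apply=> s /hM.
by rewrite cnorm_real.
Qed.

Lemma normr_sin_le (x : R) : 0 <= x -> `|sin x| <= x.
Proof.
move=> x0; have := rmvt (M := 1) x0 (rC1_sin 0 x 1); rewrite !mul1r sin0 !subr0.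
apply=> s _; rewrite mul1r ler_norml cos_geN1 cos_le1 //.
Qed.

Lemma one_sub_cos_le (x : R) : 0 <= x -> 1 - cos x <= x ^+ 2.
Proof.
move=> x0; have -> : cos x = cos (x / 2 *+ 2) by congr cos; rewrite mulr2n; lra.
rewrite cos_mulr2n; have := cos2Dsin2 (x / 2).
have := @normr_sin_le (x / 2) (divr_ge0 x0 (ler0n _ _)); rewrite ler_norml => /andP[h1 h2].
move: (cos (x / 2)) (sin (x / 2)) h1 h2 => c t h1 h2 h3.
by rewrite mulr2n; nra.
Qed.

(** The derivative [1 - cos s] is at most [s <= x], by the mean value inequality for the cosine;
    integrating gives the square. *)
Lemma sub_sin_le (x : R) : 0 <= x -> `|x - sin x| <= x ^+ 2.
Proof.
move=> x0; have := rmvt (M := x) x0 (rC1D (rC1_id 0 x) (rC1N (rC1_sin 0 x 1))).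
rewrite /= !mul1r sin0 subrr !subr0 -expr2; apply=> s /andP[s0 sx].
rewrite !mul1r ger0_norm ?subr_ge0 ?cos_le1 //.
have := rmvt (M := 1) (ltW s0) (rC1_cos 0 s 1); rewrite !mul1r cos0 subr0 => h.
have : `|cos s - 1| <= s.
  by apply: h => t _; rewrite mulN1r normrN mul1r ler_norml sin_geN1 sin_le1.
by rewrite distrC ger0_norm ?subr_ge0 ?cos_le1 //; lra.
Qed.

End fundamental.

Section coefficients.
Context {R : realType} (a b eps : R).

Local Notation mu := (mu a b).
Local Notation omega := (omega a b eps).

(** The rescaled frequency [eps^2 omega]. It is at least 1, whence [1 / omega <= eps^2], and for
    [eps <= 1] it is at most [1 + mu^2]. *)
Definition kap l : R := Num.sqrt (1 + mu l ^+ 2 * eps ^+ 2).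

Lemma kap_sq l : kap l ^+ 2 = 1 + mu l ^+ 2 * eps ^+ 2.
Proof. by rewrite sqr_sqrtr // addr_ge0 // mulr_ge0 ?sqr_ge0. Qed.

Lemma kap_ge1 l : 1 <= kap l.
Proof.
rewrite -[leLHS]ger0_norm // -sqrtr_sqr; apply: ler_wsqrtr.
by rewrite expr1n lerDl mulr_ge0 ?sqr_ge0.
Qed.

Lemma kap_gt0 l : 0 < kap l.
Proof. exact: lt_le_trans (kap_ge1 l). Qed.

Lemma omegaE l : omega l = kap l / eps ^+ 2.
Proof. by rewrite /Defs.omega mulrC. Qed.

Lemma omegaN l : omega (- l) = omega l.
Proof. by rewrite /Defs.omega mu_sqN. Qed.

Context (he : 0 < eps).

Lemma omega_gt0 l : 0 < omega l.
Proof. by rewrite omegaE divr_gt0 ?kap_gt0 ?exprn_gt0. Qed.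

Lemma eps2_omega l : eps ^+ 2 * omega l = kap l.
Proof. by rewrite omegaE mulrC divfK // expf_neq0 // gt_eqF. Qed.

Section one_frequency.
Variables (l : int) (w : R).
Hypothesis hw : omega l = w.
Let w_gt0 : 0 < w. Proof. by rewrite -hw omega_gt0. Qed.
Let w0 : w != 0. Proof. by rewrite gt_eqF. Qed.
Let ekw : eps ^+ 2 * w = kap l. Proof. by rewrite -hw eps2_omega. Qed.
Let k0 : kap l != 0. Proof. by rewrite gt_eqF ?kap_gt0. Qed.
Let e0 : eps != 0. Proof. by rewrite gt_eqF. Qed.

Lemma lambda_pE : lambda_p a b eps l = - (eps ^- 2 + w).
Proof. by rewrite /lambda_p -hw /Defs.omega mulrDr mulr1. Qed.

Lemma lambda_mE : lambda_m a b eps l = w - eps ^- 2.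
Proof. by rewrite /lambda_m -hw /Defs.omega; ring. Qed.

(** Solution of [y'' + w^2 y = 0] with [y(0) = 1] and [y'(0) = i / eps^2]: the coefficient [a_l]
    with its carrier [exp(- i s / eps^2)] removed. For [eps^2 b_l] the corresponding function is
    [sin (w s) / w]. *)
Definition gcoef (s : R) : R[i] := (cos (w * s))%:C%C + 'i%C * (sin (w * s) / kap l)%:C%C.

Lemma acoefE s : acoef a b eps l s = expi (- (eps ^- 2) * s) * gcoef s.
Proof.
rewrite /acoef lambda_pE lambda_mE.
have -> : expi (s * (w - eps ^- 2)) = expi (- (eps ^- 2) * s) * expi (w * s).
  by rewrite -expiD; congr expi; ring.
have -> : expi (s * - (eps ^- 2 + w)) = expi (- (eps ^- 2) * s) * conjc (expi (w * s)).
  by rewrite -expiN -expiD; congr expi; ring.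
have -> : - (eps ^- 2 + w) - (w - eps ^- 2) = - (2 * w) by ring.
have h : (- (2 * w))%:C%C != 0 :> R[i].
  by rewrite (inj_eq (@complexI R)) oppr_eq0 mulf_neq0.
apply: (mulIf h); rewrite divfK //.
apply: complex_ext; rewrite /gcoef !(ReM, ImM, ReD, ImD, ReN, ImN, Re_conj, Im_conj) /=;
  rewrite -ekw; field; rewrite ?e0 ?w0 //.
Qed.

Lemma bcoefE s : (eps ^+ 2)%:C%C * bcoef a b eps l s =
  expi (- (eps ^- 2) * s) * (sin (w * s) / w)%:C%C.
Proof.
rewrite /bcoef lambda_pE lambda_mE.
have -> : expi (s * (w - eps ^- 2)) = expi (- (eps ^- 2) * s) * expi (w * s).
  by rewrite -expiD; congr expi; ring.
have -> : expi (s * - (eps ^- 2 + w)) = expi (- (eps ^- 2) * s) * conjc (expi (w * s)).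
  by rewrite -expiN -expiD; congr expi; ring.
have -> : eps ^+ 2 * (w - eps ^- 2 - - (eps ^- 2 + w)) = eps ^+ 2 * (2 * w) by ring.
have h : (eps ^+ 2 * (2 * w))%:C%C != 0 :> R[i].
  by rewrite (inj_eq (@complexI R)) mulf_neq0 ?expf_neq0 // mulf_neq0 // pnatr_eq0.
apply: (mulIf h); rewrite -[LHS]mulrA -[X in _ * X]mulrA divfK //.
have hs : (sin (w * s) / w)%:C%C * (eps ^+ 2 * (2 * w))%:C%C =
    2 * (eps ^+ 2)%:C%C * (sin (w * s))%:C%C :> R[i].
  rewrite -[2 in RHS](rmorph_nat (real_complex R)) -!rmorphM.
  by apply: (congr1 (fun x : R => x%:C%C)); field.
rewrite -[RHS]mulrA hs conj_expiE (expiE (w * s)); ring: (@mul_ii R).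
Qed.

Lemma rC1_sin_div A B (x : R) :
  rC1 A B (fun s => sin (w * s) / x) (fun s => w * cos (w * s) / x).
Proof.
apply: (rC1_ext (rC1M (rC1_sin A B w) (rC1_cst A B x^-1))) => s *; first by [].
by rewrite mulr0 addr0.
Qed.

Definition dgcoef (s : R) : R[i] :=
  (- w * sin (w * s))%:C%C + 'i%C * (cos (w * s) / eps ^+ 2)%:C%C.

Lemma C1on_gcoef A B : C1on A B gcoef dgcoef.
Proof.
apply: (C1on_ext (C1onD (C1on_real (rC1_cos A B w))
  (C1onZ 'i%C (C1on_real (rC1_sin_div A B (kap l)))))) => s * //.
rewrite /dgcoef; congr (_ + _ * _%:C%C).
by rewrite -ekw; field; rewrite e0 w0.
Qed.

(** [Z'] enters the scheme only as [Z' + i eps^-2 Z], the demodulated derivative of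
    [exp(i s / eps^2) Z]. In this combination the derivative of the carrier drops out. *)
Lemma dacoefE s : cderive1 (acoef a b eps l) s + 'i%C * (eps ^- 2)%:C%C * acoef a b eps l s =
  expi (- (eps ^- 2) * s) * dgcoef s.
Proof.
have h : C1on (s - 1) (s + 1) (acoef a b eps l)
  (fun s => 'i%C * (- (eps ^- 2))%:C%C * expi (- (eps ^- 2) * s) * gcoef s
     + expi (- (eps ^- 2) * s) * dgcoef s).
  apply: (C1on_ext (C1onM (C1on_expi _ _ (- (eps ^- 2))) (C1on_gcoef _ _))) => x * //.
  by rewrite acoefE.
rewrite (cderive1E h); last by rewrite gtrBl ltrDl ltr01.
by rewrite acoefE rmorphN; ring.
Qed.

Lemma dbcoefE s : (eps ^+ 2)%:C%C * cderive1 (bcoef a b eps l) s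
   + 'i%C * (eps ^- 2)%:C%C * ((eps ^+ 2)%:C%C * bcoef a b eps l s) =
  expi (- (eps ^- 2) * s) * (cos (w * s))%:C%C.
Proof.
have e2 : (eps ^+ 2)%:C%C != 0 :> R[i] by rewrite (inj_eq (@complexI R)) expf_neq0.
have h : C1on (s - 1) (s + 1) (bcoef a b eps l)
  (fun s => ((eps ^+ 2)%:C%C)^-1 * ('i%C * (- (eps ^- 2))%:C%C * expi (- (eps ^- 2) * s) *
     (sin (w * s) / w)%:C%C
     + expi (- (eps ^- 2) * s) * (w * cos (w * s) / w)%:C%C)).
  apply: (C1on_ext (C1onZ ((eps ^+ 2)%:C%C)^-1 (C1onM (C1on_expi _ _ (- (eps ^- 2)))
    (C1on_real (rC1_sin_div _ _ w))))) => x * //.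
  by rewrite -bcoefE mulKf.
rewrite (cderive1E h); last by rewrite gtrBl ltrDl ltr01.
rewrite mulVKf // bcoefE rmorphN (_ : w * cos (w * s) / w = cos (w * s)); last by field.
ring.
Qed.

Lemma rC1_cosD A B (c d : R) :
  rC1 A B (fun s => cos (c * s + d)) (fun s => - c * sin (c * s + d)).
Proof.
apply: (rC1_ext (rC1D (rC1M (rC1_cos A B c) (rC1_cst A B (cos d)))
  (rC1N (rC1M (rC1_sin A B c) (rC1_cst A B (sin d)))))) => x *.
  by rewrite cosD.
by rewrite sinD; ring.
Qed.

Lemma rC1_sinD A B (c d : R) :
  rC1 A B (fun s => sin (c * s + d)) (fun s => c * cos (c * s + d)).
Proof.
apply: (rC1_ext (rC1D (rC1M (rC1_sin A B c) (rC1_cst A B (cos d)))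
  (rC1M (rC1_cos A B c) (rC1_cst A B (sin d))))) => x *.
  by rewrite sinD.
by rewrite cosD; ring.
Qed.

Lemma pcoefE s : 0 <= s -> pcoef a b eps l s = (1 - cos (w * s)) / (eps ^+ 2 * w ^+ 2).
Proof.
move=> s0; rewrite /pcoef hw; pose x := (eps ^+ 2 * w ^+ 2)^-1; pose y := (eps ^+ 2 * w)^-1.
have hs := rC1_sinD 0 s (- w) (w * s); have hc := rC1_cosD 0 s (- w) (w * s).
have e t : w * (s - t) = - w * t + w * s by ring.
under eq_Rintegral do rewrite e.
have hF : rC1 0 s (fun t => cos (- w * t + w * s) * x) (fun t => sin (- w * t + w * s) * y).
  apply: (rC1_ext (rC1M hc (rC1_cst 0 s x))) => t *; first by [].
  by rewrite /x /y /=; field; rewrite e0 w0.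
rewrite (ftc2_rC1 s0 hF (rC1M hs (rC1_cst 0 s y)).1).
by rewrite mulr0 add0r mulNr addNr cos0 -mulrBl.
Qed.

Lemma dpcoefE s : 0 <= s -> dpcoef a b eps l s = sin (w * s) / (eps ^+ 2 * w).
Proof.
move=> s0; rewrite /dpcoef hw; pose x := (eps ^+ 2 * w)^-1; pose y := (eps ^+ 2)^-1.
have hs := rC1_sinD 0 s (- w) (w * s); have hc := rC1_cosD 0 s (- w) (w * s).
have e t : w * (s - t) = - w * t + w * s by ring.
under eq_Rintegral do rewrite e.
have hF : rC1 0 s (fun t => - sin (- w * t + w * s) * x) (fun t => cos (- w * t + w * s) * y).
  apply: (rC1_ext (rC1M (rC1N hs) (rC1_cst 0 s x))) => t *; first by [].
  by rewrite /x /y /=; field; rewrite e0 w0.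
rewrite (ftc2_rC1 s0 hF (rC1M hc (rC1_cst 0 s y)).1).
by rewrite mulr0 add0r (_ : - w * s + w * s = 0) ?sin0 /x; ring.
Qed.

Lemma qcoefE s : 0 <= s ->
  qcoef a b eps l s = (s - sin (w * s) / w) / (eps ^+ 2 * w ^+ 2).
Proof.
move=> s0; rewrite /qcoef hw; pose x := (eps ^+ 2 * w ^+ 2)^-1; pose y := (eps ^+ 2 * w)^-1.
have hs := rC1_sinD 0 s (- w) (w * s); have hc := rC1_cosD 0 s (- w) (w * s).
have e t : w * (s - t) = - w * t + w * s by ring.
under eq_Rintegral do rewrite e.
have hF : rC1 0 s (fun t => (t * cos (- w * t + w * s) + w^-1 * sin (- w * t + w * s)) * x)
    (fun t => sin (- w * t + w * s) * y * t).
  apply: (rC1_ext (rC1M (rC1D (rC1M (rC1_id 0 s) hc) (rC1M (rC1_cst 0 s w^-1) hs)) (rC1_cst 0 s x))) => t *; first by [].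
  by rewrite /x /y /=; field; rewrite e0 w0.
rewrite (ftc2_rC1 s0 hF (rC1M (rC1M hs (rC1_cst 0 s y)) (rC1_id 0 s)).1).
rewrite /x /y (_ : - w * s + w * s = 0); last by ring.
by rewrite mulr0 mul0r !add0r cos0 sin0; field; rewrite e0 w0.
Qed.

Lemma dqcoefE s : 0 <= s ->
  dqcoef a b eps l s = (1 - cos (w * s)) / (eps ^+ 2 * w ^+ 2).
Proof.
move=> s0; rewrite /dqcoef hw; pose x := (eps ^+ 2 * w ^+ 2)^-1; pose y := (eps ^+ 2)^-1.
have hs := rC1_sinD 0 s (- w) (w * s); have hc := rC1_cosD 0 s (- w) (w * s).
have e t : w * (s - t) = - w * t + w * s by ring.
under eq_Rintegral do rewrite e.
have hF : rC1 0 s (fun t => (- (w * (t * sin (- w * t + w * s))) + cos (- w * t + w * s)) * x)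
    (fun t => cos (- w * t + w * s) * y * t).
  apply: (rC1_ext (rC1M (rC1D (rC1N (rC1M (rC1_cst 0 s w) (rC1M (rC1_id 0 s) hs))) hc) (rC1_cst 0 s x))) => t *; first by [].
  by rewrite /x /y /=; field; rewrite e0 w0.
rewrite (ftc2_rC1 s0 hF (rC1M (rC1M hc (rC1_cst 0 s y)) (rC1_id 0 s)).1).
rewrite /x /y (_ : - w * s + w * s = 0); last by ring.
by rewrite mulr0 mul0r !add0r cos0 sin0; field; rewrite e0 w0.
Qed.

Let ew_gt0 : 0 < eps ^+ 2 * w ^+ 2.
Proof. by rewrite mulr_gt0 // exprn_gt0. Qed.

Let kw : 1 <= eps ^+ 2 * w. Proof. by rewrite ekw kap_ge1. Qed.

(** Two regimes, one for each error bound: [1 - cos x <= x^2] for short steps, and [1 - cos x <= 2]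
    together with [eps^2 w >= 1] for steps that do not resolve the oscillation. *)
Lemma pcoef_bounds s : 0 <= s ->
  `|pcoef a b eps l s| <= s ^+ 2 / eps ^+ 2 /\ `|pcoef a b eps l s| <= 2 * eps ^+ 2.
Proof.
move=> s0; rewrite pcoefE //.
have c0 : 0 <= 1 - cos (w * s) by rewrite subr_ge0 cos_le1.
rewrite ger0_norm; last by rewrite divr_ge0 // ltW.
rewrite !ler_pdivrMr //; split.
  apply: le_trans (one_sub_cos_le (mulr_ge0 (ltW w_gt0) s0)) _.
  by rewrite le_eqVlt; apply/orP; left; apply/eqP; field.
apply: le_trans (_ : 2 * (eps ^+ 2 * w) ^+ 2 <= _); last first.
  by rewrite le_eqVlt; apply/orP; left; apply/eqP; ring.
apply: le_trans (_ : 2 <= _); first by have := cos_geN1 (w * s); lra.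
by rewrite ler_peMr // exprn_ege1.
Qed.

Lemma qcoef_bounds s : 0 <= s -> `|qcoef a b eps l s| <= 2 * s * eps ^+ 2 /\
  `|qcoef a b eps l s| <= s ^+ 2.
Proof.
move=> s0; rewrite qcoefE //; have ws0 := mulr_ge0 (ltW w_gt0) s0.
have hx : s - sin (w * s) / w = (w * s - sin (w * s)) / w by field.
have hn (x : R) : `|x / w| = `|x| / w by rewrite normrM normfV (gtr0_norm w_gt0).
rewrite normrM normfV (gtr0_norm ew_gt0) !ler_pdivrMr //; split.
  apply: le_trans (_ : 2 * s * 1 <= _).
    apply: le_trans (ler_normB _ _) _; rewrite ger0_norm // mulr1 mulr2n mulrDl mul1r lerD2l.
    by rewrite hn ler_pdivrMr // [s * w]mulrC; exact: normr_sin_le.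
  rewrite -[leRHS]mulrA ler_wpM2l ?mulr_ge0 //.
  have -> : eps ^+ 2 * (eps ^+ 2 * w ^+ 2) = (eps ^+ 2 * w) ^+ 2 by ring.
  exact: exprn_ege1.
rewrite hx hn ler_pdivrMr //; apply: le_trans (sub_sin_le ws0) _.
rewrite (_ : _ * w = (w * s) ^+ 2 * (eps ^+ 2 * w)); last by ring.
by rewrite ler_peMr ?sqr_ge0.
Qed.

Section signed_energy.
Variable sg : R.
Hypothesis hsg : sg ^+ 2 = 1.

Definition PP s : R[i] := (eps ^+ 2 * dpcoef a b eps l s)%:C%C
   + 'i%C * (sg * kap l * pcoef a b eps l s)%:C%C.
Definition QQ s : R[i] := (eps ^+ 2 * dqcoef a b eps l s)%:C%C
   + 'i%C * (sg * kap l * qcoef a b eps l s)%:C%C.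

(* PP and QQ multiplied by exp (- i sg w s) are the primitives of exp (- i sg w s)
   and s exp (- i sg w s) that vanish at 0. *)
Definition PPr s : R[i] := (sin (w * s) / w)%:C%C + 'i%C * (sg * (1 - cos (w * s)) / w)%:C%C.
Definition QQr s : R[i] := ((1 - cos (w * s)) / w ^+ 2)%:C%C
   + 'i%C * (sg * (s - sin (w * s) / w) / w)%:C%C.

Lemma PPE s : 0 <= s -> PP s = PPr s.
Proof.
move=> s0; rewrite /PP /PPr dpcoefE // pcoefE //; congr (_%:C%C + 'i%C * _%:C%C).
  by field; rewrite e0 w0.
by rewrite -ekw; field; rewrite e0 w0.
Qed.

Lemma QQE s : 0 <= s -> QQ s = QQr s.
Proof.
move=> s0; rewrite /QQ /QQr dqcoefE // qcoefE //; congr (_%:C%C + 'i%C * _%:C%C).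
  by field; rewrite e0 w0.
by rewrite -ekw; field; rewrite e0 w0.
Qed.

Lemma sg1 : sg = 1 \/ sg = -1.
Proof. by move/eqP: hsg; rewrite sqrf_eq1 => /orP[] /eqP ->; [left|right]. Qed.

Lemma C1on_PPr A B : C1on A B (fun s => expi (- (sg * w) * s) * PPr s)
  (fun s => expi (- (sg * w) * s)).
Proof.
have hs := rC1_sin A B w; have hc := rC1_cos A B w.
have h := C1onM (C1on_expi A B (- (sg * w))) (C1onD
  (C1on_real (rC1M hs (rC1_cst A B w^-1)))
  (C1onZ 'i%C (C1on_real (rC1M (rC1_cst A B sg) (rC1M (rC1D (rC1_cst A B 1) (rC1N hc)) (rC1_cst A B w^-1)))))).
apply: (C1on_ext h) => s *; first by rewrite /PPr !mulrA.
have e (x y z t : R[i]) : x * y * z + y * t = y * (x * z + t) by ring.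
rewrite -[RHS]mulr1 e; congr (_ * _); apply: complex_ext; rewrite !(ReM, ImM, ReD, ImD, ReN, ImN) /=;
  case: sg1 => ->; field; rewrite ?w0 //.
Qed.

Lemma C1on_QQr A B : C1on A B (fun s => expi (- (sg * w) * s) * QQr s)
  (fun s => s%:C%C * expi (- (sg * w) * s)).
Proof.
have hs := rC1_sin A B w; have hc := rC1_cos A B w.
have h := C1onM (C1on_expi A B (- (sg * w))) (C1onD
  (C1on_real (rC1M (rC1D (rC1_cst A B 1) (rC1N hc)) (rC1_cst A B (w ^- 2))))
  (C1onZ 'i%C (C1on_real (rC1M (rC1_cst A B sg) (rC1M (rC1D (rC1_id A B)
    (rC1N (rC1M hs (rC1_cst A B w^-1)))) (rC1_cst A B w^-1)))))).
apply: (C1on_ext h) => s *; first by rewrite /QQr !mulrA.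
have e (x y z t : R[i]) : x * y * z + y * t = y * (x * z + t) by ring.
rewrite [RHS]mulrC e; congr (_ * _); apply: complex_ext; rewrite !(ReM, ImM, ReD, ImD, ReN, ImN) /=;
  case: sg1 => ->; field; rewrite ?w0 //.
Qed.

Lemma PPr0 : PPr 0 = 0.
Proof. by rewrite /PPr mulr0 sin0 cos0 subrr mulr0 !mul0r mulr0 addr0. Qed.
Lemma QQr0 : QQr 0 = 0.
Proof. by rewrite /QQr mulr0 sin0 cos0 !subrr !mul0r subrr mulr0 mul0r mulr0 addr0. Qed.

(** In the rotating frame [PP] has a derivative of modulus 1. The bound is therefore uniform in
    [eps] and in the frequency, although the definition contains the unbounded factor [kap]. *)
Lemma PP_le s : 0 <= s -> cnorm (PP s) <= s.
Proof.
move=> s0; rewrite PPE //; have := cmvt (M := 1) s0 (C1on_PPr 0 s).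
rewrite PPr0 mulr0 !subr0 mul1r cnormM cnorm_expi mul1r; apply=> t _.
by rewrite cnorm_expi.
Qed.

Lemma QQ_le s : 0 <= s -> cnorm (QQ s) <= s ^+ 2.
Proof.
move=> s0; rewrite QQE //; have := cmvt (M := s) s0 (C1on_QQr 0 s).
rewrite QQr0 mulr0 !subr0 cnormM cnorm_expi mul1r; apply=> t /andP[t0 ts].
by rewrite cnormM cnorm_expi mulr1 cnorm_real ger0_norm ltW.
Qed.

End signed_energy.

(** * Coefficients of the Schroedinger part *)

Section dispersive.
Variable sg : R.
Let m2 := mu l ^+ 2.
Let k := m2 + sg * eps ^- 2.

(** Primitive of [exp(i k s)] that vanishes at 0. The exponent [k] is zero at the resonance
    [mu^2 = eps^-2] when [sg = -1], hence the case distinction; later bounds use only the derivative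
    and are uniform across the resonance. *)
Definition EE (s : R) : R[i] :=
  if k == 0 then s%:C%C else - 'i%C * (k^-1)%:C%C * (expi (k * s) - 1).
Definition DE (s : R) : R[i] :=
  if k == 0 then (s * s / 2)%:C%C
  else - 'i%C * (k^-1)%:C%C * s%:C%C * expi (k * s) + (k ^- 2)%:C%C * (expi (k * s) - 1).

Lemma C1on_EE A B : C1on A B EE (fun s => expi (k * s)).
Proof.
rewrite /EE; case: (eqVneq k 0) => [->|kn0].
  by apply: (C1on_ext (C1on_real (rC1_id A B))) => s *; rewrite ?mul0r ?expi0.
apply: (C1on_ext (C1onZ (- 'i%C * (k^-1)%:C%C) (C1onB (C1on_expi A B k) (C1on_cst A B 1)))) => s * //.
have kk : (k^-1)%:C%C * k%:C%C = 1 :> R[i] by rewrite -rmorphM mulVf.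
have k2 : (k ^- 2)%:C%C * k%:C%C = (k^-1)%:C%C :> R[i].
  by rewrite -rmorphM; apply: congr1; field.
ring: (@mul_ii R) kk k2.
Qed.

Lemma C1on_DE A B : C1on A B DE (fun s => expi (k * s) * s%:C%C).
Proof.
rewrite /DE; case: (eqVneq k 0) => [->|kn0].
  apply: (C1on_ext (C1on_real (rC1M (rC1M (rC1_id A B) (rC1_id A B)) (rC1_cst A B 2^-1)))) => s * //.
  by rewrite mul0r expi0 !mul1r; apply: (congr1 (fun x : R => x%:C%C)); field.
apply: (C1on_ext (C1onD (C1onM (C1onZ (- 'i%C * (k^-1)%:C%C) (C1on_real (rC1_id A B))) (C1on_expi A B k))
  (C1onZ (k ^- 2)%:C%C (C1onB (C1on_expi A B k) (C1on_cst A B 1))))) => s * //.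
have kk : (k^-1)%:C%C * k%:C%C = 1 :> R[i] by rewrite -rmorphM mulVf.
have k2 : (k ^- 2)%:C%C * k%:C%C = (k^-1)%:C%C :> R[i].
  by rewrite -rmorphM; apply: congr1; field.
ring: (@mul_ii R) kk k2.
Qed.

Definition CC s : R[i] := 'i%C * expi (- m2 * s) * EE s.
Definition DD s : R[i] := 'i%C * expi (- m2 * s) * DE s.

Lemma EE0 : EE 0 = 0.
Proof. by rewrite /EE; case: ifP; rewrite ?mulr0 ?expi0 ?subrr ?mulr0. Qed.
Lemma DE0 : DE 0 = 0.
Proof. by rewrite /DE; case: ifP; rewrite ?mulr0 ?mul0r ?mulr0 ?expi0 ?subrr ?mulr0 ?mul0r ?addr0. Qed.

Lemma ccoefE s : 0 <= s -> ccoef a b eps l sg s = CC s.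
Proof.
move=> s0; rewrite /ccoef (ftc2_C1on s0 (C1on_EE 0 s) (C1on_expi 0 s k)).
by rewrite EE0 subr0 /CC mulNr.
Qed.

Lemma dcoefE s : 0 <= s -> dcoef a b eps l sg s = DD s.
Proof.
move=> s0; rewrite /dcoef (ftc2_C1on s0 (C1on_DE 0 s)
  (C1onM (C1on_expi 0 s k) (C1on_real (rC1_id 0 s)))).
by rewrite DE0 subr0 /DD mulNr.
Qed.

(* In the interaction picture, exp (i mu^2 s) CC s is a primitive of an exponential. *)
Lemma C1on_CC A B : C1on A B (fun s => expi (m2 * s) * CC s)
  (fun s => 'i%C * (expi (m2 * s) * expi (sg * eps ^- 2 * s))).
Proof.
apply: (C1on_ext (C1onZ 'i%C (C1on_EE A B))) => s *.
  by rewrite /CC mulNr; ring: (expiNM (m2 * s)).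
by rewrite -expiD -mulrDl.
Qed.

Lemma C1on_DD A B : C1on A B (fun s => expi (m2 * s) * DD s)
  (fun s => 'i%C * (expi (m2 * s) * expi (sg * eps ^- 2 * s) * s%:C%C)).
Proof.
apply: (C1on_ext (C1onZ 'i%C (C1on_DE A B))) => s *.
  by rewrite /DD mulNr; ring: (expiNM (m2 * s)).
by rewrite -expiD -mulrDl.
Qed.

Lemma CC0 : CC 0 = 0. Proof. by rewrite /CC EE0 mulr0. Qed.
Lemma DD0 : DD 0 = 0. Proof. by rewrite /DD DE0 mulr0. Qed.

Lemma ccoef_le s : 0 <= s -> cnorm (ccoef a b eps l sg s) <= s.
Proof.
move=> s0; rewrite ccoefE //; have := cmvt (M := 1) s0 (C1on_CC 0 s).
rewrite CC0 mulr0 !subr0 mul1r cnormM cnorm_expi mul1r; apply=> t _.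
by rewrite !cnormM cnorm_i !cnorm_expi !mul1r.
Qed.

Lemma dcoef_le s : 0 <= s -> cnorm (dcoef a b eps l sg s) <= s ^+ 2.
Proof.
move=> s0; rewrite dcoefE //; have := cmvt (M := s) s0 (C1on_DD 0 s).
rewrite DD0 mulr0 !subr0 cnormM cnorm_expi mul1r; apply=> t /andP[t0 ts].
by rewrite !cnormM cnorm_i !cnorm_expi !mul1r cnorm_real ger0_norm ltW.
Qed.

End dispersive.

End one_frequency.

End coefficients.

(** * The scheme in Fourier variables *)

Section scheme_in_frequency.
Context {R : realType} (a b eps tau : R) (N : nat).
Implicit Types V W U : int -> R[i].

Local Notation mu := (mu a b).
Local Notation cconv := (cconv a b N).
Local Notation cj := (cj a b N).
Local Notation omega := (omega a b eps).

(** Filtered version of [mu^2]. It is bounded by [mu^2], used for the smooth exact solution, and by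
    [1 / tau], used for the numerical one. *)
Definition sincf l : R := sin (mu l ^+ 2 * tau) / tau.

Definition cZ0 V W l : R[i] := 2^-1 * (V l - 'i%C * (eps ^+ 2)%:C%C * W l).
Definition cZd V W l : R[i] := 'i%C * (sincf l / 2)%:C%C * cZ0 V W l.
Definition cUd V U l : R[i] := - ('i%C * (sincf l)%:C%C * U l) + 'i%C * cconv V U l.
Definition cRd V W l : R[i] := - cZd V W l - cj (cZd V W) l.
Definition csq U : int -> R[i] := cconv (cj U) U.
(** Contains the factor 2 that the scheme writes in front of [q_l]: a complex number plus its
    conjugate is twice its real part. *)
Definition cre V U l : R[i] := cconv (cj U) (cUd V U) l + cconv U (cj (cUd V U)) l.
Definition cR1 V W U l : R[i] :=
  (sin (omega l * tau) / omega l)%:C%C * cRd V W l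
  + (pcoef a b eps l tau)%:C%C * csq U l + (qcoef a b eps l tau)%:C%C * cre V U l.
Definition cU1 V W U l : R[i] :=
  expi (- (mu l ^+ 2 * tau)) * U l
  + ccoef a b eps l 1 tau * cconv (cZ0 V W) U l
  + dcoef a b eps l 1 tau * (cconv (cZd V W) U l + cconv (cZ0 V W) (cUd V U) l)
  + ccoef a b eps l (-1) tau * cconv (cj (cZ0 V W)) U l
  + dcoef a b eps l (-1) tau *
      (cconv (cj (cZd V W)) U l + cconv (cj (cZ0 V W)) (cUd V U) l)
  + 'i%C * (tau / 2)%:C%C * cconv (cR1 V W U) U l
  + 'i%C * (tau ^+ 2 / 2)%:C%C * cconv (cR1 V W U) (cUd V U) l.

Definition eta (sg : R) V W l : R[i] :=
  (eps ^+ 2)%:C%C * W l + 'i%C * (sg * kap a b eps l)%:C%C * V l.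

Context (hab : a < b) (he : 0 < eps) (htau : 0 < tau) (N0 : (0 < N)%N) (No : ~~ odd N).

Local Notation F := (@dft R a b N).
Local Notation V_ := (@of_coef R a b N).

Let Foc c k : (k < N)%N -> F (V_ c) (freq N k) = c (freq N k).
Proof. exact: dft_of_coef. Qed.

Lemma sincfN l : sincf (- l) = sincf l.
Proof. by rewrite /sincf mu_sqN. Qed.

Lemma pcoefN l : pcoef a b eps (- l) tau = pcoef a b eps l tau.
Proof. by rewrite /pcoef omegaN. Qed.
Lemma qcoefN l : qcoef a b eps (- l) tau = qcoef a b eps l tau.
Proof. by rewrite /qcoef omegaN. Qed.
Lemma dpcoefN l : dpcoef a b eps (- l) tau = dpcoef a b eps l tau.
Proof. by rewrite /dpcoef omegaN. Qed.
Lemma dqcoefN l : dqcoef a b eps (- l) tau = dqcoef a b eps l tau.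
Proof. by rewrite /dqcoef omegaN. Qed.
Lemma acoefN l : acoef a b eps (- l) = acoef a b eps l.
Proof. by rewrite /acoef /lambda_p /lambda_m mu_sqN. Qed.
Lemma bcoefN l : bcoef a b eps (- l) = bcoef a b eps l.
Proof. by rewrite /bcoef /lambda_p /lambda_m mu_sqN. Qed.

Section one_step.
Variable st : @state R N.
Let V := F (Phi st).
Let W := F (dPhi st).
Let U := F (Psi st).
Let st' := mti_step a b eps tau st.

(** The intermediate vectors of [mti_step], restated with names so that each can be identified with
    its coefficient formula. *)
Let vZ0 := V_ (cZ0 V W).
Let vZd := V_ (fun l => 'i%C * (sincf l / 2)%:C%C * F vZ0 l).
Let vRd := V_ (fun l => - F vZd l - F (vconj vZd) l).
Let vUd := V_ (fun l => - ('i%C * (sincf l)%:C%C * F (Psi st) l)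
                        + 'i%C * F (vmul (Phi st) (Psi st)) l).
Let vre := vRe (vmul (vconj (Psi st)) vUd).
Let vR := V_ (fun l =>
      (sin (omega l * tau) / omega l)%:C%C * F vRd l
      + (pcoef a b eps l tau)%:C%C * F (vsqnorm (Psi st)) l
      + 2 * (qcoef a b eps l tau)%:C%C * F vre l).
Let vR' := V_ (fun l =>
      (cos (omega l * tau))%:C%C * F vRd l
      + (dpcoef a b eps l tau)%:C%C * F (vsqnorm (Psi st)) l
      + 2 * (dqcoef a b eps l tau)%:C%C * F vre l).
Let vZ := V_ (fun l => acoef a b eps l tau * F vZ0 l
      + (eps ^+ 2)%:C%C * bcoef a b eps l tau * F vZd l).
Let vZ' := V_ (fun l => cderive1 (acoef a b eps l) tau * F vZ0 l
      + (eps ^+ 2)%:C%C * cderive1 (bcoef a b eps l) tau * F vZd l).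

Let FZ0 k : (k < N)%N -> F vZ0 (freq N k) = cZ0 V W (freq N k).
Proof. exact: Foc. Qed.
Let FZd k : (k < N)%N -> F vZd (freq N k) = cZd V W (freq N k).
Proof. by move=> kN; rewrite Foc // FZ0. Qed.
Let FcZd k : (k < N)%N -> F (vconj vZd) (freq N k) = cj (cZd V W) (freq N k).
Proof. by move=> kN; rewrite dft_vconj //; apply: cj_ext => // k' k'N; exact: FZd. Qed.
Let FcZ0 k : (k < N)%N -> F (vconj vZ0) (freq N k) = cj (cZ0 V W) (freq N k).
Proof. by move=> kN; rewrite dft_vconj //; apply: cj_ext => // k' k'N; exact: FZ0. Qed.
Let FRd k : (k < N)%N -> F vRd (freq N k) = cRd V W (freq N k).
Proof. by move=> kN; rewrite Foc // FZd // FcZd. Qed.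
Let FUd k : (k < N)%N -> F vUd (freq N k) = cUd V U (freq N k).
Proof. by move=> kN; rewrite Foc // dft_vmul. Qed.
Let FcU k : (k < N)%N -> F (vconj (Psi st)) (freq N k) = cj U (freq N k).
Proof. by move=> kN; rewrite dft_vconj. Qed.
Let FcUd k : (k < N)%N -> F (vconj vUd) (freq N k) = cj (cUd V U) (freq N k).
Proof. by move=> kN; rewrite dft_vconj //; apply: cj_ext => // k' k'N; exact: FUd. Qed.

Let Fmul (u v : @vec R N) c d k : (k < N)%N ->
  (forall k, (k < N)%N -> F u (freq N k) = c (freq N k)) ->
  (forall k, (k < N)%N -> F v (freq N k) = d (freq N k)) ->
  F (vmul u v) (freq N k) = cconv c d (freq N k).
Proof. by move=> kN hu hv; rewrite dft_vmul //; exact: cconv_ext. Qed.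

Let Fsq k : (k < N)%N -> F (vsqnorm (Psi st)) (freq N k) = csq U (freq N k).
Proof.
move=> kN; rewrite /csq -(Fmul kN FcU (fun _ _ => erefl)); apply: dft_ext => j.
rewrite /vsqnorm /vmul /vconj cnorm_sq.
by case: (Psi st _) => x y; apply: complex_ext; rewrite /= ?ReM ?ImM /=; ring.
Qed.

Let Fre k : (k < N)%N -> 2 * F vre (freq N k) = cre V U (freq N k).
Proof.
move=> kN; rewrite /cre -(Fmul kN FcU FUd) -(Fmul kN (fun _ _ => erefl) FcUd) -dftD -dftZ.
apply: dft_ext => j; rewrite /vre /vRe /vmul /vconj.
case: (Psi st _) => x y; case: (vUd _) => z t.
apply: complex_ext; rewrite ?ReD ?ImD ?ReM ?ImM /=; first by ring.
by rewrite !(mulr0, mul0r, addr0); ring.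
Qed.

Let FR k : (k < N)%N -> F vR (freq N k) = cR1 V W U (freq N k).
Proof.
move=> kN; rewrite Foc // FRd // Fsq // /cR1; congr (_ + _).
by rewrite mulrAC Fre // mulrC.
Qed.

Let FR' k : (k < N)%N -> F vR' (freq N k) =
  (cos (omega (freq N k) * tau))%:C%C * cRd V W (freq N k)
      + (dpcoef a b eps (freq N k) tau)%:C%C * csq U (freq N k)
      + (dqcoef a b eps (freq N k) tau)%:C%C * cre V U (freq N k).
Proof.
move=> kN; rewrite Foc // FRd // Fsq //; congr (_ + _).
by rewrite mulrAC Fre // mulrC.
Qed.

Lemma step_U k : (k < N)%N -> F (Psi st') (freq N k) = cU1 V W U (freq N k).
Proof.
move=> kN; rewrite Foc // /cU1 -/U.
have e (x x' y y' z z' t t' r r' s s' : R[i]) : x = x' -> y = y' -> z = z' -> t = t' ->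
  r = r' -> s = s' -> x + y + z + t + r + s = x' + y' + z' + t' + r' + s' by do 6! move=> ->.
rewrite -!addrA !addrA; congr (_ + _); last first.
  by congr (_ * _); apply: (Fmul kN FR FUd).
apply: e; congr (_ * _).
- exact: (Fmul kN FZ0 (fun _ _ => erefl)).
- by congr (_ + _); [exact: (Fmul kN FZd (fun _ _ => erefl))|exact: (Fmul kN FZ0 FUd)].
- exact: (Fmul kN FcZ0 (fun _ _ => erefl)).
- by congr (_ + _); [exact: (Fmul kN FcZd (fun _ _ => erefl))|exact: (Fmul kN FcZ0 FUd)].
- exact: (Fmul kN FR (fun _ _ => erefl)).
Qed.

Context (hP : real_vec (Phi st)) (hP' : real_vec (dPhi st)).

Let rV : real_coef a b N V. Proof. exact: real_vec_dft. Qed.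
Let rW : real_coef a b N W. Proof. exact: real_vec_dft. Qed.

Let e1 := expi (tau / eps ^+ 2).

Let conj_e1 : conjc e1 = expi (- (tau / eps ^+ 2)).
Proof. by rewrite expiN. Qed.

Let e1M : e1 * expi (- (eps ^- 2) * tau) = 1.
Proof. by rewrite mulrC (_ : _ * tau = - (tau / eps ^+ 2)) ?expiNM //; ring. Qed.

Let cjZ0 k : (k < N)%N -> cj (cZ0 V W) (freq N k) =
  2^-1 * (V (freq N k) + 'i%C * (eps ^+ 2)%:C%C * W (freq N k)).
Proof.
move=> kN; rewrite /cZ0 (cjM hab (m := fun=> 2^-1)) // cjB // (cjM hab (m := fun=> 'i%C * (eps ^+ 2)%:C%C)) //.
rewrite rV ?rW // conjc_inv conjc_nat.
have -> : conjc ('i%C * (eps ^+ 2)%:C%C) = - ('i%C * (eps ^+ 2)%:C%C) :> R[i].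
  by apply: complex_ext; rewrite /= ?ReM ?ImM /=; ring.
by rewrite mulNr opprK.
Qed.

Let cjZ (m : int -> R[i]) (n : int -> R[i]) k : (k < N)%N ->
  (forall l, m (- l) = m l) -> (forall l, n (- l) = n l) ->
  F (vconj (V_ (fun l => m l * F vZ0 l + n l * F vZd l))) (freq N k) =
  conjc (m (freq N k)) * cj (cZ0 V W) (freq N k)
  + conjc (n (freq N k)) * cj (cZd V W) (freq N k).
Proof.
move=> kN hm hn; rewrite dft_vconj //.
rewrite (@cj_ext R a b hab N _ (fun l => m l * cZ0 V W l + n l * cZd V W l)) //.
  by rewrite cjD // (cjM hab (m := m)) // (cjM hab (m := n)).
by move=> k' k'N; rewrite Foc // FZ0 // FZd.
Qed.

(** For real data the carriers of [Z] and of its conjugate cancel against the outer exponentials,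
    and the contributions of [cZd] cancel against [cRd]. What remains is the exact Klein-Gordon
    propagator plus a quadrature of the force. *)
Lemma step_Phi k : (k < N)%N -> let l := freq N k in
  F (Phi st') l = (cos (omega l * tau))%:C%C * V l
    + (sin (omega l * tau) / omega l)%:C%C * W l
    + (pcoef a b eps l tau)%:C%C * csq U l + (qcoef a b eps l tau)%:C%C * cre V U l.
Proof.
move=> kN l; rewrite [LHS](_ : _ = e1 * F vZ l + conjc e1 * F (vconj vZ) l + F vR l); last first.
  by rewrite conj_e1 -!dftZ -!dftD.
rewrite FR // (cjZ (m := fun l => acoef a b eps l tau)
   (n := fun l => (eps ^+ 2)%:C%C * bcoef a b eps l tau)) //; last 2 first.
- by move=> l'; rewrite acoefN.
- by move=> l'; rewrite bcoefN.
rewrite Foc // FZ0 // FZd // -/l cjZ0 // -/l.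
rewrite (acoefE he (erefl (omega l))) (bcoefE he (erefl (omega l))).
rewrite !conjcM conjc_real /cR1 /cRd.
have h1 := e1M; have h2 : conjc e1 * conjc (expi (- (eps ^- 2) * tau)) = 1.
  by rewrite -conjcM e1M conjc1.
have w0 : omega l != 0 by rewrite gt_eqF ?omega_gt0.
have e0 : eps != 0 by rewrite gt_eqF.
rewrite {1}/cZ0 /gcoef conjcD conjcM !conjc_real.
have -> : conjc 'i%C = - 'i%C :> R[i] by apply: complex_ext => /=; ring.
have hs : (eps ^+ 2)%:C%C * (sin (omega l * tau) / kap a b eps l)%:C%C =
   (sin (omega l * tau) / omega l)%:C%C :> R[i].
  by rewrite -rmorphM -(eps2_omega a b he l); apply: (congr1 (fun x : R => x%:C%C)); field; rewrite e0 w0.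
have h2' : 2^-1 * 2 = 1 :> R[i] by rewrite mulVf // pnatr_eq0.
move: hs h1 h2 h2'; move: (expi (- (eps ^- 2) * tau)) => E.
move: (sin (omega l * tau) / kap a b eps l)%:C%C (sin (omega l * tau) / omega l)%:C%C
  (eps ^+ 2)%:C%C (cos (omega l * tau))%:C%C => sk sw e2 c hs h1 h2 h2'.
ring: (@mul_ii R) hs h1 h2 h2'.
Qed.

Lemma step_dPhi k : (k < N)%N -> let l := freq N k in
  F (dPhi st') l = (- omega l * sin (omega l * tau))%:C%C * V l
    + (cos (omega l * tau))%:C%C * W l
    + (dpcoef a b eps l tau)%:C%C * csq U l + (dqcoef a b eps l tau)%:C%C * cre V U l.
Proof.
move=> kN l; pose ie : R[i] := 'i%C * (eps ^- 2)%:C%C.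
pose m l := cderive1 (acoef a b eps l) tau + ie * acoef a b eps l tau.
pose n l := (eps ^+ 2)%:C%C * cderive1 (bcoef a b eps l) tau
   + ie * ((eps ^+ 2)%:C%C * bcoef a b eps l tau).
(* Coefficients of [Z' + i eps^-2 Z], so that [dPhi] takes the form of [Phi] with [vY] in place of
   [vZ]. *)
pose vY := V_ (fun l => m l * F vZ0 l + n l * F vZd l).
have cie : conjc ie = - ie by apply: complex_ext; rewrite /= ?ReM ?ImM /=; ring.
have hY (j : 'I_N) : vY (inord j) = vZ' (inord j) + ie * vZ (inord j).
  rewrite /vY /vZ' /vZ /of_coef /trig mulr_sumr -big_split; apply: eq_bigr => i _ /=.
  rewrite /m /n; ring.
rewrite [LHS](_ : _ = e1 * F vY l + conjc e1 * F (vconj vY) l + F vR' l); last first.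
  rewrite conj_e1 -!dftZ -!dftD; apply: dft_ext => j.
  rewrite /vconj hY conjcD conjcM cie mulNr.
  by rewrite -!/(vZ _) -!/(vZ' _).
rewrite FR' // (cjZ (m := m) (n := n)) //; last 2 first.
- by move=> l'; rewrite /m acoefN.
- by move=> l'; rewrite /n bcoefN.
rewrite Foc // FZ0 // FZd // -/l cjZ0 // -/l /m /n.
rewrite (dacoefE he (erefl (omega l))) (dbcoefE he (erefl (omega l))).
rewrite !conjcM conjc_real /cRd.
have h1 := e1M; have h2 : conjc e1 * conjc (expi (- (eps ^- 2) * tau)) = 1.
  by rewrite -conjcM e1M conjc1.
have e0 : eps != 0 by rewrite gt_eqF.
rewrite {1}/cZ0 /dgcoef conjcD conjcM !conjc_real.
have -> : conjc 'i%C = - 'i%C :> R[i] by apply: complex_ext => /=; ring.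
have hs : (eps ^+ 2)%:C%C * (cos (omega l * tau) / eps ^+ 2)%:C%C =
   (cos (omega l * tau))%:C%C :> R[i].
  by rewrite -rmorphM; apply: (congr1 (fun x : R => x%:C%C)); field.
have h2' : 2^-1 * 2 = 1 :> R[i] by rewrite mulVf // pnatr_eq0.
move: hs h1 h2 h2'; move: (expi (- (eps ^- 2) * tau)) => E.
move: (- omega l * sin (omega l * tau))%:C%C (cos (omega l * tau) / eps ^+ 2)%:C%C
  (eps ^+ 2)%:C%C (cos (omega l * tau))%:C%C => sk sw e2 c hs h1 h2 h2'.
ring: (@mul_ii R) hs h1 h2 h2'.
Qed.

(** Both components have the form [x + conj x + r], where [r] has real grid values because its
    coefficients come from real vectors through even real multipliers. *)
Lemma step_real : real_vec (Phi st') /\ real_vec (dPhi st').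
Proof.
have rRd : real_coef a b N (F vRd).
  move=> k kN; rewrite (cj_ext hab (d := fun l => - F vZd l - F (vconj vZd) l)) //; last exact: Foc.
  rewrite cjB // cjN // Foc //.
  have -> : cj (F (vconj vZd)) (freq N k) = F vZd (freq N k).
    by rewrite (cj_ext hab (d := cj (F vZd))) // ?cjK // => k' _; rewrite dft_vconj.
  by rewrite -dft_vconj // addrC.
have rsq : real_coef a b N (F (vsqnorm (Psi st))).
  by apply: real_vec_dft => // j; rewrite /vsqnorm conjc_real.
have rre : real_coef a b N (F vre) by apply: real_vec_dft => // j; rewrite /vre /vRe conjc_real.
have rR (x y z : int -> R) : (forall l, x (- l) = x l) -> (forall l, y (- l) = y l) ->
   (forall l, z (- l) = z l) ->
   real_vec (V_ (fun l => (x l)%:C%C * F vRd l + (y l)%:C%C * F (vsqnorm (Psi st)) l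
      + 2 * (z l)%:C%C * F vre l)).
  move=> hx hy hz; apply: (real_coef_vec hab); apply: real_coefD => //.
    by apply: real_coefD => //; apply: real_coefM.
  have := @real_coefM R a b hab N (fun l => 2 * z l) (F vre) No; rewrite /real_coef => h k kN.
  have e l : 2 * (z l)%:C%C * F vre l = (2 * z l)%:C%C * F vre l by rewrite rmorphM rmorph_nat.
  rewrite (@cj_ext R a b hab N _ (fun l => (2 * z l)%:C%C * F vre l)) // ?h // ?e //.
  by move=> l; rewrite hz.
have cc (x y : R[i]) : conjc (x + conjc x + y) = x + conjc x + conjc y.
  by rewrite !conjcD conjcK [conjc x + x]addrC.
split=> j.
  rewrite (_ : Phi st' (inord j) = e1 * vZ (inord j) + conjc (e1 * vZ (inord j)) + vR (inord j)).
    by rewrite cc (rR (fun l => sin (omega l * tau) / omega l) (pcoef a b eps ^~ tau) (qcoef a b eps ^~ tau)) // => l;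
      rewrite ?omegaN ?pcoefN ?qcoefN.
  by rewrite conjcM conj_e1.
pose ie : R[i] := 'i%C * (eps ^- 2)%:C%C.
have cie : conjc ie = - ie by apply: complex_ext; rewrite /= ?ReM ?ImM /=; ring.
rewrite (_ : dPhi st' (inord j) = e1 * (vZ' (inord j) + ie * vZ (inord j))
   + conjc (e1 * (vZ' (inord j) + ie * vZ (inord j))) + vR' (inord j)).
  by rewrite cc (rR (fun l => cos (omega l * tau)) (dpcoef a b eps ^~ tau) (dqcoef a b eps ^~ tau)) // => l;
    rewrite ?omegaN ?dpcoefN ?dqcoefN.
by rewrite conjcM conj_e1 conjcD conjcM cie mulNr.
Qed.

(** The half-waves diagonalise the linear part of [step_Phi] and [step_dPhi]: it becomes a factor of
    modulus 1, and the force terms combine into [PP] and [QQ]. *)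
Lemma step_eta sg k : sg ^+ 2 = 1 -> (k < N)%N -> let l := freq N k in
  eta sg (F (Phi st')) (F (dPhi st')) l = expi (sg * omega l * tau) * eta sg V W l
   + PP a b eps l sg tau * csq U l + QQ a b eps l sg tau * cre V U l.
Proof.
move=> hsg kN l; rewrite /eta step_Phi // step_dPhi // -/l /PP /QQ.
have w0 : omega l != 0 by rewrite gt_eqF ?omega_gt0.
have -> : expi (sg * omega l * tau) = (cos (omega l * tau))%:C%C + 'i%C * (sg * sin (omega l * tau))%:C%C.
  by rewrite expiE; case: (sg1 hsg) => ->; rewrite ?mul1r // !mulN1r !mulNr cosN sinN.
rewrite -(eps2_omega a b he l); move: (omega l) (eps ^+ 2) w0 => w e2 w0.
have hw : w%:C%C * (sin (w * tau) / w)%:C%C = (sin (w * tau))%:C%C :> R[i].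
  by rewrite -rmorphM; apply: (congr1 (fun x : R => x%:C%C)); field.
have hs2 : sg%:C%C * sg%:C%C = 1 :> R[i] by rewrite -rmorphM -expr2 hsg.
have rM (x y : R) : (x * y)%:C%C = x%:C%C * y%:C%C :> R[i] by exact: rmorphM.
have rN (x y : R) : (- x * y)%:C%C = - (x%:C%C * y%:C%C) :> R[i] by rewrite mulNr -rM; exact: rmorphN.
move: hw hs2; rewrite rN (rM sg (sin _)) (rM sg (e2 * w)) (rM e2 w) (rM e2 (dpcoef _ _ _ _ _)) (rM e2 (dqcoef _ _ _ _ _)).
rewrite (rM (sg * (e2 * w)) (pcoef _ _ _ _ _)) (rM (sg * (e2 * w)) (qcoef _ _ _ _ _)).
rewrite !(rM sg (e2 * w)) !(rM e2 w).
move: (sin (w * tau) / w)%:C%C (sin (w * tau))%:C%C (cos (w * tau))%:C%C => x y z hw hs2.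
ring: (@mul_ii R) hw hs2.
Qed.

End one_step.

End scheme_in_frequency.

(** * Local error *)

Section big_O.
Context {R : realType} (a b : R) (hab : a < b) {P : Type}.
Variables (N : P -> nat) (tau : P -> R).
Hypothesis N_even : forall p, ~~ odd (N p).
Hypothesis N_gt0 : forall p, (0 < N p)%N.
Hypothesis tau_bd : forall p, 0 < tau p <= 1.
Implicit Types (c d : P -> R -> int -> R[i]) (g h : P -> R).

(* c = O(g) in H^(2k), uniformly in the parameter p and in the local time
   s in [0, tau p]. *)
Definition Ov k c g : Prop := exists2 C : R, 0 <= C &
  forall p s, 0 <= s <= tau p -> nrm a b (N p) k (c p s) <= C * g p.

Lemma nrm_ge0 n k (e : int -> R[i]) : 0 <= nrm a b n k e.
Proof. exact: wn_ge0. Qed.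

Let bX := @bwX_ge0 R a b.

Lemma Ov_ge k c g h : Ov k c g -> (forall p, g p <= h p) -> Ov k c h.
Proof.
move=> [C C0 hc] gh; exists C => // p s ps; apply: le_trans (hc _ _ ps) _.
by rewrite ler_wpM2l.
Qed.

Lemma Ov_scale k c g h (K : R) : Ov k c g -> 0 <= K -> (forall p, g p <= K * h p) -> Ov k c h.
Proof.
move=> [C C0 hc] K0 gh; exists (C * K); first exact: mulr_ge0.
by move=> p s ps; apply: le_trans (hc _ _ ps) _; rewrite -mulrA ler_wpM2l.
Qed.

Lemma Ov_ext k c d g : Ov k c g ->
  (forall p s k', (k' < N p)%N -> 0 <= s <= tau p ->
    c p s (freq (N p) k') = d p s (freq (N p) k')) -> Ov k d g.
Proof.
move=> [C C0 hc] cd; exists C => // p s ps; apply: le_trans (hc _ _ ps).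
by rewrite le_eqVlt; apply/orP; left; apply/eqP; apply: wn_eq => k' k'N; rewrite cd.
Qed.

Lemma OvD k c d g : Ov k c g -> Ov k d g -> Ov k (fun p s l => c p s l + d p s l) g.
Proof.
move=> [C C0 hc] [D D0 hd]; exists (C + D) => [|p s ps]; first exact: addr_ge0.
by rewrite mulrDl; apply: le_trans (wnD _ _ _ (bX k)) (lerD (hc _ _ ps) (hd _ _ ps)).
Qed.

Lemma OvN k c g : Ov k c g -> Ov k (fun p s l => - c p s l) g.
Proof. by move=> [C C0 hc]; exists C => // p s ps; rewrite /nrm wnN; exact: hc. Qed.

Lemma OvB k c d g : Ov k c g -> Ov k d g -> Ov k (fun p s l => c p s l - d p s l) g.
Proof. by move=> hc hd; apply: OvD => //; exact: OvN. Qed.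

(** A multiplier growing like [bw^j] spends [j] powers of the weight, and its smallness [h] is
    passed on to the product. *)
Lemma Ov_mul j k c g h (K : R) (m : P -> R -> int -> R[i]) : 0 <= K ->
  (forall p, 0 <= h p) ->
  (forall p s l, 0 <= s <= tau p -> cnorm (m p s l) <= K * h p * bw a b l ^+ j) ->
  Ov (k + j) c g -> Ov k (fun p s l => m p s l * c p s l) (fun p => h p * g p).
Proof.
move=> K0 h0 hm [C C0 hc]; exists (K * C) => [|p s ps]; first exact: mulr_ge0.
rewrite mulrACA; apply: le_trans (ler_wpM2l _ (hc _ _ ps)); last exact: mulr_ge0.
rewrite /nrm -[K * h p]ger0_norm ?mulr_ge0 // -[`|_|]cnorm_real -wnZ.
apply: wn_le => [l|k' k'N]; first exact: bX.
rewrite !cnormM cnorm_real ger0_norm ?mulr_ge0 // exprD.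
set x := bw _ _ _ ^+ k; rewrite [_ * cnorm (c _ _ _)]mulrC !mulrA -mulrA [leRHS]mulrAC.
rewrite [X in X <= _](_ : _ = x * cnorm (c p s (freq (N p) k')) * cnorm (m p s (freq (N p) k'))); last by ring.
rewrite [leRHS](_ : _ = x * cnorm (c p s (freq (N p) k')) * (K * h p * bw a b (freq (N p) k') ^+ j)); last by ring.
by rewrite ler_wpM2l ?hm // mulr_ge0 ?bX.
Qed.

Lemma Ov_mono k k' c g : (k <= k')%N -> Ov k' c g -> Ov k c g.
Proof.
move=> kk' [C C0 hc]; exists C => // p s ps; apply: le_trans (hc _ _ ps).
apply: wn_le => [l|j jN]; first exact: bX.
by rewrite ler_wpM2r // ler_weXn2l ?bw_ge1.
Qed.

Lemma Ov_cconv k c d g h : (0 < k)%N -> (forall p, 0 <= g p) -> Ov k c g -> Ov k d h ->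
  Ov k (fun p s l => cconv a b (N p) (c p s) (d p s) l) (fun p => g p * h p).
Proof.
move=> k0 g0 [C C0 hc] [D D0 hd]; have [K K0 hK] := conv_nrm hab k.
exists (K * (C * D)) => [|p s ps]; first by rewrite mulr_ge0 ?mulr_ge0.
apply: le_trans (hK _ _ _ (N_even p) k0) _; rewrite -mulrA ler_wpM2l // mulrACA.
by apply: ler_pM; rewrite ?nrm_ge0 ?hc ?hd.
Qed.

Lemma Ov_cconvl k c d g : (0 < k)%N -> Ov k c (fun=> 1) -> Ov k d g ->
  Ov k (fun p s l => cconv a b (N p) (c p s) (d p s) l) g.
Proof.
move=> k0 hc hd; apply: Ov_ge (Ov_cconv k0 _ hc hd) _ => // p; by rewrite mul1r.
Qed.

Lemma Ov_cconvr k c d g : (0 < k)%N -> Ov k c g -> Ov k d (fun=> 1) ->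
  Ov k (fun p s l => cconv a b (N p) (c p s) (d p s) l) g.
Proof.
move=> k0 hc hd; apply: Ov_ext (Ov_cconvl k0 hd hc) _ => p s k' k'N _.
exact: cconvC.
Qed.

Lemma Ov_cj k c g : Ov k c g -> Ov k (fun p s l => cj a b (N p) (c p s) l) g.
Proof. by move=> [C C0 hc]; exists C => // p s ps; rewrite nrm_cj // hc. Qed.

Lemma Ov_loss j k c g (m : P -> R -> int -> R[i]) : Ov (k + j) c g ->
  (forall p s l, 0 <= s <= tau p -> cnorm (m p s l) <= bw a b l ^+ j) ->
  Ov k (fun p s l => m p s l * c p s l) g.
Proof.
move=> hc hm; apply: Ov_ge (Ov_mul (h := fun=> 1) (K := 1) _ _ _ hc) _ => // [p s l ps|p].
  by rewrite !mul1r hm.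
by rewrite mul1r.
Qed.

Lemma Ov_unit k c g (m : P -> R -> int -> R[i]) : Ov k c g ->
  (forall p s l, 0 <= s <= tau p -> cnorm (m p s l) <= 1) ->
  Ov k (fun p s l => m p s l * c p s l) g.
Proof. by move=> hc hm; rewrite -[k]addn0 in hc; apply: Ov_loss hc hm. Qed.

Lemma Ov_small k c g h (K : R) (m : P -> R -> int -> R[i]) : Ov k c g ->
  0 <= K -> (forall p, 0 <= h p) ->
  (forall p s l, 0 <= s <= tau p -> cnorm (m p s l) <= K * h p) ->
  Ov k (fun p s l => m p s l * c p s l) (fun p => h p * g p).
Proof.
move=> hc K0 h0 hm; rewrite -[k]addn0 in hc; apply: Ov_mul K0 h0 _ hc => p s l ps.
by rewrite expr0 mulr1 hm.
Qed.

Lemma Ov_at0 k c g : Ov k c g -> Ov k (fun p _ => c p 0) g.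
Proof.
move=> [C C0 hc]; exists C => // p s ps; apply: hc.
by rewrite lexx ltW //; case/andP: (tau_bd p).
Qed.

Lemma Ov_attau k c g : Ov k c g -> Ov k (fun p _ => c p (tau p)) g.
Proof.
move=> [C C0 hc]; exists C => // p s ps; apply: hc.
by rewrite lexx andbT ltW //; case/andP: (tau_bd p).
Qed.

(** One integration in time gains a factor [tau], at every intermediate time of the step as well as
    at its end. *)
Lemma Ov_mvt k c (c' : P -> R -> int -> R[i]) g :
  (forall p k', (k' < N p)%N ->
    C1on 0 (tau p) (fun s => c p s (freq (N p) k')) (fun s => c' p s (freq (N p) k'))) ->
  Ov k c' g -> (forall p, 0 <= g p) ->
  Ov k (fun p s l => c p s l - c p 0 l) (fun p => tau p * g p).
Proof.
move=> hd [C C0 hc] g0; exists C => // p s /andP[s0 st].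
apply: le_trans (_ : C * g p * (s - 0) <= _); last first.
  by rewrite subr0 -mulrA ler_wpM2l // mulrC ler_wpM2r.
apply: (@wn_mvt R (N p) _ (c p) (c' p)) => // [k' k'N|t /andP[t0 ts]].
  have [[c1 d1] [c2 d2]] := hd p k' k'N.
  have sub : `[0, s] `<=` `[0, tau p].
    by move=> x /=; rewrite !in_itv /= => /andP[-> /le_trans]; apply.
  have sub' x : x \in `]0, s[%R -> x \in `]0, tau p[%R.
    by rewrite !in_itv /= => /andP[-> /lt_le_trans]; apply.
  by split; split=> [|x /sub' xs]; [exact: continuous_subspaceW sub c1|exact: d1
    |exact: continuous_subspaceW sub c2|exact: d2].
by apply: hc; rewrite (ltW t0) (le_trans (ltW ts)).
Qed.

End big_O.

(** * Bounds for the sine filter *)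

Section filters.
Context {R : realType} (a b tau : R).
Hypothesis tau_gt0 : 0 < tau.

Local Notation mu := (mu a b).

Lemma cnorm_iR (x : R) : cnorm ('i%C * x%:C%C) = `|x|.
Proof. by rewrite cnormM cnorm_i mul1r cnorm_real. Qed.

Lemma mu2_bw l : mu l ^+ 2 <= bw a b l.
Proof. by rewrite lerDr. Qed.

Lemma sincf_le l : `|sincf a b tau l| <= mu l ^+ 2.
Proof.
rewrite /sincf normrM normfV (gtr0_norm tau_gt0) ler_pdivrMr //.
by apply: normr_sin_le; rewrite mulr_ge0 ?sqr_ge0 // ltW.
Qed.

Lemma sincf_le_inv l : `|sincf a b tau l| <= tau^-1.
Proof.
rewrite /sincf normrM normfV (gtr0_norm tau_gt0) ler_piMl ?sin_max //.
by rewrite invr_ge0 ltW.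
Qed.

(** The error of the filter is of first order in [tau], at the price of a second power of the
    weight. *)
Lemma mu2_sincf_le l : `|mu l ^+ 2 - sincf a b tau l| <= tau * bw a b l ^+ 2.
Proof.
have t0 : tau != 0 by rewrite gt_eqF.
have -> : mu l ^+ 2 - sincf a b tau l = (mu l ^+ 2 * tau - sin (mu l ^+ 2 * tau)) / tau.
  by rewrite /sincf; field.
rewrite normrM normfV (gtr0_norm tau_gt0) ler_pdivrMr //.
have m0 : 0 <= mu l ^+ 2 * tau by rewrite mulr_ge0 ?sqr_ge0 // ltW.
apply: le_trans (sub_sin_le m0) _; rewrite exprMn.
rewrite [leRHS](_ : _ = bw a b l ^+ 2 * tau ^+ 2); last by ring.
rewrite ler_wpM2r ?sqr_ge0 // ler_sqr ?nnegrE ?sqr_ge0 ?mu2_bw //.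
by rewrite ltW // bw_gt0.
Qed.

End filters.


Section local_error.
Context {R : realType} (a b : R) (hab : a < b) {P : Type}.
Variables (N : P -> nat) (eps tau : P -> R).
Hypothesis N_even : forall p, ~~ odd (N p).
Hypothesis N_gt0 : forall p, (0 < N p)%N.
Hypothesis tau_bd : forall p, 0 < tau p <= 1.
Hypothesis eps_bd : forall p, 0 < eps p <= 1.

(* The exact solution on one time step, truncated to |l| < N/2, in local time:
   u, v, w are the coefficients of psi, phi, d_t phi; al and be collect the
   truncation and aliasing errors. *)
Variables (u u' v w w' al be : P -> R -> int -> R[i]) (dl : P -> R).

Local Notation mu := (mu a b).
Local Notation bw := (bw a b).
Local Notation O := (Ov a b N tau).
Local Notation cconv p := (cconv a b (N p)).
Local Notation cj p := (cj a b (N p)).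
Local Notation om p := (omega a b (eps p)).
Local Notation kp p := (kap a b (eps p)).

Hypothesis dl_ge0 : forall p, 0 <= dl p.
Hypothesis Du : forall p k, (k < N p)%N ->
  C1on 0 (tau p) (fun s => u p s (freq (N p) k)) (fun s => u' p s (freq (N p) k)).
Hypothesis Dv : forall p k, (k < N p)%N ->
  C1on 0 (tau p) (fun s => v p s (freq (N p) k)) (fun s => w p s (freq (N p) k)).
Hypothesis Dw : forall p k, (k < N p)%N ->
  C1on 0 (tau p) (fun s => w p s (freq (N p) k)) (fun s => w' p s (freq (N p) k)).
Hypothesis ODEu : forall p k s, (k < N p)%N -> 0 < s < tau p -> let l := freq (N p) k in
  u' p s l = - ('i%C * (mu l ^+ 2)%:C%C * u p s l)
    + 'i%C * cconv p (v p s) (u p s) l + 'i%C * al p s l.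
Hypothesis ODEv : forall p k s, (k < N p)%N -> 0 < s < tau p -> let l := freq (N p) k in
  (eps p ^+ 2)%:C%C * (w' p s l + (om p l ^+ 2)%:C%C * v p s l)
    = cconv p (cj p (u p s)) (u p s) l + be p s l.
Hypothesis Ov4 : O 4 v (fun=> 1).
Hypothesis Ow4 : O 4 (fun p s l => (eps p ^+ 2)%:C%C * w p s l) (fun=> 1).
Hypothesis Ou3 : O 3 u (fun=> 1).
Hypothesis Ou2' : O 2 u' (fun=> 1).
Hypothesis Oal : O 1 al dl.
Hypothesis Obe : O 1 be dl.
Hypothesis v_real : forall p, real_coef a b (N p) (v p 0).
Hypothesis w_real : forall p, real_coef a b (N p) (w p 0).

Let t0 p : 0 < tau p. Proof. by case/andP: (tau_bd p). Qed.
Let t1 p : tau p <= 1. Proof. by case/andP: (tau_bd p). Qed.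
Let e0 p : 0 < eps p. Proof. by case/andP: (eps_bd p). Qed.
Let e20 p : 0 < eps p ^+ 2. Proof. by rewrite exprn_gt0. Qed.
Let e21 p : eps p ^+ 2 <= 1.
Proof. by case/andP: (eps_bd p) => ? ?; rewrite exprn_ile1 // ltW. Qed.

Let te p := tau p ^+ 2 / eps p ^+ 2.
Let te0 p : 0 <= te p. Proof. by rewrite divr_ge0 ?sqr_ge0. Qed.
Let tte p : tau p ^+ 2 <= te p.
Proof. by rewrite ler_pdivlMr // ler_piMr ?sqr_ge0. Qed.

Let z0 p := cZ0 (eps p) (v p 0) (w p 0).
Let zd p := cZd a b (eps p) (tau p) (v p 0) (w p 0).
Let ud p := cUd a b (tau p) (N p) (v p 0) (u p 0).
Let rd p := cRd a b (eps p) (tau p) (N p) (v p 0) (w p 0).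

Lemma Ov0 : O 4 (fun p _ => v p 0) (fun=> 1). Proof. exact: Ov_at0. Qed.
Lemma Ou0 : O 3 (fun p _ => u p 0) (fun=> 1). Proof. exact: Ov_at0. Qed.

Lemma Oz0 : O 4 (fun p _ => z0 p) (fun=> 1).
Proof.
have h := OvB Ov0 (Ov_unit (m := fun _ _ _ => 'i%C) (Ov_at0 tau_bd Ow4) _).
apply: Ov_ext (Ov_unit (m := fun _ _ _ => 2^-1) (h _) _) _ => p s k *.
- by rewrite cnorm_i.
- rewrite cnormV -[2]/((2%:R) : R[i]) -(rmorph_nat (real_complex R)) cnorm_real.
  by rewrite ger0_norm // invf_le1 // ler1n.
- by rewrite /z0 /cZ0 mulrA.
Qed.

Lemma Ozd : O 3 (fun p _ => zd p) (fun=> 1).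
Proof.
apply: (Ov_loss (j := 1) (k := 3) (m := fun p _ l => 'i%C * (sincf a b (tau p) l / 2)%:C%C) Oz0).
move=> p s l _; rewrite cnorm_iR expr1 normrM [X in _ * X]ger0_norm ?invr_ge0 //.
have := sincf_le a b (t0 p) l; have := mu2_bw a b l; have := normr_ge0 (sincf a b (tau p) l).
by lra.
Qed.

Lemma Oud : O 2 (fun p _ => ud p) (fun=> 1).
Proof.
apply: OvD.
  apply: OvN; apply: (Ov_loss (j := 1) (k := 2) (m := fun p _ l => 'i%C * (sincf a b (tau p) l)%:C%C) Ou0).
  by move=> p s l _; rewrite cnorm_iR expr1; apply: le_trans (sincf_le a b (t0 p) l) _; exact: mu2_bw.
apply: (Ov_unit (m := fun _ _ _ => 'i%C)) => [|*]; last by rewrite cnorm_i.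
by apply: Ov_cconvl => //; [exact: Ov_mono Ov0|exact: Ov_mono Ou0].
Qed.

Lemma Ord : O 3 (fun p _ => rd p) (fun=> 1).
Proof. by apply: OvB; [apply: OvN; exact: Ozd|apply: Ov_cj => //; exact: Ozd]. Qed.

Lemma Ou_inc : O 2 (fun p s l => u p s l - u p 0 l) tau.
Proof. by apply: Ov_ge (Ov_mvt Du Ou2' _) _ => p; rewrite ?mulr1. Qed.

Lemma Ow : O 4 w (fun p => eps p ^- 2).
Proof.
have h := Ov_small (m := fun p _ _ => (eps p ^- 2)%:C%C) (K := 1) (h := fun p => eps p ^- 2) Ow4.
apply: Ov_ext (Ov_ge (h _ _ _) _) _ => [||p s l _|p|p s k kN _] //.
- by move=> p; rewrite invr_ge0 ltW.
- by rewrite cnorm_real mul1r ger0_norm // invr_ge0 ltW.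
- by rewrite mulr1.
- by rewrite mulrA -rmorphM mulVf ?mul1r // gt_eqF.
Qed.

Lemma Ov_inc : O 4 (fun p s l => v p s l - v p 0 l) (fun p => tau p / eps p ^+ 2).
Proof. by apply: Ov_mvt Dv Ow _ => // p; rewrite invr_ge0 ltW. Qed.

(** Size of the derivative of the first-order Taylor remainder of [u]: the increment of [v], which
    moves at speed [eps^-2], plus the spatial error. *)
Let g1 p := tau p / eps p ^+ 2 + dl p.
Let te1 p : tau p <= tau p / eps p ^+ 2.
Proof. by rewrite ler_pdivlMr // ler_piMr // ltW. Qed.

(* u' is compared with the filtered derivative ud through the equation rather
   than through a second time derivative. *)
Lemma Ou_taylor : O 1 (fun p s l => u p s l - u p 0 l - s%:C%C * ud p l) (fun p => tau p * g1 p).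
Proof.
pose F' p s l : R[i] := - ('i%C * ((mu l ^+ 2)%:C%C * (u p s l - u p 0 l)))
   - 'i%C * ((mu l ^+ 2 - sincf a b (tau p) l)%:C%C * u p 0 l)
   + 'i%C * (cconv p (fun l => v p s l - v p 0 l) (u p s) l
             + cconv p (v p 0) (fun l => u p s l - u p 0 l) l) + 'i%C * al p s l.
pose F p s l : R[i] := u p s l - s%:C%C * ud p l.
have hF : O 1 F' g1.
  have i1 (p : P) (s : R) (l : int) : 0 <= s <= tau p -> cnorm ('i%C : R[i]) <= 1 by rewrite cnorm_i.
  have tg1 p : tau p <= g1 p by rewrite (le_trans (te1 p)) // lerDl.
  apply: OvD; last first.
    by apply: Ov_unit (fun p s l => i1 p s l); apply: Ov_ge Oal _ => p; rewrite lerDr divr_ge0 // ltW.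
  apply: OvD; last first.
    apply: Ov_unit (fun p s l => i1 p s l); apply: OvD.
      apply: Ov_cconvr => //; last by apply: Ov_mono Ou3.
      by apply: Ov_ge (Ov_mono _ Ov_inc) _ => // p; rewrite lerDl.
    apply: Ov_cconvl => //; first by apply: Ov_mono Ov0.
    exact: Ov_ge (Ov_mono _ Ou_inc) _.
  apply: OvB.
    apply: OvN; apply: Ov_unit (fun p s l => i1 p s l).
    apply: (Ov_loss (j := 1) (k := 1) (Ov_ge Ou_inc tg1)) => p s l _.
    by rewrite expr1 cnorm_real ger0_norm ?sqr_ge0 // mu2_bw.
  apply: Ov_unit (fun p s l => i1 p s l).
  apply: Ov_ge (Ov_mul (j := 2) (k := 1) (h := tau) (K := 1) _ _ _ Ou0) _ => // [p|p s l _|p].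
  - exact: ltW.
  - by rewrite mul1r cnorm_real mu2_sincf_le.
  - by rewrite mulr1.
have dF p k : (k < N p)%N -> C1on 0 (tau p) (fun s => F p s (freq (N p) k)) (fun s => F' p s (freq (N p) k)).
  move=> kN; set l := freq _ _.
  apply: (C1on_ext (C1onB (Du kN) (C1onM (C1on_real (rC1_id 0 (tau p))) (C1on_cst _ _ (ud p l))))) => s // sp.
  rewrite ODEu //.
  rewrite /F' /ud /cUd cconvBl // cconvBr // rmorphB; ring.
apply: Ov_ext (Ov_mvt dF hF _) _ => [p|p s k kN _].
  by rewrite addr_ge0 // divr_ge0 // ltW.
by rewrite /F mul0r subr0; ring.
Qed.

Hypothesis dl_le1 : forall p, dl p <= 1.

Let i1 (p : P) (s : R) (l : int) : 0 <= s <= tau p -> cnorm ('i%C : R[i]) <= 1.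
Proof. by rewrite cnorm_i. Qed.
Let g10 p : 0 <= g1 p. Proof. by rewrite addr_ge0 // divr_ge0 // ltW. Qed.
Let tg1 p : tau p <= g1 p. Proof. by rewrite (le_trans (te1 p)) // lerDl. Qed.

Let sq p s l : R[i] := cconv p (cj p (u p s)) (u p s) l.
Let sq' p s l : R[i] := cconv p (cj p (u' p s)) (u p s) l + cconv p (cj p (u p s)) (u' p s) l.
Let cs p := csq a b (N p) (u p 0).
Let cr p := cre a b (tau p) (N p) (v p 0) (u p 0).
Let fo p s l : R[i] := sq p s l - cs p l - s%:C%C * cr p l.
Let fo' p s l : R[i] := sq' p s l - cr p l.

Let Ocl k c d g (hc : O k c (fun=> 1)) (hd : O k d g) (k0 : (0 < k)%N) :=
  Ov_cconvl hab N_even k0 hc hd.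
Let Ocr' k c d g (hc : O k c g) (hd : O k d (fun=> 1)) (k0 : (0 < k)%N) :=
  Ov_cconvr hab N_even N_gt0 k0 hc hd.
Let Ocj k c g (hc : O k c g) := Ov_cj hab N_even hc.

Let Ou0_1 : O 1 (fun p _ => u p 0) (fun=> 1). Proof. exact: Ov_mono Ou0. Qed.
Let Oud_1 : O 1 (fun p _ => ud p) (fun=> 1). Proof. exact: Ov_mono Oud. Qed.
Let Ou_1 : O 1 u (fun=> 1). Proof. exact: Ov_mono Ou3. Qed.
Let Ou'_1 : O 1 u' (fun=> 1). Proof. exact: Ov_mono Ou2'. Qed.
Let Ou_inc1 : O 1 (fun p s l => u p s l - u p 0 l) tau. Proof. exact: Ov_mono Ou_inc. Qed.

Lemma Ocr : O 1 (fun p _ => cr p) (fun=> 1).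
Proof. exact: (OvD (Ocl (Ocj Ou0_1) Oud_1 isT) (Ocl Ou0_1 (Ocj Oud_1) isT)). Qed.

Lemma Osq : O 1 sq (fun=> 1).
Proof. exact: (Ocl (Ocj Ou_1) Ou_1 isT). Qed.

Lemma Osq' : O 1 sq' (fun=> 1).
Proof. exact: (OvD (Ocl (Ocj Ou'_1) Ou_1 isT) (Ocl (Ocj Ou_1) Ou'_1 isT)). Qed.

Lemma Dsq p k : (k < N p)%N ->
  C1on 0 (tau p) (fun s => sq p s (freq (N p) k)) (fun s => sq' p s (freq (N p) k)).
Proof.
move=> kN; apply: C1on_cconv => // k' k'N; last exact: Du.
by apply: C1on_cj => // k'' k''N; exact: Du.
Qed.

Lemma Dfo p k : (k < N p)%N ->
  C1on 0 (tau p) (fun s => fo p s (freq (N p) k)) (fun s => fo' p s (freq (N p) k)).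
Proof.
move=> kN; set l := freq _ _.
apply: (C1on_ext (C1onB (C1onB (Dsq kN) (C1on_cst _ _ (cs p l)))
  (C1onM (C1on_real (rC1_id 0 (tau p))) (C1on_cst _ _ (cr p l))))) => s // _.
by rewrite mulr0 addr0 mul1r subr0.
Qed.

Lemma Ofo' : O 1 fo' (fun=> 1).
Proof. by apply: OvB; [exact: Osq'|exact: Ocr]. Qed.

Let fo0 p l : fo p 0 l = 0.
Proof. by rewrite /fo mul0r subr0 subrr. Qed.

Lemma Ofo_tau : O 1 fo tau.
Proof.
apply: Ov_ext (Ov_ge (Ov_mvt Dfo Ofo' _) _) _ => // [p|p s k _ _].
  by rewrite mulr1.
by rewrite fo0 subr0.
Qed.

Let sC (p : P) (s : R) (l : int) : 0 <= s <= tau p -> cnorm (s%:C%C) <= 1 * tau p.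
Proof. by move=> /andP[s0 st]; rewrite mul1r cnorm_real ger0_norm. Qed.

(** With [e = u - u0 - s ud], the remainder equals [conj(u0) e + conj(e) u + s conj(ud) (u - u0)],
    so it inherits the Taylor bound of [u]. *)
Lemma Ofo : O 1 fo (fun p => tau p * g1 p).
Proof.
pose e p s l : R[i] := u p s l - u p 0 l - s%:C%C * ud p l.
have h : O 1 (fun p s l => cconv p (cj p (u p 0)) (e p s) l + cconv p (cj p (e p s)) (u p s) l
    + s%:C%C * cconv p (cj p (ud p)) (fun l => u p s l - u p 0 l) l) (fun p => tau p * g1 p).
  apply: OvD; first apply: OvD.
  - exact: (Ocl (Ocj Ou0_1) Ou_taylor isT).
  - exact: (Ocr' (Ocj Ou_taylor) Ou_1 isT).
  - apply: (Ov_small (K := 1)) => // [|p]; last exact: ltW.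
    exact: (Ov_ge (Ocl (Ocj Oud_1) Ou_inc1 isT) tg1).
apply: Ov_ext h _ => p s k kN _; set l := freq _ _.
have -> : cconv p (cj p (e p s)) (u p s) l =
    cconv p (fun l => cj p (u p s) l - cj p (u p 0) l - s%:C%C * cj p (ud p) l) (u p s) l.
  apply: cconv_ext => // k' k'N.
  rewrite /e cjB // cjB // (cjM hab (m := fun=> s%:C%C)) // conjc_real //.
rewrite /e !(cconvBl, cconvBr, cconvZl hab s%:C%C, cconvZr hab s%:C%C) //.
rewrite /fo /sq /cs /cr /csq /cre -/(ud p) (cconvC a b (u p 0) (cj p (ud p))) //.
ring.
Qed.

(** * Local error of the half-waves *)

Section energy.
Variable sg : R.
Hypothesis hsg : sg ^+ 2 = 1.

Let X p s l : R[i] := expi (- (sg * om p l) * s).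
Let et p s l := eta a b (eps p) sg (v p s) (w p s) l.

Let X1 p s l : 0 <= s <= tau p -> cnorm (X p s l) <= 1.
Proof. by rewrite cnorm_expi. Qed.

Let cE p s l : R[i] := X p s l * et p s l.

(** In the frame rotating with [exp(- i sg omega s)] the linear part disappears and only the rotated
    force drives the half-wave. *)
Lemma Denergy p k : (k < N p)%N -> let l := freq (N p) k in
  C1on 0 (tau p) (fun s => X p s l * et p s l) (fun s => X p s l * (sq p s l + be p s l)).
Proof.
move=> kN l.
apply: (C1on_ext (C1onM (C1on_expi 0 (tau p) (- (sg * om p l)))
  (C1onD (C1onZ (eps p ^+ 2)%:C%C (Dw kN)) (C1onZ ('i%C * (sg * kp p l)%:C%C) (Dv kN))))) => s // sp.
rewrite /sq -ODEv //.
have hk : (sg * kp p l)%:C%C = sg%:C%C * (eps p ^+ 2)%:C%C * (om p l)%:C%C :> R[i].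
  by rewrite -!rmorphM -mulrA eps2_omega.
have ho : (- (sg * om p l))%:C%C = - (sg%:C%C * (om p l)%:C%C) :> R[i].
  by rewrite -rmorphM; exact: rmorphN.
have ho2 : (om p l ^+ 2)%:C%C = (om p l)%:C%C * (om p l)%:C%C :> R[i].
  by rewrite -rmorphM.
have hs : sg%:C%C * sg%:C%C = 1 :> R[i] by rewrite -rmorphM -expr2 hsg.
rewrite -/l hk ho ho2 /X; move: (eps p ^+ 2)%:C%C => e2; ring: (@mul_ii R) hs.
Qed.

(** Inverse of the factor [- i sg omega] that differentiation of the rotation produces, since
    [sg^2 = 1]. Its modulus is at most [eps^2]. *)
Let iw p l : R[i] := 'i%C * (sg / om p l)%:C%C.

Let iw_le p l : cnorm (iw p l) <= eps p ^+ 2.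
Proof.
rewrite /iw cnorm_iR normrM normfV (gtr0_norm (omega_gt0 a b (e0 p) l)).
have -> : `|sg| = 1 by case: (sg1 hsg) => ->; rewrite ?normrN normr1.
rewrite mul1r omegaE invf_div ler_pdivrMr ?kap_gt0 //.
by rewrite ler_peMr ?kap_ge1 // ltW.
Qed.

(* Integration by parts against the oscillating factor, in differential form. *)
Lemma energy_parts (f f' M : P -> R -> int -> R[i]) :
  (forall p k, (k < N p)%N -> let l := freq (N p) k in
    C1on 0 (tau p) (fun s => M p s l) (fun s => X p s l * (f p s l + be p s l))) ->
  (forall p k, (k < N p)%N -> let l := freq (N p) k in
    C1on 0 (tau p) (fun s => f p s l) (fun s => f' p s l)) ->
  O 1 f' (fun=> 1) ->
  O 1 (fun p s l => M p s l - M p 0 l - iw p l * (X p s l * f p s l - f p 0 l))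
    (fun p => tau p * (dl p + eps p ^+ 2)).
Proof.
move=> DM Df Of'.
pose F p s l : R[i] := M p s l - iw p l * (X p s l * f p s l).
pose F' p s l : R[i] := X p s l * be p s l - iw p l * (X p s l * f' p s l).
have hF : O 1 F' (fun p => dl p + eps p ^+ 2).
  apply: OvB.
    by apply: Ov_ge (Ov_unit Obe X1) _ => p; rewrite lerDl ltW.
  apply: Ov_ge (Ov_small (h := fun p => eps p ^+ 2) (K := 1) (Ov_unit Of' X1) _ _ _) _ => // [p|p s l _|p].
  - exact: ltW.
  - by rewrite mul1r iw_le.
  - by rewrite mulr1 lerDr.
have DF p k : (k < N p)%N -> C1on 0 (tau p) (fun s => F p s (freq (N p) k)) (fun s => F' p s (freq (N p) k)).
  move=> kN; set l := freq _ _.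
  apply: (C1on_ext (C1onB (DM _ _ kN) (C1onZ (iw p l) (C1onM (C1on_expi 0 (tau p) (- (sg * om p l))) (Df _ _ kN))))) => s // _.
  have h : iw p l * ('i%C * (- (sg * om p l))%:C%C) = 1.
    rewrite /iw mulrACA mul_ii -rmorphM mulN1r -rmorphN -[RHS]/(1%:C%C); apply: (congr1 (fun x : R => x%:C%C)).
    have w0 : om p l != 0 by rewrite gt_eqF ?omega_gt0.
    by rewrite -hsg; field.
  rewrite /F' -/l /X; move: (- (sg * om p l))%:C%C h => y h; ring: h.
apply: Ov_ext (Ov_mvt DF hF _) _ => [p|p s k kN _]; first by rewrite addr_ge0 // ltW.
by rewrite /F /X mulr0 expi0; ring.
Qed.

Let X0 p l : X p 0 l = 1. Proof. by rewrite /X mulr0 expi0. Qed.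

Lemma Oenergy : O 1 (fun p s l => X p s l * et p s l - et p 0 l) tau.
Proof.
have h : O 1 (fun p s l => X p s l * (sq p s l + be p s l)) (fun=> 1).
  by apply: Ov_unit X1; apply: OvD; [exact: Osq|exact: Ov_ge Obe _].
apply: Ov_ext (Ov_ge (Ov_mvt (c := cE) Denergy h _) _) _ => // [p|p s k kN _]; first by rewrite mulr1.
by rewrite /cE X0 mul1r.
Qed.

(** Integration by parts leaves boundary terms of size [eps^2] and a bulk of size
    [tau (dl + eps^2)]; [tau <= 1] absorbs the second part of the bulk. *)
Lemma Oenergy2 : O 1 (fun p s l => X p s l * et p s l - et p 0 l) (fun p => tau p * dl p + eps p ^+ 2).
Proof.
have h := energy_parts (M := cE) (f := sq) Denergy Dsq Osq'.
have h2 : O 1 (fun p s l => iw p l * (X p s l * sq p s l - sq p 0 l)) (fun p => tau p * dl p + eps p ^+ 2).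
  apply: Ov_ge (Ov_small (h := fun p => eps p ^+ 2) (K := 1) (OvB (Ov_unit Osq X1) (Ov_at0 tau_bd Osq)) _ _ _) _ => // [p|p s l _|p].
  - exact: ltW.
  - by rewrite mul1r iw_le.
  - by rewrite mulr1 lerDr mulr_ge0 // ltW.
apply: Ov_ext (OvD (Ov_ge h _) h2) _ => [p|p s k kN _].
  by rewrite mulrDr lerD2l ler_piMl // ltW.
by rewrite /= /cE X0 mul1r; ring.
Qed.

Let er p l : R[i] := et p (tau p) l - (expi (sg * om p l * tau p) * et p 0 l
   + PP a b (eps p) l sg (tau p) * cs p l + QQ a b (eps p) l sg (tau p) * cr p l).

(** The rotated half-wave minus the part that the scheme integrates exactly. Up to a phase, the
    local error is its increment over the step. *)
Let M p s l : R[i] := X p s l * et p s l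
   - X p s l * PPr (om p l) sg s * cs p l - X p s l * QQr (om p l) sg s * cr p l.

Let DM p k : (k < N p)%N -> let l := freq (N p) k in
  C1on 0 (tau p) (fun s => M p s l) (fun s => X p s l * (fo p s l + be p s l)).
Proof.
move=> kN l.
have w0 := omega_gt0 a b (e0 p) l.
apply: (C1on_ext (C1onB (C1onB (Denergy kN) (C1onM (C1on_PPr (e0 p) (erefl (om p l)) hsg 0 (tau p)) (C1on_cst _ _ (cs p l))))
  (C1onM (C1on_QQr (e0 p) (erefl (om p l)) hsg 0 (tau p)) (C1on_cst _ _ (cr p l))))) => s // _.
by rewrite -/l /fo /X; ring.
Qed.

Let erE p k : (k < N p)%N -> let l := freq (N p) k in
  er p l = expi (sg * om p l * tau p) * (M p (tau p) l - M p 0 l).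
Proof.
move=> kN l; have w0 := omega_gt0 a b (e0 p) l.
rewrite /er /M X0 PPr0 QQr0 (PPE (e0 p) (erefl (om p l)) _ (ltW (t0 p))) (QQE (e0 p) (erefl (om p l)) _ (ltW (t0 p))).
have h : expi (sg * om p l * tau p) * X p (tau p) l = 1.
  by rewrite /X mulNr mulrC expiNM.
ring: h.
Qed.

Let Z1 (p : P) (s : R) l : 0 <= s <= tau p -> cnorm (expi (sg * om p l * tau p)) <= 1.
Proof. by rewrite cnorm_expi. Qed.

Lemma err_energy1 : O 1 (fun p _ => er p) (fun p => tau p * (te p + dl p)).
Proof.
have h : O 1 (fun p s l => X p s l * (fo p s l + be p s l)) (fun p => te p + dl p).
  apply: Ov_unit X1; apply: OvD; last by apply: Ov_ge Obe _ => p; rewrite lerDr.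
  apply: Ov_ge Ofo _ => p; rewrite /g1 mulrDr mulrA -expr2 lerD2l ler_piMl //.
have h2 := Ov_attau tau_bd (Ov_mvt (c := M) DM h (fun p => addr_ge0 (te0 p) (dl_ge0 p))).
by apply: Ov_ext (Ov_unit h2 Z1) _ => p s k kN _; rewrite erE.
Qed.

(** [fo] vanishes at 0 and is [O(tau)], so the boundary term of the integration by parts is
    [O(eps^2 tau)]. A full factor [tau] survives, as the summation over all steps requires. *)
Lemma err_energy2 : O 1 (fun p _ => er p) (fun p => tau p * (eps p ^+ 2 + dl p)).
Proof.
have h := energy_parts (M := M) (f := fo) DM Dfo Ofo'.
have h2 : O 1 (fun p s l => iw p l * (X p s l * fo p s l)) (fun p => tau p * (eps p ^+ 2 + dl p)).
  apply: Ov_ge (Ov_small (h := fun p => eps p ^+ 2) (K := 1) (Ov_unit Ofo_tau X1) _ _ _) _ => // [p|p s l _|p].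
  - exact: ltW.
  - by rewrite mul1r iw_le.
  - by rewrite mulrC ler_wpM2l ?lerDl // ltW.
have h3 := Ov_attau tau_bd (OvD (Ov_ge h (fun p => _ : _ <= tau p * (eps p ^+ 2 + dl p))) h2).
apply: Ov_ext (Ov_unit (h3 _) Z1) _ => [p|p s k kN _]; first by rewrite addrC.
by rewrite erE // fo0 subr0 subrK.
Qed.

End energy.


(** * Deviation of phi from the free flow, and its envelope decomposition *)

Let om0 p l : 0 < om p l. Proof. exact: omega_gt0. Qed.
Let kp1 p l : 1 <= kp p l. Proof. exact: kap_ge1. Qed.
Let kp0 p l : 0 < kp p l. Proof. exact: kap_gt0. Qed.
Let omk p l : om p l = kp p l / eps p ^+ 2. Proof. exact: omegaE. Qed.
Let iom_le p l : (om p l)^-1 <= eps p ^+ 2.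
Proof. by rewrite omk invf_div ler_pdivrMr // ler_peMr // ltW. Qed.

Let kp_bw p l : kp p l <= bw l.
Proof.
apply: le_trans (_ : kp p l ^+ 2 <= _).
  by rewrite expr2 ler_peMr // ltW.
by rewrite kap_sq lerD2l ler_piMr ?sqr_ge0.
Qed.

Let Os k c g (hc : O k c g) : O k (fun p s l => s%:C%C * c p s l) (fun p => tau p * g p).
Proof. by apply: Ov_small hc ler01 _ sC => p; exact: ltW. Qed.

(** Deviation of [v] from the free Klein-Gordon flow of its initial data. It is recovered from the
    two half-wave deviations [dt] after division by [kap >= 1]. *)
Let y p s l : R[i] := v p s l - (cos (om p l * s))%:C%C * v p 0 l
  - (sin (om p l * s) / om p l)%:C%C * w p 0 l.
Let y' p s l : R[i] := w p s l + (om p l * sin (om p l * s))%:C%C * v p 0 l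
  - (cos (om p l * s))%:C%C * w p 0 l.

Let dt sg p s l : R[i] := expi (sg * om p l * s) *
  (expi (- (sg * om p l) * s) * eta a b (eps p) sg (v p s) (w p s) l
    - eta a b (eps p) sg (v p 0) (w p 0) l).

Let dtE sg p s l : dt sg p s l = eta a b (eps p) sg (v p s) (w p s) l
  - expi (sg * om p l * s) * eta a b (eps p) sg (v p 0) (w p 0) l.
Proof.
rewrite /dt mulrBr mulrA (_ : _ * expi _ = 1) ?mul1r //.
by rewrite mulNr mulrC expiNM.
Qed.

Let sgn1 : (1 : R) ^+ 2 = 1. Proof. by rewrite expr1n. Qed.
Let sgnN1 : (-1 : R) ^+ 2 = 1. Proof. by rewrite sqrrN expr1n. Qed.

Let Odt sg g : sg ^+ 2 = 1 ->
  O 1 (fun p s l => expi (- (sg * om p l) * s) * eta a b (eps p) sg (v p s) (w p s) l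
    - eta a b (eps p) sg (v p 0) (w p 0) l) g -> O 1 (dt sg) g.
Proof. by move=> hsg h; apply: Ov_unit h _ => p s l _; rewrite cnorm_expi. Qed.

Let half_le1 : cnorm (2^-1 : R[i]) <= 1.
Proof.
rewrite cnormV -[2]/((2%:R) : R[i]) -(rmorph_nat (real_complex R)) cnorm_real.
by rewrite ger0_norm // invf_le1 // ler1n.
Qed.

Let rN (x : R) : (- x)%:C%C = - x%:C%C :> R[i]. Proof. exact: rmorphN. Qed.
Let rM (x z : R) : (x * z)%:C%C = x%:C%C * z%:C%C :> R[i]. Proof. exact: rmorphM. Qed.

Let ykE p s l : (kp p l)%:C%C * y p s l = 2^-1 * (- 'i%C * (dt 1 p s l - dt (-1) p s l)).
Proof.
rewrite !dtE /y /eta.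
have -> : expi (1 * om p l * s) = (cos (om p l * s))%:C%C + 'i%C * (sin (om p l * s))%:C%C.
  by rewrite expiE mul1r.
have -> : expi (-1 * om p l * s) = (cos (om p l * s))%:C%C - 'i%C * (sin (om p l * s))%:C%C.
  by rewrite expiE mulN1r mulNr cosN sinN rmorphN mulrN.
have hk : (kp p l)%:C%C * (sin (om p l * s) / om p l)%:C%C = (eps p ^+ 2)%:C%C * (sin (om p l * s))%:C%C :> R[i].
  by rewrite -!rmorphM -(eps2_omega a b (e0 p) l); apply: (congr1 (fun x : R => x%:C%C)); field; rewrite gt_eqF.
rewrite mul1r mulN1r rN.
move: hk; move: (sin (om p l * s) / om p l)%:C%C => x hk.
by field: (@mul_ii R) hk.
Qed.

Let ydE p s l : (eps p ^+ 2)%:C%C * y' p s l = 2^-1 * (dt 1 p s l + dt (-1) p s l).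
Proof.
rewrite !dtE /y' /eta.
have -> : expi (1 * om p l * s) = (cos (om p l * s))%:C%C + 'i%C * (sin (om p l * s))%:C%C.
  by rewrite expiE mul1r.
have -> : expi (-1 * om p l * s) = (cos (om p l * s))%:C%C - 'i%C * (sin (om p l * s))%:C%C.
  by rewrite expiE mulN1r mulNr cosN sinN rmorphN mulrN.
have hk : (kp p l)%:C%C = (eps p ^+ 2)%:C%C * (om p l)%:C%C :> R[i].
  by rewrite -!rmorphM (eps2_omega a b (e0 p) l).
have hm : (om p l * sin (om p l * s))%:C%C = (om p l)%:C%C * (sin (om p l * s))%:C%C :> R[i].
  by rewrite -rmorphM.
rewrite mul1r mulN1r rN hk hm.
by field: (@mul_ii R).
Qed.

Lemma Oy2 : O 1 y (fun p => tau p * dl p + eps p ^+ 2).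
Proof.
have h := OvB (Odt sgn1 (Oenergy2 sgn1)) (Odt sgnN1 (Oenergy2 sgnN1)).
have h' := Ov_unit (m := fun p s l => (kp p l)%:C%C^-1 * (2^-1 * - 'i%C)) h.
apply: Ov_ext (h' _) _ => [p s l _|p s k kN _].
  rewrite !cnormM cnormV cnorm_real cnormN cnorm_i mulr1 gtr0_norm //.
  by rewrite mulr_ile1 ?invf_le1 ?invr_ge0 ?(ltW (kp0 p l)).
apply: (mulfI (x := (kp p (freq (N p) k))%:C%C)).
  by rewrite (inj_eq (@complexI R)) gt_eqF.
by rewrite ykE -!mulrA mulVKf // (inj_eq (@complexI R)) gt_eqF.
Qed.

Let Dy p k : (k < N p)%N -> C1on 0 (tau p) (fun s => y p s (freq (N p) k)) (fun s => y' p s (freq (N p) k)).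
Proof.
move=> kN; set l := freq _ _.
apply: (C1on_ext (C1onB (C1onB (Dv kN) (C1onM (C1on_real (rC1_cos 0 (tau p) (om p l))) (C1on_cst _ _ (v p 0 l))))
   (C1onM (C1on_real (rC1M (rC1_sin 0 (tau p) (om p l)) (rC1_cst 0 (tau p) (om p l)^-1))) (C1on_cst _ _ (w p 0 l))))) => s // _.
rewrite mulr0 addr0 mulr0 addr0 mulr0 addr0 /y' mulNr rmorphN mulNr opprK; congr (_ - _%:C%C * _).
by rewrite mulrC mulKf // gt_eqF.
Qed.

Let y0 p l : y p 0 l = 0.
Proof. by rewrite /y !mulr0 cos0 sin0 mul0r mul1r mul0r subrr subr0. Qed.

(** [eps^2 y'] is the mean of the two half-wave deviations, hence [O(tau)]. Division by [eps^2] and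
    one integration give [tau^2 / eps^2]. *)
Lemma Oy1 : O 1 y te.
Proof.
have h := OvD (Odt sgn1 (Oenergy sgn1)) (Odt sgnN1 (Oenergy sgnN1)).
have h1 : O 1 (fun p s l => (eps p ^+ 2)%:C%C * y' p s l) tau.
  by apply: Ov_ext (Ov_unit (m := fun _ _ _ => 2^-1) h _) _ => // p s k *; rewrite ydE.
have h2 : O 1 y' (fun p => eps p ^- 2 * tau p).
  have h' := Ov_small (m := fun p _ _ => (eps p ^- 2)%:C%C) (K := 1) (h := fun p => eps p ^- 2) h1.
  apply: Ov_ext (h' _ _ _) _ => // [p|p s l _|p s k kN _].
  - by rewrite invr_ge0 ltW.
  - by rewrite cnorm_real mul1r ger0_norm // invr_ge0 ltW.
  - by rewrite mulrA -rmorphM mulVf ?mul1r // gt_eqF.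
apply: Ov_ext (Ov_ge (Ov_mvt Dy h2 _) _) _ => [p|p|p s k kN _].
- by rewrite mulr_ge0 ?invr_ge0 // ltW.
- by rewrite /te expr2 -mulrA [_^-1 * _]mulrC.
- by rewrite y0 subr0.
Qed.

Let lm p l := om p l - eps p ^- 2.
Let lp p l := - (eps p ^- 2 + om p l).
(** Share of the fast exponential in the envelope, chosen to fit the slope:
    [(1 - bt) lm + bt lp = sincf / 2] is, up to the factor i, the multiplier by which the scheme
    obtains the slope from [Z0]. *)
Let bt p l := (lm p l - sincf a b (tau p) l / 2) / (2 * om p l).

Let lm_ge0 p l : 0 <= lm p l.
Proof. by rewrite subr_ge0 omk ler_peMl ?invr_ge0 // ltW. Qed.

(** [lm = (kap - 1) / eps^2] and [kap^2 - 1 = mu^2 eps^2], so the slow exponent is bounded by [mu^2]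
    uniformly in [eps]. *)
Let lm_le p l : lm p l <= bw l.
Proof.
apply: le_trans (_ : mu l ^+ 2 <= _); last exact: mu2_bw.
rewrite /lm omk -[X in _ - X]mul1r -mulrBl ler_pdivrMr //.
have := kap_sq a b (eps p) l; have := kp1 p l; move: (kp p l) => x.
by nra.
Qed.

Let lp_le p l : `|lp p l| <= 2 * kp p l / eps p ^+ 2.
Proof.
rewrite normrN ger0_norm; last by rewrite addr_ge0 ?invr_ge0 // ltW.
by rewrite omk -[X in X + _]mul1r -mulrDl ler_wpM2r ?invr_ge0 ?(ltW (e20 p)) //; have := kp1 p l; lra.
Qed.

(** The numerator of [bt] has size [mu^2], the denominator contains [omega = kap / eps^2]. The fast
    share is thus [O(eps^2)] and compensates one factor [lp = O(eps^-2)]: the envelope has a bounded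
    first derivative, and a second one of size [eps^-2]. *)
Let bt_le p l : `|bt p l| <= bw l * eps p ^+ 2 / kp p l.
Proof.
rewrite /bt normrM normfV [X in _ / X]gtr0_norm ?mulr_gt0 //.
rewrite omk invfM invf_div mulrA -[leRHS]mulrA ler_wpM2r ?divr_ge0 ?(ltW (e20 p)) ?(ltW (kp0 p l)) //.
rewrite ler_pdivrMr //.
- apply: le_trans (ler_normB _ _) _.
  rewrite (ger0_norm (lm_ge0 p l)) normrM [X in _ * X]ger0_norm ?invr_ge0 //.
have := lm_le p l; have := sincf_le a b (t0 p) l; have := mu2_bw a b l; have := normr_ge0 (sincf a b (tau p) l).
by move: `|_| => x; lra.
- by rewrite invr_gt0.
- exact: kp0.
Qed.

Let bt_bw p l : `|bt p l| <= bw l.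
Proof.
apply: le_trans (bt_le p l) _; rewrite ler_pdivrMr // ler_wpM2l ?(ltW (bw_gt0 a b l)) //.
exact: le_trans (e21 p) (kp1 p l).
Qed.

Let zm (p : P) (s : R) (l : int) : R[i] := (1 - bt p l)%:C%C * expi (lm p l * s) + (bt p l)%:C%C * expi (lp p l * s).
Let zm' (p : P) (s : R) (l : int) : R[i] := (1 - bt p l)%:C%C * ('i%C * (lm p l)%:C%C * expi (lm p l * s))
  + (bt p l)%:C%C * ('i%C * (lp p l)%:C%C * expi (lp p l * s)).
Let zm'' (p : P) (s : R) (l : int) : R[i] :=
  (1 - bt p l)%:C%C * ('i%C * (lm p l)%:C%C * ('i%C * (lm p l)%:C%C * expi (lm p l * s)))
  + (bt p l)%:C%C * ('i%C * (lp p l)%:C%C * ('i%C * (lp p l)%:C%C * expi (lp p l * s))).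

Let b1 l : 1 <= bw l. Proof. exact: bw_ge1. Qed.

Let cb_le p l : `|1 - bt p l| <= 2 * bw l.
Proof.
apply: le_trans (ler_normB _ _) _; rewrite normr1.
by have := bt_bw p l; have := b1 l; lra.
Qed.

Let zm_le p s l : cnorm (zm p s l) <= 3 * bw l.
Proof.
apply: le_trans (cnormD _ _) _; rewrite !cnormM !cnorm_expi !cnorm_real !mulr1.
by have := cb_le p l; have := bt_bw p l; lra.
Qed.

Let zm'_le p s l : cnorm (zm' p s l) <= 4 * bw l ^+ 2.
Proof.
apply: le_trans (cnormD _ _) _; rewrite !cnormM !cnorm_expi !cnorm_i !cnorm_real !mulr1 !mul1r.
rewrite (ger0_norm (lm_ge0 p l)).
have h1 : `|1 - bt p l| * lm p l <= 2 * bw l * bw l by rewrite ler_pM.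
have h2 : `|bt p l| * `|lp p l| <= 2 * bw l.
  apply: le_trans (ler_pM _ _ (bt_le p l) (lp_le p l)) _ => //.
  by rewrite le_eqVlt; apply/orP; left; apply/eqP; field; rewrite !gt_eqF.
have := b1 l; move: h1 h2; move: (_ * _) (_ * _) (bw l) => x1 x2 x; nra.
Qed.

Let zm''_le p s l : cnorm (zm'' p s l) <= 6 * eps p ^- 2 * bw l ^+ 3.
Proof.
apply: le_trans (cnormD _ _) _; rewrite !cnormM !cnorm_expi !cnorm_i !cnorm_real !mulr1 !mul1r.
rewrite (ger0_norm (lm_ge0 p l)).
have ie1 : 1 <= eps p ^- 2 by rewrite invf_ge1.
have bw3 : 0 <= bw l ^+ 3 by exact: bwX_ge0.
have h1 : `|1 - bt p l| * (lm p l * lm p l) <= 2 * bw l ^+ 3 * eps p ^- 2.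
  apply: le_trans (_ : 2 * bw l ^+ 3 <= _); last by rewrite ler_peMr // mulr_ge0.
  by rewrite !exprS mulr1 mulrA ler_pM ?mulr_ge0 // ?ler_pM.
have h2 : `|bt p l| * (`|lp p l| * `|lp p l|) <= 4 * bw l ^+ 3 * eps p ^- 2.
  apply: le_trans (_ : (bw l * eps p ^+ 2 / kp p l) * ((2 * kp p l / eps p ^+ 2) * (2 * kp p l / eps p ^+ 2)) <= _).
    by rewrite ler_pM ?mulr_ge0 // ?ler_pM ?bt_le ?lp_le.
  rewrite (_ : _ * _ = 4 * (bw l * kp p l) * eps p ^- 2); last by field; rewrite !gt_eqF.
  rewrite ler_wpM2r ?invr_ge0 ?(ltW (e20 p)) // ler_wpM2l //.
  have := kp_bw p l; have := b1 l; have := kp0 p l; rewrite exprS expr2; move: (kp p l) (bw l) => x z; nra.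
apply: le_trans (lerD h1 h2) _; rewrite -mulrDl -mulrA -mulrDl.
by rewrite mulrAC mulrA le_eqVlt; apply/orP; left; apply/eqP; ring.
Qed.

Let zs p s l : R[i] := zm p s l * z0 p l.
Let zs' p s l : R[i] := zm' p s l * z0 p l.
Let zs'' p s l : R[i] := zm'' p s l * z0 p l.

Let Dzs p l : C1on 0 (tau p) (fun s => zs p s l) (fun s => zs' p s l).
Proof.
apply: (C1on_ext (C1onM (C1onD (C1onZ (1 - bt p l)%:C%C (C1on_expi 0 (tau p) (lm p l)))
  (C1onZ (bt p l)%:C%C (C1on_expi 0 (tau p) (lp p l)))) (C1on_cst _ _ (z0 p l)))) => s // _.
by rewrite mulr0 addr0.
Qed.

Let Dzs' p l : C1on 0 (tau p) (fun s => zs' p s l) (fun s => zs'' p s l).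
Proof.
apply: (C1on_ext (C1onM (C1onD (C1onZ (1 - bt p l)%:C%C (C1onZ ('i%C * (lm p l)%:C%C) (C1on_expi 0 (tau p) (lm p l))))
  (C1onZ (bt p l)%:C%C (C1onZ ('i%C * (lp p l)%:C%C) (C1on_expi 0 (tau p) (lp p l))))) (C1on_cst _ _ (z0 p l)))) => s // _.
by rewrite mulr0 addr0.
Qed.

Let zs0 p l : zs p 0 l = z0 p l.
Proof. by rewrite /zs /zm !mulr0 expi0 !mulr1 -rmorphD subrK mul1r. Qed.

Let zs'0 p l : zs' p 0 l = zd p l.
Proof.
rewrite /zs' /zm' !mulr0 expi0 !mulr1 /zd /cZd -/(z0 p).
have -> : (sincf a b (tau p) l / 2)%:C%C = (1 - bt p l)%:C%C * (lm p l)%:C%C + (bt p l)%:C%C * (lp p l)%:C%C :> R[i].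
  rewrite -!rmorphM -rmorphD; apply: (congr1 (fun x : R => x%:C%C)).
  have -> : (1 - bt p l) * lm p l + bt p l * lp p l = lm p l - 2 * om p l * bt p l.
    by rewrite /lp /lm; ring.
  rewrite /bt; field; rewrite gt_eqF //.
by ring.
Qed.

Lemma Ozs : O 3 zs (fun=> 1).
Proof.
apply: Ov_ge (Ov_mul (j := 1) (k := 3) (h := fun=> 1) (K := 3) _ _ _ Oz0) _ => // p s l _.
by rewrite mulr1 expr1 zm_le.
Qed.

Lemma Ozs' : O 2 zs' (fun=> 1).
Proof.
apply: Ov_ge (Ov_mul (j := 2) (k := 2) (h := fun=> 1) (K := 4) _ _ _ Oz0) _ => // p s l _.
by rewrite mulr1 zm'_le.
Qed.

Lemma Ozs'' : O 1 zs'' (fun p => eps p ^- 2).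
Proof.
apply: Ov_ge (Ov_mul (j := 3) (k := 1) (h := fun p => eps p ^- 2) (K := 6) _ _ _ Oz0) _ => // p.
- by rewrite invr_ge0 ltW.
- by rewrite mulr1.
Qed.

(** Value and slope of the envelope at 0 are those of the scheme, so the remainder is two
    integrations of [zs'' = O(eps^-2)]. *)
Lemma Ozs_taylor : O 1 (fun p s l => zs p s l - z0 p l - s%:C%C * zd p l) te.
Proof.
have h1 := Ov_mvt (fun p k kN => Dzs' p (freq (N p) k)) Ozs'' (fun p => _ : 0 <= eps p ^- 2).
have {}h1 : O 1 (fun p s l => zs' p s l - zd p l) (fun p => tau p / eps p ^+ 2).
  by apply: Ov_ext (h1 _) _ => [p|p s k _ _]; rewrite ?invr_ge0 ?(ltW (e20 p)) // zs'0.
pose F p s l : R[i] := zs p s l - s%:C%C * zd p l.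
have DF p k : (k < N p)%N -> C1on 0 (tau p) (fun s => F p s (freq (N p) k)) (fun s => zs' p s (freq (N p) k) - zd p (freq (N p) k)).
  move=> kN; set l := freq _ _.
  apply: (C1on_ext (C1onB (Dzs p l) (C1onM (C1on_real (rC1_id 0 (tau p))) (C1on_cst _ _ (zd p l))))) => s // _.
  by rewrite mulr0 addr0 mul1r.
apply: Ov_ext (Ov_ge (Ov_mvt (c := F) DF h1 _) _) _ => [p|p|p s k _ _].
- by rewrite divr_ge0 // ltW.
- by rewrite mulrA -expr2.
- by rewrite /F mul0r subr0 zs0; ring.
Qed.

Let rr p s l : R[i] := y p s l + (sin (om p l * s) / om p l)%:C%C * rd p l.

Let cjz0 p k : (k < N p)%N -> let l := freq (N p) k in
  cj p (z0 p) l = 2^-1 * (v p 0 l + 'i%C * (eps p ^+ 2)%:C%C * w p 0 l).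
Proof.
move=> kN l; rewrite /l /z0 /cZ0 (cjM hab (m := fun=> 2^-1)) // cjB // (cjM hab (m := fun=> 'i%C * (eps p ^+ 2)%:C%C)) //.
rewrite v_real ?w_real // conjc_inv conjc_nat.
have -> : conjc ('i%C * (eps p ^+ 2)%:C%C) = - ('i%C * (eps p ^+ 2)%:C%C) :> R[i].
  by apply: complex_ext; rewrite /= ?ReM ?ImM /=; ring.
by rewrite mulNr opprK.
Qed.

Let rdE p k : (k < N p)%N -> let l := freq (N p) k in
  rd p l = - (sincf a b (tau p) l / 2 * eps p ^+ 2)%:C%C * w p 0 l.
Proof.
move=> kN l; rewrite /rd /cRd /cZd -/(z0 p) (cjM hab (m := fun l => 'i%C * (sincf a b (tau p) l / 2)%:C%C)) //; last first.
  by move=> l'; rewrite sincfN.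
rewrite -/l cjz0 // -/l /z0 /cZ0 (rM (_ / 2) (_ ^+ 2)).
have -> : conjc ('i%C * (sincf a b (tau p) l / 2)%:C%C) = - ('i%C * (sincf a b (tau p) l / 2)%:C%C) :> R[i].
  by apply: complex_ext; rewrite /= ?ReM ?ImM /=; ring.
move: (sincf a b (tau p) l / 2)%:C%C => x; by field: (@mul_ii R).
Qed.

Let ep (p : P) (s : R) : R[i] := expi (1 * eps p ^- 2 * s).
Let em (p : P) (s : R) : R[i] := expi (-1 * eps p ^- 2 * s).

(** Because of the filtered slope, the two envelopes exceed the free flow by
    [(sincf / 2) eps^2 sin(omega s) / omega] times the initial velocity. The term of [rr] containing
    [rd] is the exact negative of this excess. *)
Lemma v_decomp p s k : (k < N p)%N -> let l := freq (N p) k in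
  v p s l = ep p s * zs p s l + em p s * cj p (zs p s) l + rr p s l.
Proof.
move=> kN l.
rewrite /zs (cjM hab (m := zm p s)) //; last first.
  by move=> l'; rewrite /zm /bt /lm /lp omegaN sincfN.
rewrite -/l cjz0 // -/l /rr rdE // -/l /y /z0 /cZ0.
have h1 : ep p s * zm p s l = (cos (om p l * s))%:C%C + (1 - 2 * bt p l)%:C%C * ('i%C * (sin (om p l * s))%:C%C).
  rewrite /zm mulrDr ![ep p s * (_ * _)]mulrCA -!expiD.
  have -> : 1 * eps p ^- 2 * s + lm p l * s = om p l * s by rewrite /lm; ring.
  have -> : 1 * eps p ^- 2 * s + lp p l * s = - (om p l * s) by rewrite /lp; ring.
  rewrite !expiE cosN sinN.
  by apply: complex_ext; rewrite !(ReM, ImM, ReD, ImD, ReN, ImN) /=; ring.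
have h2 : em p s * conjc (zm p s l) = (cos (om p l * s))%:C%C - (1 - 2 * bt p l)%:C%C * ('i%C * (sin (om p l * s))%:C%C).
  have -> : em p s = conjc (ep p s) by rewrite -expiN; congr expi; ring.
  rewrite -conjcM h1 conjcD conjcM !conjc_real conjcM conjc_real.
  have -> : conjc 'i%C = - 'i%C :> R[i] by apply: complex_ext => /=; ring.
  ring.
have h3 : (1 - 2 * bt p l)%:C%C * (eps p ^+ 2)%:C%C * (sin (om p l * s))%:C%C =
   (sin (om p l * s) / om p l)%:C%C * (1 + (sincf a b (tau p) l / 2 * eps p ^+ 2)%:C%C) :> R[i].
  rewrite -[1 in RHS](rmorph1 (real_complex R)) -rmorphD -!rmorphM; apply: (congr1 (fun x : R => x%:C%C)).
  by rewrite /bt /lm; field; rewrite !gt_eqF.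
move: h1 h2 h3; move: (zm p s l) (conjc _) => x x'.
move: (1 - 2 * bt p l)%:C%C (eps p ^+ 2)%:C%C (sin (om p l * s))%:C%C (cos (om p l * s))%:C%C
  (sin (om p l * s) / om p l)%:C%C (sincf a b (tau p) l / 2 * eps p ^+ 2)%:C%C => B e2 sn c S t h1 h2 h3.
rewrite (mulrA (ep p s)) (mulrA (em p s)) h1 h2.
have h4 : S * t = B * e2 * sn - S by rewrite h3; ring.
by field: (@mul_ii R) h4.
Qed.

Lemma Orr_taylor : O 1 (fun p s l => rr p s l - s%:C%C * rd p l) te.
Proof.
have h : O 1 (fun p s l => (sin (om p l * s) / om p l - s)%:C%C * rd p l) te.
  apply: Ov_ge (Ov_mul (j := 1) (k := 1) (h := te) (K := 1) _ _ _ (Ov_mono _ Ord)) _ => // [p s l /andP[s0 st]|p].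
    rewrite mul1r cnorm_real expr1 distrC.
    have -> : s - sin (om p l * s) / om p l = (om p l * s - sin (om p l * s)) / om p l by field; rewrite gt_eqF.
    rewrite normrM normfV (gtr0_norm (om0 p l)) ler_pdivrMr //.
    apply: le_trans (sub_sin_le (mulr_ge0 (ltW (om0 p l)) s0)) _.
    rewrite (_ : _ ^+ 2 = s ^+ 2 * om p l * om p l); last by ring.
    rewrite ler_wpM2r ?(ltW (om0 p l)) // omk /te mulrA [leRHS]mulrAC ler_wpM2r ?invr_ge0 ?(ltW (e20 p)) //.
    by apply: ler_pM => //; rewrite ?ler_sqr ?nnegrE ?mulr_ge0 ?sqr_ge0 ?(ltW (kp0 p l)) // (le_trans s0).
  by rewrite mulr1.
apply: Ov_ext (OvD Oy1 h) _ => p s k _ _.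
by rewrite /rr rmorphB; ring.
Qed.

Let sino_le p s l : `|sin (om p l * s) / om p l| <= eps p ^+ 2.
Proof.
rewrite normrM normfV (gtr0_norm (om0 p l)); apply: le_trans (iom_le p l).
by rewrite ler_piMl ?sin_max // invr_ge0 ltW.
Qed.

Lemma Orr : O 1 rr (fun p => tau p * dl p + eps p ^+ 2).
Proof.
apply: OvD Oy2 _.
apply: Ov_ge (Ov_small (h := fun p => eps p ^+ 2) (K := 1) (Ov_mono _ Ord) _ _ _) _ => // [p|p s l _|p].
- exact: ltW.
- by rewrite cnorm_real mul1r sino_le.
- by rewrite mulr1 lerDr mulr_ge0 // ltW.
Qed.

Let R1 p := cR1 a b (eps p) (tau p) (N p) (v p 0) (w p 0) (u p 0).

Let Ocs : O 1 (fun p _ => cs p) (fun=> 1). Proof. exact: (Ov_at0 tau_bd Osq). Qed.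

Let Ord1 : O 1 (fun p _ => rd p) (fun=> 1). Proof. exact: Ov_mono Ord. Qed.

Lemma OR1_eps : O 1 (fun p _ => R1 p) (fun p => eps p ^+ 2).
Proof.
have e2 p : 0 <= eps p ^+ 2 by exact: ltW.
apply: OvD; first apply: OvD.
- apply: Ov_ge (Ov_small (h := fun p => eps p ^+ 2) (K := 1) Ord1 _ _ _) _ => // [p s l _|p]; last by rewrite mulr1.
  by rewrite mul1r cnorm_real sino_le.
- apply: Ov_ge (Ov_small (h := fun p => eps p ^+ 2) (K := 2) Ocs _ _ _) _ => // [p s l _|p]; last by rewrite mulr1.
  by rewrite cnorm_real; case: (pcoef_bounds (e0 p) (erefl (om p l)) (ltW (t0 p))).
- apply: Ov_ge (Ov_small (h := fun p => eps p ^+ 2) (K := 2) Ocr _ _ _) _ => // [p s l _|p]; last by rewrite mulr1.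
  rewrite cnorm_real; apply: le_trans (qcoef_bounds (e0 p) (erefl (om p l)) (ltW (t0 p))).1 _.
  by rewrite ler_wpM2r // ler_piMr.
Qed.

Let sint_le p l : `|sin (om p l * tau p) / om p l| <= tau p.
Proof.
rewrite normrM normfV (gtr0_norm (om0 p l)) ler_pdivrMr // [tau p * _]mulrC.
by apply: normr_sin_le; rewrite mulr_ge0 // ltW.
Qed.

(** Geometric mean of the two bounds of [pcoef_bounds]: their product is [2 tau^2], free of
    [eps]. *)
Let p_le p l : `|pcoef a b (eps p) l (tau p)| <= 2 * tau p.
Proof.
have [h1 h2] := pcoef_bounds (e0 p) (erefl (om p l)) (ltW (t0 p)).
rewrite -ler_sqr ?nnegrE ?mulr_ge0 ?(ltW (t0 p)) // expr2.
apply: le_trans (ler_pM _ _ h1 h2) _ => //.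
rewrite mulrCA divfK ?gt_eqF // exprMn ler_wpM2r ?sqr_ge0 //; lra.
Qed.

Lemma OR1_tau : O 1 (fun p _ => R1 p) tau.
Proof.
have t0' p : 0 <= tau p by exact: ltW.
apply: OvD; first apply: OvD.
- apply: Ov_ge (Ov_small (h := tau) (K := 1) Ord1 _ _ _) _ => // [p s l _|p]; last by rewrite mulr1.
  by rewrite mul1r cnorm_real sint_le.
- apply: Ov_ge (Ov_small (h := tau) (K := 2) Ocs _ _ _) _ => // [p s l _|p]; last by rewrite mulr1.
  by rewrite cnorm_real p_le.
- apply: Ov_ge (Ov_small (h := tau) (K := 1) Ocr _ _ _) _ => // [p s l _|p]; last by rewrite mulr1.
  rewrite cnorm_real; apply: le_trans (qcoef_bounds (e0 p) (erefl (om p l)) (ltW (t0 p))).2 _.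
  by rewrite mul1r expr2 ler_piMr.
Qed.

(** Serves to match the trapezoidal term [(tau / 2) R u] of the scheme with the integral of [s rd u]
    over the step. *)
Lemma OR1_taylor : O 1 (fun p _ l => R1 p l - (tau p)%:C%C * rd p l) te.
Proof.
have h : O 1 (fun p _ l => (sin (om p l * tau p) / om p l - tau p)%:C%C * rd p l) te.
  have h1 := Ov_attau tau_bd Orr_taylor; have h2 := Ov_attau tau_bd Oy1.
  by apply: Ov_ext (OvB h1 h2) _ => p s k _ _; rewrite /rr rmorphB; ring.
have h2 : O 1 (fun p _ l => (pcoef a b (eps p) l (tau p))%:C%C * cs p l
    + (qcoef a b (eps p) l (tau p))%:C%C * cr p l) te.
  apply: OvD.
  - apply: Ov_ge (Ov_small (h := te) (K := 1) Ocs _ _ _) _ => // [p s l _|p]; last by rewrite mulr1.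
    by rewrite mul1r cnorm_real; case: (pcoef_bounds (e0 p) (erefl (om p l)) (ltW (t0 p))).
  - apply: Ov_ge (Ov_small (h := te) (K := 1) Ocr _ _ _) _ => // [p s l _|p]; last by rewrite mulr1.
    rewrite mul1r cnorm_real; apply: le_trans (qcoef_bounds (e0 p) (erefl (om p l)) (ltW (t0 p))).2 _.
    exact: tte.
apply: Ov_ext (OvD h h2) _ => p s k _ _.
by rewrite /R1 /cR1 -/(rd p) -/(cs p) -/(cr p) rmorphB; ring.
Qed.


(** * Products of the envelope with psi *)

Let c1 p : int -> R[i] := cconv p (z0 p) (u p 0).
Let d1 p l : R[i] := cconv p (zd p) (u p 0) l + cconv p (z0 p) (ud p) l.
Let c2 p : int -> R[i] := cconv p (cj p (z0 p)) (u p 0).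
Let d2 p l : R[i] := cconv p (cj p (zd p)) (u p 0) l + cconv p (cj p (z0 p)) (ud p) l.

Section product.
Variables (x x' : P -> R -> int -> R[i]) (x0 x1 : P -> int -> R[i]).
Hypothesis Dx : forall p k, (k < N p)%N ->
  C1on 0 (tau p) (fun s => x p s (freq (N p) k)) (fun s => x' p s (freq (N p) k)).
Hypothesis x00 : forall p k, (k < N p)%N -> x p 0 (freq (N p) k) = x0 p (freq (N p) k).
Hypothesis Ox : O 2 x (fun=> 1).
Hypothesis Ox' : O 2 x' (fun=> 1).
Hypothesis Ox0 : O 2 (fun p _ => x0 p) (fun=> 1).
Hypothesis Ox1 : O 2 (fun p _ => x1 p) (fun=> 1).
Hypothesis Ox_taylor : O 1 (fun p s l => x p s l - x0 p l - s%:C%C * x1 p l) te.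

Let G p s l : R[i] := cconv p (x p s) (u p s) l - cconv p (x0 p) (u p 0) l
  - s%:C%C * (cconv p (x1 p) (u p 0) l + cconv p (x0 p) (ud p) l).
Let G' p s l : R[i] := cconv p (x' p s) (u p s) l + cconv p (x p s) (u' p s) l
  - (cconv p (x1 p) (u p 0) l + cconv p (x0 p) (ud p) l).

(** The same telescoping of a product as for the force. [x] will be the envelope and its
    conjugate. *)
Lemma prod_taylor : O 1 G (fun p => tau p * g1 p).
Proof.
have teg p : te p <= tau p * g1 p by rewrite /g1 mulrDr mulrA -expr2 lerDl mulr_ge0 // ltW.
pose emode p s l : R[i] := x p s l - x0 p l - s%:C%C * x1 p l.
pose eu p s l : R[i] := u p s l - u p 0 l - s%:C%C * ud p l.
have h : O 1 (fun p s l => cconv p (emode p s) (u p s) l + cconv p (x0 p) (eu p s) l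
    + s%:C%C * cconv p (x1 p) (fun l => u p s l - u p 0 l) l) (fun p => tau p * g1 p).
  apply: OvD; first apply: OvD.
  - exact: Ov_ge (Ocr' Ox_taylor Ou_1 isT) teg.
  - exact: (Ocl (Ov_mono (leqnSn 1) Ox0) Ou_taylor isT).
  - apply: Os; exact: (Ov_ge (Ocl (Ov_mono (leqnSn 1) Ox1) Ou_inc1 isT) tg1).
apply: Ov_ext h _ => p s k kN _; set l := freq _ _.
rewrite /emode /eu !(cconvBl, cconvBr, cconvZl hab s%:C%C, cconvZr hab s%:C%C) //.
rewrite /G; ring.
Qed.

Lemma Oprod : O 2 G (fun=> 1).
Proof.
have Ou2 : O 2 (fun p _ => u p 0) (fun=> 1) by exact: Ov_mono Ou0.
apply: OvB; first apply: OvB.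
- exact: (Ocl Ox (Ov_mono (leqnSn 2) Ou3) isT).
- exact: (Ocl Ox0 Ou2 isT).
- apply: Ov_ge (Os (OvD (Ocl Ox1 Ou2 isT) (Ocl Ox0 Oud isT))) _ => p.
  by rewrite mulr1.
Qed.

Lemma Oprod' : O 1 G' (fun=> 1).
Proof.
apply: (@Ov_mono _ _ _ _ _ _ 1 2) => //; apply: OvB; apply: OvD.
- exact: (Ocl Ox' (Ov_mono (leqnSn 2) Ou3) isT).
- exact: (Ocl Ox Ou2' isT).
- exact: (Ocl Ox1 (Ov_mono (leqnSn 2) Ou0) isT).
- exact: (Ocl Ox0 Oud isT).
Qed.

Lemma Dprod p k : (k < N p)%N -> C1on 0 (tau p) (fun s => G p s (freq (N p) k)) (fun s => G' p s (freq (N p) k)).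
Proof.
move=> kN; set l := freq _ _.
apply: (C1on_ext (C1onB (C1onB (C1on_cconv hab l (N_gt0 p) (fun k' k'N => Dx k'N) (fun k' k'N => Du k'N)) (C1on_cst _ _ (cconv p (x0 p) (u p 0) l)))
  (C1onM (C1on_real (rC1_id 0 (tau p))) (C1on_cst _ _ (cconv p (x1 p) (u p 0) l + cconv p (x0 p) (ud p) l))))) => s // _.
by rewrite mulr0 addr0 mul1r subr0.
Qed.

Lemma prod0 p k : (k < N p)%N -> G p 0 (freq (N p) k) = 0.
Proof.
move=> kN; rewrite /G mul0r subr0 (cconv_ext hab (c' := x0 p) (d' := u p 0)) ?subrr // => k' k'N.
by rewrite x00.
Qed.

Lemma Oprod_tau : O 1 G tau.
Proof.
apply: Ov_ext (Ov_ge (Ov_mvt Dprod Oprod' _) _) _ => // [p|p s k kN _].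
  by rewrite mulr1.
by rewrite prod0 // subr0.
Qed.

End product.

Let gp p s l : R[i] := cconv p (zs p s) (u p s) l - c1 p l - s%:C%C * d1 p l.
Let gm p s l : R[i] := cconv p (cj p (zs p s)) (u p s) l - c2 p l - s%:C%C * d2 p l.
Let gp' p s l : R[i] := cconv p (zs' p s) (u p s) l + cconv p (zs p s) (u' p s) l - d1 p l.
Let gm' p s l : R[i] := cconv p (cj p (zs' p s)) (u p s) l + cconv p (cj p (zs p s)) (u' p s) l - d2 p l.

Let Dzk p k (_ : (k < N p)%N) : C1on 0 (tau p) (fun s => zs p s (freq (N p) k)) (fun s => zs' p s (freq (N p) k)).
Proof. exact: Dzs. Qed.
Let Dcz p k : (k < N p)%N -> C1on 0 (tau p) (fun s => cj p (zs p s) (freq (N p) k)) (fun s => cj p (zs' p s) (freq (N p) k)).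
Proof. by move=> kN; apply: C1on_cj => // k' k'N; exact: Dzs. Qed.

Let Ozs2 : O 2 zs (fun=> 1). Proof. exact: Ov_mono Ozs. Qed.
Let Oz02 : O 2 (fun p _ => z0 p) (fun=> 1). Proof. exact: Ov_mono Oz0. Qed.
Let Ozd2 : O 2 (fun p _ => zd p) (fun=> 1). Proof. exact: Ov_mono Ozd. Qed.

Let zsk p k (_ : (k < N p)%N) : zs p 0 (freq (N p) k) = z0 p (freq (N p) k).
Proof. exact: zs0. Qed.
Let czsk p k (kN : (k < N p)%N) : cj p (zs p 0) (freq (N p) k) = cj p (z0 p) (freq (N p) k).
Proof. by apply: cj_ext => // k' k'N; rewrite zs0. Qed.

Let Ocz_taylor : O 1 (fun p s l => cj p (zs p s) l - cj p (z0 p) l - s%:C%C * cj p (zd p) l) te.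
Proof.
apply: Ov_ext (Ocj Ozs_taylor) _ => p s k kN _.
by rewrite cjB // cjB // (cjM hab (m := fun=> s%:C%C)) // conjc_real.
Qed.

Let gp0 p k : (k < N p)%N -> gp p 0 (freq (N p) k) = 0.
Proof. exact (@prod0 zs z0 zd zsk p k). Qed.
Let gm0 p k : (k < N p)%N -> gm p 0 (freq (N p) k) = 0.
Proof. exact (@prod0 (fun p s => cj p (zs p s)) (fun p => cj p (z0 p)) (fun p => cj p (zd p)) czsk p k). Qed.

Let ogp : [/\ O 1 gp (fun p => tau p * g1 p), O 2 gp (fun=> 1), O 1 gp' (fun=> 1) & O 1 gp tau].
Proof.
split; [exact (@prod_taylor zs z0 zd Oz02 Ozd2 Ozs_taylor)|exact (@Oprod zs z0 zd Ozs2 Oz02 Ozd2)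
  |exact (@Oprod' zs zs' z0 zd Ozs2 Ozs' Oz02 Ozd2)
  |exact (@Oprod_tau zs zs' z0 zd Dzk zsk Ozs2 Ozs' Oz02 Ozd2)].
Qed.

Let ogm : [/\ O 1 gm (fun p => tau p * g1 p), O 2 gm (fun=> 1), O 1 gm' (fun=> 1) & O 1 gm tau].
Proof.
pose x p s := cj p (zs p s); pose x' p s := cj p (zs' p s).
pose x0 p := cj p (z0 p); pose x1 p := cj p (zd p).
have h := Ocj Ozs'; have h1 := Ocj Ozs2; have h2 := Ocj Oz02; have h3 := Ocj Ozd2.
split; [exact (@prod_taylor x x0 x1 h2 h3 Ocz_taylor)|exact (@Oprod x x0 x1 h1 h2 h3)
  |exact (@Oprod' x x' x0 x1 h1 h h2 h3)|exact (@Oprod_tau x x' x0 x1 Dcz czsk h1 h h2 h3)].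
Qed.

(** * Local error of psi *)

Let L (p : P) (s : R) (l : int) : R[i] := expi (mu l ^+ 2 * s).

Let L1 p s l : 0 <= s <= tau p -> cnorm (L p s l) <= 1.
Proof. by rewrite cnorm_expi. Qed.
Let ep1 p s (l : int) : 0 <= s <= tau p -> cnorm (ep p s) <= 1.
Proof. by rewrite cnorm_expi. Qed.
Let em1 p s (l : int) : 0 <= s <= tau p -> cnorm (em p s) <= 1.
Proof. by rewrite cnorm_expi. Qed.

(** Interaction picture: [u] rotated by [exp(i mu^2 s)], minus the four quadratures that the scheme
    evaluates in closed form. Its derivative contains only Taylor remainders, the contribution of
    [rr] and the spatial error. *)
Let E p s l : R[i] := L p s l * u p s l
  - L p s l * CC a b (eps p) l 1 s * c1 p l - L p s l * DD a b (eps p) l 1 s * d1 p l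
  - L p s l * CC a b (eps p) l (-1) s * c2 p l - L p s l * DD a b (eps p) l (-1) s * d2 p l.
Let E' p s l : R[i] := 'i%C * (L p s l * (ep p s * gp p s l + em p s * gm p s l
  + cconv p (rr p s) (u p s) l + al p s l)).

Let DL p l : C1on 0 (tau p) (fun s => L p s l) (fun s => 'i%C * (mu l ^+ 2)%:C%C * L p s l).
Proof. exact: C1on_expi. Qed.

Let DE p k : (k < N p)%N -> C1on 0 (tau p) (fun s => E p s (freq (N p) k)) (fun s => E' p s (freq (N p) k)).
Proof.
move=> kN; set l := freq _ _.
have h1 := C1onM (DL p l) (Du kN).
have h2 := C1onM (C1on_CC a b (eps p) l 1 0 (tau p)) (C1on_cst _ _ (c1 p l)).
have h3 := C1onM (C1on_DD a b (eps p) l 1 0 (tau p)) (C1on_cst _ _ (d1 p l)).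
have h4 := C1onM (C1on_CC a b (eps p) l (-1) 0 (tau p)) (C1on_cst _ _ (c2 p l)).
have h5 := C1onM (C1on_DD a b (eps p) l (-1) 0 (tau p)) (C1on_cst _ _ (d2 p l)).
apply: (C1on_ext (C1onB (C1onB (C1onB (C1onB h1 h2) h3) h4) h5)) => s // sp.
rewrite ODEu // -/l.
have -> : cconv p (v p s) (u p s) l = ep p s * cconv p (zs p s) (u p s) l
   + em p s * cconv p (cj p (zs p s)) (u p s) l + cconv p (rr p s) (u p s) l.
  rewrite -!cconvZl // -!cconvDl //; apply: cconv_ext => // k' k'N.
  exact: v_decomp.
rewrite -/(L p s l) -/(ep p s) -/(em p s) /E' /gp /gm; ring.
Qed.

Let U1 p := cU1 a b (eps p) (tau p) (N p) (v p 0) (w p 0) (u p 0).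
Let ru p := cconv p (rd p) (u p 0).

Let LN p l : R[i] := expi (- (mu l ^+ 2 * tau p)).
Let LNM p l : LN p l * L p (tau p) l = 1. Proof. exact: expiNM. Qed.

Let E0 p l : E p 0 l = u p 0 l.
Proof. by rewrite /E !CC0 !DD0 /L !mulr0 expi0 mul1r !mul0r !subr0. Qed.

Let errE p l : u p (tau p) l - U1 p l = LN p l * (E p (tau p) l - u p 0 l)
  - 'i%C * ((tau p / 2)%:C%C * cconv p (R1 p) (u p 0) l
            + (tau p ^+ 2 / 2)%:C%C * cconv p (R1 p) (ud p) l).
Proof.
rewrite /U1 /cU1 -!/(z0 p) -!/(zd p) -!/(ud p) -!/(R1 p) -!/(c1 p) -!/(c2 p).
rewrite !ccoefE ?(ltW (t0 p)) // !dcoefE ?(ltW (t0 p)) //.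
rewrite /E -/(d1 p l) -/(d2 p l) -/(LN p l); move: (LNM p l).
move: (LN p l) (L p (tau p) l) (u p (tau p) l) (CC _ _ _ _ _ _) (CC _ _ _ _ _ _) (DD _ _ _ _ _ _) (DD _ _ _ _ _ _) => x1 x2 x3 x4 x5 x6 x7 h.
ring: h.
Qed.

Let Oru : O 2 (fun p _ => ru p) (fun=> 1).
Proof. exact: (Ocl (Ov_mono (leqnSn 2) Ord) (Ov_mono (leqnSn 2) Ou0) isT). Qed.

Let Orru : O 1 (fun p s l => cconv p (rr p s) (u p s) l - s%:C%C * ru p l) te.
Proof.
have h : O 1 (fun p s l => cconv p (fun l => rr p s l - s%:C%C * rd p l) (u p s) l
    + s%:C%C * cconv p (rd p) (fun l => u p s l - u p 0 l) l) te.
  apply: OvD; first exact: (Ocr' Orr_taylor Ou_1 isT).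
  by apply: Ov_ge (Os (Ocl Ord1 Ou_inc1 isT)) _ => p; rewrite -expr2.
apply: Ov_ext h _ => p s k kN _; set l := freq _ _.
rewrite /ru; move: (rd p) => x.
rewrite cconvBl // (cconvZl hab s%:C%C) // cconvBr //; ring.
Qed.

Let tdl_le p : tau p * g1 p <= te p + dl p.
Proof. by rewrite /g1 mulrDr mulrA -expr2 lerD2l ler_piMl. Qed.

Let tC (p : P) (s : R) (l : int) : 0 <= s <= tau p -> cnorm ((tau p / 2)%:C%C : R[i]) <= 1 * tau p.
Proof.
by move=> _; rewrite mul1r cnorm_real ger0_norm ?divr_ge0 ?(ltW (t0 p)) //; have := t0 p; lra.
Qed.
Let ttC (p : P) (s : R) (l : int) : 0 <= s <= tau p -> cnorm ((tau p ^+ 2 / 2)%:C%C : R[i]) <= 1 * tau p ^+ 2.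
Proof.
move=> _; rewrite mul1r cnorm_real ger0_norm ?divr_ge0 ?sqr_ge0 //.
by have := sqr_ge0 (tau p); lra.
Qed.

(** The contribution of [rr] is [s rd u0] up to [tau^2 / eps^2]. Subtracting its primitive
    [(s^2 / 2) rd u0] leaves a small derivative, and the same quantity at [s = tau] is the leading
    part of the trapezoidal term by [OR1_taylor]. *)
Lemma err_U1 : O 1 (fun p _ l => u p (tau p) l - U1 p l) (fun p => tau p * (te p + dl p)).
Proof.
have [gp1 _ _ _] := ogp; have [gm1 _ _ _] := ogm.
pose F p s l : R[i] := E p s l - 'i%C * ((s ^+ 2 / 2)%:C%C * ru p l).
pose F' p s l : R[i] := 'i%C * (L p s l * (ep p s * gp p s l + em p s * gm p s l
  + (cconv p (rr p s) (u p s) l - s%:C%C * ru p l) + al p s l)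
  + (L p s l - 1) * (s%:C%C * ru p l)).
have hF : O 1 F' (fun p => te p + dl p).
  apply: Ov_unit i1; apply: OvD; last first.
    have h := Os Oru.
    have h2 := Ov_mul (j := 1) (k := 1) (h := tau) (K := 1) (m := fun p s l => L p s l - 1) _ _ _ h.
    apply: Ov_ge (h2 _ _ _) _ => // [p|p s l /andP[s0 st]|p].
    - exact: ltW.
    - rewrite mul1r expr1; have := cmvt (M := mu l ^+ 2) s0 (C1on_expi 0 s (mu l ^+ 2)).
      rewrite mulr0 expi0 subr0 => h'; apply: le_trans (h' _) _ => [t _|].
        by rewrite !cnormM cnorm_i cnorm_expi cnorm_real mul1r mulr1 ger0_norm ?sqr_ge0.
      by rewrite mulrC ler_pM ?sqr_ge0 ?mu2_bw.
    - by rewrite mulr1 -expr2 (le_trans (tte p)) // lerDl.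
  apply: Ov_unit L1; apply: OvD; last by apply: Ov_ge Oal _ => p; rewrite lerDr.
  apply: OvD; last by apply: Ov_ge Orru _ => p; rewrite lerDl.
  by apply: Ov_ge (OvD (Ov_unit gp1 ep1) (Ov_unit gm1 em1)) _.
have DF p k : (k < N p)%N -> C1on 0 (tau p) (fun s => F p s (freq (N p) k)) (fun s => F' p s (freq (N p) k)).
  move=> kN; set l := freq _ _.
  apply: (C1on_ext (C1onB (DE kN) (C1onZ 'i%C (C1onM (C1on_real (rC1M (rC1M (rC1_id 0 (tau p)) (rC1_id 0 (tau p))) (rC1_cst 0 (tau p) 2^-1))) (C1on_cst _ _ (ru p l)))))) => s // _.
  rewrite (_ : _ + _ = s) ?mulr0 ?addr0; last by field.
  by rewrite /E' /F' -/l; ring.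
have hF1 := Ov_attau tau_bd (Ov_mvt DF hF (fun p => addr_ge0 (te0 p) (dl_ge0 p))).
(* The trapezoidal term of the scheme is not rotated by the free propagator. The discrepancy
   [LN - 1] is [O(tau mu^2)] and spends one power of the weight. *)
have hL : O 1 (fun p _ l => (LN p l - 1) * ru p l) tau.
  apply: Ov_ge (Ov_mul (j := 1) (k := 1) (h := tau) (K := 1) _ _ _ Oru) _ => // [p|p s l _|p].
  - exact: ltW.
  - have -> : LN p l - 1 = - (LN p l * (L p (tau p) l - 1)) by have := LNM p l => h; ring: h.
    rewrite cnormN cnormM cnorm_expi !mul1r expr1.
    have := cmvt (M := mu l ^+ 2) (ltW (t0 p)) (C1on_expi 0 (tau p) (mu l ^+ 2)).
    rewrite mulr0 expi0 subr0 => h'; apply: le_trans (h' _) _ => [t _|].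
      by rewrite !cnormM cnorm_i cnorm_expi cnorm_real mul1r mulr1 ger0_norm ?sqr_ge0.
    by rewrite mulrC ler_pM ?sqr_ge0 ?mu2_bw // ltW.
  - by rewrite mulr1.
have tt p : 0 <= tau p ^+ 2 by exact: sqr_ge0.
have tt3 p : tau p ^+ 2 * tau p <= tau p * (te p + dl p).
  by rewrite mulrC ler_wpM2l ?(ltW (t0 p)) // (le_trans (tte p)) // lerDl.
have h1 := Ov_ge (Ov_small hL ler01 tt ttC) tt3.
have h2 := Ov_ge (Ov_small (Ocr' OR1_tau Oud_1 isT) ler01 tt ttC) tt3.
have h3 := Ov_small (Ocr' OR1_taylor Ou0_1 isT) ler01 (fun p => ltW (t0 p)) tC.
have {}h3 := Ov_ge h3 (fun p => _ : _ <= tau p * (te p + dl p)).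
have h4 := Ov_unit hF1 (m := fun p _ l => LN p l) (fun p s l _ => _).
apply: Ov_ext (OvD (h4 _) (Ov_unit (OvB (OvB h1 (h3 _)) h2) i1)) _ => [p s l|p|p s k kN _].
- by rewrite cnorm_expi.
- by rewrite ler_wpM2l ?lerDl // ltW.
rewrite errE // /F E0.
have -> : (0 ^+ 2 / 2 : R) = 0 by rewrite expr0n mul0r.
rewrite mul0r mulr0 subr0 cconvBl // (cconvZl hab (tau p)%:C%C) //.
set l := freq _ _.
have -> : (tau p ^+ 2 / 2)%:C%C = (tau p / 2)%:C%C * (tau p)%:C%C :> R[i].
  by rewrite -rM; apply: (congr1 (fun x : R => x%:C%C)); field.
by rewrite /ru; ring.
Qed.

(** [eps^2 (ep gp - em gm)] differentiates to [i (ep gp + em gm)] plus [O(eps^2)], so subtracting it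
    as a corrector removes the oscillating forcing. The corrector vanishes at 0 and is
    [O(eps^2 tau)] at the end of the step; [rr] and [R1] are estimated by their size alone. *)
Lemma err_U2 : O 1 (fun p _ l => u p (tau p) l - U1 p l) (fun p => tau p * (eps p ^+ 2 + dl p)).
Proof.
have [_ gp2 gp3 gp4] := ogp; have [_ gm2 gm3 gm4] := ogm.
have e2 p : 0 <= eps p ^+ 2 by exact: ltW.
have ed p : 0 <= eps p ^+ 2 + dl p by exact: addr_ge0.
have eC (p : P) (s : R) (l : int) : 0 <= s <= tau p -> cnorm ((eps p ^+ 2)%:C%C : R[i]) <= 1 * eps p ^+ 2.
  by move=> _; rewrite mul1r cnorm_real ger0_norm.
pose B p s l : R[i] := ep p s * gp p s l - em p s * gm p s l.
pose F p s l : R[i] := E p s l - (eps p ^+ 2)%:C%C * (L p s l * B p s l).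
pose F' p s l : R[i] := 'i%C * (L p s l * (cconv p (rr p s) (u p s) l + al p s l))
  - (eps p ^+ 2)%:C%C * (L p s l * ('i%C * ((mu l ^+ 2)%:C%C * B p s l)
      + (ep p s * gp' p s l - em p s * gm' p s l))).
have hF : O 1 F' (fun p => eps p ^+ 2 + dl p).
  apply: OvB.
    apply: Ov_unit i1; apply: Ov_unit L1; apply: OvD; last by apply: Ov_ge Oal _ => p; rewrite lerDr.
    apply: Ov_ge (Ocr' Orr Ou_1 isT) _ => p.
    by rewrite addrC lerD2l ler_piMl.
  suff h : O 1 (fun p s l => L p s l * ('i%C * ((mu l ^+ 2)%:C%C * B p s l)
      + (ep p s * gp' p s l - em p s * gm' p s l))) (fun=> 1).
    by apply: Ov_ge (Ov_small h ler01 e2 eC) _ => p; rewrite mulr1 lerDl.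
  apply: Ov_unit L1; apply: OvD; last exact: (OvB (Ov_unit gp3 ep1) (Ov_unit gm3 em1)).
  apply: Ov_unit i1; apply: (Ov_loss (j := 1) (k := 1) (OvB (Ov_unit gp2 ep1) (Ov_unit gm2 em1))) => p s l _.
  by rewrite expr1 cnorm_real ger0_norm ?sqr_ge0 // mu2_bw.
have DF p k : (k < N p)%N -> C1on 0 (tau p) (fun s => F p s (freq (N p) k)) (fun s => F' p s (freq (N p) k)).
  move=> kN; set l := freq _ _.
  have dp := @Dprod zs zs' z0 zd Dzk p k kN.
  have dm := @Dprod (fun p s => cj p (zs p s)) (fun p s => cj p (zs' p s)) (fun p => cj p (z0 p)) (fun p => cj p (zd p)) Dcz p k kN.
  have dep := C1on_expi 0 (tau p) (1 * eps p ^- 2); have dem := C1on_expi 0 (tau p) (-1 * eps p ^- 2).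
  apply: (C1on_ext (C1onB (DE kN) (C1onZ (eps p ^+ 2)%:C%C (C1onM (DL p l) (C1onB (C1onM dep dp) (C1onM dem dm)))))) => s // _.
  have h : (eps p ^+ 2)%:C%C * ('i%C * (1 / eps p ^+ 2)%:C%C) = 'i%C :> R[i].
    by rewrite mulrCA -rM mul1r mulfV ?gt_eqF // mulr1.
  have h' : (eps p ^+ 2)%:C%C * ('i%C * (-1 / eps p ^+ 2)%:C%C) = - 'i%C :> R[i].
    by rewrite mulrCA -rM mulN1r mulrN mulfV ?gt_eqF // rN mulrN1.
  rewrite -!/(gp p s l) -!/(gm p s l) -!/(gp' p s l) -!/(gm' p s l) -!/(ep p s) -!/(em p s) /E' /F' /B -/l.
  move: h h'; move: (1 / eps p ^+ 2)%:C%C (-1 / eps p ^+ 2)%:C%C (eps p ^+ 2)%:C%C => x x' e.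
  move: (ep p s) (em p s) (gp p s l) (gm p s l) (gp' p s l) (gm' p s l) (L p s l) (cconv _ _ _ _) (al _ _ _) => y1 y2 y3 y4 y5 y6 y7 y8 y9.
  move: ('i%C * x) ('i%C * x') (mu l ^+ 2)%:C%C => z z' m2 h h'.
  rewrite [X in _ - X = _](_ : _ = e * (y7 * ('i%C * (m2 * (y1 * y3 - y2 * y4)) + (y1 * y5 - y2 * y6)))
     + (e * z) * (y7 * y1 * y3) - (e * z') * (y7 * y2 * y4)); last by ring.
  rewrite h h'; ring.
have hF1 := Ov_attau tau_bd (Ov_mvt DF hF ed).
have hB := Ov_attau tau_bd (Ov_small (Ov_unit (OvB (Ov_unit gp4 ep1) (Ov_unit gm4 em1)) L1) ler01 e2 eC).
have et p : eps p ^+ 2 * tau p <= tau p * (eps p ^+ 2 + dl p).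
  by rewrite mulrC ler_wpM2l ?lerDl // ltW.
have tt p : 0 <= tau p ^+ 2 by exact: sqr_ge0.
have h2 := Ov_ge (Ov_small (Ocr' OR1_eps Oud_1 isT) ler01 tt ttC) (fun p => _ : _ <= tau p * (eps p ^+ 2 + dl p)).
have h3 := Ov_ge (Ov_small (Ocr' OR1_eps Ou0_1 isT) ler01 (fun p => ltW (t0 p)) tC) (fun p => _ : _ <= tau p * (eps p ^+ 2 + dl p)).
have h4 := Ov_unit (OvD hF1 (Ov_ge hB et)) (m := fun p _ l => LN p l) (fun p s l _ => _).
apply: Ov_ext (OvB (h4 _) (Ov_unit (OvD (h3 _) (h2 _)) i1)) _ => [p s l|p|p|p s k kN _].
- by rewrite cnorm_expi.
- by rewrite mulrC.
- by rewrite expr2 -mulrA ler_wpM2l ?(ltW (t0 p)) // (le_trans _ (_ : eps p ^+ 2 <= _)) ?lerDl // ler_piMl.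
rewrite errE // /F E0.
have b0 : B p 0 (freq (N p) k) = 0.
  by rewrite /B (gp0 kN) (gm0 kN) !mulr0 subrr.
by rewrite b0 /B; ring.
Qed.

End local_error.

(** * Stability and convergence *)

Local Opaque cj cconv.

Section stability.
Context {R : realType} (a b : R) (hab : a < b) {P : Type}.
Variables (N : P -> nat) (eps tau : P -> R).
Hypothesis N_even : forall p, ~~ odd (N p).
Hypothesis N_gt0 : forall p, (0 < N p)%N.
Hypothesis tau_bd : forall p, 0 < tau p <= 1.
Hypothesis eps_bd : forall p, 0 < eps p <= 1.
Variable d : P -> R.
Hypothesis d_ge0 : forall p, 0 <= d p.
Implicit Types (c e V W U : P -> int -> R[i]) (g h : P -> R).

Local Notation mu := (mu a b).
Local Notation O := (Ov a b N tau 1).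
Local Notation cconv p := (cconv a b (N p)).
Local Notation cj p := (cj a b (N p)).

Let t0 p : 0 < tau p. Proof. by case/andP: (tau_bd p). Qed.
Let t1 p : tau p <= 1. Proof. by case/andP: (tau_bd p). Qed.
Let e0 p : 0 < eps p. Proof. by case/andP: (eps_bd p). Qed.
Let it0 p : 0 <= (tau p)^-1. Proof. by rewrite invr_ge0 ltW. Qed.

(* c and c' have size g and are at distance g d. *)
Definition Od c c' g : Prop := [/\ forall p, 0 <= g p,
  O (fun p _ => c p) g, O (fun p _ => c' p) g &
  O (fun p _ l => c p l - c' p l) (fun p => g p * d p)].

Lemma Od_scale c c' g h (K : R) : 0 <= K -> (forall p, g p <= K * h p) ->
  (forall p, 0 <= h p) -> Od c c' g -> Od c c' h.
Proof.
move=> K0 gh h0 [g0 h1 h2 h3]; split=> //; [exact: Ov_scale h1 K0 gh|exact: Ov_scale h2 K0 gh|].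
by apply: Ov_scale h3 K0 _ => p; rewrite mulrA ler_wpM2r.
Qed.

Lemma OdD c c' e e' g : Od c c' g -> Od e e' g ->
  Od (fun p l => c p l + e p l) (fun p l => c' p l + e' p l) g.
Proof.
move=> [g0 h1 h2 h3] [_ k1 k2 k3]; split=> //; [exact: OvD|exact: OvD|].
by apply: Ov_ext (OvD h3 k3) _ => p s k *; ring.
Qed.

Lemma OdN c c' g : Od c c' g -> Od (fun p l => - c p l) (fun p l => - c' p l) g.
Proof.
move=> [g0 h1 h2 h3]; split=> //; [exact: OvN|exact: OvN|].
by apply: Ov_ext (OvN h3) _ => p s k *; ring.
Qed.

Lemma OdB c c' e e' g : Od c c' g -> Od e e' g ->
  Od (fun p l => c p l - e p l) (fun p l => c' p l - e' p l) g.
Proof. by move=> hc he; apply: OdD => //; exact: OdN. Qed.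

Lemma OdM c c' g h (K : R) (m : P -> int -> R[i]) : 0 <= K -> (forall p, 0 <= h p) ->
  (forall p l, cnorm (m p l) <= K * h p) -> Od c c' g ->
  Od (fun p l => m p l * c p l) (fun p l => m p l * c' p l) (fun p => h p * g p).
Proof.
move=> K0 h0 hm [g0 h1 h2 h3].
have hm' p (s : R) l : 0 <= s <= tau p -> cnorm (m p l) <= K * h p by [].
split=> [p|||]; first exact: mulr_ge0.
- exact: Ov_small h1 K0 h0 hm'.
- exact: Ov_small h2 K0 h0 hm'.
apply: Ov_ext (Ov_ge (Ov_small h3 K0 h0 hm') _) _ => [p|p s k *].
  by rewrite mulrA.
by ring.
Qed.

Lemma OdM1 c c' g (m : P -> int -> R[i]) : (forall p l, cnorm (m p l) <= 1) -> Od c c' g ->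
  Od (fun p l => m p l * c p l) (fun p l => m p l * c' p l) g.
Proof.
move=> hm h; apply: Od_scale ler01 _ _ (OdM (h := fun=> 1) ler01 (fun=> ler01) _ h) => [p|p|p l].
- by rewrite !mul1r.
- by case: h.
- by rewrite mul1r.
Qed.

Lemma Od_cconv c c' e e' g h : Od c c' g -> Od e e' h ->
  Od (fun p => cconv p (c p) (e p)) (fun p => cconv p (c' p) (e' p)) (fun p => g p * h p).
Proof.
move=> [g0 h1 h2 h3] [k0 k1 k2 k3]; split=> [p|||].
- exact: mulr_ge0.
- exact: (@Ov_cconv _ _ _ hab _ _ tau N_even 1 (fun p _ => c p) (fun p _ => e p) _ _ isT g0 h1 k1).
- exact: (@Ov_cconv _ _ _ hab _ _ tau N_even 1 (fun p _ => c' p) (fun p _ => e' p) _ _ isT g0 h2 k2).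
have gd p : 0 <= g p * d p by exact: mulr_ge0.
have j1 := Ov_ge (@Ov_cconv _ _ _ hab _ _ tau N_even 1 (fun p _ l => c p l - c' p l) (fun p _ => e p) _ _ isT gd h3 k1) (fun p => _ : _ <= g p * h p * d p).
have j2 := Ov_ge (@Ov_cconv _ _ _ hab _ _ tau N_even 1 (fun p _ => c' p) (fun p _ l => e p l - e' p l) _ _ isT g0 h2 k3) (fun p => _ : _ <= g p * h p * d p).
apply: Ov_ext (OvD (j1 _) (j2 _)) _ => [p|p|p s k kN _].
- by rewrite mulrAC.
- by rewrite mulrA.
- by rewrite (cconvB hab).
Qed.

Lemma Od_cj c c' g : Od c c' g -> Od (fun p => cj p (c p)) (fun p => cj p (c' p)) g.
Proof.
move=> [g0 h1 h2 h3]; split=> //; [exact: Ov_cj h1|exact: Ov_cj h2|].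
by apply: Ov_ext (Ov_cj hab N_even h3) _ => p s k kN _; rewrite cjB.
Qed.

Variables V V' W W' U U' : P -> int -> R[i].
Hypothesis OV : Od V V' (fun=> 1).
Hypothesis OW : Od (fun p l => (eps p ^+ 2)%:C%C * W p l) (fun p l => (eps p ^+ 2)%:C%C * W' p l) (fun=> 1).
Hypothesis OU : Od U U' (fun=> 1).

Let om p l := omega a b (eps p) l.
Let om0 p l : 0 < om p l. Proof. exact: omega_gt0. Qed.
Let tle1 p : tau p <= 1 * 1. Proof. by rewrite mul1r. Qed.

Lemma Od_Z0 : Od (fun p => cZ0 (eps p) (V p) (W p)) (fun p => cZ0 (eps p) (V' p) (W' p)) (fun=> 1).
Proof.
have h : Od (fun p l => 2^-1 * (V p l - 'i%C * ((eps p ^+ 2)%:C%C * W p l)))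
    (fun p l => 2^-1 * (V' p l - 'i%C * ((eps p ^+ 2)%:C%C * W' p l))) (fun=> 1).
  apply: (OdM1 (m := fun _ _ => 2^-1)).
    move=> *; rewrite cnormV -[2]/((2%:R) : R[i]) -(rmorph_nat (real_complex R)) cnorm_real.
    by rewrite ger0_norm // invf_le1 // ler1n.
  apply: OdB => //; apply: (OdM1 (m := fun _ _ => 'i%C)) => // *; by rewrite cnorm_i.
have e V1 W1 : (fun p => cZ0 (eps p) (V1 p) (W1 p)) = (fun (p : P) l => 2^-1 * (V1 p l - 'i%C * ((eps p ^+ 2)%:C%C * W1 p l))).
  by apply/funext => p; apply/funext => l; rewrite /cZ0 mulrA.
by rewrite (e V W) (e V' W').
Qed.

Let sf p l : `|sincf a b (tau p) l| <= 1 * (tau p)^-1.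
Proof. by rewrite mul1r; exact: sincf_le_inv. Qed.

Let sf2 p l : cnorm ('i%C * (sincf a b (tau p) l / 2)%:C%C) <= 1 * (tau p)^-1.
Proof.
rewrite cnorm_iR normrM [X in _ * X]ger0_norm ?invr_ge0 //.
by have := sf p l; have := normr_ge0 (sincf a b (tau p) l); lra.
Qed.

(** The numerical solution is controlled in H^2 only, so the filter is bounded by [1 / tau]. Each
    such loss later meets a quadrature weight of order [tau^2], or of order [tau] inside [R]. *)
Lemma Od_Zd : Od (fun p => cZd a b (eps p) (tau p) (V p) (W p))
  (fun p => cZd a b (eps p) (tau p) (V' p) (W' p)) (fun p => (tau p)^-1).
Proof.
apply: Od_scale ler01 _ it0 (OdM (m := fun p l => 'i%C * (sincf a b (tau p) l / 2)%:C%C) ler01 it0 sf2 Od_Z0).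
by move=> p; rewrite mulr1 mul1r.
Qed.

Let it1 p : 1 <= (tau p)^-1. Proof. by rewrite invf_ge1. Qed.

Lemma Od_Ud : Od (fun p => cUd a b (tau p) (N p) (V p) (U p))
  (fun p => cUd a b (tau p) (N p) (V' p) (U' p)) (fun p => (tau p)^-1).
Proof.
apply: OdD.
  apply: OdN; apply: Od_scale ler01 _ it0 (OdM (m := fun p l => 'i%C * (sincf a b (tau p) l)%:C%C) ler01 it0 _ OU).
    by move=> p; rewrite mulr1 mul1r.
  by move=> p l; rewrite cnorm_iR.
apply: (OdM1 (m := fun _ _ => 'i%C)) => [*|]; first by rewrite cnorm_i.
by apply: Od_scale ler01 _ it0 (Od_cconv OV OU) => p; rewrite !mul1r.
Qed.

Lemma Od_Rd : Od (fun p => cRd a b (eps p) (tau p) (N p) (V p) (W p))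
  (fun p => cRd a b (eps p) (tau p) (N p) (V' p) (W' p)) (fun p => (tau p)^-1).
Proof. by apply: OdB; [apply: OdN; exact: Od_Zd|apply: Od_cj; exact: Od_Zd]. Qed.

Lemma Od_sq : Od (fun p => csq a b (N p) (U p)) (fun p => csq a b (N p) (U' p)) (fun=> 1).
Proof. by apply: Od_scale ler01 _ _ (Od_cconv (Od_cj OU) OU) => // p; rewrite !mulr1. Qed.

Lemma Od_re : Od (fun p => cre a b (tau p) (N p) (V p) (U p))
  (fun p => cre a b (tau p) (N p) (V' p) (U' p)) (fun p => (tau p)^-1).
Proof.
apply: OdD.
  by apply: Od_scale ler01 _ it0 (Od_cconv (Od_cj OU) Od_Ud) => p; rewrite !mul1r.
by apply: Od_scale ler01 _ it0 (Od_cconv OU (Od_cj Od_Ud)) => p; rewrite !mul1r.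
Qed.

Let tt0 p : 0 <= tau p. Proof. exact: ltW. Qed.
Let ttp0 p : 0 <= tau p ^+ 2. Proof. exact: sqr_ge0. Qed.
Let tit p : tau p * (tau p)^-1 = 1. Proof. by rewrite mulfV // gt_eqF. Qed.
Let ttit p : tau p ^+ 2 * (tau p)^-1 = tau p. Proof. by rewrite expr2 mulfK // gt_eqF. Qed.

Let qb p l : `|qcoef a b (eps p) l (tau p)| <= 1 * tau p ^+ 2.
Proof. by rewrite mul1r; case: (qcoef_bounds (e0 p) (erefl (om p l)) (tt0 p)). Qed.

Lemma Od_R1 : Od (fun p => cR1 a b (eps p) (tau p) (N p) (V p) (W p) (U p))
  (fun p => cR1 a b (eps p) (tau p) (N p) (V' p) (W' p) (U' p)) (fun=> 1).
Proof.
apply: OdD; first apply: OdD.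
- apply: Od_scale ler01 _ _ (OdM (m := fun p l => (sin (om p l * tau p) / om p l)%:C%C) ler01 tt0 _ Od_Rd) => // [p|p l].
    by rewrite tit mulr1.
  rewrite cnorm_real mul1r normrM normfV (gtr0_norm (om0 p l)) ler_pdivrMr // [tau p * _]mulrC.
  by apply: normr_sin_le; rewrite mulr_ge0 // ltW.
- apply: Od_scale (ler0n _ 2) _ _ (OdM (m := fun p l => (pcoef a b (eps p) l (tau p))%:C%C) ler01 (fun=> ler0n _ 2) _ Od_sq) => // p l.
  rewrite cnorm_real mul1r; apply: le_trans (pcoef_bounds (e0 p) (erefl (om p l)) (tt0 p)).2 _.
  by have /andP[h1 h2] := eps_bd p; rewrite ler_piMr // exprn_ile1 // ltW.
- apply: Od_scale ler01 _ _ (OdM (m := fun p l => (qcoef a b (eps p) l (tau p))%:C%C) ler01 ttp0 _ Od_re) => // [p|p l].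
    by rewrite ttit.
  by rewrite cnorm_real.
Qed.

Let it_half (x : R) : 0 <= x -> cnorm ('i%C * (x / 2)%:C%C) <= 1 * x.
Proof. by move=> x0; rewrite cnorm_iR ger0_norm ?divr_ge0 //; lra. Qed.

(** Without the free propagator, every term is a weight [tau] times a quantity of size 1, or a
    weight [tau^2] times one of size [1 / tau]. Hence the Lipschitz constant [C tau]. *)
Lemma Od_U1 : Od (fun p l => cU1 a b (eps p) (tau p) (N p) (V p) (W p) (U p) l - expi (- (mu l ^+ 2 * tau p)) * U p l)
  (fun p l => cU1 a b (eps p) (tau p) (N p) (V' p) (W' p) (U' p) l - expi (- (mu l ^+ 2 * tau p)) * U' p l) tau.
Proof.
pose T V W U p l : R[i] := ccoef a b (eps p) l 1 (tau p) * cconv p (cZ0 (eps p) (V p) (W p)) (U p) l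
  + dcoef a b (eps p) l 1 (tau p) * (cconv p (cZd a b (eps p) (tau p) (V p) (W p)) (U p) l + cconv p (cZ0 (eps p) (V p) (W p)) (cUd a b (tau p) (N p) (V p) (U p)) l)
  + ccoef a b (eps p) l (-1) (tau p) * cconv p (cj p (cZ0 (eps p) (V p) (W p))) (U p) l
  + dcoef a b (eps p) l (-1) (tau p) *
      (cconv p (cj p (cZd a b (eps p) (tau p) (V p) (W p))) (U p) l + cconv p (cj p (cZ0 (eps p) (V p) (W p))) (cUd a b (tau p) (N p) (V p) (U p)) l)
  + 'i%C * (tau p / 2)%:C%C * cconv p (cR1 a b (eps p) (tau p) (N p) (V p) (W p) (U p)) (U p) l
  + 'i%C * (tau p ^+ 2 / 2)%:C%C * cconv p (cR1 a b (eps p) (tau p) (N p) (V p) (W p) (U p)) (cUd a b (tau p) (N p) (V p) (U p)) l.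
have TE V1 W1 U1 : (fun p l => cU1 a b (eps p) (tau p) (N p) (V1 p) (W1 p) (U1 p) l - expi (- (mu l ^+ 2 * tau p)) * U1 p l) = T V1 W1 U1.
  by apply/funext => p; apply/funext => l; rewrite /cU1 /T; ring.
rewrite !TE /T.
have cb sg p l : sg ^+ 2 = 1 -> cnorm (ccoef a b (eps p) l sg (tau p)) <= 1 * tau p.
  by move=> hsg; rewrite mul1r; exact: ccoef_le.
have db sg p l : sg ^+ 2 = 1 -> cnorm (dcoef a b (eps p) l sg (tau p)) <= 1 * tau p ^+ 2.
  by move=> hsg; rewrite mul1r; exact: dcoef_le.
have s1 : (1 : R) ^+ 2 = 1 by rewrite expr1n.
have s2 : (-1 : R) ^+ 2 = 1 by rewrite sqrrN expr1n.
have sc1 g : (forall p, g p = 1 :> R) -> forall p, tau p * g p <= 1 * tau p by move=> hg p; rewrite hg mulr1 mul1r.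
have sc2 g : (forall p, g p = (tau p)^-1) -> forall p, tau p ^+ 2 * g p <= 1 * tau p.
  by move=> hg p; rewrite hg ttit mul1r.
have m1 : forall p : P, (1 : R) * 1 = 1 by move=> ?; rewrite mulr1.
have D1 : Od (fun p l => cconv p (cZd a b (eps p) (tau p) (V p) (W p)) (U p) l + cconv p (cZ0 (eps p) (V p) (W p)) (cUd a b (tau p) (N p) (V p) (U p)) l)
   (fun p l => cconv p (cZd a b (eps p) (tau p) (V' p) (W' p)) (U' p) l + cconv p (cZ0 (eps p) (V' p) (W' p)) (cUd a b (tau p) (N p) (V' p) (U' p)) l) (fun p => (tau p)^-1).
  apply: OdD.
    by apply: Od_scale ler01 _ it0 (Od_cconv Od_Zd OU) => p; rewrite mulr1 mul1r.
  by apply: Od_scale ler01 _ it0 (Od_cconv Od_Z0 Od_Ud) => p; rewrite !mul1r.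
have D2 : Od (fun p l => cconv p (cj p (cZd a b (eps p) (tau p) (V p) (W p))) (U p) l + cconv p (cj p (cZ0 (eps p) (V p) (W p))) (cUd a b (tau p) (N p) (V p) (U p)) l)
   (fun p l => cconv p (cj p (cZd a b (eps p) (tau p) (V' p) (W' p))) (U' p) l + cconv p (cj p (cZ0 (eps p) (V' p) (W' p))) (cUd a b (tau p) (N p) (V' p) (U' p)) l) (fun p => (tau p)^-1).
  apply: OdD.
    by apply: Od_scale ler01 _ it0 (Od_cconv (Od_cj Od_Zd) OU) => p; rewrite mulr1 mul1r.
  by apply: Od_scale ler01 _ it0 (Od_cconv (Od_cj Od_Z0) Od_Ud) => p; rewrite !mul1r.
apply: OdD; last first.
  apply: Od_scale ler01 (sc2 _ (fun p => _)) tt0 (OdM (m := fun p _ => 'i%C * (tau p ^+ 2 / 2)%:C%C) ler01 ttp0 _ (Od_cconv Od_R1 Od_Ud)) => [|p _].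
    by move=> p; rewrite mul1r.
  exact: it_half.
apply: OdD; last first.
  apply: Od_scale ler01 (sc1 _ m1) tt0 (OdM (m := fun p _ => 'i%C * (tau p / 2)%:C%C) ler01 tt0 _ (Od_cconv Od_R1 OU)) => p _.
  exact: it_half.
apply: OdD; last exact: Od_scale ler01 (sc2 _ (fun=> erefl)) tt0 (OdM ler01 ttp0 (fun p l => db (-1) p l s2) D2).
apply: OdD; last exact: Od_scale ler01 (sc1 _ m1) tt0 (OdM ler01 tt0 (fun p l => cb (-1) p l s2) (Od_cconv (Od_cj Od_Z0) OU)).
apply: OdD; last exact: Od_scale ler01 (sc2 _ (fun=> erefl)) tt0 (OdM ler01 ttp0 (fun p l => db 1 p l s1) D1).
exact: Od_scale ler01 (sc1 _ m1) tt0 (OdM ler01 tt0 (fun p l => cb 1 p l s1) (Od_cconv Od_Z0 OU)).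
Qed.

Lemma Od_force sg : sg ^+ 2 = 1 ->
  Od (fun p l => PP a b (eps p) l sg (tau p) * csq a b (N p) (U p) l + QQ a b (eps p) l sg (tau p) * cre a b (tau p) (N p) (V p) (U p) l)
     (fun p l => PP a b (eps p) l sg (tau p) * csq a b (N p) (U' p) l + QQ a b (eps p) l sg (tau p) * cre a b (tau p) (N p) (V' p) (U' p) l) tau.
Proof.
move=> hsg; apply: OdD.
  apply: Od_scale ler01 _ tt0 (OdM (m := fun p l => PP a b (eps p) l sg (tau p)) ler01 tt0 _ Od_sq) => [p|p l].
    by rewrite mulr1 mul1r.
  by rewrite mul1r; exact: (PP_le (e0 p) (erefl (om p l)) hsg).
apply: Od_scale ler01 _ tt0 (OdM (m := fun p l => QQ a b (eps p) l sg (tau p)) ler01 ttp0 _ Od_re) => [p|p l].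
  by rewrite ttit mul1r.
by rewrite mul1r; exact: (QQ_le (e0 p) (erefl (om p l)) hsg).
Qed.

End stability.

(** * Recovery of the unknowns from the half-waves *)

Section energy_norm.
Context {R : realType} (a b eps : R).
Implicit Types V W : int -> R[i].

Let rN (x : R) : (- x)%:C%C = - x%:C%C :> R[i]. Proof. exact: rmorphN. Qed.
Let hC (x : R) : x%:C%C != 0 :> R[i] = (x != 0). Proof. by rewrite (inj_eq (@complexI R)). Qed.

Lemma nrm_triple N k (m : int -> R[i]) (c e f : int -> R[i]) :
  (forall k', (k' < N)%N -> c (freq N k') = m (freq N k') * (e (freq N k') + f (freq N k'))) ->
  (forall l, cnorm (m l) <= 1) ->
  nrm a b N k c <= nrm a b N k e + nrm a b N k f.
Proof.
move=> hc hm; apply: le_trans (wnD _ _ _ (bwX_ge0 a b k)).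
apply: wn_le => [l|k' k'N]; first exact: bwX_ge0.
by rewrite hc // cnormM ler_wpM2l ?bwX_ge0 // ler_piMl.
Qed.

Lemma nrm_unit N k (m c : int -> R[i]) : (forall l, cnorm (m l) <= 1) ->
  nrm a b N k (fun l => m l * c l) <= nrm a b N k c.
Proof.
move=> hm; apply: wn_le => [l|k' k'N]; first exact: bwX_ge0.
by rewrite cnormM ler_wpM2l ?bwX_ge0 // ler_piMl.
Qed.

Let half (x : R[i]) : cnorm x = 1 -> cnorm (2^-1 * x) <= 1.
Proof.
move=> hx; rewrite cnormM hx mulr1 cnormV -[2]/((2%:R) : R[i]) -(rmorph_nat (real_complex R)) cnorm_real.
by rewrite ger0_norm // invf_le1 // ler1n.
Qed.

(** [V] is the difference of the two half-waves divided by [2 i kap], and [kap >= 1]. *)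
Lemma nrm_eta_V N k V W :
  nrm a b N k V <= nrm a b N k (eta a b eps 1 V W) + nrm a b N k (eta a b eps (-1) V W).
Proof.
have -> : nrm a b N k (eta a b eps (-1) V W) = nrm a b N k (fun l => - eta a b eps (-1) V W l).
  by rewrite /nrm wnN.
apply: (@nrm_triple N k (fun l => (kap a b eps l)%:C%C^-1 * (2^-1 * - 'i%C))) => [k' k'N|l].
  set l := freq _ _; have k0 : (kap a b eps l)%:C%C != 0 :> R[i] by rewrite hC gt_eqF ?kap_gt0.
  apply: (mulfI k0); rewrite -!mulrA mulVKf // /eta mul1r mulN1r rN.
  move: (kap a b eps l)%:C%C (eps ^+ 2)%:C%C => x y.
  by field: (@mul_ii R).
rewrite cnormM cnormV cnorm_real gtr0_norm ?kap_gt0 // mulr_ile1 ?invr_ge0 ?(ltW (kap_gt0 _ _ _ _)) ?invf_le1 ?kap_gt0 ?kap_ge1 //.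
by apply: half; rewrite cnormN cnorm_i.
Qed.

Lemma nrm_eta_W N k V W : nrm a b N k (fun l => (eps ^+ 2)%:C%C * W l) <=
  nrm a b N k (eta a b eps 1 V W) + nrm a b N k (eta a b eps (-1) V W).
Proof.
apply: (@nrm_triple N k (fun l => 2^-1 * 1)) => [k' k'N|l]; last by apply: half; rewrite -(cnorm_expi 0) expi0.
set l := freq _ _; rewrite /eta mul1r mulN1r rN.
move: (kap a b eps l)%:C%C (eps ^+ 2)%:C%C => x y.
by field.
Qed.

Lemma etaB sg V W V' W' l :
  eta a b eps sg (fun l => V l - V' l) (fun l => W l - W' l) l
  = eta a b eps sg V W l - eta a b eps sg V' W' l.
Proof. by rewrite /eta; ring. Qed.

End energy_norm.

(** * Discrete Gronwall argument *)

Section convergence.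
Context {R : realType} (a b T : R) (hab : a < b) (hT : 0 < T) {Q : Type}.
Variables (N : Q -> nat) (eps tau dl : Q -> R).
Hypothesis N_even : forall q, ~~ odd (N q).
Hypothesis N_gt0 : forall q, (0 < N q)%N.
Hypothesis tau_bd : forall q, 0 < tau q <= 1.
Hypothesis eps_bd : forall q, 0 < eps q <= 1.
Hypothesis dl_bd : forall q, 0 <= dl q <= 1.

Variables (u u' v w w' al be : Q -> R -> int -> R[i]) (V W U : Q -> nat -> int -> R[i]).

Local Notation nrm q := (nrm a b (N q)).
Local Notation cconv q := (cconv a b (N q)).
Local Notation cj q := (cj a b (N q)).
Local Notation om q := (omega a b (eps q)).

(** The counterpart of [Ov] on the whole interval [[0, T]], before any step is singled out. *)
Definition bd k (c : Q -> R -> int -> R[i]) (g : Q -> R) : Prop := exists2 C : R, 0 <= C &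
  forall q t, 0 <= t <= T -> nrm q k (c q t) <= C * g q.

Hypothesis Du : forall q k c, (k < N q)%N -> 0 <= c -> c + tau q <= T ->
  C1on 0 (tau q) (fun s => u q (c + s) (freq (N q) k)) (fun s => u' q (c + s) (freq (N q) k)).
Hypothesis Dv : forall q k c, (k < N q)%N -> 0 <= c -> c + tau q <= T ->
  C1on 0 (tau q) (fun s => v q (c + s) (freq (N q) k)) (fun s => w q (c + s) (freq (N q) k)).
Hypothesis Dw : forall q k c, (k < N q)%N -> 0 <= c -> c + tau q <= T ->
  C1on 0 (tau q) (fun s => w q (c + s) (freq (N q) k)) (fun s => w' q (c + s) (freq (N q) k)).
Hypothesis ODEu : forall q k t, (k < N q)%N -> 0 < t < T -> let l := freq (N q) k in
  u' q t l = - ('i%C * (mu a b l ^+ 2)%:C%C * u q t l)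
    + 'i%C * cconv q (v q t) (u q t) l + 'i%C * al q t l.
Hypothesis ODEv : forall q k t, (k < N q)%N -> 0 < t < T -> let l := freq (N q) k in
  (eps q ^+ 2)%:C%C * (w' q t l + (om q l ^+ 2)%:C%C * v q t l)
    = cconv q (cj q (u q t)) (u q t) l + be q t l.
Hypothesis bv : bd 4 v (fun=> 1).
Hypothesis bw4 : bd 4 (fun q t l => (eps q ^+ 2)%:C%C * w q t l) (fun=> 1).
Hypothesis bu : bd 3 u (fun=> 1).
Hypothesis bu' : bd 2 u' (fun=> 1).
Hypothesis bal : bd 1 al dl.
Hypothesis bbe : bd 1 be dl.
Hypothesis v_real : forall q t, 0 <= t <= T -> real_coef a b (N q) (v q t).
Hypothesis w_real : forall q t, 0 <= t <= T -> real_coef a b (N q) (w q t).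

Hypothesis num_U : forall q n k, (k < N q)%N ->
  U q n.+1 (freq (N q) k) = cU1 a b (eps q) (tau q) (N q) (V q n) (W q n) (U q n) (freq (N q) k).
Hypothesis num_eta : forall q n k sg, sg ^+ 2 = 1 -> (k < N q)%N -> let l := freq (N q) k in
  eta a b (eps q) sg (V q n.+1) (W q n.+1) l =
    expi (sg * om q l * tau q) * eta a b (eps q) sg (V q n) (W q n) l
   + PP a b (eps q) l sg (tau q) * csq a b (N q) (U q n) l
   + QQ a b (eps q) l sg (tau q) * cre a b (tau q) (N q) (V q n) (U q n) l.

Definition edist q n : R := let t := n%:R * tau q in
  let e sg := nrm q 1 (eta a b (eps q) sg (fun l => V q n l - v q t l) (fun l => W q n l - w q t l)) in
  e 1 + e (-1) + nrm q 1 (fun l => U q n l - u q t l).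

Hypothesis dist0 : forall q, edist q 0%N <= dl q.

(** Index set of the one-step estimates: parameters and step number such that the step after the
    next index stays within [T] as required by the clause on [x.2.+1], and the current error is at
    most 1. Used as parameter type, it makes the constants independent of the step. *)
Let P := {x : Q * nat | x.2.+1%:R * tau x.1 <= T /\ edist x.1 x.2 <= 1}.
Let pq (p : P) : Q := (proj1_sig p).1.
Let pn (p : P) : nat := (proj1_sig p).2.
Let pt (p : P) : R := (pn p)%:R * tau (pq p).

Let t0 q : 0 < tau q. Proof. by case/andP: (tau_bd q). Qed.

Let pt_ge0 p : 0 <= pt p. Proof. by rewrite mulr_ge0 // ltW. Qed.
Let pt_le p : pt p + tau (pq p) <= T.
Proof. by have [h _] := proj2_sig p; move: h; rewrite -natr1 mulrDl mul1r. Qed.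

Let sT p s : 0 <= s <= tau (pq p) -> 0 <= pt p + s <= T.
Proof.
move=> /andP[s0 st]; rewrite addr_ge0 //=; apply: le_trans (pt_le p).
by rewrite lerD2l.
Qed.

Let loc (c : Q -> R -> int -> R[i]) (p : P) (s : R) := c (pq p) (pt p + s).

Let loc_bd k c g : bd k c g -> Ov a b (fun p => N (pq p)) (fun p => tau (pq p)) k (loc c) (fun p => g (pq p)).
Proof. by move=> [C C0 hC]; exists C => // p s ps; apply: hC; exact: sT. Qed.

Let loc0 c p : loc c p 0 = c (pq p) (pt p).
Proof. by rewrite /loc addr0. Qed.

Let O := Ov a b (fun p => N (pq p)) (fun p => tau (pq p)).

Let ODEu' p k s : (k < N (pq p))%N -> 0 < s < tau (pq p) -> let l := freq (N (pq p)) k in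
  loc u' p s l = - ('i%C * (mu a b l ^+ 2)%:C%C * loc u p s l)
    + 'i%C * cconv (pq p) (loc v p s) (loc u p s) l + 'i%C * loc al p s l.
Proof.
move=> kN /andP[s0 st] l; apply: ODEu => //.
rewrite ltr_wpDl //=; apply: lt_le_trans (pt_le p); by rewrite ltrD2l.
Qed.

Let ODEv' p k s : (k < N (pq p))%N -> 0 < s < tau (pq p) -> let l := freq (N (pq p)) k in
  (eps (pq p) ^+ 2)%:C%C * (loc w' p s l + (om (pq p) l ^+ 2)%:C%C * loc v p s l)
    = cconv (pq p) (cj (pq p) (loc u p s)) (loc u p s) l + loc be p s l.
Proof.
move=> kN /andP[s0 st] l; apply: ODEv => //.
rewrite ltr_wpDl //=; apply: lt_le_trans (pt_le p); by rewrite ltrD2l.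
Qed.

Let vr p : real_coef a b (N (pq p)) (loc v p 0).
Proof. by apply: v_real; apply: sT; rewrite lexx ltW. Qed.
Let wr p : real_coef a b (N (pq p)) (loc w p 0).
Proof. by apply: w_real; apply: sT; rewrite lexx ltW. Qed.
Let dl0 p : 0 <= dl (pq p). Proof. by case/andP: (dl_bd (pq p)). Qed.
Let dl1 p : dl (pq p) <= 1. Proof. by case/andP: (dl_bd (pq p)). Qed.
Let Dlu p k (kN : (k < N (pq p))%N) := Du kN (pt_ge0 p) (pt_le p).
Let Dlv p k (kN : (k < N (pq p))%N) := Dv kN (pt_ge0 p) (pt_le p).
Let Dlw p k (kN : (k < N (pq p))%N) := Dw kN (pt_ge0 p) (pt_le p).
Let pN_even p := N_even (pq p).
Let pN_gt0 p := N_gt0 (pq p).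
Let ptau p := tau_bd (pq p).
Let peps p := eps_bd (pq p).

Let te p := tau (pq p) ^+ 2 / eps (pq p) ^+ 2.
Let e2 p := eps (pq p) ^+ 2.


Let lu := loc u. Let lv := loc v. Let lw := loc w.
Let U0 p := U (pq p) (pn p). Let V0 p := V (pq p) (pn p). Let W0 p := W (pq p) (pn p).
Let d p := edist (pq p) (pn p).
Let ex_U p := cU1 a b (eps (pq p)) (tau (pq p)) (N (pq p)) (lv p 0) (lw p 0) (lu p 0).
Let ex_eta sg p l : R[i] := expi (sg * om (pq p) l * tau (pq p)) * eta a b (eps (pq p)) sg (lv p 0) (lw p 0) l
   + PP a b (eps (pq p)) l sg (tau (pq p)) * csq a b (N (pq p)) (lu p 0) l
   + QQ a b (eps (pq p)) l sg (tau (pq p)) * cre a b (tau (pq p)) (N (pq p)) (lv p 0) (lu p 0) l.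

Let eU1 : O 1 (fun p _ l => lu p (tau (pq p)) l - ex_U p l) (fun p => tau (pq p) * (te p + dl (pq p))).
Proof.
exact (err_U1 hab pN_even pN_gt0 ptau peps dl0 Dlu Dlv Dlw ODEu' ODEv' (loc_bd bv) (loc_bd bw4)
  (loc_bd bu) (loc_bd bu') (loc_bd bal) (loc_bd bbe) vr wr dl1).
Qed.
Let eU2 : O 1 (fun p _ l => lu p (tau (pq p)) l - ex_U p l) (fun p => tau (pq p) * (e2 p + dl (pq p))).
Proof.
exact (err_U2 hab pN_even pN_gt0 ptau peps dl0 Dlu Dlv Dlw ODEu' ODEv' (loc_bd bv) (loc_bd bw4)
  (loc_bd bu) (loc_bd bu') (loc_bd bal) (loc_bd bbe) vr wr).
Qed.
Let ee1 sg (hsg : sg ^+ 2 = 1) : O 1 (fun p _ l => eta a b (eps (pq p)) sg (lv p (tau (pq p))) (lw p (tau (pq p))) l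
   - ex_eta sg p l) (fun p => tau (pq p) * (te p + dl (pq p))).
Proof.
exact (err_energy1 hab pN_even pN_gt0 ptau peps dl0 Dlu Dlv Dlw ODEu' ODEv' (loc_bd bv) (loc_bd bw4)
  (loc_bd bu) (loc_bd bu') (loc_bd bal) (loc_bd bbe) hsg).
Qed.
Let ee2 sg (hsg : sg ^+ 2 = 1) : O 1 (fun p _ l => eta a b (eps (pq p)) sg (lv p (tau (pq p))) (lw p (tau (pq p))) l
   - ex_eta sg p l) (fun p => tau (pq p) * (e2 p + dl (pq p))).
Proof.
exact (err_energy2 hab pN_even pN_gt0 ptau peps dl0 Dlu Dlv Dlw ODEv' (loc_bd bv)
  (loc_bd bu) (loc_bd bu') (loc_bd bbe) hsg).
Qed.

Let nrm_ge0 q k c : 0 <= nrm q k c. Proof. exact: wn_ge0. Qed.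
Let edist_ge0 q n : 0 <= edist q n. Proof. by rewrite !addr_ge0. Qed.
Let d_ge0 p : 0 <= d p. Proof. exact: edist_ge0. Qed.
Let d_le1 p : d p <= 1. Proof. by case: p => x []. Qed.

(** Only the exact solution has to be bounded; the numerical one is within distance [d <= 1] of
    it. *)
Let OdP (c : P -> int -> R[i]) (c' : P -> int -> R[i]) : O 1 (fun p _ => c' p) (fun=> 1) ->
  (forall p, nrm (pq p) 1 (fun l => c p l - c' p l) <= d p) ->
  Od a b (fun p => N (pq p)) (fun p => tau (pq p)) d c c' (fun=> 1).
Proof.
move=> hc' hd.
have h : O 1 (fun p _ l => c p l - c' p l) (fun p => 1 * d p).
  by exists 1 => // p s _; rewrite !mul1r.
split=> //; apply: Ov_ext (OvD hc' (Ov_ge h _)) _ => [p|p s k *]; first by rewrite mul1r.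
by rewrite addrC subrK.
Qed.

Let at_bd k c : bd k c (fun=> 1) -> (1 <= k)%N -> O 1 (fun p _ => loc c p 0) (fun=> 1).
Proof. by move=> h k1; apply: (Ov_at0 ptau); exact: Ov_mono k1 (loc_bd h). Qed.

Let OV : Od a b (fun p => N (pq p)) (fun p => tau (pq p)) d V0 (fun p => lv p 0) (fun=> 1).
Proof.
apply: OdP => [|p]; first exact: at_bd bv isT.
apply: le_trans (nrm_eta_V a b (eps (pq p)) _ _ _ (fun l => W0 p l - lw p 0 l)) _.
by rewrite /d /edist /V0 /W0 /lv /lw !loc0 lerDl.
Qed.

Let OW : Od a b (fun p => N (pq p)) (fun p => tau (pq p)) d
  (fun p l => (eps (pq p) ^+ 2)%:C%C * W0 p l) (fun p l => (eps (pq p) ^+ 2)%:C%C * lw p 0 l) (fun=> 1).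
Proof.
apply: OdP => [|p]; first exact: at_bd bw4 isT.
rewrite (_ : (fun l => _ - _) = (fun l => (eps (pq p) ^+ 2)%:C%C * (W0 p l - lw p 0 l))); last first.
  by apply/funext => l; rewrite mulrBr.
apply: le_trans (nrm_eta_W a b (eps (pq p)) _ _ (fun l => V0 p l - lv p 0 l) _) _.
by rewrite /d /edist /V0 /W0 /lv /lw !loc0 lerDl.
Qed.

Let OU : Od a b (fun p => N (pq p)) (fun p => tau (pq p)) d U0 (fun p => lu p 0) (fun=> 1).
Proof.
apply: OdP => [|p]; first exact: at_bd bu isT.
by rewrite /d /edist /U0 /lu !loc0 lerDr addr_ge0.
Qed.

Let ptE p : (pn p).+1%:R * tau (pq p) = pt p + tau (pq p).
Proof. by rewrite -natr1 mulrDl mul1r. Qed.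

(** The new error is the rotated old error, plus the difference of the nonlinear increments, minus
    the local error. The rotation does not increase the norm, the second part is [C tau d] by
    stability, the third is [C tau g], where [g] stands for either local bound. *)
Let step_part (g : P -> R) : (forall p, 0 <= g p) ->
  O 1 (fun p _ l => lu p (tau (pq p)) l - ex_U p l) (fun p => tau (pq p) * g p) ->
  (forall sg, sg ^+ 2 = 1 -> O 1 (fun p _ l => eta a b (eps (pq p)) sg (lv p (tau (pq p))) (lw p (tau (pq p))) l
   - ex_eta sg p l) (fun p => tau (pq p) * g p)) ->
  exists2 C : R, 0 <= C & forall p, edist (pq p) (pn p).+1 <=
    d p + C * (tau (pq p) * d p) + C * (tau (pq p) * g p).
Proof.
move=> g0 hU he.
have s1 : (1 : R) ^+ 2 = 1 by rewrite expr1n.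
have s2 : (-1 : R) ^+ 2 = 1 by rewrite sqrrN expr1n.
have [_ _ _ [CU CU0 dU]] := Od_U1 hab pN_even pN_gt0 ptau peps d_ge0 OV OW OU.
have [CU' CU'0 eU] := hU.
have st sg (hsg : sg ^+ 2 = 1) : exists2 C : R, 0 <= C & forall p,
    nrm (pq p) 1 (eta a b (eps (pq p)) sg (fun l => V (pq p) (pn p).+1 l - v (pq p) ((pn p).+1%:R * tau (pq p)) l)
       (fun l => W (pq p) (pn p).+1 l - w (pq p) ((pn p).+1%:R * tau (pq p)) l))
     <= nrm (pq p) 1 (eta a b (eps (pq p)) sg (fun l => V (pq p) (pn p) l - v (pq p) (pt p) l)
       (fun l => W (pq p) (pn p) l - w (pq p) (pt p) l)) + C * (tau (pq p) * d p) + C * (tau (pq p) * g p).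
  have [_ _ _ [C1 C10 h1]] := Od_force hab pN_even pN_gt0 ptau peps d_ge0 OV OU hsg.
  have [C2 C20 h2] := he sg hsg.
  exists (C1 + C2) => [|p]; first exact: addr_ge0.
  have ps : 0 <= (0 : R) <= tau (pq p) by rewrite lexx ltW.
  rewrite (_ : nrm (pq p) 1 (eta _ _ _ _ _ _) = nrm (pq p) 1 (fun l => expi (sg * om (pq p) l * tau (pq p)) *
      eta a b (eps (pq p)) sg (fun l => V (pq p) (pn p) l - v (pq p) (pt p) l)
       (fun l => W (pq p) (pn p) l - w (pq p) (pt p) l) l
     + ((PP a b (eps (pq p)) l sg (tau (pq p)) * csq a b (N (pq p)) (U0 p) l +
             QQ a b (eps (pq p)) l sg (tau (pq p)) * cre a b (tau (pq p)) (N (pq p)) (V0 p) (U0 p) l -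
             (PP a b (eps (pq p)) l sg (tau (pq p)) * csq a b (N (pq p)) (lu p 0) l +
              QQ a b (eps (pq p)) l sg (tau (pq p)) * cre a b (tau (pq p)) (N (pq p)) (lv p 0) (lu p 0) l))
        - (eta a b (eps (pq p)) sg (lv p (tau (pq p))) (lw p (tau (pq p))) l - ex_eta sg p l)))); last first.
    apply: wn_eq => k kN; rewrite !etaB num_eta // ptE /ex_eta /lv /lw !loc0 -/(U0 p) -/(V0 p) -/(W0 p); ring.
  apply: le_trans (wnD _ _ _ (bwX_ge0 a b 1)) _; rewrite -addrA; apply: lerD.
    apply: (@nrm_unit _ a b _ _ (fun l => expi (sg * om (pq p) l * tau (pq p)))) => l; by rewrite cnorm_expi.
  apply: le_trans (wnB _ _ _ (bwX_ge0 a b 1)) _.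
  apply: le_trans (lerD (h1 p 0 ps) (h2 p 0 ps)) _.
  by rewrite lerD // ler_wpM2r ?lerDl ?lerDr // mulr_ge0 // ltW.
have [C1 C10 h1] := st 1 s1; have [C2 C20 h2] := st (-1) s2.
exists (C1 + C2 + (CU + CU')) => [|p]; first by rewrite !addr_ge0.
have ps : 0 <= (0 : R) <= tau (pq p) by rewrite lexx ltW.
have hu : nrm (pq p) 1 (fun l => U (pq p) (pn p).+1 l - u (pq p) ((pn p).+1%:R * tau (pq p)) l)
   <= nrm (pq p) 1 (fun l => U (pq p) (pn p) l - u (pq p) (pt p) l)
     + CU * (tau (pq p) * d p) + CU' * (tau (pq p) * g p).
  rewrite (_ : nrm (pq p) 1 (fun l => U _ _.+1 l - _) = nrm (pq p) 1 (fun l =>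
      expi (- (mu a b l ^+ 2 * tau (pq p))) * (U (pq p) (pn p) l - u (pq p) (pt p) l)
      + ((cU1 a b (eps (pq p)) (tau (pq p)) (N (pq p)) (V0 p) (W0 p) (U0 p) l - expi (- (mu a b l ^+ 2 * tau (pq p))) * U0 p l
         - (cU1 a b (eps (pq p)) (tau (pq p)) (N (pq p)) (lv p 0) (lw p 0) (lu p 0) l - expi (- (mu a b l ^+ 2 * tau (pq p))) * lu p 0 l))
        - (lu p (tau (pq p)) l - ex_U p l)))); last first.
    apply: wn_eq => k kN; rewrite num_U // ptE /ex_U /lu !loc0 /loc -/(U0 p) -/(V0 p) -/(W0 p).
    by move: (cU1 _ _ _ _ _ _ _ _ _) (cU1 _ _ _ _ _ _ _ _ _) => x1 x2; ring.
  apply: le_trans (wnD _ _ _ (bwX_ge0 a b 1)) _; rewrite -addrA; apply: lerD.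
    apply: (@nrm_unit _ a b _ _ (fun l => expi (- (mu a b l ^+ 2 * tau (pq p))))) => l; by rewrite cnorm_expi.
  apply: le_trans (wnB _ _ _ (bwX_ge0 a b 1)) _.
  exact: lerD (dU p 0 ps) (eU p 0 ps).
have := h1 p; have := h2 p; rewrite /edist.
rewrite -[n in nrm n]/(pq p) => k2 k1; apply: le_trans (lerD (lerD k1 k2) hu) _.
have y1' : 0 <= CU' * (tau (pq p) * d p) by rewrite !mulr_ge0 // ltW.
have y2' : 0 <= CU * (tau (pq p) * g p) by rewrite !mulr_ge0 // ltW.
move: (tau (pq p) * d p) (tau (pq p) * g p) y1' y2' => x1 x2 x1' x2'; rewrite /d /edist -/(pt p).
move: (nrm _ _ _) (nrm _ _ _) (nrm _ _ _) => y1 y2 y3.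
by rewrite !mulrDl; lra.
Qed.

Let te_ge0 p : 0 <= te p. Proof. by rewrite divr_ge0 // sqr_ge0. Qed.
Let e2_ge0 p : 0 <= e2 p. Proof. exact: sqr_ge0. Qed.

Lemma one_step : exists2 C : R, 0 <= C & forall q n, n.+1%:R * tau q <= T -> edist q n <= 1 ->
  edist q n.+1 <= edist q n + C * (tau q * edist q n) + C * (tau q * (tau q ^+ 2 / eps q ^+ 2 + dl q)) /\
  edist q n.+1 <= edist q n + C * (tau q * edist q n) + C * (tau q * (eps q ^+ 2 + dl q)).
Proof.
have [C1 C10 h1] := step_part (fun p => addr_ge0 (te_ge0 p) (dl0 p)) eU1 ee1.
have [C2 C20 h2] := step_part (fun p => addr_ge0 (e2_ge0 p) (dl0 p)) eU2 ee2.
exists (C1 + C2) => [|q n qn d1]; first exact: addr_ge0.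
pose p : P := exist _ (q, n) (conj qn d1).
have dl0' : 0 <= dl q by case/andP: (dl_bd q).
have tt0 := ltW (t0 q).
have x1 : 0 <= tau q * edist q n by rewrite mulr_ge0.
have x2 : 0 <= tau q * (tau q ^+ 2 / eps q ^+ 2 + dl q).
  by rewrite mulr_ge0 // addr_ge0 // divr_ge0 // sqr_ge0.
have x3 : 0 <= tau q * (eps q ^+ 2 + dl q) by rewrite mulr_ge0 // addr_ge0 // sqr_ge0.
split.
  apply: le_trans (h1 p) _; rewrite /d /te /=.
  by rewrite !lerD // ler_wpM2r // lerDl.
apply: le_trans (h2 p) _; rewrite /d /e2 /=.
by rewrite !lerD // ler_wpM2r // lerDr.
Qed.

(** The two recursions run together. One of [tau^2 / eps^2] and [eps^2] is at most [tau], so the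
    smallness condition keeps the corresponding bound, hence the error, below 1, and the one-step
    estimate applies again. *)
Theorem convergence : exists C : R, 0 < C /\ forall q, C * (dl q + tau q) <= 1 ->
  forall n, n%:R * tau q <= T ->
  edist q n <= C * (tau q ^+ 2 / eps q ^+ 2 + dl q) /\ edist q n <= C * (eps q ^+ 2 + dl q).
Proof.
have [C C0 step] := one_step.
pose K := expR (C * T) * (1 + C * T).
have CT0 : 0 <= C * T by rewrite mulr_ge0 // ltW.
exists K; split; first by rewrite mulr_gt0 ?expR_gt0 // ltr_wpDr.
move=> q hK.
have /andP[dlq0 dlq1] := dl_bd q; have tq := t0 q; have eq0 : 0 < eps q by case/andP: (eps_bd q).
have te0 : 0 <= tau q ^+ 2 / eps q ^+ 2 by rewrite divr_ge0 // sqr_ge0.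
(* Majorant of the recursion [D' = (1 + C tau) D + C tau (G + dl)] started at [dl]. It is stable
   under a step since [1 + x <= exp x]. *)
pose B n G := expR (C * (n%:R * tau q)) * (dl q + C * (n%:R * tau q) * (G + dl q)).
have BK n G : 0 <= G -> n%:R * tau q <= T -> B n G <= K * (G + dl q).
  move=> G0 nT; rewrite /B /K -[leRHS]mulrA ler_pM ?expR_ge0 //.
  - by rewrite addr_ge0 // !mulr_ge0 ?addr_ge0 // ltW.
  - by rewrite ler_expR ler_wpM2l.
  - by rewrite mulrDl mul1r lerD ?lerDr // ler_wpM2r ?addr_ge0 // ler_wpM2l.
have BS n G D : 0 <= G -> D <= B n G -> 0 <= D ->
    D + C * (tau q * D) + C * (tau q * (G + dl q)) <= B n.+1 G.
  move=> G0 DB D0; rewrite /B.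
  have -> : C * (n.+1%:R * tau q) = C * tau q + C * (n%:R * tau q) by rewrite -natr1; ring.
  rewrite expRD; set x := C * tau q; set y := C * (n%:R * tau q).
  have x0 : 0 <= x by rewrite mulr_ge0 // ltW.
  have y0 : 0 <= y by rewrite !mulr_ge0 // ltW.
  have emode : 1 + x <= expR x by exact: expR_ge1Dx.
  have ey : 1 <= expR y by apply: le_trans (expR_ge1Dx y); rewrite lerDl.
  have ex1 : 1 <= expR x by apply: le_trans emode; rewrite lerDl.
  apply: le_trans (_ : expR x * D + expR x * expR y * (x * (G + dl q)) <= _).
    apply: lerD.
      by rewrite mulrA -/x -[X in X + _]mul1r -mulrDl ler_wpM2r.
    have z0 : 0 <= x * (G + dl q) by apply: mulr_ge0 => //; exact: addr_ge0.
    by rewrite (mulrA C) -/x; apply: ler_peMl z0 _; exact: mulr_ege1.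
  apply: le_trans (lerD (ler_wpM2l (expR_ge0 x) DB) (lexx _)) _.
  rewrite /B -/y le_eqVlt; apply/orP; left; apply/eqP; ring.
have small G D : 0 <= G -> D <= K * (G + dl q) -> G <= tau q -> D <= 1.
  move=> G0 h Gt; apply: le_trans h (le_trans _ hK); rewrite ler_wpM2l //.
    by rewrite mulr_ge0 ?expR_ge0 // addr_ge0.
  by rewrite addrC lerD2l.
have main n : n%:R * tau q <= T ->
    edist q n <= B n (tau q ^+ 2 / eps q ^+ 2) /\ edist q n <= B n (eps q ^+ 2).
  elim: n => [_|n ih nT].
    have b0 G : B 0%N G = dl q by rewrite /B !(mul0r, mulr0, expR0, addr0, mul1r).
    by rewrite !b0; split; exact: dist0.
  have nT' : n%:R * tau q <= T by apply: le_trans nT; rewrite ler_wpM2r ?ler_nat // ltW.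
  have [i1 i2] := ih nT'.
  have d1 : edist q n <= 1.
    have [h|/ltW h] := leP (eps q ^+ 2) (tau q).
      by apply: small h => //; [exact: sqr_ge0|apply: le_trans i2 (BK _ _ _ nT'); exact: sqr_ge0].
    apply: (small (tau q ^+ 2 / eps q ^+ 2)) => //; first exact: le_trans i1 (BK _ _ te0 nT').
    by rewrite ler_pdivrMr ?exprn_gt0 // expr2 ler_wpM2l // ltW.
  have [s1 s2] := step q n nT d1.
  split; [apply: le_trans s1 _|apply: le_trans s2 _]; apply: BS => //; exact: sqr_ge0.
move=> n nT; have [h1 h2] := main n nT.
by split; [apply: le_trans h1 _|apply: le_trans h2 _]; apply: BK => //; exact: sqr_ge0.
Qed.

End convergence.

(** * Test functions *)

Section smooth_functions.
Context {R : realType}.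
Implicit Types f g : R -> R.

(** [n] successive derivatives on the whole line, given by witnesses. The recursive form makes
    closure under the operations a plain induction; [Ck_derivable] converts to iterated
    derivatives. *)
Fixpoint Ck n f : Prop :=
  if n is m.+1 then exists2 f' : R -> R, (forall x : R, is_derive x 1 f (f' x)) & Ck m f' else True.

Lemma CkS n f : Ck n.+1 f -> Ck n f.
Proof. by elim: n f => // n ih f [f' df /ih Cf]; exists f'. Qed.

Lemma Ck_cst n (c : R) : Ck n (fun=> c).
Proof. by elim: n c => // n ih c; exists (fun=> 0) => // x; exact: is_derive_cst. Qed.

Lemma CkD n f g : Ck n f -> Ck n g -> Ck n (fun x => f x + g x).
Proof.
elim: n f g => // n ih f g [f' df Cf] [g' dg Cg]; exists (fun x => f' x + g' x); last exact: ih.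
by move=> x; exact: is_deriveD.
Qed.

Lemma is_derive_mul f g (f' g' x : R) : is_derive x 1 f f' -> is_derive x 1 g g' ->
  is_derive x 1 (fun x => f x * g x) (f' * g x + f x * g').
Proof.
move=> df dg; have h := @is_deriveM _ _ f g x 1 _ _ df dg.
by apply: (is_derive_eq h); rewrite /GRing.scale /= addrC [g x * _]mulrC.
Qed.

Lemma CkM n f g : Ck n f -> Ck n g -> Ck n (fun x => f x * g x).
Proof.
elim: n f g => // n ih f g Cf' Cg'; have [f' df Cf] := Cf'; have [g' dg Cg] := Cg'.
exists (fun x => f' x * g x + f x * g' x).
  by move=> x; exact: is_derive_mul.
by apply: CkD; apply: ih => //; exact: CkS.
Qed.

Lemma CkV n f : (forall x, f x != 0) -> Ck n f -> Ck n (fun x => (f x)^-1).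
Proof.
move=> f0; elim: n f f0 => // n ih f f0 Cf'; have [f' df Cf] := Cf'.
exists (fun x => - 1 * ((f x)^-1 * (f x)^-1 * f' x)).
  move=> x; have h := is_deriveV (f0 x) (df x); apply: (is_derive_eq h).
  by rewrite /GRing.scale /= mulN1r mulNr expr2 invfM.
apply: CkM; first exact: Ck_cst.
by apply: CkM => //; apply: CkM; apply: ih => //; exact: CkS.
Qed.

Lemma is_derive_affine f (f' c d x : R) : is_derive (c * x + d) 1 f f' ->
  is_derive x 1 (fun x => f (c * x + d)) (c * f').
Proof.
move=> df; have h : is_derive x 1 (fun x : R => c * x + d) c.
  have := @is_deriveD _ _ _ (fun x : R => c * x) (fun=> d) x 1 _ _
    (is_derive_mul (is_derive_cst c x 1) (is_derive_id x 1)) (is_derive_cst d x 1).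
  by move=> h; apply: (is_derive_eq h); rewrite mul0r add0r mulr1 addr0.
have h2 := @is_derive1_comp _ f (fun x => c * x + d) x _ _ df h.
by apply: (is_derive_eq h2); rewrite mulrC.
Qed.

Lemma Ck_affine n f c d : Ck n f -> Ck n (fun x => f (c * x + d)).
Proof.
elim: n f => // n ih f [f' df Cf]; exists (fun x => c * f' (c * x + d)).
  by move=> x; exact: is_derive_affine.
by apply: CkM; [exact: Ck_cst|exact: ih].
Qed.

Lemma Ck_trig n : Ck n (@cos R) /\ Ck n (@sin R).
Proof.
elim: n => // n [ihc ihs]; split; last by exists cos => // x; exact: is_derive_sin.
exists (fun x => - 1 * sin x); last by apply: CkM => //; exact: Ck_cst.
by move=> x; apply: (is_derive_eq (is_derive_cos x)); rewrite mulN1r.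
Qed.

Lemma Ck_derivable f : (forall n, Ck n f) -> forall k x, derivable (f^`(k)%classic) x 1.
Proof.
move=> h k; have := h k.+1; elim: k f {h} => [|k ih] f.
  by move=> [f' df _] x; case: (df x).
move=> [f' df Cf] x; rewrite derive1Sn.
have -> : f^`()%classic = f'; last exact: ih.
by apply/funext => y; rewrite derive1E; case: (df y).
Qed.

Lemma is_derive_cont f (f' x : R) : is_derive x 1 f f' -> {for x, continuous f}.
Proof. by case=> d _; apply: differentiable_continuous; apply/derivable1_diffP. Qed.

(** [x^-n exp(- 1 / x)] extended by 0. Differentiation maps the family into its own span, which
    yields smoothness of all members at once. *)
Definition flat n (x : R) : R := if 0 < x then x^-1 ^+ n * expR (- x^-1) else 0.

(** With [y = 1 / x], the exponential of [y] dominates [y^(n + 1) / (n + 1)!], which leaves one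
    power of [x]. *)
Lemma flat_le n x : `|flat n x| <= n.+1`!%:R * `|x|.
Proof.
rewrite /flat; case: ifPn => [x0|_]; last by rewrite normr0 mulr_ge0.
have [y y0 ->] : exists2 y, 0 < y & x = y^-1 by exists x^-1; rewrite ?invr_gt0 ?invrK.
rewrite invrK ger0_norm ?mulr_ge0 ?expR_ge0 ?exprn_ge0 ?(ltW y0) // gtr0_norm ?invr_gt0 //.
rewrite expRN ler_pdivrMr ?expR_gt0 //.
have h := expR_ge1Dxn n (ltW y0).
have f0 : 0 < n.+1`!%:R :> R by rewrite ltr0n fact_gt0.
rewrite mulrAC ler_pdivlMr // -exprSr -ler_pdivrMl // mulrC.
by apply: le_trans h; rewrite lerDr.
Qed.

Lemma is_derive_flat n (x : R) : is_derive x 1 (flat n) (- n%:R * flat n.+1 x + flat n.+2 x).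
Proof.
have [x0|x0|->] := ltgtP x 0.
- have -> : - n%:R * flat n.+1 x + flat n.+2 x = 0.
    by rewrite /flat !ltNge !(ltW x0) /= mulr0 addr0.
  apply: near_eq_is_derive (is_derive_cst 0 x 1); near=> z.
  rewrite /flat ltNge ifF //; apply/negbTE; rewrite negbK.
  by apply/ltW; near: z; exact: lt_nbhsl.
- have -> : - n%:R * flat n.+1 x + flat n.+2 x =
      - n%:R * x^-1 ^+ n.+1 * expR (- x^-1) + x^-1 ^+ n.+2 * expR (- x^-1).
    by rewrite /flat !x0 mulrA.
  have hV : is_derive x 1 (fun x : R => x^-1) (- x^-1 ^+ 2).
    have h := is_deriveV (f := id) (x := x) (t := 1) (v := 1) (lt0r_neq0 x0) (is_derive_id x 1).
    by apply: (is_derive_eq h); rewrite /GRing.scale /= mulr1 exprVn.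
  have hX : is_derive x 1 (fun x : R => x^-1 ^+ n) (- n%:R * x^-1 ^+ n.+1).
    elim: (n) => [|m ih]; first by rewrite oppr0 mul0r; exact: is_derive_cst.
    have -> : (fun x : R => x^-1 ^+ m.+1) = (fun x => x^-1 * x^-1 ^+ m).
      by apply/funext => z; rewrite exprS.
    by apply: (is_derive_eq (is_derive_mul hV ih)); rewrite -natr1 !exprS; ring.
  have hE : is_derive x 1 (fun x : R => expR (- x^-1)) (x^-1 ^+ 2 * expR (- x^-1)).
    have h := @is_derive1_comp _ expR (fun x => - x^-1) x _ _ (is_derive_expR _) (is_deriveN hV).
    by apply: (is_derive_eq h); rewrite opprK mulrC.
  apply: near_eq_is_derive (is_derive_eq (is_derive_mul hX hE) _).
    near=> z; rewrite /flat ifT //; near: z; exact: lt_nbhsr.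
  by congr (_ + _); rewrite mulrA -exprD addn2.
- have -> : - n%:R * flat n.+1 0 + flat n.+2 0 = 0.
    by rewrite /flat ltxx mulr0 addr0.
  (* At 0 the difference quotient of [flat n] is [flat n.+1], which is continuous there by
     [flat_le]. *)
  apply/is_derive1_caratheodory; exists (flat n.+1); split.
  + move=> z; rewrite subr0 /flat ltxx subr0; case: ifPn => z0; last by rewrite mul0r.
    by rewrite exprS; field; rewrite gt_eqF.
  + apply/cvgrPdist_le => e e0; near=> z.
    rewrite {1}/flat ltxx sub0r normrN; apply: le_trans (flat_le _ _) _.
    rewrite mulrC -ler_pdivlMr ?ltr0n ?fact_gt0 //; near: z.
    exists (e / n.+2`!%:R) => /= [|y]; first by rewrite divr_gt0 // ltr0n fact_gt0.
    by rewrite /ball_ /= sub0r normrN => /ltW.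
  + by rewrite /flat ltxx.
Unshelve. all: by end_near. Qed.

Lemma Ck_flat k n : Ck k (flat n).
Proof.
elim: k n => // k ih n; exists (fun x => - n%:R * flat n.+1 x + flat n.+2 x).
  by move=> x; exact: is_derive_flat.
by apply: CkD => //; apply: CkM => //; exact: Ck_cst.
Qed.

Lemma flat_ge0 n x : 0 <= flat n x.
Proof.
by rewrite /flat; case: ifP => // x0; rewrite mulr_ge0 ?expR_ge0 ?exprn_ge0 // invr_ge0 ltW.
Qed.

Lemma flat_gt0 n x : 0 < x -> 0 < flat n x.
Proof. by move=> x0; rewrite /flat x0 mulr_gt0 ?expR_gt0 ?exprn_gt0 ?invr_gt0. Qed.

Lemma flat_eq0 n x : x <= 0 -> flat n x = 0.
Proof. by move=> x0; rewrite /flat ltNge x0. Qed.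

Let den x := flat 0 x + flat 0 (- 1 * x + 1).

Let den_gt0 x : 0 < den x.
Proof.
have [x0|x0] := ltP 0 x; first by rewrite ltr_pwDl ?flat_gt0 ?flat_ge0.
by rewrite ltr_wpDl ?flat_ge0 // flat_gt0 //; lra.
Qed.

Definition sstep x : R := flat 0 x * (den x)^-1.

Lemma Ck_sstep n : Ck n sstep.
Proof.
apply: CkM; first exact: Ck_flat.
apply: CkV => [x|]; first by rewrite gt_eqF.
by apply: CkD; [exact: Ck_flat|exact: Ck_affine (Ck_flat _ _)].
Qed.

Lemma sstep_eq0 x : x <= 0 -> sstep x = 0.
Proof. by move=> x0; rewrite /sstep flat_eq0 // mul0r. Qed.

Lemma sstep_eq1 x : 1 <= x -> sstep x = 1.
Proof.
move=> x1; rewrite /sstep /den [flat _ (_ + _)]flat_eq0; last by lra.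
by rewrite addr0 mulfV // gt_eqF // flat_gt0 //; lra.
Qed.

Lemma sstep_bd x : 0 <= sstep x <= 1.
Proof.
rewrite /sstep divr_ge0 ?flat_ge0 ?(ltW (den_gt0 x)) //= ler_pdivrMr // mul1r.
by rewrite lerDl flat_ge0.
Qed.

(** The derivative is continuous and vanishes outside the open unit interval, so the extreme value
    theorem on [[0, 1]] bounds it globally. [flat 2] appears as the derivative of [flat 0]. *)
Lemma sstep_derive : exists2 C : R, 0 <= C & exists2 s' : R -> R,
  (forall x : R, is_derive x 1 sstep (s' x)) &
  (forall x, `|s' x| <= C) /\ forall x, ~~ (0 < x < 1) -> s' x = 0.
Proof.
pose s' x := flat 2 x * (den x)^-1 +
  flat 0 x * (- 1 * ((den x)^-1 * (den x)^-1 * (flat 2 x + - 1 * flat 2 (- 1 * x + 1)))).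
have dfl (x : R) : is_derive x 1 (flat 0) (flat 2 x).
  by apply: (is_derive_eq (is_derive_flat 0 x)); rewrite oppr0 mul0r add0r.
have ds (x : R) : is_derive x 1 sstep (s' x).
  have hd : is_derive x 1 den (flat 2 x + - 1 * flat 2 (- 1 * x + 1)).
    by apply: is_deriveD; apply: is_derive_affine; exact: dfl.
  have h := is_deriveV (lt0r_neq0 (den_gt0 x)) hd; apply: (is_derive_eq (is_derive_mul (dfl x) h)).
  rewrite /s'; congr (_ + _ * _).
  move: (den x) (flat 2 x + _) => p q; by rewrite /GRing.scale /= mulN1r mulNr expr2 invfM.
have s'0 x : ~~ (0 < x < 1) -> s' x = 0.
  rewrite negb_and -!leNgt => /orP[x0|x1].
    by rewrite /s' !(flat_eq0 _ x0) !mul0r addr0.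
  have h : - 1 * x + 1 <= 0 by lra.
  rewrite /s' /den !(flat_eq0 _ h) addr0 mulr0 addr0.
  by field; rewrite gt_eqF // flat_gt0 //; lra.
have cs' : continuous s'.
  have Cs' : Ck 1 s'.
    have Cd : Ck 1 (fun x => (den x)^-1).
      apply: CkV => [x|]; first by rewrite gt_eqF.
      by apply: CkD; [exact: Ck_flat|exact: Ck_affine (Ck_flat _ _)].
    apply: CkD; first by apply: CkM => //; exact: Ck_flat.
    apply: CkM; first exact: Ck_flat.
    apply: CkM; first exact: Ck_cst.
    apply: CkM; first exact: CkM.
    apply: CkD; first exact: Ck_flat.
    by apply: CkM; [exact: Ck_cst|exact: Ck_affine (Ck_flat _ _)].
  by case: Cs' => f' df' _ x; exact: is_derive_cont (df' x).
have cn : {within `[0, 1], continuous (fun x => `|s' x|)}.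
  by apply: continuous_subspaceT => x; apply: cvg_norm; exact: cs'.
have [c _ hc] := EVT_max ler01 cn.
exists `|s' c| => //; exists s' => //; split=> // x.
have [x01|] := boolP (0 < x < 1); last by move/s'0 => ->; rewrite normr0.
by apply: hc; rewrite in_itv /=; case/andP: x01 => /ltW -> /ltW ->.
Qed.

End smooth_functions.

(** * Cut-off functions *)

Section cutoff.
Context {R : realType}.
Implicit Types c d x y z : R.

Definition step (c d x : R) : R := sstep (d^-1 * x + - c / d).
(** An approximate point mass: integral 1, support in [[c, c + d]], height at most [C / d]. *)
Definition dstep (c d : R) : R -> R := (step c d)^`()%classic.

Let stepE (c d x : R) : 0 < d -> d^-1 * x + - c / d = (x - c) / d.
Proof. by move=> d0; field; rewrite gt_eqF. Qed.

Lemma Ck_step n c d : Ck n (step c d).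
Proof. by apply: Ck_affine; exact: Ck_sstep. Qed.

Lemma step_bd c d x : 0 <= step c d x <= 1.
Proof. exact: sstep_bd. Qed.

Lemma step_eq0 c d x : 0 < d -> x <= c -> step c d x = 0.
Proof. by move=> d0 h; rewrite /step stepE // sstep_eq0 // ler_pdivrMr // mul0r subr_le0. Qed.

Lemma step_eq1 c d x : 0 < d -> c + d <= x -> step c d x = 1.
Proof. by move=> d0 h; rewrite /step stepE // sstep_eq1 // ler_pdivlMr //; lra. Qed.

Lemma is_derive_step c d (x : R) : is_derive x 1 (step c d) (dstep c d x).
Proof. by case: (Ck_step 1 c d) => f' df _; have h := df x; rewrite /dstep derive1E derive_val. Qed.

Lemma dstep_cont c d : continuous (dstep c d).
Proof.
case: (Ck_step 2 c d) => f' df [f2 df2 _].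
have -> : dstep c d = f' by apply/funext => x; have h := df x; rewrite /dstep derive1E derive_val.
move=> x; exact: is_derive_cont (df2 x).
Qed.

Lemma dstep_bd : exists2 C : R, 0 <= C & forall c d x, 0 < d ->
  `|dstep c d x| <= C / d /\ (~~ (c <= x <= c + d) -> dstep c d x = 0).
Proof.
have [C C0 [s' ds [s'C s'0]]] := @sstep_derive R.
exists C => // c d x d0.
have -> : dstep c d x = d^-1 * s' (d^-1 * x + - c / d).
  have h : is_derive x 1 (step c d) (d^-1 * s' (d^-1 * x + - c / d)) by apply: is_derive_affine; exact: ds.
  by rewrite /dstep derive1E derive_val.
split; first by rewrite normrM normfV (gtr0_norm d0) mulrC ler_wpM2r // invr_ge0 ltW.
rewrite stepE // => h; rewrite s'0 ?mulr0 //; apply: contra h => /andP[h1 h2].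
have h3 : 0 < x - c by move: h1; rewrite pmulr_lgt0 // invr_gt0.
by move: h2; rewrite ltr_pdivrMr // mul1r => h2; apply/andP; split; lra.
Qed.

(** Equal to 1 on [[y + 2 d, z - 2 d]] and to 0 off [[y + d, z - d]]; the outer margin [d] keeps the
    support inside the open interval. *)
Definition cutoff (y z d x : R) : R := step (y + d) d x - step (z - 2 * d) d x.

Lemma Ck_cutoff n y z d : Ck n (cutoff y z d).
Proof.
apply: CkD; first exact: Ck_step.
have := CkM (Ck_cst n (-1)) (Ck_step n (z - 2 * d) d).
by have -> : (fun x => -1 * step (z - 2 * d) d x) = (fun x => - step (z - 2 * d) d x)
  by apply/funext => x; rewrite mulN1r.
Qed.

Lemma cutoff_bd y z d x : 0 < d -> 4 * d <= z - y -> 0 <= cutoff y z d x <= 1.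
Proof.
move=> d0 h; rewrite /cutoff; have [/andP[p0 p1] /andP[q0 q1]] := (step_bd (y + d) d x, step_bd (z - 2 * d) d x).
have [h1|h1] := leP x (z - 2 * d); first by rewrite (step_eq0 d0 h1) subr0 p0.
by rewrite (@step_eq1 (y + d)) //; [apply/andP; split; lra|lra].
Qed.

Lemma cutoff_eq1 y z d x : 0 < d -> y + 2 * d <= x <= z - 2 * d -> cutoff y z d x = 1.
Proof. by move=> d0 /andP[h1 h2]; rewrite /cutoff step_eq1 ?step_eq0 ?subr0 //; lra. Qed.

Lemma cutoff_eq0 y z d x : 0 < d -> 4 * d <= z - y -> ~~ (y + d <= x <= z - d) -> cutoff y z d x = 0.
Proof.
move=> d0 h; rewrite negb_and -!ltNge => /orP[hx|hx]; rewrite /cutoff.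
  by rewrite !step_eq0 ?subrr //; lra.
by rewrite !step_eq1 ?subrr //; lra.
Qed.

Lemma is_derive_cutoff y z d (x : R) :
  is_derive x 1 (cutoff y z d) (dstep (y + d) d x - dstep (z - 2 * d) d x).
Proof. by apply: is_deriveB; exact: is_derive_step. Qed.

Lemma test_cutoff a b y z d (e : R -> R) : 0 < d -> 4 * d <= z - y -> a <= y -> z <= b ->
  (forall n, Ck n e) -> test_function a b (fun x => cutoff y z d x * e x).
Proof.
move=> d0 h ay zb Ce; split; first by apply: Ck_derivable => n; apply: CkM => //; exact: Ck_cutoff.
exists (y + d), (z - d); split; [lra|lra|] => x hx.
by rewrite cutoff_eq0 // mul0r.
Qed.

Lemma test_derive a b (e : R -> R) : test_function a b e -> test_function a b e^`()%classic.
Proof.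
move=> [de [c [d [ac db e0]]]]; split; first by move=> k x; rewrite -derive1Sn; exact: de.
exists c, d; split=> // x; rewrite negb_and -!ltNge => h.
rewrite derive1E; have -> : 0 = 'D_1 (fun=> 0 : R) x by rewrite derive_cst.
apply: near_eq_derive; case/orP: h => h; near=> z; rewrite e0 // negb_and -!ltNge.
  by apply/orP; left; near: z; exact: lt_nbhsl.
by apply/orP; right; near: z; exact: lt_nbhsr.
Unshelve. all: by end_near. Qed.

End cutoff.

(** * Integrals and weak derivatives *)

Section integrals.
Context {R : realType} (a b : R) (hab : a < b).

Local Notation leb := (@lebesgue_measure R).
Local Notation D := (`]a, b[%classic : set R).
Implicit Types f g : R -> R.

Definition rint f : Prop := leb.-integrable D (EFin \o f).
Definition rI f : R := \int[leb]_(x in D) f x.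

Let mD : measurable D. Proof. exact: measurable_itv. Qed.
Let lebD : leb D = (b - a)%:E.
Proof. by rewrite lebesgue_measure_itv /= lte_fin hab -EFinD. Qed.

Lemma rint_mf f : rint f -> measurable_fun D f.
Proof. by move=> /integrableP[/measurable_EFinP]. Qed.

Lemma rint_ext f g : (forall x, a < x < b -> f x = g x) -> rint f -> rint g.
Proof.
move=> fg; apply: eq_integrable => // x; rewrite inE /= in_itv /= => xD.
by rewrite fg.
Qed.

Lemma rI_ext f g : (forall x, a < x < b -> f x = g x) -> rI f = rI g.
Proof. by move=> fg; apply: eq_Rintegral => x; rewrite inE /= in_itv /=; exact: fg. Qed.

Lemma rintD f g : rint f -> rint g -> rint (fun x => f x + g x).
Proof. by move=> hf hg; exact: (@integrableD _ _ _ leb D mD (EFin \o f) (EFin \o g) hf hg). Qed.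

Lemma rIDE f g : rint f -> rint g -> rI (fun x => f x + g x) = rI f + rI g.
Proof. exact: RintegralD. Qed.

Lemma rintZ (c : R) f : rint f -> rint (fun x => c * f x).
Proof. by move=> hf; exact: (@integrableZl _ _ _ leb D mD c (EFin \o f) hf). Qed.

Lemma rIZE (c : R) f : rint f -> rI (fun x => c * f x) = c * rI f.
Proof. exact: RintegralZl. Qed.

Lemma rintN f : rint f -> rint (fun x => - f x).
Proof. by move=> hf; apply: rint_ext (rintZ (-1) hf) => x _; rewrite mulN1r. Qed.

Lemma rINE f : rint f -> rI (fun x => - f x) = - rI f.
Proof.
move=> hf; rewrite -mulN1r -rIZE //; apply: rI_ext => x _; by rewrite mulN1r.
Qed.

Lemma rintB f g : rint f -> rint g -> rint (fun x => f x - g x).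
Proof. by move=> hf hg; apply: rintD => //; exact: rintN. Qed.

Lemma rIBE f g : rint f -> rint g -> rI (fun x => f x - g x) = rI f - rI g.
Proof. by move=> hf hg; rewrite rIDE ?rINE //; exact: rintN. Qed.

Lemma rint_cst (c : R) : rint (fun=> c).
Proof.
apply: measurable_bounded_integrable => //; first by rewrite [X in (X < _)%E]lebD ltry.
by exists `|c|; split; [exact: num_real|move=> M hM x _ /=; exact: ltW].
Qed.

Lemma rI_cst (c : R) : rI (fun=> c) = c * (b - a).
Proof. by rewrite /rI Rintegral_cst // [X in fine X]lebD. Qed.

Lemma rint_le f g : measurable_fun D f -> rint g -> (forall x, a < x < b -> `|f x| <= g x) -> rint f.
Proof.
move=> mf hg fg; apply: (@le_integrable _ _ _ leb D mD (EFin \o f) (EFin \o g) _ _ hg); first exact/measurable_EFinP.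
move=> x /=; rewrite in_itv /= lee_fin => xD; apply: le_trans (fg x xD) _; exact: ler_norm.
Qed.

Lemma rI_le f g : rint f -> rint g -> (forall x, a < x < b -> f x <= g x) -> rI f <= rI g.
Proof. by move=> hf hg fg; apply: le_Rintegral => // x; rewrite /= in_itv /=; exact: fg. Qed.

Lemma rI_ge0 f : (forall x, a < x < b -> 0 <= f x) -> 0 <= rI f.
Proof. by move=> f0; apply: Rintegral_ge0 => x; rewrite /= in_itv /=; exact: f0. Qed.

Lemma rI_abs_le f g : rint f -> rint g -> (forall x, a < x < b -> `|f x| <= g x) -> `|rI f| <= rI g.
Proof.
move=> hf hg fg; rewrite ler_norml -rINE //.
apply/andP; split; apply: rI_le => //; first exact: rintN.
  by move=> x xD; have := fg x xD; rewrite ler_norml => /andP[].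
by move=> x xD; apply: le_trans (fg x xD); exact: ler_norm.
Qed.

Lemma mf_within f : {within `[a, b], continuous f} -> measurable_fun D f.
Proof.
move=> cf; apply: measurable_funS (subspace_continuous_measurable_fun _ cf) => //.
by apply: subset_itv; rewrite bnd_simp.
Qed.

Lemma rint_cont f : {within `[a, b], continuous f} -> rint f.
Proof.
move=> cf; apply: integrableS (continuous_compact_integrable (@segment_compact _ a b) cf) => //.
by apply: subset_itv; rewrite bnd_simp.
Qed.

Lemma within_bounded f : {within `[a, b], continuous f} ->
  exists2 M, 0 <= M & forall x, a <= x <= b -> `|f x| <= M.
Proof.
move=> cf; have cn : {within `[a, b], continuous (fun x => `|f x|)}.
  by move=> x; apply: cvg_norm; exact: cf.
have [c _ hc] := EVT_max (ltW hab) cn; exists `|f c| => // x xD; exact: hc.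
Qed.

Lemma rintM f g (M : R) : rint f -> measurable_fun D g -> (forall x, a < x < b -> `|g x| <= M) ->
  rint (fun x => f x * g x).
Proof.
move=> hf mg hM; apply: (rint_le (g := fun x => M * `|f x|)).
- by apply: measurable_funM => //; exact: rint_mf.
- apply: rintZ; exact: integrable_norm hf.
- by move=> x xD; rewrite normrM mulrC ler_wpM2r // hM.
Qed.

Lemma rI_ftc (F f : R -> R) : rC1 a b F f -> {within `[a, b], continuous f} -> rI f = F b - F a.
Proof.
move=> [cF dF] cf; have hi := rint_cont cf.
have hi2 : leb.-integrable `[a, b[ (EFin \o f).
  apply: integrableS (continuous_compact_integrable (@segment_compact _ a b) cf) => //.
  by apply: subset_itv; rewrite bnd_simp.
rewrite /rI Rintegral_itv_obnd_cbnd // Rintegral_itv_bndo_bndc //.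
have [_ c0 c1] := (continuous_within_itvP _ hab).1 cF.
rewrite /Rintegral (continuous_FTC2 hab cf (F := F)) //.
  by split=> // x xs; case: (dF x xs).
by move=> x xs; rewrite derive1E (@derive_val _ _ _ _ _ _ _ (dF x xs)).
Qed.

Implicit Types u v : R -> R[i].

Definition cib u : Prop := rint (fun x => complex.Re (u x)) /\ rint (fun x => complex.Im (u x)).
Definition cI u : R[i] := cint D u.

Lemma cib_ext u v : (forall x, a < x < b -> u x = v x) -> cib u -> cib v.
Proof. by move=> uv [h1 h2]; split; [apply: rint_ext h1|apply: rint_ext h2] => x xD; rewrite uv. Qed.

Lemma cI_ext u v : (forall x, a < x < b -> u x = v x) -> cI u = cI v.
Proof.
by move=> uv; rewrite /cI /cint; congr Complex; apply: rI_ext => x xD; rewrite uv.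
Qed.

Lemma cibD u v : cib u -> cib v -> cib (fun x => u x + v x).
Proof.
move=> [h1 h2] [k1 k2]; split.
  by apply: rint_ext (rintD h1 k1) => x _; rewrite ReD.
by apply: rint_ext (rintD h2 k2) => x _; rewrite ImD.
Qed.

Lemma cID u v : cib u -> cib v -> cI (fun x => u x + v x) = cI u + cI v.
Proof.
move=> [h1 h2] [k1 k2]; apply: complex_ext; rewrite ?ReD ?ImD /=.
  rewrite -[RHS](rIDE h1 k1); apply: rI_ext => x _; by rewrite ReD.
rewrite -[RHS](rIDE h2 k2); apply: rI_ext => x _; by rewrite ImD.
Qed.

Lemma cibZ (c : R[i]) u : cib u -> cib (fun x => c * u x).
Proof.
move=> [h1 h2]; split.
  apply: rint_ext (rintB (rintZ (complex.Re c) h1) (rintZ (complex.Im c) h2)) => x _; by rewrite ReM.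
apply: rint_ext (rintD (rintZ (complex.Re c) h2) (rintZ (complex.Im c) h1)) => x _; by rewrite ImM.
Qed.

Lemma cIZ (c : R[i]) u : cib u -> cI (fun x => c * u x) = c * cI u.
Proof.
move=> [h1 h2]; apply: complex_ext; rewrite ?ReM ?ImM /=.
  transitivity (rI (fun x => complex.Re c * complex.Re (u x) - complex.Im c * complex.Im (u x))).
    by apply: rI_ext => x _; rewrite ReM.
  by rewrite rIBE ?rIZE //; exact: rintZ.
transitivity (rI (fun x => complex.Re c * complex.Im (u x) + complex.Im c * complex.Re (u x))).
  by apply: rI_ext => x _; rewrite ImM.
by rewrite rIDE ?rIZE //; exact: rintZ.
Qed.

Lemma cibN u : cib u -> cib (fun x => - u x).
Proof. by move=> h; apply: cib_ext (cibZ (-1) h) => x _; rewrite mulN1r. Qed.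

Lemma cIN u : cib u -> cI (fun x => - u x) = - cI u.
Proof. by move=> h; rewrite -mulN1r -cIZ //; apply: cI_ext => x _; rewrite mulN1r. Qed.

Lemma cibB u v : cib u -> cib v -> cib (fun x => u x - v x).
Proof. by move=> hu hv; apply: cibD => //; exact: cibN. Qed.

Lemma cIB u v : cib u -> cib v -> cI (fun x => u x - v x) = cI u - cI v.
Proof. by move=> hu hv; rewrite cID ?cIN //; exact: cibN. Qed.

Lemma cib0 : cib (fun=> 0).
Proof. by split; exact: rint_cst. Qed.

Lemma cI0 : cI (fun=> 0) = 0.
Proof.
transitivity (cI (fun x => 0 * (fun=> 0) x)); first by apply: cI_ext => x _; rewrite mul0r.
by rewrite cIZ ?mul0r //; exact: cib0.
Qed.

Lemma cib_sum (I : Type) (r : seq I) (F : I -> R -> R[i]) : (forall i, cib (F i)) ->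
  cib (fun x => \sum_(i <- r) F i x) /\
  cI (fun x => \sum_(i <- r) F i x) = \sum_(i <- r) cI (F i).
Proof.
move=> h; elim: r => [|i r [ih1 ih2]].
  split; first by apply: cib_ext cib0 => x _; rewrite big_nil.
  transitivity (cI (fun=> 0)); first by apply: cI_ext => x _; rewrite big_nil.
  by rewrite cI0 big_nil.
split; first by apply: cib_ext (cibD (h i) ih1) => x _; rewrite big_cons.
by rewrite big_cons -ih2 -cID //; apply: cI_ext => x _; rewrite big_cons.
Qed.

Lemma cI_conj u : cib u -> cI (fun x => conjc (u x)) = conjc (cI u).
Proof.
move=> [h1 h2]; apply: complex_ext; rewrite ?Re_conj ?Im_conj /=.
  by apply: rI_ext => x _; rewrite Re_conj.
rewrite -[RHS](rINE h2); apply: rI_ext => x _; by rewrite Im_conj.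
Qed.

Lemma Re_cI u : complex.Re (cI u) = rI (fun x => complex.Re (u x)).
Proof. by []. Qed.

Lemma cnorm_rot (z : R[i]) : exists2 c : R[i], cnorm c <= 1 & c * z = (cnorm z)%:C%C.
Proof.
have [->|z0] := eqVneq z 0; first by exists 0; rewrite ?cnorm0 ?mulr0.
have n0 : cnorm z != 0 by apply/eqP => /cnorm_eq0 /eqP; rewrite (negPf z0).
have zz : conjc z * z = (cnorm z ^+ 2)%:C%C.
  by rewrite cnorm_sq; apply: complex_ext; rewrite ?ReM ?ImM ?Re_conj ?Im_conj /=; ring.
exists ((cnorm z)^-1%:C%C * conjc z).
  by rewrite cnormM cnorm_conj cnorm_real ger0_norm ?invr_ge0 // mulVf.
by rewrite -mulrA zz -rmorphM expr2 mulKf.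
Qed.

(** Multiplying by a phase makes the integral real and nonnegative; the inequality for real
    integrals then applies to the real part. *)
Lemma cI_le u g : cib u -> rint g -> (forall x, a < x < b -> cnorm (u x) <= g x) ->
  cnorm (cI u) <= rI g.
Proof.
move=> hu hg ug; have [c c1 hc] := cnorm_rot (cI u).
have -> : cnorm (cI u) = complex.Re (cI (fun x => c * u x)) by rewrite cIZ // hc.
rewrite Re_cI; apply: rI_le => //; first by case: (cibZ c hu).
move=> x xD; apply: le_trans (ler_norm _) (le_trans (Re_le_cnorm _) _).
rewrite cnormM; apply: le_trans (ug x xD); by rewrite ler_piMl.
Qed.

Lemma cib_cont u : ccontinuous_on `[a, b] u -> cib u.
Proof. by move=> [h1 h2]; split; exact: rint_cont. Qed.

Lemma cI_ftc (U u : R -> R[i]) : C1on a b U u -> ccontinuous_on `[a, b] u -> cI u = U b - U a.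
Proof.
move=> [h1 h2] [c1 c2]; apply: complex_ext; rewrite ?ReD ?ImD ?ReN ?ImN.
  exact: rI_ftc h1 c1.
exact: rI_ftc h2 c2.
Qed.

Definition cmul u (M : R) : Prop :=
  [/\ measurable_fun D (fun x => complex.Re (u x)), measurable_fun D (fun x => complex.Im (u x)) &
      forall x, a < x < b -> cnorm (u x) <= M].

Lemma cibM u v (M : R) : cib u -> cmul v M -> cib (fun x => u x * v x).
Proof.
move=> [h1 h2] [k1 k2 k3].
have b1 x : a < x < b -> `|complex.Re (v x)| <= M.
  by move=> xD; apply: le_trans (Re_le_cnorm _) (k3 x xD).
have b2 x : a < x < b -> `|complex.Im (v x)| <= M.
  by move=> xD; apply: le_trans (Im_le_cnorm _) (k3 x xD).
split.
  by apply: rint_ext (rintB (rintM h1 k1 b1) (rintM h2 k2 b2)) => x _; rewrite ReM.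
by apply: rint_ext (rintD (rintM h1 k2 b2) (rintM h2 k1 b1)) => x _; rewrite ImM.
Qed.

Lemma ccont_bounded u : ccontinuous_on `[a, b] u ->
  exists2 M, 0 <= M & forall x, a <= x <= b -> cnorm (u x) <= M.
Proof.
move=> [c1 c2]; have [M1 M10 h1] := within_bounded c1; have [M2 M20 h2] := within_bounded c2.
exists (M1 + M2) => [|x xD]; first exact: addr_ge0.
by apply: le_trans (cnorm_le_ReIm _) (lerD (h1 x xD) (h2 x xD)).
Qed.

Lemma cmul_cont u : ccontinuous_on `[a, b] u -> exists2 M, 0 <= M & cmul u M.
Proof.
move=> cu; have [M M0 hM] := ccont_bounded cu; case: (cu) => c1 c2; exists M => //.
split; [exact: mf_within|exact: mf_within|] => x /andP[h1 h2].
by apply: hM; rewrite !ltW.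
Qed.

Definition cL2 u : Prop :=
  [/\ measurable_fun D (fun x => complex.Re (u x)), measurable_fun D (fun x => complex.Im (u x)) &
      rint (fun x => cnorm (u x) ^+ 2)].
Definition sqn u : R := rI (fun x => cnorm (u x) ^+ 2).

Lemma sqn_ge0 u : 0 <= sqn u.
Proof. by apply: rI_ge0 => x _; rewrite sqr_ge0. Qed.

Lemma mf_cnorm2 u : measurable_fun D (fun x => complex.Re (u x)) ->
  measurable_fun D (fun x => complex.Im (u x)) -> measurable_fun D (fun x => cnorm (u x) ^+ 2).
Proof.
move=> h1 h2; have -> : (fun x => cnorm (u x) ^+ 2) =
   (fun x => complex.Re (u x) ^+ 2 + complex.Im (u x) ^+ 2) by apply/funext => x; rewrite cnorm_sq.
by apply: measurable_funD; exact: measurable_funX.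
Qed.

Lemma cL2_le u g : measurable_fun D (fun x => complex.Re (u x)) ->
  measurable_fun D (fun x => complex.Im (u x)) -> rint g ->
  (forall x, a < x < b -> cnorm (u x) ^+ 2 <= g x) -> cL2 u.
Proof.
move=> h1 h2 hg ug; split=> //; apply: rint_le (mf_cnorm2 h1 h2) hg _ => x xD.
by rewrite ger0_norm ?sqr_ge0 // ug.
Qed.

Lemma cL2_cib u : cL2 u -> cib u.
Proof.
move=> [h1 h2 h3]; have hg := rintD (rint_cst 1) h3.
have e (x : R) : cnorm (u x) <= 1 + cnorm (u x) ^+ 2.
  by have := cnorm_ge0 (u x); move: (cnorm _) => y y0; nra.
by split; apply: rint_le hg _ => // x _; apply: le_trans (e x); [exact: Re_le_cnorm|exact: Im_le_cnorm].
Qed.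

Lemma cnormD_sq (z w : R[i]) : cnorm (z + w) ^+ 2 <= 2 * cnorm z ^+ 2 + 2 * cnorm w ^+ 2.
Proof.
apply: le_trans (_ : (cnorm z + cnorm w) ^+ 2 <= _).
  by rewrite ler_sqr ?nnegrE ?addr_ge0 // cnormD.
by have := sqr_ge0 (cnorm z - cnorm w); rewrite sqrrB sqrrD; lra.
Qed.

Lemma cL2D u v : cL2 u -> cL2 v -> cL2 (fun x => u x + v x) /\ sqn (fun x => u x + v x) <= 2 * sqn u + 2 * sqn v.
Proof.
move=> [h1 h2 h3] [k1 k2 k3].
have hg := rintD (rintZ 2 h3) (rintZ 2 k3).
have huv : cL2 (fun x => u x + v x).
  apply: cL2_le hg _ => [||x _]; last exact: cnormD_sq.
  - have -> : (fun x => complex.Re (u x + v x)) = (fun x => complex.Re (u x) + complex.Re (v x)).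
      by apply/funext => x; rewrite ReD.
    exact: measurable_funD.
  - have -> : (fun x => complex.Im (u x + v x)) = (fun x => complex.Im (u x) + complex.Im (v x)).
      by apply/funext => x; rewrite ImD.
    exact: measurable_funD.
split=> //; have -> : 2 * sqn u + 2 * sqn v = rI (fun x => 2 * cnorm (u x) ^+ 2 + 2 * cnorm (v x) ^+ 2).
  by rewrite rIDE ?rIZE //; exact: rintZ.
by apply: rI_le => //; [case: huv|move=> x _; exact: cnormD_sq].
Qed.

Lemma cL2Z (c : R[i]) u : cL2 u -> cL2 (fun x => c * u x).
Proof.
move=> [h1 h2 h3]; apply: (cL2_le (g := fun x => cnorm c ^+ 2 * cnorm (u x) ^+ 2)).
- have -> : (fun x => complex.Re (c * u x)) =
      (fun x => complex.Re c * complex.Re (u x) - complex.Im c * complex.Im (u x)).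
    by apply/funext => x; rewrite ReM.
  by apply: measurable_funB; exact: measurable_funM.
- have -> : (fun x => complex.Im (c * u x)) =
      (fun x => complex.Re c * complex.Im (u x) + complex.Im c * complex.Re (u x)).
    by apply/funext => x; rewrite ImM.
  by apply: measurable_funD; exact: measurable_funM.
- exact: rintZ.
- by move=> x _; rewrite cnormM exprMn.
Qed.

Lemma cL2B u v : cL2 u -> cL2 v -> cL2 (fun x => u x - v x).
Proof.
move=> hu hv; have [h _] := cL2D hu (cL2Z (-1) hv).
by have <- : (fun x => u x + -1 * v x) = (fun x => u x - v x) by apply/funext => x; rewrite mulN1r.
Qed.

Lemma cL2_cont u : ccontinuous_on `[a, b] u -> cL2 u.
Proof.
move=> cu; have [M M0 [h1 h2 h3]] := cmul_cont cu.
apply: (cL2_le (g := fun=> M ^+ 2)) => //; first exact: rint_cst.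
by move=> x xD; rewrite ler_sqr ?nnegrE ?h3.
Qed.

End integrals.

(** * Weak derivatives tested by cut-offs *)

Section weak_derivatives.
Context {R : realType} (a b : R) (hab : a < b).

Local Notation leb := (@lebesgue_measure R).
Local Notation D := (`]a, b[%classic : set R).
Local Notation rint := (rint a b).
Local Notation rI := (rI a b).
Local Notation cib := (cib a b).
Local Notation cI := (cI a b).
Local Notation cL2 := (cL2 a b).
Local Notation sqn := (sqn a b).
Implicit Types (f g : R -> R) (u v w : R -> R[i]) (c d x y z p : R).

Lemma within_delta f (A : set R) p : {within A, continuous f} -> A p ->
  forall e, 0 < e -> exists2 d, 0 < d & forall x, A x -> `|x - p| < d -> `|f x - f p| <= e.
Proof.
move=> /subspace_continuousP cf Ap e e0.
have /cvgrPdist_le /(_ e e0) := cf p Ap.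
rewrite near_withinE => /nbhs_ballP[d /= d0 hd]; exists d => // x Ax xp.
have px : ball p d x by rewrite /ball /= distrC.
by have := hd x px Ax; rewrite distrC.
Qed.

Lemma ccontD u v : ccontinuous_on `[a, b] u -> ccontinuous_on `[a, b] v ->
  ccontinuous_on `[a, b] (fun x => u x + v x).
Proof.
move=> [u1 u2] [v1 v2]; split.
  have -> : (fun x => complex.Re (u x + v x)) = (fun x => complex.Re (u x) + complex.Re (v x)).
    by apply/funext => x; rewrite ReD.
  by move=> x; apply: cvgD; [exact: u1|exact: v1].
have -> : (fun x => complex.Im (u x + v x)) = (fun x => complex.Im (u x) + complex.Im (v x)).
  by apply/funext => x; rewrite ImD.
by move=> x; apply: cvgD; [exact: u2|exact: v2].
Qed.

Lemma ccontM u v : ccontinuous_on `[a, b] u -> ccontinuous_on `[a, b] v ->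
  ccontinuous_on `[a, b] (fun x => u x * v x).
Proof.
move=> [u1 u2] [v1 v2]; split.
  have -> : (fun x => complex.Re (u x * v x)) =
      (fun x => complex.Re (u x) * complex.Re (v x) - complex.Im (u x) * complex.Im (v x)).
    by apply/funext => x; rewrite ReM.
  by move=> x; apply: cvgB; apply: cvgM; [exact: u1|exact: v1|exact: u2|exact: v2].
have -> : (fun x => complex.Im (u x * v x)) =
    (fun x => complex.Re (u x) * complex.Im (v x) + complex.Im (u x) * complex.Re (v x)).
  by apply/funext => x; rewrite ImM.
by move=> x; apply: cvgD; apply: cvgM; [exact: u1|exact: v2|exact: u2|exact: v1].
Qed.

Lemma ccont_cst (k : R[i]) : ccontinuous_on `[a, b] (fun=> k).
Proof. by split=> x; exact: cvg_cst. Qed.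

Lemma ccontB u v : ccontinuous_on `[a, b] u -> ccontinuous_on `[a, b] v ->
  ccontinuous_on `[a, b] (fun x => u x - v x).
Proof.
move=> hu hv; have := ccontD hu (ccontM (ccont_cst (-1)) hv).
by have -> : (fun x => u x + -1 * v x) = (fun x => u x - v x) by apply/funext => x; rewrite mulN1r.
Qed.

Lemma ccont_real f : continuous f -> ccontinuous_on `[a, b] (fun x => (f x)%:C%C).
Proof. by move=> cf; split; [exact: continuous_subspaceT|move=> x; exact: cvg_cst]. Qed.

Lemma cL2M u v (M : R) : cL2 u -> cmul a b v M -> cL2 (fun x => u x * v x).
Proof.
move=> [h1 h2 h3] [k1 k2 k3]; apply: (cL2_le (g := fun x => M ^+ 2 * cnorm (u x) ^+ 2)).
- have -> : (fun x => complex.Re (u x * v x)) =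
      (fun x => complex.Re (u x) * complex.Re (v x) - complex.Im (u x) * complex.Im (v x)).
    by apply/funext => x; rewrite ReM.
  by apply: measurable_funB; exact: measurable_funM.
- have -> : (fun x => complex.Im (u x * v x)) =
      (fun x => complex.Re (u x) * complex.Im (v x) + complex.Im (u x) * complex.Re (v x)).
    by apply/funext => x; rewrite ImM.
  by apply: measurable_funD; exact: measurable_funM.
- exact: rintZ.
- move=> x xD; rewrite cnormM exprMn mulrC ler_wpM2r ?sqr_ge0 //.
  by rewrite ler_sqr ?nnegrE ?k3 //; apply: le_trans (k3 x xD).
Qed.

Lemma rint_ind c d : rint (\1_`[c, d]) /\ (c <= d -> rI (\1_`[c, d]) <= d - c).
Proof.
have h : rint (\1_`[c, d]).
  apply: rint_le (rint_cst hab 1) _; first by apply: measurable_indic; exact: measurable_itv.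
  by move=> x _; rewrite indicE; case: (_ \in _); rewrite /= ?normr1 ?normr0.
split=> // cd; rewrite /rI /Rintegral.
have h1 : leb `[c, d]%classic = (d - c)%:E.
  by rewrite lebesgue_measure_itv /= lte_fin; move: cd; rewrite le_eqVlt => /predU1P[->|->]; rewrite ?ltxx ?subrr ?EFinB.
have h2 : (\int[leb]_(x in D) (\1_`[c, d] x)%:E = leb (`[c, d]%classic `&` D))%E.
  by apply: integral_indic; exact: measurable_itv.
have h3 : (leb (`[c, d]%classic `&` D) <= (d - c)%:E)%E.
  by rewrite -h1; apply: le_measure; rewrite ?inE; [apply: measurableI; exact: measurable_itv|exact: measurable_itv|move=> x []].
rewrite h2 -[leRHS]/(fine (d - c)%:E); apply: fine_le => //.
rewrite ge0_fin_numE //; exact: le_lt_trans h3 (ltry _).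
Qed.

Lemma rint_dstep c d : 0 < d -> a <= c -> c + d <= b -> rint (dstep c d) /\ rI (dstep c d) = 1.
Proof.
move=> d0 ac db.
have cb : {within `[a, b], continuous (dstep c d)}.
  by apply: continuous_subspaceT; exact: dstep_cont.
split; first exact: rint_cont.
have -> : rI (dstep c d) = step c d b - step c d a; last by rewrite step_eq1 // step_eq0 // subr0.
apply: (rI_ftc hab _ cb); split; last by move=> x _; exact: is_derive_step.
by apply: continuous_subspaceT => x; exact: is_derive_cont (is_derive_step c d x).
Qed.

(** Height [C / d] times width [d] is bounded, so the kernel averages [f] near [p] with an error of
    at most [C] times its oscillation. Dividing by [C + 1] instead of [C] covers [C = 0]. *)
Lemma dstep_lim_real f p : {within `[a, b], continuous f} -> a <= p <= b ->
  forall e, 0 < e -> exists2 r, 0 < r & forall c d, 0 < d -> a <= c -> c + d <= b ->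
    p - r < c -> c + d < p + r -> `|rI (fun x => f x * dstep c d x) - f p| <= e.
Proof.
move=> cf pab e e0; have [C C0 hC] := @dstep_bd R.
have e1 : 0 < e / (C + 1) by rewrite divr_gt0 // ltr_wpDl.
have pab' : (`[a, b]%classic : set R) p by rewrite /= in_itv.
have [r r0 hr] := within_delta cf pab' e1; exists r => // c d d0 ac db pc pd.
have [hb hb1] := rint_dstep d0 ac db.
have cb : measurable_fun D (dstep c d) by exact: rint_mf hb.
have bM x : a < x < b -> `|dstep c d x| <= C / d by move=> _; case: (hC c d x d0).
have hf := rint_cont cf.
have hfb : rint (fun x => f x * dstep c d x) by exact: rintM cb bM.
have -> : rI (fun x => f x * dstep c d x) - f p = rI (fun x => f x * dstep c d x - f p * dstep c d x).
  by rewrite rIBE // ?rIZE // ?hb1 ?mulr1 //; exact: rintZ.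
have [hi hi1] := rint_ind c (c + d).
apply: le_trans (_ : rI (fun x => (e / (C + 1) * (C / d)) * \1_`[c, c + d] x) <= _).
  apply: rI_abs_le => //; first by apply: rintB => //; exact: rintZ.
    exact: rintZ.
  move=> x /andP[ax xb]; rewrite -mulrBl normrM.
  have [b1 b2] := hC c d x d0; rewrite indicE.
  have [xin|xout] := boolP (x \in `[c, c + d]).
    have -> : (x \in (`[c, c + d]%classic : set R)) = true by rewrite mem_setE.
    rewrite mulr1; apply: ler_pM => //; apply: hr; first by rewrite /= in_itv /= !ltW.
    by move: xin; rewrite in_itv /= ltr_distl => /andP[h1 h2]; apply/andP; split; lra.
  have -> : (x \in (`[c, c + d]%classic : set R)) = false by rewrite mem_setE (negbTE xout).
  by rewrite b2 ?normr0 ?mulr0 //; move: xout; rewrite in_itv.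
rewrite rIZE //.
have h : c <= c + d by lra.
apply: le_trans (ler_wpM2l _ (hi1 h)) _; first by apply: mulr_ge0; [exact: ltW|apply: divr_ge0 => //; exact: ltW].
have C1 : 0 < C + 1 by lra.
have -> : e / (C + 1) * (C / d) * (c + d - c) = e * C / (C + 1) by field; rewrite !gt_eqF.
by rewrite ler_pdivrMr // ler_wpM2l ?(ltW e0) //; lra.
Qed.

Lemma dstep_lim u p : ccontinuous_on `[a, b] u -> a <= p <= b ->
  forall e, 0 < e -> exists2 r, 0 < r & forall c d, 0 < d -> a <= c -> c + d <= b ->
    p - r < c -> c + d < p + r -> cnorm (cI (fun x => u x * (dstep c d x)%:C%C) - u p) <= e.
Proof.
move=> [c1 c2] pab e e0; have e2 : 0 < e / 2 by rewrite divr_gt0.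
have [r1 r10 h1] := dstep_lim_real c1 pab e2; have [r2 r20 h2] := dstep_lim_real c2 pab e2.
exists (Num.min r1 r2) => [|c d d0 ac cb hc hd]; first by rewrite lt_min r10.
have [hr1 hr2] : Num.min r1 r2 <= r1 /\ Num.min r1 r2 <= r2 by rewrite !ge_min !lexx orbT.
apply: le_trans (cnorm_le_ReIm _) _; rewrite ReD ImD ReN ImN (splitr e); apply: lerD.
  rewrite Re_cI (@rI_ext _ a b _ (fun x => complex.Re (u x) * dstep c d x)).
    by apply: h1 => //; lra.
  by move=> x _; rewrite ReM /= mulr0 subr0.
rewrite -[complex.Im (cI _)]/(rI _) (@rI_ext _ a b _ (fun x => complex.Im (u x) * dstep c d x)).
  by apply: h2 => //; lra.
by move=> x _; rewrite ImM /= mulr0 add0r.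
Qed.

Lemma cib_dstep u c d : cib u -> 0 < d -> cib (fun x => u x * (dstep c d x)%:C%C).
Proof.
move=> hu d0; have [M _ hM] := cmul_cont hab (ccont_real (@dstep_cont R c d)).
exact: cibM hu hM.
Qed.

Definition dcutoff y z d x : R := dstep (y + d) d x - dstep (z - 2 * d) d x.

(** The derivative of a cut-off is a unit bump near [y] minus one near [z]. A continuous [u] tested
    against it yields its values at these points in the limit. *)
Lemma cutoff_lim u y z : ccontinuous_on `[a, b] u -> a <= y -> y < z -> z <= b ->
  forall e, 0 < e -> exists2 r, 0 < r & forall d, 0 < d -> d < r ->
    cnorm (cI (fun x => u x * (dcutoff y z d x)%:C%C) - (u y - u z)) <= e.
Proof.
move=> cu ay yz zb e e0; have e2 : 0 < e / 2 by rewrite divr_gt0.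
have hy : a <= y <= b by apply/andP; split; lra.
have hz : a <= z <= b by apply/andP; split; lra.
have [r1 r10 h1] := dstep_lim cu hy e2; have [r2 r20 h2] := dstep_lim cu hz e2.
exists (Num.min (Num.min r1 r2) (z - y) / 4) => [|d d0 hd]; first by rewrite divr_gt0 // !lt_min r10 r20 subr_gt0.
have [hr1 hr2 hr3] : [/\ 4 * d < r1, 4 * d < r2 & 4 * d < z - y].
  by move: hd; rewrite ltr_pdivlMr // !lt_min => /andP[/andP[? ?] ?]; split; lra.
have hu := cib_cont cu.
have -> : cI (fun x => u x * (dcutoff y z d x)%:C%C) =
    cI (fun x => u x * (dstep (y + d) d x)%:C%C) - cI (fun x => u x * (dstep (z - 2 * d) d x)%:C%C).
  rewrite -cIB; [|exact: cib_dstep|exact: cib_dstep].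
  by apply: cI_ext => x _; rewrite /dcutoff rmorphB mulrBr.
have ac (A B C E : R[i]) : A - B - (C - E) = (A - C) - (B - E) by ring.
rewrite ac.
apply: le_trans (cnormB _ _) _; rewrite (splitr e); apply: lerD; [apply: h1|apply: h2] => //; lra.
Qed.

(** The first-order relation between consecutive weak derivatives (see [weak_deriv_wd]), without the
    integrability clauses. *)
Definition wd u v : Prop := forall eta, test_function a b eta ->
  cI (fun x => u x * (eta^`()%classic x)%:C%C) = - cI (fun x => v x * (eta x)%:C%C).

Lemma cutoff_cont y z d : continuous (cutoff y z d).
Proof. by move=> x; exact: is_derive_cont (is_derive_cutoff y z d x). Qed.

Lemma Ck1 n : Ck n (fun=> 1 : R). Proof. exact: Ck_cst. Qed.

(** Testing with a cut-off of [[y, z]] gives [u y - u z] on one side, in the limit, and on the other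
    an integral of [v] over an interval of length at most [z - y]. *)
Lemma wd_lipschitz u v (M : R) : ccontinuous_on `[a, b] u -> cib v ->
  (forall x, a < x < b -> cnorm (v x) <= M) -> wd u v ->
  forall y z, a <= y -> y <= z -> z <= b -> cnorm (u y - u z) <= M * (z - y).
Proof.
move=> cu hv vM huv y z ay; rewrite le_eqVlt => /predU1P[->|yz] zb.
  by rewrite !subrr mulr0 cnorm0.
have M0 : 0 <= M.
  have h : a < (a + b) / 2 < b by apply/andP; split; lra.
  exact: le_trans (cnorm_ge0 _) (vM _ h).
apply/ler_addgt0Pr => e e0; have [r r0 hr] := cutoff_lim cu ay yz zb e0.
pose d := Num.min r (z - y) / 4.
have d0 : 0 < d by rewrite divr_gt0 // lt_min r0 subr_gt0.
have [dr dzy] : 4 * d <= r /\ 4 * d <= z - y.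
  by rewrite /d mulrC divfK ?pnatr_eq0 // !ge_min !lexx orbT.
have hd : d < r by lra.
rewrite -[u y - u z](subKr (cI (fun x => u x * (dcutoff y z d x)%:C%C))).
apply: le_trans (cnormB _ _) (lerD _ (hr d d0 hd)).
have te := test_cutoff d0 dzy ay zb Ck1.
have he : (fun x => cutoff y z d x * 1) = cutoff y z d by apply/funext => x; rewrite mulr1.
rewrite he in te; have := huv _ te.
have -> : (cutoff y z d)^`()%classic = dcutoff y z d.
  by apply/funext => x; have h := is_derive_cutoff y z d x; rewrite derive1E derive_val.
move=> ->; rewrite cnormN.
have [hi hi1] := rint_ind y z.
apply: le_trans (_ : rI (fun x => M * \1_`[y, z] x) <= _).
  apply: cI_le; [|exact: rintZ|].
    have [K _ hK] := cmul_cont hab (ccont_real (cutoff_cont (y := y) (z := z) (d := d))).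
    exact: cibM hv hK.
  move=> x xD; rewrite cnormM cnorm_real.
  have /andP[c0 c1] := cutoff_bd x d0 dzy; rewrite (ger0_norm c0).
  rewrite indicE; have [xin|xout] := boolP (x \in `[y, z]).
    have -> : (x \in (`[y, z]%classic : set R)) = true by rewrite mem_setE.
    by rewrite mulr1; apply: le_trans (ler_piMr (cnorm_ge0 _) c1) (vM x xD).
  rewrite cutoff_eq0 ?mulr0 ?mulr_ge0 //; apply: contra xout => /andP[h1 h2].
  by rewrite in_itv /=; apply/andP; split; lra.
by rewrite rIZE // ler_wpM2l // hi1 ?ltW.
Qed.

(** [w] is only square integrable, so on the boundary layers, of total width [4 d], its modulus [W]
    is split by [W <= t W^2 + 1 / (4 t)]. The choice of [t] makes the first part small, then [d] the
    second. *)
Lemma cutoff_one_lim w : cL2 w -> forall e, 0 < e -> exists2 r, 0 < r & forall d, 0 < d -> d < r ->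
  4 * d <= b - a /\ cnorm (cI (fun x => w x * (cutoff a b d x)%:C%C) - cI w) <= e.
Proof.
move=> hw e e0; have [_ _ hw2] := hw; have S0 := sqn_ge0 a b w.
pose t := e / (2 * (sqn w + 1)).
have t0 : 0 < t by rewrite divr_gt0 // mulr_gt0 // ltr_wpDl.
exists (Num.min (b - a) (e * t) / 4) => [|d d0 hd].
  by rewrite divr_gt0 // lt_min subr_gt0 hab mulr_gt0.
have [h1 h2] : 4 * d < b - a /\ 4 * d < e * t.
  by move: hd; rewrite ltr_pdivlMr // lt_min => /andP[? ?]; split; lra.
split; first exact: ltW.
have [K _ hK] := cmul_cont hab (ccont_real (cutoff_cont (y := a) (z := b) (d := d))).
have hwc := cibM (cL2_cib hab hw) hK.
rewrite -cIB //; last exact: cL2_cib.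
have [i1 j1] := rint_ind a (a + 2 * d); have [i2 j2] := rint_ind (b - 2 * d) b.
have {}j1 : rI (\1_`[a, a + 2 * d]) <= 2 * d by apply: le_trans (j1 _) _; lra.
have {}j2 : rI (\1_`[b - 2 * d, b]) <= 2 * d by apply: le_trans (j2 _) _; lra.
have q0 : 0 <= (4 * t)^-1 by rewrite invr_ge0 mulr_ge0 // ltW.
have hs := rintZ (4 * t)^-1 (rintD i1 i2).
have hg := rintD (rintZ t hw2) hs.
apply: le_trans (cI_le _ hg _) _.
- by apply: cibB => //; exact: cL2_cib.
- move=> x xD; have := xD => /andP[ax xb].
  have ac (W : R[i]) (k : R) : W * k%:C%C - W = W * (k - 1)%:C%C.
    by apply: complex_ext; rewrite !(ReM, ImM, ReD, ImD, ReN, ImN) /=; ring.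
  rewrite ac.
  rewrite cnormM cnorm_real; set W := cnorm (w x).
  have W0 : 0 <= W by exact: cnorm_ge0.
  have [hin|hout] := boolP (a + 2 * d <= x <= b - 2 * d).
    rewrite cutoff_eq1 // subrr normr0 mulr0.
    have p1 : 0 <= t * W ^+ 2 by rewrite mulr_ge0 ?sqr_ge0 ?(ltW t0).
    have p2 : 0 <= (4 * t)^-1 * (\1_`[a, a + 2 * d] x + \1_`[b - 2 * d, b] x).
      by apply: mulr_ge0 => //; apply: addr_ge0; rewrite indicE.
    exact: addr_ge0.
  have -> : (\1_`[a, a + 2 * d] x + \1_`[b - 2 * d, b] x : R) = 1 + ((\1_`[a, a + 2 * d] x + \1_`[b - 2 * d, b] x) - 1) by ring.
  have /andP[c0 c1] := cutoff_bd x d0 (ltW h1).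
  apply: le_trans (_ : W * 1 <= _).
    by apply: ler_wpM2l => //; rewrite ler_norml; apply/andP; split; lra.
  have k0 : 0 <= (\1_`[a, a + 2 * d] x + \1_`[b - 2 * d, b] x) - 1 :> R.
    rewrite subr_ge0 !indicE; move: hout; rewrite negb_and -!ltNge => /orP[h|h].
      have -> : (x \in (`[a, a + 2 * d]%classic : set R)) = true.
        by rewrite mem_setE in_itv /= !ltW.
      by rewrite lerDl.
    have -> : (x \in (`[b - 2 * d, b]%classic : set R)) = true.
      by rewrite mem_setE in_itv /= !ltW.
    by rewrite lerDr.
  apply: le_trans (_ : t * W ^+ 2 + (4 * t)^-1 * 1 <= _); last first.
    by rewrite lerD2l ler_wpM2l // lerDl.
  rewrite !mulr1 -subr_ge0 (_ : _ - _ = (2 * t * W - 1) ^+ 2 / (4 * t)); last by field; rewrite gt_eqF.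
  by rewrite mulr_ge0 ?sqr_ge0.
have i12 := rintD i1 i2.
rewrite rIDE ?rIZE ?rIDE //; last exact: rintZ.
apply: le_trans (_ : e / 2 + (4 * t)^-1 * (e * t) <= _).
  apply: lerD.
    rewrite /t -/(sqn w) mulrAC ler_pdivrMr ?mulr_gt0 ?ltr_wpDl //.
    by rewrite mulrA divfK // ler_wpM2l ?(ltW e0) //; lra.
  by rewrite ler_wpM2l //; lra.
have -> : e / 2 + (4 * t)^-1 * (e * t) = e * (3 / 4) by field; rewrite gt_eqF.
lra.
Qed.

Lemma small_eq0 (k : R[i]) : (forall e, 0 < e -> cnorm k <= e) -> k = 0.
Proof.
move=> h; apply: cnorm_eq0; apply/eqP; rewrite eq_le cnorm_ge0 andbT.
by apply/ler_addgt0Pr => e e0; rewrite add0r h.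
Qed.

(** Orthogonality to compactly supported test functions extends to every smooth [e], such as cosine
    and sine, by letting the cut-off tend to 1. *)
Lemma weak_zero w (e : R -> R) : cL2 w -> (forall n, Ck n e) ->
  (forall eta, test_function a b eta -> cI (fun x => w x * (eta x)%:C%C) = 0) ->
  cI (fun x => w x * (e x)%:C%C) = 0.
Proof.
move=> hw Ce h0; apply: small_eq0 => t t0.
have ce : continuous e by case: (Ce 1%N) => f' df _ x; exact: is_derive_cont (df x).
have [K _ hK] := cmul_cont hab (ccont_real ce).
have [r r0 hr] := cutoff_one_lim (cL2M hw hK) t0.
have r2 : 0 < r / 2 by lra.
have r2r : r / 2 < r by lra.
have [d4 h] := hr _ r2 r2r.
have := h0 _ (test_cutoff r2 d4 (lexx a) (lexx b) Ce) => hz.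
rewrite -[X in cnorm X](subKr 0) !sub0r cnormN.
apply: le_trans h; rewrite le_eqVlt; apply/orP; left; apply/eqP; congr cnorm.
have -> : cI (fun x => w x * (e x)%:C%C * (cutoff a b (r / 2) x)%:C%C) = 0.
  rewrite -hz; apply: cI_ext => x _; by rewrite -mulrA -rmorphM [e x * _]mulrC.
by rewrite sub0r.
Qed.

(** The test function is [e] times a cut-off. As the layers shrink, the derivative of the cut-off
    produces the two boundary values, and the cut-off disappears from the other integrals. *)
Lemma wd_by_parts u v (e e' : R -> R) : ccontinuous_on `[a, b] u -> cL2 v -> wd u v ->
  (forall n, Ck n e) -> (forall x : R, is_derive x 1 e (e' x)) -> (forall n, Ck n e') ->
  cI (fun x => v x * (e x)%:C%C) =
  u b * (e b)%:C%C - u a * (e a)%:C%C - cI (fun x => u x * (e' x)%:C%C).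
Proof.
move=> cu hv huv Ce de Ce'; apply/eqP; rewrite -subr_eq0; apply/eqP; apply: small_eq0 => t t0.
have ce : continuous e by move=> x; exact: is_derive_cont (de x).
have ce' : continuous e' by case: (Ce' 1%N) => f' df _ x; exact: is_derive_cont (df x).
have [K _ hK] := cmul_cont hab (ccont_real ce).
have [K' _ hK'] := cmul_cont hab (ccont_real ce').
have cue := ccontM cu (ccont_real ce).
have t3 : 0 < t / 3 by rewrite divr_gt0.
have [r1 r10 h1] := cutoff_lim cue (lexx a) hab (lexx b) t3.
have hu := cL2_cont hab cu.
have hve := cL2M hv hK; have hue := cL2M hu hK'.
have [r2 r20 h2] := cutoff_one_lim hve t3.
have [r3 r30 h3] := cutoff_one_lim hue t3.
pose d := Num.min r1 (Num.min r2 r3) / 2.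
have d0 : 0 < d by rewrite divr_gt0 // !lt_min r10 r20.
have [d1 [d2 d3]] : d < r1 /\ (d < r2 /\ d < r3).
  have : d < Num.min r1 (Num.min r2 r3) by move: d0; rewrite /d; lra.
  by rewrite !lt_min => /andP[-> /andP[-> ->]].
have {}h1 := h1 d d0 d1; have [d4 {}h2] := h2 d d0 d2; have [_ {}h3] := h3 d d0 d3.
have := huv _ (test_cutoff d0 d4 (lexx a) (lexx b) Ce).
have [Kd _ hKd] := cmul_cont hab (ccont_real (cutoff_cont (y := a) (z := b) (d := d))).
have cdc : continuous (dcutoff a b d).
  by move=> x; apply: cvgB; exact: dstep_cont.
have [Kc _ hKc] := cmul_cont hab (ccont_real cdc).
have E x : (fun x => cutoff a b d x * e x)^`()%classic x = dcutoff a b d x * e x + cutoff a b d x * e' x.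
  have h := is_derive_mul (is_derive_cutoff a b d x) (de x).
  by rewrite derive1E derive_val.
have -> : cI (fun x => u x * ((fun x => cutoff a b d x * e x)^`()%classic x)%:C%C) =
   cI (fun x => u x * (e x)%:C%C * (dcutoff a b d x)%:C%C) + cI (fun x => u x * (e' x)%:C%C * (cutoff a b d x)%:C%C).
  rewrite -cID; [| |].
  - by apply: cI_ext => x _; rewrite E rmorphD !rmorphM; ring.
  - by apply: cibM (cib_cont cue) hKc.
  - by apply: cibM (cL2_cib hab hue) hKd.
have -> : cI (fun x => v x * (cutoff a b d x * e x)%:C%C) = cI (fun x => v x * (e x)%:C%C * (cutoff a b d x)%:C%C).
  by apply: cI_ext => x _; rewrite rmorphM; ring.
move: h1 h2 h3; set A1 := cI _; set A2 := cI _; set A3 := cI _; set A4 := cI _; set A5 := cI _ => h1 h2 h3 hs.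
rewrite [X in cnorm X](_ : _ = - (A1 - (u a * (e a)%:C%C - u b * (e b)%:C%C)) - (A2 - A3) - (A4 - A5) + (A1 + A4 + A2)); last by ring.
rewrite hs addNr addr0.
apply: le_trans (cnormB _ _) (le_trans (lerD (cnormB _ _) (lexx _)) _); rewrite cnormN; lra.
Qed.

End weak_derivatives.

(** * Fourier series *)

Section fourier_series.
Context {R : realType} (a b : R) (hab : a < b).

Local Notation leb := (@lebesgue_measure R).
Local Notation D := (`]a, b[%classic : set R).
Local Notation mu := (mu a b).
Local Notation rint := (rint a b).
Local Notation rI := (rI a b).
Local Notation cib := (cib a b).
Local Notation cI := (cI a b).
Local Notation cL2 := (cL2 a b).
Local Notation sqn := (sqn a b).
Implicit Types (u v w g : R -> R[i]) (x y z : R) (l m : int) (c : int -> R[i]) (r : seq int).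

Let ba0 : 0 < b - a. Proof. by rewrite subr_gt0. Qed.
Let ba1 : b - a != 0. Proof. by rewrite gt_eqF. Qed.

Definition emode l x : R[i] := expi (mu l * (x - a)).

Lemma exD l m x : emode (l + m) x = emode l x * emode m x.
Proof. by rewrite /emode muD mulrDl expiD. Qed.
Lemma exN l x : emode (- l) x = conjc (emode l x).
Proof. by rewrite /emode muN mulNr expiN. Qed.
Lemma ex0 x : emode 0 x = 1.
Proof. by rewrite /emode mu0 mul0r expi0. Qed.
Lemma ex_a l : emode l a = 1.
Proof. by rewrite /emode subrr mulr0 expi0. Qed.
Lemma ex_b l : emode l b = 1.
Proof. by rewrite /emode /Defs.mu divfK // expi_period. Qed.
Lemma cnorm_ex l x : cnorm (emode l x) = 1.
Proof. exact: cnorm_expi. Qed.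

Lemma C1on_ex l : C1on a b (emode l) (fun x => 'i%C * (mu l)%:C%C * emode l x).
Proof.
have h := C1onZ (expi (- (mu l * a))) (C1on_expi a b (mu l)).
have e x : expi (- (mu l * a)) * expi (mu l * x) = emode l x.
  by rewrite -expiD /emode; congr expi; ring.
by apply: (C1on_ext h) => x *; rewrite -e // mulrCA.
Qed.

Lemma ccont_ex l : ccontinuous_on `[a, b] (emode l).
Proof. by have [[h1 _] [h2 _]] := C1on_ex l. Qed.

Lemma cmul_ex l : cmul a b (emode l) 1.
Proof.
have [K _ [h1 h2 _]] := cmul_cont hab (ccont_ex l).
by split=> // x _; rewrite cnorm_ex.
Qed.

Lemma cI_ex l : cI (emode l) = (if l == 0 then b - a else 0)%:C%C.
Proof.
have [->|l0] := eqVneq l 0.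
  rewrite (@cI_ext _ a b _ (fun=> 1)); last by move=> x _; rewrite ex0.
  apply: complex_ext; first by rewrite Re_cI rI_cst // mul1r.
  by rewrite -[LHS]/(rI (fun=> 0)) rI_cst // mul0r.
have h := C1on_ex l.
have k0 : 'i%C * (mu l)%:C%C != 0 :> R[i].
  apply/eqP => /(congr1 cnorm); rewrite cnormM cnorm_i mul1r cnorm_real cnorm0 => /eqP.
  rewrite normr_eq0 /Defs.mu !mulf_eq0 invr_eq0 (negPf ba1) intr_eq0 (negPf l0) !orbF.
  by rewrite pnatr_eq0 /= gt_eqF // pi_gt0.
have hk : cI (fun x => 'i%C * (mu l)%:C%C * emode l x) = 0.
  rewrite (cI_ftc hab h); first by rewrite ex_a ex_b subrr.
  exact: ccontM (ccont_cst _ _ _) (ccont_ex l).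
move: hk; rewrite cIZ; last exact: cib_cont (ccont_ex l).
by move=> /eqP; rewrite mulf_eq0 (negPf k0) => /eqP.
Qed.

Definition fc u l : R[i] := ((b - a)^-1)%:C%C * cI (fun x => u x * emode (- l) x).

Lemma cib_ex u l : cib u -> cib (fun x => u x * emode l x).
Proof. by move=> hu; exact: cibM hu (cmul_ex l). Qed.

Lemma fc_ext u v l : (forall x, a < x < b -> u x = v x) -> fc u l = fc v l.
Proof. by move=> uv; congr (_ * _); apply: cI_ext => x xD; rewrite uv. Qed.

Lemma fcD u v l : cib u -> cib v -> fc (fun x => u x + v x) l = fc u l + fc v l.
Proof.
move=> hu hv; rewrite /fc -mulrDr -cID; [|exact: cib_ex|exact: cib_ex].
by congr (_ * _); apply: cI_ext => x _; rewrite mulrDl.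
Qed.

Lemma fcZ (k : R[i]) u l : cib u -> fc (fun x => k * u x) l = k * fc u l.
Proof.
move=> hu; rewrite /fc [RHS]mulrCA; congr (_ * _); rewrite -cIZ; last exact: cib_ex.
by  apply: cI_ext => x _; rewrite mulrA.
Qed.

Lemma fcB u v l : cib u -> cib v -> fc (fun x => u x - v x) l = fc u l - fc v l.
Proof.
move=> hu hv; rewrite -mulN1r -fcZ // -fcD //; last exact: cibZ.
by apply: fc_ext => x _; rewrite mulN1r.
Qed.

Lemma fc_conj u l : cib u -> fc (fun x => conjc (u x)) l = conjc (fc u (- l)).
Proof.
move=> hu; rewrite /fc conjcM opprK; congr (_ * _).
  by apply: complex_ext; rewrite ?Re_conj ?Im_conj /= ?oppr0.
rewrite -cI_conj; last exact: cib_ex.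
by apply: cI_ext => x _; rewrite conjcM exN.
Qed.

Lemma fc_ex m l : fc (emode m) l = (m == l)%:R.
Proof.
rewrite /fc (@cI_ext _ a b _ (emode (m - l))); last by move=> x _; rewrite exD.
rewrite cI_ex subr_eq0; case: eqP => _; last by rewrite mulr0.
by rewrite -rmorphM mulVf.
Qed.

Lemma cib_exp m : cib (emode m). Proof. exact: cib_cont (ccont_ex m). Qed.

Lemma fc_le u (M : R) l : cib u -> (forall x, a < x < b -> cnorm (u x) <= M) -> cnorm (fc u l) <= M.
Proof.
move=> hu uM; rewrite /fc cnormM cnorm_real ger0_norm ?invr_ge0 ?(ltW ba0) //.
rewrite ler_pdivrMl // mulrC -(rI_cst hab M); apply: cI_le; [exact: cib_ex|exact: rint_cst|].
by move=> x xD; rewrite cnormM cnorm_ex mulr1 uM.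
Qed.

Lemma sqn_ext u v : (forall x, a < x < b -> cnorm (u x) = cnorm (v x)) -> sqn u = sqn v.
Proof. by move=> uv; apply: rI_ext => x xD; rewrite uv. Qed.

Lemma cL2_exZ (k : R[i]) m : cL2 (fun x => k * emode m x).
Proof. by apply: cL2Z; exact: cL2_cont (ccont_ex m). Qed.

(** Pythagoras for the orthogonal projection along one mode. *)
Lemma sqn_sub u m : cL2 u ->
  sqn (fun x => u x - fc u m * emode m x) = sqn u - (b - a) * cnorm (fc u m) ^+ 2.
Proof.
move=> hu; set k := fc u m; have [_ _ hu2] := hu; have hu1 := cL2_cib hab hu.
have hi := cib_ex (- m) hu1.
have [hr _] := cibZ (- (2 * conjc k)) hi.
have hc := rint_cst hab (cnorm k ^+ 2).
have E0 (z w k0 : R[i]) : cnorm w = 1 -> cnorm (z - k0 * w) ^+ 2 =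
    cnorm z ^+ 2 + (complex.Re (- (2 * conjc k0) * (z * conjc w)) + cnorm k0 ^+ 2).
  move=> w1; have h := cnorm_sq w; rewrite w1 expr1n in h.
  rewrite !cnorm_sq; move: h; case: z => p q; case: k0 => s t; case: w w1 => y z _ /= h.
  transitivity (p ^+ 2 + q ^+ 2 - 2 * (s * (p * y + q * z) + t * (q * y - p * z)) + (s ^+ 2 + t ^+ 2) * (y ^+ 2 + z ^+ 2)); first by ring.
  by rewrite -h; ring.
have E x : cnorm (u x - k * emode m x) ^+ 2 =
    cnorm (u x) ^+ 2 + (complex.Re (- (2 * conjc k) * (u x * emode (- m) x)) + cnorm k ^+ 2).
  by rewrite exN E0 ?cnorm_ex.
rewrite /sqn (@rI_ext _ a b _ _ (fun x _ => E x)) rIDE //; last exact: rintD.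
rewrite rIDE // rI_cst // -(@Re_cI _ a b (fun x => - (2 * conjc k) * (u x * emode (- m) x))) cIZ //.
have -> : cI (fun x => u x * emode (- m) x) = (b - a)%:C%C * k.
  by rewrite /k /fc mulrA -rmorphM mulfV // mul1r.
have fin (I B : R) (k0 : R[i]) : I + (complex.Re (- (2 * conjc k0) * (B%:C%C * k0)) + cnorm k0 ^+ 2 * B) =
    I - B * cnorm k0 ^+ 2 by rewrite cnorm_sq; case: k0 => s t /=; ring.
exact: fin.
Qed.

Lemma fc_sub u m l : cib u -> l != m -> fc (fun x => u x - fc u m * emode m x) l = fc u l.
Proof.
move=> hu lm; rewrite fcB //; last exact: cibZ (cib_exp m).
by rewrite fcZ ?fc_ex 1?eq_sym ?(negPf lm) ?mulr0 ?subr0 //; exact: cib_exp.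
Qed.

(** Modes are peeled off one at a time by [sqn_sub]; the other coefficients do not change, and the
    final residual norm is nonnegative. *)
Lemma bessel r u : cL2 u -> uniq r -> (b - a) * (\sum_(l <- r) cnorm (fc u l) ^+ 2) <= sqn u.
Proof.
elim: r u => [|m r ih] u hu /=; first by rewrite big_nil mulr0 sqn_ge0.
move=> /andP[mr ur]; have hu1 := cL2B hu (cL2_exZ (fc u m) m).
have := ih _ hu1 ur; rewrite sqn_sub // big_cons mulrDr.
rewrite big_seq (eq_bigr (fun l => cnorm (fc u l) ^+ 2)) -?big_seq; first by lra.
move=> l lr; rewrite fc_sub //; first exact: cL2_cib.
by apply: contraNneq mr => <-.
Qed.

(** Otherwise every [i >= K] would contribute at least [e^2] to the Bessel sum. The asymmetric pair
    [- (K' + 1)], [K'] is the one that survives the telescoping in [psum_cvg]. *)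
Lemma bessel_small v : cL2 v -> forall e K, 0 < e ->
  exists2 K' : nat, (K <= K')%N & cnorm (fc v (- Posz K'.+1)) <= e /\ cnorm (fc v (Posz K')) <= e.
Proof.
move=> hv e K e0; apply: contrapT => hn.
have big n : n%:R * e ^+ 2 <= sqn v / (b - a).
  pose r := [seq Posz i | i <- iota K n] ++ [seq - Posz i.+1 | i <- iota K n].
  have ur : uniq r.
    rewrite cat_uniq !map_inj_uniq ?iota_uniq /= ?andbT; [|by move=> i j; lia|by move=> i j []].
    by apply/hasPn => l /mapP[i _ ->]; apply/mapP => -[j _]; lia.
  rewrite ler_pdivlMr // mulrC; apply: le_trans (bessel hv ur); rewrite ler_wpM2l ?(ltW ba0) //.
  rewrite big_cat /= !big_map -big_split /=.
  apply: le_trans (_ : \sum_(i <- iota K n) e ^+ 2 <= _).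
    by rewrite big_const_seq count_predT size_iota iter_addr_0 mulr_natl.
  rewrite big_seq [leRHS]big_seq; apply: ler_sum => i; rewrite mem_iota => /andP[Ki _].
  have [h|h] := leP (cnorm (fc v (- Posz i.+1))) e; last first.
    by rewrite ler_wpDl ?sqr_ge0 // ler_sqr ?nnegrE ?cnorm_ge0 ?ltW.
  have [h'|h'] := leP (cnorm (fc v (Posz i))) e; last first.
    by rewrite ler_wpDr ?sqr_ge0 // ler_sqr ?nnegrE ?cnorm_ge0 ?ltW.
  by exfalso; apply: hn; exists i.
have e2 : 0 < e ^+ 2 by rewrite exprn_gt0.
have q0 : 0 <= sqn v / (b - a) / e ^+ 2 by rewrite !divr_ge0 ?sqn_ge0 ?ltW.
have := archi_boundP q0; rewrite ltNge => /negP; apply.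
by rewrite ler_pdivlMr.
Qed.

(** * Partial sums and their convergence *)

Definition psum K c x : R[i] := \sum_(l <- zr K) c l * emode l x.

Lemma ccont_sum r c : ccontinuous_on `[a, b] (fun x => \sum_(l <- r) c l * emode l x).
Proof.
elim: r => [|l r ih].
  have -> : (fun x => \sum_(l <- [::]) c l * emode l x) = (fun=> 0) by apply/funext => x; rewrite big_nil.
  exact: ccont_cst.
have -> : (fun x => \sum_(l <- l :: r) c l * emode l x) = (fun x => c l * emode l x + \sum_(l <- r) c l * emode l x).
  by apply/funext => x; rewrite big_cons.
by apply: ccontD => //; exact: ccontM (ccont_cst _ _ _) (ccont_ex l).
Qed.

Lemma fc_sum r c l : uniq r -> fc (fun x => \sum_(m <- r) c m * emode m x) l = if l \in r then c l else 0.
Proof.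
elim: r => [|m r ih] /=.
  move=> _; rewrite (fc_ext (v := fun x => 0 * emode 0 x)); last by move=> x _; rewrite big_nil mul0r.
  by rewrite fcZ ?mul0r //; exact: cib_exp.
move=> /andP[mr ur].
rewrite (fc_ext (v := fun x => c m * emode m x + \sum_(m <- r) c m * emode m x)); last by move=> x _; rewrite big_cons.
rewrite fcD; [|exact: cibZ (cib_exp m)|exact: cib_cont (ccont_sum r c)].
rewrite fcZ ?fc_ex ?ih //; last exact: cib_exp.
rewrite inE [l == m]eq_sym; case: eqP => [<-|_]; last by rewrite mulr0 add0r.
by rewrite (negPf mr) mulr1 addr0.
Qed.

Lemma sqn_sum r c : uniq r ->
  sqn (fun x => \sum_(m <- r) c m * emode m x) = (b - a) * \sum_(l <- r) cnorm (c l) ^+ 2.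
Proof.
elim: r => [|m r ih].
  move=> _; rewrite big_nil mulr0 -[RHS](mul0r (b - a)) -(rI_cst hab 0); apply: rI_ext => x _.
  by rewrite big_nil cnorm0 expr0n.
move=> ur; have := sqn_sub m (cL2_cont hab (ccont_sum (m :: r) c)).
rewrite fc_sum // mem_head => h.
have -> : sqn (fun x => \sum_(m <- m :: r) c m * emode m x) =
   sqn (fun x => \sum_(m <- r) c m * emode m x) + (b - a) * cnorm (c m) ^+ 2.
  rewrite -[LHS](subrK ((b - a) * cnorm (c m) ^+ 2)) -h; congr (_ + _).
  by apply: sqn_ext => x _; rewrite big_cons addrAC subrr add0r.
by move: ur => /= /andP[_ ur]; rewrite ih // big_cons; ring.
Qed.

(** With [y = pi s / 2 <= pi / 4], [sin (2 y) = 2 cos y sin y] and the mean value theorem gives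
    [sin y = y cos c]. Both cosines are at least [cos (pi / 4)], whose square is 1/2, and [pi >= 2]
    concludes. *)
Lemma sin_lower (s : R) : 0 <= s -> s <= 2^-1 -> s <= sin (pi * s).
Proof.
move=> s0 s1; have p2 := pi_ge2 R; have p0 := pi_gt0 R.
have [->|sn0] := eqVneq s 0; first by rewrite mulr0 sin0.
have sp : 0 < s by rewrite lt_def sn0.
pose y := pi * s / 2; pose K := cos (pi / 4 : R).
have y0 : 0 < y by rewrite divr_gt0 // mulr_gt0.
have y1 : y <= pi / 4 by rewrite /y; nra.
have K0 : 0 <= K by apply: cos_ge0_pihalf; apply/andP; split; lra.
have K2 : 2 * K ^+ 2 = 1.
  have := cos_mulr2n (pi / 4 : R); rewrite -/K.
  have -> : (pi / 4) *+ 2 = pi / 2 :> R by rewrite mulr2n; field.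
  by rewrite cos_pihalf mulr2n; lra.
have cK (t : R) : 0 <= t -> t <= pi / 4 -> K <= cos t.
  move=> t0 t1; rewrite leNgt ltr_cos ?in_itv /= -?leNgt //; apply/andP; split; lra.
have cs : {within `[0, y], continuous (@sin R)}.
  by apply: continuous_subspaceT; exact: continuous_sin.
have [c] := MVT y0 (fun x _ => is_derive_sin x) cs.
rewrite in_itv /= sin0 !subr0 => /andP[c0 cy] hs.
have -> : pi * s = y *+ 2 by rewrite /y mulr2n; field.
rewrite sin_mulr2n hs.
have h1 : K <= cos c by apply: cK; lra.
have h2 : K <= cos y by apply: cK; lra.
have h3 : K * K <= cos y * cos c by apply: ler_pM.
rewrite mulr2n /y.
have h4 : K * K * (pi * s / 2) <= cos y * cos c * (pi * s / 2) by rewrite ler_wpM2r // -/y ltW.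
have h5 : s <= pi * s / 2 by nra.
by move: h4; rewrite -expr2 => h4; nra.
Qed.

Lemma sin_min (s : R) : `|s| <= 1 -> Num.min `|s| (1 - `|s|) <= `|sin (pi * s)|.
Proof.
move=> s1; have h0 := normr_ge0 s.
have -> : `|sin (pi * s)| = `|sin (pi * `|s|)|.
  by case: (ger0P s) => // _; rewrite mulrN sinN normrN.
apply: le_trans (ler_norm _); have [h|h] := leP `|s| 2^-1.
  by rewrite ge_min; apply/orP; left; exact: sin_lower.
rewrite ge_min; apply/orP; right.
have -> : sin (pi * `|s|) = sin (pi * (1 - `|s|)).
  by rewrite mulrBr mulr1 sinB sinpi cospi mul0r sub0r mulN1r opprK.
by apply: sin_lower; lra.
Qed.

Lemma ex1_dist x y : cnorm (emode 1 x - emode 1 y) = 2 * `|sin (pi * ((x - y) / (b - a)))|.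
Proof.
set t := pi * _.
have hA : mu 1 * (x - a) = mu 1 * (y - a) + t + t by rewrite /t /Defs.mu; field.
apply/eqP; rewrite -(eqrXn2 (n := 2)) ?cnorm_ge0 ?mulr_ge0 //.
rewrite cnorm_sq exprMn -normrX ger0_norm ?sqr_ge0 // /emode hA -addrA ReD ImD ReN ImN /= !(cosD, sinD).
move: (cos2Dsin2 (mu 1 * (y - a))) (cos2Dsin2 t).
move: (cos (mu 1 * (y - a))) (sin (mu 1 * (y - a))) (cos t) (sin t) => C S c s h1 h2.
apply/eqP; have hc : c ^+ 2 = 1 - s ^+ 2 by lra.
transitivity ((C ^+ 2 + S ^+ 2) * ((c ^+ 2 - s ^+ 2 - 1) ^+ 2 + 4 * s ^+ 2 * c ^+ 2)); first by ring.
by rewrite h1 hc; ring.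
Qed.

Definition per_lip u (M : R) : Prop :=
  [/\ ccontinuous_on `[a, b] u, u a = u b &
      forall y z, a <= y -> y <= z -> z <= b -> cnorm (u y - u z) <= M * (z - y)].

(* Chernoff's proof of pointwise convergence: u - u(x0) = g (e_1 - e_1(x0))
   with g square integrable, so the partial sums at x0 telescope to two
   coefficients of g, which are small by Bessel's inequality. *)
Lemma chernoff u (M : R) x0 : per_lip u M -> a <= x0 <= b ->
  exists2 g, cL2 g & forall x, a < x < b -> u x - u x0 = g x * (emode 1 x - emode 1 x0).
Proof.
move=> [cu uab hL] /andP[ax0 x0b].
have M0 : 0 <= M.
  have := le_trans (cnorm_ge0 _) (hL a b (lexx a) (ltW hab) (lexx b)).
  by rewrite pmulr_lge0.
pose den x := emode 1 x - emode 1 x0.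
(* The quotient [(u x - u x0) / den x]: exponential and logarithm form the inverse squared modulus
   out of measurable functions, and where [den] vanishes the conjugate factor makes [g] zero. *)
pose g x := (u x - u x0) * conjc (den x) * (expR (- ln (cnorm (den x) ^+ 2)))%:C%C.
pose s x := `|(x - x0) / (b - a)|.
have sE x : s x = `|x - x0| / (b - a) by rewrite /s normrM normfV (gtr0_norm ba0).
have s1 x : a <= x -> x <= b -> s x <= 1.
  by move=> ax xb; rewrite sE ler_pdivrMr // mul1r ler_norml; apply/andP; split; lra.
have hden x : a < x < b -> 2 * Num.min (s x) (1 - s x) <= cnorm (den x).
  move=> /andP[ax xb]; rewrite /den ex1_dist ler_wpM2l //; apply: sin_min; apply: s1; exact: ltW.
(* Lipschitz bound in the distance on the circle: either directly, or around through the end points,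
   where [u a = u b]. *)
have hu x : a < x < b -> cnorm (u x - u x0) <= M * (b - a) * Num.min (s x) (1 - s x).
  move=> /andP[/ltW ax /ltW xb].
  have e1 : (b - a) * s x = `|x - x0| by rewrite sE mulrC divfK.
  rewrite minElt; case: ifP => _.
    rewrite -mulrA e1; case: (ltP x x0) => h.
      by rewrite distrC ger0_norm ?subr_ge0 ?(ltW h) //; apply: hL => //; exact: ltW.
    by rewrite -cnormN opprB ger0_norm ?subr_ge0 //; exact: hL.
  rewrite -mulrA mulrBr mulr1 e1; case: (ltP x x0) => h.
    rewrite distrC ger0_norm ?subr_ge0 ?(ltW h) //.
    rewrite (_ : u x - u x0 = - (u a - u x) - (u x0 - u b)); last by rewrite uab; ring.
    apply: le_trans (cnormB _ _) _; rewrite cnormN.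
    apply: le_trans (lerD (hL a x (lexx a) ax xb) (hL x0 b ax0 x0b (lexx b))) _.
    by rewrite -mulrDr ler_wpM2l //; lra.
  rewrite ger0_norm ?subr_ge0 //.
  rewrite (_ : u x - u x0 = (u x - u b) + (u a - u x0)); last by rewrite uab; ring.
  apply: le_trans (cnormD _ _) _.
  apply: le_trans (lerD (hL x b ax xb (lexx b)) (hL a x0 (lexx a) ax0 x0b)) _.
  by rewrite -mulrDr ler_wpM2l //; lra.
have den0 x : a < x < b -> cnorm (den x) = 0 -> u x - u x0 = 0.
  move=> xD d0; have := hden x xD; have := hu x xD; rewrite d0 => h1 h2.
  apply: cnorm_eq0; apply/eqP; rewrite eq_le cnorm_ge0 andbT; apply: le_trans h1 _.
  by rewrite mulr_ge0_le0 ?mulr_ge0 ?(ltW ba0) //; lra.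
have einv x : cnorm (den x) != 0 -> expR (- ln (cnorm (den x) ^+ 2)) = (cnorm (den x) ^+ 2)^-1.
  by move=> d0; rewrite expRN lnK // posrE exprn_gt0 // lt_def d0 cnorm_ge0.
have cden : ccontinuous_on `[a, b] den by apply: ccontB; [exact: ccont_ex|exact: ccont_cst].
have ccd : ccontinuous_on `[a, b] (fun x => (u x - u x0) * conjc (den x)).
  apply: ccontM; first by apply: ccontB => //; exact: ccont_cst.
  have -> : (fun x => conjc (den x)) = (fun x => emode (- 1) x - conjc (emode 1 x0)).
    by apply/funext => x; rewrite /den exN; apply: complex_ext; rewrite !(ReD, ImD, ReN, ImN, Re_conj, Im_conj) //; ring.
  by apply: ccontB; [exact: ccont_ex|exact: ccont_cst].
have me : measurable_fun D (fun x => expR (- ln (cnorm (den x) ^+ 2))).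
  apply: measurableT_comp; first exact: measurable_expR.
  apply: measurable_funN.
  apply: measurableT_comp; first exact: measurable_ln.
  by have [h1 h2 _] := cL2_cont hab cden; exact: mf_cnorm2.
have [m1 m2 _] := cL2_cont hab ccd.
exists g.
  apply: (cL2_le (g := fun=> (M * (b - a) / 2) ^+ 2)).
  - have -> : (fun x => complex.Re (g x)) =
        (fun x => complex.Re ((u x - u x0) * conjc (den x)) * expR (- ln (cnorm (den x) ^+ 2))).
      by apply/funext => x; rewrite /g ReM /= mulr0 subr0.
    exact: measurable_funM.
  - have -> : (fun x => complex.Im (g x)) =
        (fun x => complex.Im ((u x - u x0) * conjc (den x)) * expR (- ln (cnorm (den x) ^+ 2))).
      by apply/funext => x; rewrite /g ImM /= mulr0 add0r.
    exact: measurable_funM.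
  - exact: rint_cst.
  - move=> x xD; have MB : 0 <= M * (b - a) / 2 by rewrite divr_ge0 // mulr_ge0 // ltW.
    rewrite ler_sqr ?nnegrE ?cnorm_ge0 //.
    rewrite /g !cnormM cnorm_conj cnorm_real (ger0_norm (expR_ge0 _)).
    have [d0|d0] := eqVneq (cnorm (den x)) 0; first by rewrite d0 mulr0 mul0r.
    have dp : 0 < cnorm (den x) by rewrite lt_def d0 cnorm_ge0.
    rewrite einv // -mulrA expr2 invfM mulVKf // ler_pdivrMr //.
    apply: le_trans (hu x xD) _; rewrite -[leRHS]mulrA; apply: ler_wpM2l; first by rewrite mulr_ge0 // (ltW ba0).
    by have := hden x xD; lra.
move=> x xD; rewrite /g -/(den x).
have [d0|d0] := eqVneq (cnorm (den x)) 0; first by rewrite (den0 x xD d0) !mul0r.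
rewrite einv // -[LHS]mulr1 -!mulrA; congr (_ * _).
have cc : conjc (den x) * den x = (cnorm (den x) ^+ 2)%:C%C.
  by rewrite cnorm_sq; apply: complex_ext; rewrite !(ReM, ImM, Re_conj, Im_conj) /=; ring.
by rewrite [_%:C%C * den x]mulrC mulrA cc -rmorphM mulfV // expf_neq0.
Qed.

(** Convergence is obtained along some arbitrarily large [K'] only, since Bessel's inequality gives
    no rate; the absolutely summable tail settles the rest in [per_lip_series]. *)
Lemma psum_cvg u (M : R) x0 : per_lip u M -> a <= x0 <= b ->
  forall e K, 0 < e -> exists2 K' : nat, (K <= K')%N & cnorm (u x0 - psum K' (fc u) x0) <= e.
Proof.
move=> hu hx0 e K e0; have [cu _ _] := hu.
have [g hg gE] := chernoff hu hx0; have hg1 := cL2_cib hab hg.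
have e2 : 0 < e / 2 by rewrite divr_gt0.
have [K' KK [h1 h2]] := bessel_small hg K e2; exists K' => //.
have fE l : fc u l - u x0 * (0 == l)%:R = fc g (l - 1) - emode 1 x0 * fc g l.
  rewrite -fc_ex -fcZ; last exact: cib_exp.
  rewrite -fcB; [|exact: cib_cont|exact: cibZ (cib_exp 0)].
  rewrite -fcZ // (_ : fc g (l - 1) = fc (fun x => g x * emode 1 x) l); last first.
    rewrite /fc; congr (_ * _); apply: cI_ext => x _; rewrite -mulrA -exD; congr (_ * emode _ _); ring.
  rewrite -fcB; [|exact: cib_ex|exact: cibZ].
  by apply: fc_ext => x xD; rewrite ex0 mulr1 gE // mulrBr [emode 1 x0 * _]mulrC.
have tel n : \sum_(l <- zr n) (fc u l - u x0 * (0 == l)%:R) * emode l x0 =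
    fc g (- Posz n.+1) * emode (- Posz n) x0 - fc g (Posz n) * emode (Posz n.+1) x0.
  have st l : (fc u l - u x0 * (0 == l)%:R) * emode l x0 = fc g (l - 1) * emode l x0 - fc g l * emode (l + 1) x0.
    by rewrite fE exD; ring.
  elim: n => [|n ih]; first by rewrite big_cons big_nil st sub0r add0r addr0.
  rewrite /= !big_cons ih !st.
  have -> : Negz n = - Posz n.+1 by [].
  have -> : Posz n.+1 - 1 = Posz n by lia.
  have -> : - Posz n.+1 - 1 = - Posz n.+2 by lia.
  have -> : - Posz n.+1 + 1 = - Posz n by lia.
  have -> : Posz n.+1 + 1 = Posz n.+2 by lia.
  ring.
have -> : u x0 - psum K' (fc u) x0 = - \sum_(l <- zr K') (fc u l - u x0 * (0 == l)%:R) * emode l x0.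
  rewrite (eq_bigr (fun l => fc u l * emode l x0 - u x0 * (0 == l)%:R * emode l x0)); last by move=> l _; rewrite mulrBl.
  rewrite big_split /= sumrN -/(psum K' (fc u) x0) opprB; congr (_ - _).
  have z0 : (0 : int) \in zr K' by rewrite mem_zr.
  rewrite (big_rem 0 z0) /= ex0 !mulr1 big_seq big1 ?addr0 // => l.
  by rewrite mem_rem_uniq ?zr_uniq // inE [0 == l]eq_sym => /andP[/negPf -> _]; rewrite mulr0 mul0r.
rewrite cnormN tel; apply: le_trans (cnormB _ _) _.
have nx l m : cnorm (fc g l * emode m x0) = cnorm (fc g l) by rewrite [LHS]cnormM cnorm_ex mulr1.
by rewrite !nx; apply: le_trans (lerD h1 h2) _; rewrite -splitr.
Qed.

(** Outside [zr K] one has [gw l >= K + 1]. One of the two weights is exchanged for this factor, the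
    other gives summability. *)
Lemma l1_tail (B : R) c r K : hbound 2 B c -> uniq r -> (forall l, l \in r -> l \notin zr K) ->
  l1 r c <= 2 * B / K.+1%:R.
Proof.
move=> hB ur rK; rewrite ler_pdivlMr ?ltr0Sn //.
have hB1 : hbound 1 B (fun l => (gw l)%:C%C * c l).
  move=> s us; apply: le_trans (hB s us); rewrite le_eqVlt; apply/orP; left; apply/eqP.
  congr Num.sqrt; apply: eq_bigr => l _; congr (_ ^+ 2).
  by rewrite cnormM cnorm_real gtr0_norm ?gw_gt0 // expr1 mulrA.
apply: le_trans (l1_gw (isT : (0 < 1)%N) ur hB1).
rewrite /l1 mulr_suml big_seq [leRHS]big_seq; apply: ler_sum => l lr.
rewrite cnormM cnorm_real gtr0_norm ?gw_gt0 // mulrC ler_wpM2r ?cnorm_ge0 //.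
have := rK l lr; rewrite mem_zr -ltnNge /gw => h.
by rewrite -[1]/(1%:R) -natrD ler_nat; lia.
Qed.

(** Uniform convergence of the Fourier series with an explicit rate: the form in which point values,
    hence grid samples, are tied to coefficients. *)
Definition series_to (B : R) u : Prop :=
  [/\ ccontinuous_on `[a, b] u, hbound 2 B (fc u) &
      forall K x, a <= x <= b -> cnorm (u x - psum K (fc u) x) <= 2 * B / K.+1%:R].

Lemma per_lip_series (B : R) u (M : R) : per_lip u M -> hbound 2 B (fc u) -> series_to B u.
Proof.
move=> hu hB; have [cu _ _] := hu; split=> // K x xab.
apply/ler_addgt0Pr => e e0; have [K' KK h] := psum_cvg hu xab K e0.
rewrite -[u x](subrK (psum K' (fc u) x)) -addrA addrC.
apply: le_trans (cnormD _ _) (lerD _ h).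
pose r := [seq l <- zr K' | l \notin zr K].
have -> : psum K' (fc u) x - psum K (fc u) x = \sum_(l <- r) fc u l * emode l x.
  rewrite /psum (bigID (fun l => l \in zr K)) /= big_filter addrC -addrA [X in _ + X](_ : _ = 0) ?addr0 //.
  apply/eqP; rewrite subr_eq0 -big_filter; apply/eqP; apply: perm_big; apply: uniq_perm; rewrite ?filter_uniq ?zr_uniq // => l.
  by rewrite mem_filter !mem_zr; lia.
apply: le_trans (cnorm_sum _ _ _) _.
rewrite (eq_bigr (fun l => cnorm (fc u l))); last by move=> l _; rewrite cnormM cnorm_ex mulr1.
apply: l1_tail => //; first by rewrite filter_uniq ?zr_uniq.
by move=> l; rewrite mem_filter => /andP[].
Qed.

Lemma psum_le (B : R) c K x : hbound 2 B c -> cnorm (psum K c x) <= 2 * B.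
Proof.
move=> hB; apply: le_trans (cnorm_sum _ _ _) _.
rewrite (eq_bigr (fun l => cnorm (c l))); last by move=> l _; rewrite cnormM cnorm_ex mulr1.
exact: (l1_gw (isT : (0 < 2)%N) (zr_uniq K) hB).
Qed.

Lemma inv_small (C : R) : 0 <= C -> forall e, 0 < e -> exists K : nat, C / K.+1%:R <= e.
Proof.
move=> C0 e e0; have q0 : 0 <= C / e by rewrite divr_ge0 // ltW.
exists (Num.bound (C / e)); rewrite ler_pdivrMr ?ltr0Sn // -ler_pdivrMl // mulrC.
by apply: ltW; apply: lt_le_trans (archi_boundP q0) _; rewrite ler_nat.
Qed.

Lemma hbound_ge0 s (B : R) c : hbound s B c -> 0 <= B.
Proof. by move=> /(_ [::] isT); apply: le_trans; exact: l2_ge0. Qed.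

(** The factor 2 is the price of [cnormD_sq], which avoids the cross term between the partial sum
    and the uniformly small remainder. *)
Lemma parseval_le (B X : R) u : series_to B u ->
  (forall K, \sum_(l <- zr K) cnorm (fc u l) ^+ 2 <= X) -> sqn u <= 2 * (b - a) * X.
Proof.
move=> [cu hB hK] hX; have B0 := hbound_ge0 hB.
apply/ler_addgt0Pr => e e0.
have C0 : 0 <= 2 * (b - a) * (2 * B) * (2 * B) by rewrite !mulr_ge0 // ltW.
have [K hKe] := inv_small C0 e0.
pose S := psum K (fc u); have cS : ccontinuous_on `[a, b] S by exact: ccont_sum.
have h1 : cL2 (fun x => u x - S x) by apply: cL2_cont => //; exact: ccontB.
have [_] := cL2D h1 (cL2_cont hab cS).
have -> : sqn (fun x => u x - S x + S x) = sqn u by apply: sqn_ext => x _; rewrite subrK.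
move=> h; apply: le_trans h _; rewrite addrC; apply: lerD.
  by rewrite sqn_sum ?zr_uniq // mulrA ler_wpM2l // mulr_ge0 // ltW.
apply: le_trans hKe; rewrite -!mulrA; apply: ler_wpM2l => //.
have [_ _ hr] := h1.
apply: le_trans (rI_le hr (rint_cst hab ((2 * B) * (2 * B / K.+1%:R))) _) _.
  move=> x /andP[ax xb]; have xab : a <= x <= b by rewrite !ltW.
  have k0 : 0 <= 2 * B / K.+1%:R by rewrite divr_ge0 // mulr_ge0.
  rewrite expr2; apply: ler_pM; rewrite ?cnorm_ge0 //; last exact: hK.
  apply: le_trans (hK K x xab) _; rewrite ler_pdivrMr ?ltr0Sn // ler_peMr ?mulr_ge0 //.
  by rewrite ler1n.
by rewrite rI_cst // le_eqVlt; apply/orP; left; apply/eqP; ring.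
Qed.

(** The product of two partial sums has exactly the coefficients [zconv K], so only uniform errors
    matter. The constant is [12 = 8 + 4], from [2 Bu] times [4 Bv] and [2 Bu] times [2 Bv]. *)
Lemma fc_mul_lim (Bu Bv : R) u v K l : series_to Bu u -> series_to Bv v ->
  cnorm (fc (fun x => u x * v x) l - zconv K (fc u) (fc v) l) <= 12 * (Bu * Bv) / K.+1%:R.
Proof.
move=> [cu hBu hu] [cv hBv hv]; have Bu0 := hbound_ge0 hBu; have Bv0 := hbound_ge0 hBv.
pose U := psum K (fc u); pose V := psum K (fc v).
have cU : ccontinuous_on `[a, b] U by exact: ccont_sum.
have cV : ccontinuous_on `[a, b] V by exact: ccont_sum.
have -> : zconv K (fc u) (fc v) l = fc (fun x => U x * V x) l.
  have [hi hs] := cib_sum hab (zr K) (fun j => (cib_sum hab (zr K)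
     (fun m => cibZ (fc u j * fc v m * 1) (cib_ex (- l) (cib_exp (j + m))))).1).
  transitivity (((b - a)^-1)%:C%C * cI (fun x => \sum_(j <- zr K) \sum_(m <- zr K) fc u j * fc v m * 1 * (emode (j + m) x * emode (- l) x))); last first.
    congr (_ * _); apply: cI_ext => x _; rewrite /U /V /psum big_distrl /= big_distrl /=.
    apply: eq_bigr => j _; rewrite big_distrr /= big_distrl /=; apply: eq_bigr => m _.
    by rewrite exD; ring.
  rewrite hs big_distrr /=; apply: eq_bigr => j _.
  have [_ ->] := cib_sum hab (zr K) (fun m => cibZ (fc u j * fc v m * 1) (cib_ex (- l) (cib_exp (j + m)))).
  rewrite big_distrr /=; apply: eq_bigr => m _.
  rewrite cIZ; last exact: cib_ex (cib_exp _).
  by rewrite mulr1 -fc_ex /fc mulrCA.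
have ci f g : ccontinuous_on `[a, b] f -> ccontinuous_on `[a, b] g -> cib (fun x => f x * g x).
  by move=> hf hg; exact: cib_cont (ccontM hf hg).
rewrite -fcB; [|exact: ci|exact: ci].
apply: fc_le; first by apply: cibB; exact: ci.
move=> x /andP[ax xb]; have xab : a <= x <= b by rewrite !ltW.
rewrite (_ : u x * v x - U x * V x = (u x - U x) * v x + U x * (v x - V x)); last by ring.
apply: le_trans (cnormD _ _) _; rewrite !cnormM.
have h1 := hu K x xab; have h2 := hv K x xab; have h3 : cnorm (U x) <= 2 * Bu by exact: psum_le.
have h4 : cnorm (v x) <= 4 * Bv.
  have h5 : cnorm (V x) <= 2 * Bv by exact: psum_le.
  rewrite -[v x](subrK (V x)); apply: le_trans (cnormD _ _) _.
  have : 2 * Bv / K.+1%:R <= 2 * Bv by rewrite ler_pdivrMr ?ltr0Sn // ler_peMr ?mulr_ge0 // ler1n.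
  move=> h6; rewrite (_ : 4 * Bv = 2 * Bv + 2 * Bv); last by ring.
  exact: lerD (le_trans h2 h6) h5.
apply: le_trans (lerD (ler_pM (cnorm_ge0 _) (cnorm_ge0 _) h1 h4) (ler_pM (cnorm_ge0 _) (cnorm_ge0 _) h3 h2)) _.
have k0 : K.+1%:R != 0 :> R by rewrite pnatr_eq0.
move: k0; set k : R := K.+1%:R => k0.
by rewrite le_eqVlt; apply/orP; left; apply/eqP; clearbody k; field.
Qed.

End fourier_series.

(** * Sobolev norms *)

Section sobolev_norms.
Context {R : realType} (a b : R) (hab : a < b).

Local Notation leb := (@lebesgue_measure R).
Local Notation D := (`]a, b[%classic : set R).
Local Notation mu := (mu a b).
Local Notation rint := (rint a b).
Local Notation rI := (rI a b).
Local Notation cib := (cib a b).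
Local Notation cI := (cI a b).
Local Notation cL2 := (cL2 a b).
Local Notation sqn := (sqn a b).
Local Notation emode := (emode a b).
Local Notation fc := (fc a b).
Local Notation in_L2 := (in_L2 a b).
Local Notation weak_deriv := (weak_deriv a b).
Local Notation weak_derivs := (weak_derivs a b).
Local Notation in_Hp := (in_Hp a b).
Local Notation Hnorm := (Hnorm a b).
Implicit Types (f u v w : R -> R[i]) (g : nat -> R -> R[i]) (x y z : R) (l : int) (r : seq int) (k m : nat).

Let ba0 : 0 < b - a. Proof. by rewrite subr_gt0. Qed.

Lemma L2norm_sq f : (L2norm a b f ^+ 2)%E = (\int[leb]_(x in D) (cnorm (f x) ^+ 2)%:E)%E.
Proof.
rewrite /L2norm unlock poweR12_sqrt; last by apply: integral_ge0 => x _; exact: poweR_ge0.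
rewrite sqr_sqrte; last by apply: integral_ge0 => x _; exact: poweR_ge0.
rewrite [RHS]integral_mkcond; apply: eq_integral => x _ /=.
rewrite !patchE; case: ifP => _ /=; last by rewrite normr0 powR0.
by rewrite ger0_norm ?cnorm_ge0 // powR_mulrn ?cnorm_ge0.
Qed.

Lemma in_L2P f : in_L2 f <-> cL2 f.
Proof.
split=> [[h1 h2 h3]|[h1 h2 h3]].
  split=> //; apply/integrableP; split; first by apply/measurable_EFinP; exact: mf_cnorm2.
  rewrite [ltLHS](_ : _ = (L2norm a b f ^+ 2)%E); last first.
    by rewrite L2norm_sq; apply: eq_integral => x _ /=; rewrite ger0_norm ?sqr_ge0.
  rewrite expe2; apply: lte_mul_pinfty => //; first exact: Lnorm_ge0.
  by rewrite ge0_fin_numE // Lnorm_ge0.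
split=> //.
have hf : (L2norm a b f ^+ 2)%E \is a fin_num by rewrite L2norm_sq; exact: integrable_fin_num.
rewrite ltey; apply: contraTneq hf => ->.
by rewrite expe2 mulyy.
Qed.

Lemma L2norm_sqn f : cL2 f -> (L2norm a b f ^+ 2)%E = (sqn f)%:E.
Proof.
move=> [_ _ h]; rewrite L2norm_sq fineK //; exact: integrable_fin_num.
Qed.

Lemma weak_deriv_cL2 k f v : weak_deriv k f v -> cL2 f /\ cL2 v.
Proof. by move=> [/in_L2P h1 /in_L2P h2 _]. Qed.

(** The Sobolev norm evaluated on one given family of weak derivatives, as a real number; [Hnorm] is
    the infimum over such families. *)
Definition hn m g : R := Num.sqrt (\sum_(k < m.+1) sqn (g k)).

Lemma hn_ge0 m g : 0 <= hn m g. Proof. exact: sqrtr_ge0. Qed.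
Lemma hn_sq m g : hn m g ^+ 2 = \sum_(k < m.+1) sqn (g k).
Proof. by rewrite sqr_sqrtr // sumr_ge0 // => k _; exact: sqn_ge0. Qed.

Lemma hnE m f g : weak_derivs m f g ->
  ((\sum_(k < m.+1) L2norm a b (g k) ^+ 2) `^ (2^-1))%E = (hn m g)%:E.
Proof.
move=> hg; rewrite (eq_bigr (fun k : 'I_m.+1 => (sqn (g k))%:E)); last first.
  by move=> k _; rewrite L2norm_sqn //; have [] := weak_deriv_cL2 (hg k (ltn_ord k)).
by rewrite sumEFin poweR12_sqrt // lee_fin sumr_ge0 // => k _; exact: sqn_ge0.
Qed.

Lemma Hnorm_le m f g : weak_derivs m f g -> (Hnorm m f <= (hn m g)%:E)%E.
Proof. by move=> hg; rewrite -(hnE hg); apply: ereal_inf_lbound; exists g. Qed.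

Lemma Hnorm_lt m f (x : R) : (Hnorm m f < x%:E)%E -> exists2 g, weak_derivs m f g & hn m g < x.
Proof.
by move=> /ereal_inf_lt[_ [g hg <-]]; rewrite (hnE hg) lte_fin; exists g.
Qed.

Lemma Hnorm_ge0 m f : (0 <= Hnorm m f)%E.
Proof. by apply: le_ereal_inf_tmp => _ [g hg <-]; exact: poweR_ge0. Qed.

Lemma Hnorm_mono k m f : (k <= m)%N -> (Hnorm k f <= Hnorm m f)%E.
Proof.
move=> km; apply: le_ereal_inf_tmp => _ [g hg <-]; rewrite (hnE hg).
have hk : weak_derivs k f g by move=> j jk; apply: hg; exact: leq_trans jk km.
apply: le_trans (Hnorm_le hk) _; rewrite lee_fin; apply: ler_wsqrtr.
have km1 : (k.+1 <= m.+1)%N by [].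
rewrite -!(big_mkord xpredT (fun j => sqn (g j))) [leRHS](@big_cat_nat _ _ _ k.+1) //= lerDl.
by rewrite sumr_ge0 // => j _; exact: sqn_ge0.
Qed.

Lemma eta_cont (eta : R -> R) k : test_function a b eta -> continuous (eta^`(k)%classic).
Proof.
move=> [de _] x; apply: differentiable_continuous; apply/derivable1_diffP; exact: de.
Qed.

Lemma cib_eta (eta : R -> R) k u : test_function a b eta -> cib u ->
  cib (fun x => u x * (eta^`(k)%classic x)%:C%C).
Proof.
move=> te hu; have [K _ hK] := cmul_cont hab (ccont_real a b (eta_cont (k := k) te)).
exact: cibM hu hK.
Qed.

Lemma weak_derivD k f f' u u' : weak_deriv k f u -> weak_deriv k f' u' ->
  weak_deriv k (fun x => f x + f' x) (fun x => u x + u' x).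
Proof.
move=> hf hf'; have [f2 u2] := weak_deriv_cL2 hf; have [f2' u2'] := weak_deriv_cL2 hf'.
case: hf => _ _ hf; case: hf' => _ _ hf'.
split; [exact/in_L2P/(cL2D f2 f2').1|exact/in_L2P/(cL2D u2 u2').1|] => eta te.
have := congr2 +%R (hf eta te) (hf' eta te).
rewrite -mulrDr -!cID; [|exact: (cib_eta 0 te (cL2_cib hab _))|exact: (cib_eta 0 te (cL2_cib hab _))
  |exact: cib_eta te (cL2_cib hab _)|exact: cib_eta te (cL2_cib hab _)].
move=> h; transitivity (cI (fun x => f x * (eta^`(k)%classic x)%:C%C + f' x * (eta^`(k)%classic x)%:C%C)).
  by apply: cI_ext => x _; rewrite mulrDl.
by rewrite h; congr (_ * _); apply: cI_ext => x _; rewrite mulrDl.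
Qed.

Lemma weak_derivZ k (c : R[i]) f u : weak_deriv k f u ->
  weak_deriv k (fun x => c * f x) (fun x => c * u x).
Proof.
move=> hf; have [f2 u2] := weak_deriv_cL2 hf; case: hf => _ _ hf.
split; [exact/in_L2P/cL2Z|exact/in_L2P/cL2Z|] => eta te.
transitivity (c * cI (fun x => f x * (eta^`(k)%classic x)%:C%C)).
  rewrite -cIZ; last exact: cib_eta te (cL2_cib hab f2).
  by apply: cI_ext => x _; rewrite mulrA.
rewrite [X in c * X](hf eta te) mulrCA; congr (_ * _).
rewrite -[X in c * X]/(cI _) -cIZ; last exact: (cib_eta 0 te (cL2_cib hab u2)).
by apply: cI_ext => x _; rewrite mulrA.
Qed.

(** Pointwise, [|z + w|^2 <= (1 + y/x) |z|^2 + (1 + x/y) |w|^2]. With weights matched to the bounds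
    [x] and [y] the total is exactly [(x + y)^2], which gives Minkowski's inequality without an
    inner product. *)
Lemma hnD m g g' (x y : R) : (forall k, (k <= m)%N -> cL2 (g k) /\ cL2 (g' k)) ->
  0 < x -> 0 < y -> hn m g <= x -> hn m g' <= y -> hn m (fun k t => g k t + g' k t) <= x + y.
Proof.
move=> hg x0 y0 hx hy.
have p (z w : R[i]) : cnorm (z + w) ^+ 2 <= (1 + y / x) * cnorm z ^+ 2 + (1 + x / y) * cnorm w ^+ 2.
  apply: le_trans (_ : (cnorm z + cnorm w) ^+ 2 <= _).
    by rewrite ler_sqr ?nnegrE ?addr_ge0 ?cnorm_ge0 // cnormD.
  rewrite -subr_ge0 (_ : _ - _ = (y * cnorm z - x * cnorm w) ^+ 2 / (x * y)).
    by rewrite divr_ge0 ?sqr_ge0 // mulr_ge0 // ltW.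
  by field; rewrite !gt_eqF.
have xy0 : 0 < x + y by exact: addr_gt0.
rewrite -(ler_sqr (x := hn _ _)) ?nnegrE ?hn_ge0 ?(ltW xy0) // hn_sq.
apply: le_trans (_ : (1 + y / x) * x ^+ 2 + (1 + x / y) * y ^+ 2 <= _); last first.
  by rewrite le_eqVlt; apply/orP; left; apply/eqP; field; rewrite !gt_eqF.
have c1 : 0 <= 1 + y / x by rewrite addr_ge0 // divr_ge0 // ltW.
have c2 : 0 <= 1 + x / y by rewrite addr_ge0 // divr_ge0 // ltW.
apply: le_trans (_ : (1 + y / x) * hn m g ^+ 2 + (1 + x / y) * hn m g' ^+ 2 <= _); last first.
  by apply: lerD; apply: ler_wpM2l => //; rewrite ler_sqr ?nnegrE ?hn_ge0 ?(ltW x0) ?(ltW y0).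
rewrite !hn_sq !big_distrr /= -big_split /=; apply: ler_sum => k _.
have [h1 h2] := hg k (ltn_ord k); have [_ _ i1] := h1; have [_ _ i2] := h2.
have j1 := rintZ (1 + y / x) i1; have j2 := rintZ (1 + x / y) i2.
rewrite /sqn -!rIZE // -rIDE //; apply: rI_le; [|exact: rintD|by move=> t _; exact: p].
by have [[_ _ h] _] := cL2D h1 h2.
Qed.

Lemma HnormD m f f' (x y : R) : (Hnorm m f <= x%:E)%E -> (Hnorm m f' <= y%:E)%E ->
  (Hnorm m (fun t => f t + f' t)%R <= (x + y)%:E)%E.
Proof.
move=> hx hy; apply/lee_addgt0Pr => e e0; have e2 : 0 < e / 2 by rewrite divr_gt0.
have lt1 (z : R) : z < z + e / 2 by rewrite ltrDl.
have [g hg gx] : exists2 g, weak_derivs m f g & hn m g < x + e / 2.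
  by apply: Hnorm_lt; apply: le_lt_trans hx _; rewrite lte_fin.
have [g' hg' gy] : exists2 g, weak_derivs m f' g & hn m g < y + e / 2.
  by apply: Hnorm_lt; apply: le_lt_trans hy _; rewrite lte_fin.
have hD : weak_derivs m (fun t => f t + f' t) (fun k t => g k t + g' k t).
  by move=> k km; apply: weak_derivD; [exact: hg|exact: hg'].
apply: le_trans (Hnorm_le hD) _; rewrite -EFinD lee_fin.
rewrite (_ : x + y + e = (x + e / 2) + (y + e / 2)); last by field.
apply: hnD; [|exact: le_lt_trans (hn_ge0 _ _) gx|exact: le_lt_trans (hn_ge0 _ _) gy|exact: ltW|exact: ltW].
move=> k km; have [_ h1] := weak_deriv_cL2 (hg k km); by have [_ h2] := weak_deriv_cL2 (hg' k km).
Qed.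

Lemma HnormN m f : (Hnorm m (fun t => - f t)%R <= Hnorm m f)%E.
Proof.
apply: le_ereal_inf_tmp => _ [g hg <-]; rewrite (hnE hg).
have hN : weak_derivs m (fun t => - f t) (fun k t => - g k t).
  move=> k km; have := weak_derivZ (-1) (hg k km).
  have -> : (fun x => -1 * f x) = (fun x => - f x) by apply/funext => x; rewrite mulN1r.
  by have -> : (fun x => -1 * g k x) = (fun x => - g k x) by apply/funext => x; rewrite mulN1r.
apply: le_trans (Hnorm_le hN) _; rewrite lee_fin le_eqVlt; apply/orP; left; apply/eqP.
congr Num.sqrt; apply: eq_bigr => k _; apply: sqn_ext => x _; exact: cnormN.
Qed.

Lemma weak_deriv_wd k f u v : weak_deriv k f u -> weak_deriv k.+1 f v -> wd a b u v.
Proof.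
move=> [_ _ h1] [_ _ h2] eta te.
have := h1 _ (test_derive te); have := h2 _ te.
rewrite derive1Sn => -> /eqP; rewrite exprS mulN1r mulNr eqr_oppLR -mulrN.
have s0 : (-1) ^+ k != 0 :> R[i] by rewrite expf_neq0 // oppr_eq0 oner_eq0.
by move=> /eqP /(mulfI s0) h; rewrite -[RHS]/(- cint _ _) h opprK.
Qed.

(** * Fourier coefficients of weak derivatives *)

Let cosw l x : R := cos (mu l * x + - (mu l * a)).
Let sinw l x : R := sin (mu l * x + - (mu l * a)).

Let exE l x : emode (- l) x = (cosw l x)%:C%C - 'i%C * (sinw l x)%:C%C.
Proof.
rewrite exN /emode /cosw /sinw mulrBr; apply: complex_ext.
  by rewrite Re_conj ReD ReN ReM /=; ring.
by rewrite Im_conj ImD ImN ImM /=; ring.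
Qed.

Let Ck_cosw n l : Ck n (cosw l). Proof. exact: Ck_affine (Ck_trig n).1. Qed.
Let Ck_sinw n l : Ck n (sinw l). Proof. exact: Ck_affine (Ck_trig n).2. Qed.

(** Test functions are real, so a coefficient is split into a cosine and a sine integral before weak
    derivatives are tested. *)
Let fc_trig u l : cib u ->
  fc u l = ((b - a)^-1)%:C%C * (cI (fun x => u x * (cosw l x)%:C%C) - 'i%C * cI (fun x => u x * (sinw l x)%:C%C)).
Proof.
move=> hu; rewrite /fc; congr (_ * _).
have hc (e : R -> R) : Ck 1 e -> cib (fun x => u x * (e x)%:C%C).
  move=> [e' de _]; have ce : continuous e by move=> x; exact: is_derive_cont (de x).
  have [K _ hK] := cmul_cont hab (ccont_real a b ce); exact: cibM hu hK.
rewrite -cIZ; last exact: hc.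
rewrite -cIB; [|exact: hc|by apply: cibZ; exact: hc].
by apply: cI_ext => x _; rewrite exE mulrBr mulrCA.
Qed.

(** The boundary terms of [wd_by_parts] drop out: the cosine equals 1 at both ends and [u a = u b],
    while the sine vanishes at both ends. *)
Lemma fc_wd u v l : ccontinuous_on `[a, b] u -> u a = u b -> cL2 v -> wd a b u v ->
  fc v l = 'i%C * (mu l)%:C%C * fc u l.
Proof.
move=> cu uab hv huv; rewrite !fc_trig; [|exact: cib_cont|exact: cL2_cib].
have dc (x : R) : is_derive x 1 (cosw l) (- mu l * sinw l x).
  have := @is_derive_affine _ _ (- sin (mu l * x + - (mu l * a))) (mu l) (- (mu l * a)) x (is_derive_cos _).
  by move=> h; apply: (is_derive_eq h); rewrite mulrN mulNr.
have ds (x : R) : is_derive x 1 (sinw l) (mu l * cosw l x).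
  exact: @is_derive_affine _ _ (cos (mu l * x + - (mu l * a))) (mu l) (- (mu l * a)) x (is_derive_sin _).
have Cs' n : Ck n (fun x => - mu l * sinw l x) by apply: CkM; [exact: Ck_cst|exact: Ck_sinw].
have Cc' n : Ck n (fun x => mu l * cosw l x) by apply: CkM; [exact: Ck_cst|exact: Ck_cosw].
have ea : [/\ cosw l a = 1, cosw l b = 1, sinw l a = 0 & sinw l b = 0].
  have hb := ex_b hab l; move: hb (ex_a a b l); rewrite /emode !mulrBr => -[h1 h2] [h3 h4].
  by rewrite /cosw /sinw.
have [ca cb sa sb] := ea.
rewrite (wd_by_parts hab cu hv huv (fun n => Ck_cosw n l) dc Cs').
rewrite (wd_by_parts hab cu hv huv (fun n => Ck_sinw n l) ds Cc').
rewrite ca cb sa sb uab subrr !sub0r.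
have hc (e : R -> R) : Ck 1 e -> cib (fun x => u x * (e x)%:C%C).
  move=> [e' de _]; have ce : continuous e by move=> x; exact: is_derive_cont (de x).
  have [K _ hK] := cmul_cont hab (ccont_real a b ce); exact: cibM (cib_cont cu) hK.
have -> : cI (fun x => u x * (- mu l * sinw l x)%:C%C) = - (mu l)%:C%C * cI (fun x => u x * (sinw l x)%:C%C).
  by rewrite -cIZ; [apply: cI_ext => x _; rewrite rmorphM rmorphN; ring|exact: hc].
have -> : cI (fun x => u x * (mu l * cosw l x)%:C%C) = (mu l)%:C%C * cI (fun x => u x * (cosw l x)%:C%C).
  by rewrite -cIZ; [apply: cI_ext => x _; rewrite rmorphM; ring|exact: hc].
set A := cI _; set B := cI _; set M : R[i] := (mu l)%:C%C; set k : R[i] := (_^-1)%:C%C.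
have ii : 'i%C * 'i%C = -1 :> R[i] by rewrite -expr2 sqr_i.
transitivity ('i%C * M * k * B - ('i%C * 'i%C) * M * k * A); last by ring.
by rewrite ii (_ : u b * (0:R)%:C%C = 0) ?mulr0 //; ring.
Qed.

(** The difference of two weak derivatives annihilates all test functions, hence by [weak_zero] also
    cosine and sine. *)
Lemma fc_weak_unique k f u v l : weak_deriv k f u -> weak_deriv k f v -> fc u l = fc v l.
Proof.
move=> hu hv; have [_ u2] := weak_deriv_cL2 hu; have [_ v2] := weak_deriv_cL2 hv.
case: hu => _ _ hu; case: hv => _ _ hv.
have w2 := cL2B u2 v2.
apply/eqP; rewrite -subr_eq0 -(fcB hab); [|exact: cL2_cib|exact: cL2_cib].
have h0 eta : test_function a b eta -> cI (fun x => (u x - v x) * (eta x)%:C%C) = 0.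
  move=> te; have s0 : (-1) ^+ k != 0 :> R[i] by rewrite expf_neq0 // oppr_eq0 oner_eq0.
  have := hu eta te; rewrite (hv eta te) => /(mulfI s0) h.
  rewrite (@cI_ext _ a b _ (fun x => u x * (eta x)%:C%C - v x * (eta x)%:C%C)); last by move=> x _; rewrite mulrBl.
  rewrite cIB; [|exact: (cib_eta 0 te (cL2_cib hab _))|exact: (cib_eta 0 te (cL2_cib hab _))].
  by rewrite /cI -h subrr.
rewrite fc_trig; last exact: cL2_cib.
rewrite (weak_zero hab w2 (fun n => Ck_cosw n l) h0) (weak_zero hab w2 (fun n => Ck_sinw n l) h0).
by rewrite mulr0 subrr mulr0.
Qed.

(** Below order [m] the continuous periodic representatives are differentiated one at a time. The
    top derivative is only square integrable and is reached by one more integration by parts from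
    order [m - 1]. *)
Lemma fc_derivs m f g k l : (0 < m)%N -> in_Hp m f -> weak_derivs m f g -> (k <= m)%N ->
  fc (g k) l = ('i%C * (mu l)%:C%C) ^+ k * fc f l.
Proof.
move=> m0 [_ [g0 hg0]] hg km.
have h0 j : (j < m)%N -> fc (g0 j) l = ('i%C * (mu l)%:C%C) ^+ j * fc f l.
  elim: j => [|j ih] jm.
    have [/(_ erefl) e _ _ _] := hg0 0%N m0; rewrite expr0 mul1r; apply: fc_ext => x /andP[ax xb].
    by apply: e; rewrite in_itv /= !ltW.
  have [_ cj wj pj] := hg0 j (ltnW jm); have [_ _ wj1 _] := hg0 _ jm.
  rewrite (fc_wd l cj pj (weak_deriv_cL2 wj1).2 (weak_deriv_wd wj wj1)) ih ?(ltnW jm) //.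
  by rewrite exprS mulrA.
move: km; rewrite leq_eqVlt => /predU1P[->|km]; last first.
  by have [_ _ wk _] := hg0 k km; rewrite (fc_weak_unique l (hg k (ltnW km)) wk) h0.
case: m m0 hg hg0 h0 => // m _ hg hg0 h0.
have [_ cj wj pj] := hg0 m (ltnSn m).
have wm := hg m.+1 (leqnn _).
by rewrite (fc_wd l cj pj (weak_deriv_cL2 wm).2 (weak_deriv_wd wj wm)) h0 // exprS mulrA.
Qed.

Lemma bwX_le m l : bw a b l ^+ m <= 2 ^+ m * (1 + (mu l ^+ 2) ^+ m).
Proof.
rewrite /bw; have := sqr_ge0 (mu l); move: (mu l ^+ 2) => t t0.
have [h|h] := leP t 1.
  apply: le_trans (_ : 2 ^+ m <= _); first by apply: lerXn2r; rewrite ?nnegrE; lra.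
  by rewrite ler_peMr ?exprn_ge0 // lerDl exprn_ge0.
apply: le_trans (_ : (2 * t) ^+ m <= _); first by apply: lerXn2r; rewrite ?nnegrE; lra.
by rewrite exprMn ler_wpM2l ?exprn_ge0 // lerDr.
Qed.

Lemma Hnorm_hbound m : (0 < m)%N -> exists2 C, 0 <= C & forall f (B : R),
  in_Hp m f -> (Hnorm m f <= B%:E)%E -> hbound m (C * B) (fc f).
Proof.
move=> m0; pose K0 : R := 2 * (1 + mu 1 ^- 2).
have K00 : 0 <= K0 by rewrite mulr_ge0 // addr_ge0 // invr_ge0 sqr_ge0.
pose K := K0 ^+ m * 2 ^+ m / (b - a).
have K10 : 0 <= K by rewrite divr_ge0 ?(ltW ba0) // mulr_ge0 // exprn_ge0.
exists (Num.sqrt K) => [|f B hf hB r ur]; first exact: sqrtr_ge0.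
have B0 : 0 <= B by rewrite -lee_fin; exact: le_trans (Hnorm_ge0 _ _) hB.
(* The norm is an infimum, so a family of derivatives is available only up to a slack [e]. *)
suff H e : 0 < e -> l2 r (fun l => gw l ^+ m * cnorm (fc f l)) <= Num.sqrt K * (B + e).
  apply/ler_addgt0Pr => e e0.
  have k0 : 0 < Num.sqrt K + 1 by rewrite ltr_wpDl // sqrtr_ge0.
  have := H (e / (Num.sqrt K + 1)) (divr_gt0 e0 k0); move/le_trans; apply.
  rewrite mulrDr lerD2l mulrCA ler_piMr ?(ltW e0) // ler_pdivrMr // mul1r lerDl //.
move=> e0; have [g hg gB] : exists2 g, weak_derivs m f g & hn m g < B + e.
  by apply: Hnorm_lt; apply: le_lt_trans hB _; rewrite lte_fin ltrDl.
have Be : 0 <= B + e by rewrite addr_ge0 // ltW.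
apply: le_trans (_ : Num.sqrt K * hn m g <= _); last by rewrite ler_wpM2l ?sqrtr_ge0 // ltW.
rewrite /l2 /hn -sqrtrM //; apply: ler_wsqrtr.
apply: le_trans (_ : \sum_(l <- r) (K0 ^+ m * 2 ^+ m) * (cnorm (fc (g 0%N) l) ^+ 2 + cnorm (fc (g m) l) ^+ 2) <= _).
  apply: ler_sum => l _; rewrite !(fc_derivs l m0 hf hg) // expr0 mul1r [X in X <= _]exprMn cnormM [X in _ <= _ * (_ + X)]exprMn.
  have -> : cnorm (('i%C * (mu l)%:C%C) ^+ m) ^+ 2 = (mu l ^+ 2) ^+ m.
    have -> : cnorm (('i%C * (mu l)%:C%C) ^+ m) = `|mu l| ^+ m.
      elim: (m) => [|j ih]; first by rewrite !expr0 -[RHS](normr1 R) -cnorm_real.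
      by rewrite exprS cnormM ih cnormM cnorm_i mul1r cnorm_real -exprS.
    by rewrite -!exprM mulnC !exprM real_normK ?num_real.
  rewrite -[X in _ * (X + _)]mul1r -mulrDl mulrA ler_wpM2r ?sqr_ge0 //.
  rewrite [leLHS]exprAC; apply: le_trans (_ : (K0 * bw a b l) ^+ m <= _).
    by apply: lerXn2r (gw_bw hab l); rewrite nnegrE ?sqr_ge0 // mulr_ge0 // ltW // bw_gt0.
  by rewrite exprMn -mulrA ler_wpM2l ?exprn_ge0 // bwX_le.
rewrite -big_distrr /= big_split /= /K [leRHS]mulrAC -[leRHS]mulrA ler_wpM2l ?mulr_ge0 ?exprn_ge0 //.
rewrite ler_pdivlMr // mulrC mulrDr.
have hb k : (k <= m)%N -> (b - a) * \sum_(l <- r) cnorm (fc (g k) l) ^+ 2 <= sqn (g k).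
  by move=> km; apply: bessel => //; have [] := weak_deriv_cL2 (hg k km).
apply: le_trans (lerD (hb 0%N isT) (hb m (leqnn _))) _.
case: m m0 {K K10 hf hB hg gB hb} => // m _.
rewrite big_ord_recl big_ord_recr /= addrA [X in _ <= X + _]addrC lerD2r //=.
by rewrite lerDr sumr_ge0 // => i _; exact: sqn_ge0.
Qed.

Lemma fc_Hnorm : exists2 C, 0 <= C & forall m f l (B : R),
  (Hnorm m f <= B%:E)%E -> cnorm (fc f l) <= C * B.
Proof.
exists (Num.sqrt (b - a)^-1) => [|m f l B hB]; first exact: sqrtr_ge0.
set C := Num.sqrt _; have C0 : 0 <= C by exact: sqrtr_ge0.
suff H e : 0 < e -> cnorm (fc f l) <= C * (B + e).
  apply/ler_addgt0Pr => e e0.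
  have k0 : 0 < C + 1 by rewrite ltr_wpDl.
  have := H (e / (C + 1)) (divr_gt0 e0 k0); move/le_trans; apply.
  rewrite mulrDr lerD2l mulrCA ler_piMr ?(ltW e0) // ler_pdivrMr // mul1r lerDl //.
move=> e0; have [g hg gB] : exists2 g, weak_derivs m f g & hn m g < B + e.
  by apply: Hnorm_lt; apply: le_lt_trans hB _; rewrite lte_fin ltrDl.
apply: le_trans (_ : C * hn m g <= _); last by rewrite ler_wpM2l // ltW.
have h0 := hg 0%N isT; have [f2 g2] := weak_deriv_cL2 h0.
have hff : weak_deriv 0 f f.
  by split; [exact/in_L2P|exact/in_L2P|] => eta _; rewrite expr0 mul1r.
rewrite (fc_weak_unique l hff h0) -[leLHS](ger0_norm (cnorm_ge0 _)) -sqrtr_sqr.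
rewrite /hn -sqrtrM ?invr_ge0 ?(ltW ba0) //; apply: ler_wsqrtr.
rewrite ler_pdivlMl //; have := bessel hab (r := [:: l]) g2 isT; rewrite big_seq1 => /le_trans; apply.
by rewrite big_ord_recl lerDl sumr_ge0 // => i _; exact: sqn_ge0.
Qed.

Lemma wd_per_lip u v : ccontinuous_on `[a, b] u -> u a = u b -> ccontinuous_on `[a, b] v -> wd a b u v ->
  exists M, per_lip a b u M.
Proof.
move=> cu uab cv huv; have [M M0 hM] := ccont_bounded hab cv; exists M; split=> // y z ay yz zb.
apply: (wd_lipschitz hab cu (cib_cont cv) _ huv) => // x /andP[ax xb].
by apply: hM; rewrite !ltW.
Qed.

Lemma ccont_ext u v : (forall x, a <= x <= b -> u x = v x) -> ccontinuous_on `[a, b] u ->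
  ccontinuous_on `[a, b] v.
Proof.
move=> uv [h1 h2]; split; [apply: (@subspace_eq_continuous _ _ _ (fun x => complex.Re (u x)) (fun x => complex.Re (v x)) _ h1)
  |apply: (@subspace_eq_continuous _ _ _ (fun x => complex.Im (u x)) (fun x => complex.Im (v x)) _ h2)] => x;
  by rewrite inE /= in_itv /= => xab; rewrite [u x]uv.
Qed.

Lemma per_lip_ext u v (M : R) : (forall x, a <= x <= b -> u x = v x) -> per_lip a b u M -> per_lip a b v M.
Proof.
move=> uv [cu uab hL]; split; first exact: ccont_ext cu.
  by rewrite -!uv ?lexx ?(ltW hab).
move=> y z ay yz zb; rewrite -!uv; first exact: hL.
  by rewrite (le_trans ay yz).
by rewrite ay (le_trans yz zb).
Qed.

Lemma in_Hp_series m f (B : R) : (2 <= m)%N -> in_Hp m f -> hbound 2 B (fc f) -> series_to a b B f.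
Proof.
move=> m2 [_ [g hg]] hB.
have [/(_ erefl) e c0 w0 p0] := hg 0%N (ltnW m2); have [_ c1 w1 _] := hg 1%N m2.
have [M hM] := wd_per_lip c0 p0 c1 (weak_deriv_wd w0 w1).
apply: (per_lip_series hab (M := M)) => //; apply: per_lip_ext hM => x xab.
by apply: e; rewrite in_itv.
Qed.

(** Converse of [Hnorm_hbound] for H^2. Each derivative of order at most 2 must be the sum of its
    Fourier series, for which the next derivative is taken continuous; orders up to 3 lie below [m]
    when [4 <= m]. The constant counts three derivatives and the factor [2 (b - a)] of
    [parseval_le]. *)
Lemma Hp_Hnorm2_le : exists2 C, 0 <= C & forall m f (X : R), (4 <= m)%N -> in_Hp m f ->
  (forall r, uniq r -> l2 r (fun l => bw a b l * cnorm (fc f l)) <= X) -> (Hnorm 2 f <= (C * X)%:E)%E.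
Proof.
exists (Num.sqrt (3 * (2 * (b - a)))) => [|m f X m4 hf hX]; first exact: sqrtr_ge0.
have X0 : 0 <= X by apply: le_trans (hX [::] isT); exact: l2_ge0.
have m0 : (0 < m)%N by apply: leq_trans m4.
have [[g1 hg1] _] := hf; have [CB CB0 hCB] := Hnorm_hbound m0.
have hB := hCB _ _ hf (Hnorm_le hg1); set B := CB * _ in hB.
case: (hf) => _ [g hg].
have hw k : (k < m)%N -> weak_deriv k f (g k) by move=> km; have [] := hg k km.
have hg1E k l : (k < m)%N -> fc (g k) l = ('i%C * (mu l)%:C%C) ^+ k * fc f l.
  by move=> km; rewrite (fc_weak_unique l (hw k km) (hg1 k (ltnW km))) (fc_derivs l m0 hf hg1 (ltnW km)).
have w2 : weak_derivs 2 f g by move=> k k2; apply: hw; apply: leq_ltn_trans k2 _; exact: ltnW m4.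
apply: le_trans (Hnorm_le w2) _; rewrite lee_fin.
have cn k l : cnorm (('i%C * (mu l)%:C%C) ^+ k : R[i]) = `|mu l| ^+ k.
  elim: k => [|j ih]; first by rewrite !expr0 -[RHS](normr1 R) -cnorm_real.
  by rewrite exprS cnormM ih cnormM cnorm_i mul1r cnorm_real -exprS.
have mubw k l : (k <= 2)%N -> `|mu l| ^+ k <= bw a b l.
  rewrite /bw -real_normK ?num_real // => k2; have := normr_ge0 (mu l); move: `|mu l| => t t0.
  have h : t <= 1 + t ^+ 2 by nra.
  by case: k k2 => [|[|[|//]]] _; rewrite ?expr0 ?expr1 ?lerDl ?sqr_ge0 ?lerDr.
have sq k : (k <= 2)%N -> sqn (g k) <= 2 * (b - a) * X ^+ 2.
  move=> k2; have km : (k.+1 < m)%N by apply: leq_ltn_trans m4; rewrite ltnS.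
  have [_ ck wk pk] := hg k (ltnW km); have [_ ck1 wk1 _] := hg k.+1 km.
  have [M hM] := wd_per_lip ck pk ck1 (weak_deriv_wd wk wk1).
  pose K1 := 1 + mu 1 ^+ 2.
  have K10 : 0 <= K1 by rewrite addr_ge0 // sqr_ge0.
  have hB2 : hbound 2 (K1 * B) (fc (g k)).
    move=> r ur; apply: le_trans (_ : l2 r (fun l => K1 * (gw l ^+ m * cnorm (fc f l))) <= _); last first.
      by rewrite l2Z // ler_wpM2l // hB.
    apply: l2_le => l; first by rewrite mulr_ge0 ?cnorm_ge0 // exprn_ge0 // ltW // gw_gt0.
    rewrite hg1E ?(ltnW km) // cnormM cn !mulrA ler_wpM2r ?cnorm_ge0 //.
    apply: le_trans (_ : gw l ^+ 2 * (K1 * gw l ^+ 2) <= _).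
      apply: ler_wpM2l; first by rewrite exprn_ge0 // ltW // gw_gt0.
      by apply: le_trans (mubw k l k2) _; exact: bw_gw.
    rewrite mulrCA -exprD ler_wpM2l // ler_weXn2l ?gw_ge1 //.
  apply: (parseval_le hab (B := K1 * B)); first exact: per_lip_series hM hB2.
  move=> K; have := hX _ (zr_uniq K); rewrite -(ler_sqr (x := l2 _ _)) ?nnegrE ?l2_ge0 // l2_sq.
  apply: le_trans; apply: ler_sum => l _; rewrite hg1E ?(ltnW km) // cnormM cn ler_sqr ?nnegrE ?mulr_ge0 ?cnorm_ge0 ?exprn_ge0 ?(ltW (bw_gt0 _ _ _)) //.
  by rewrite ler_wpM2r ?cnorm_ge0 // mubw.
have -> : Num.sqrt (3 * (2 * (b - a))) * X = Num.sqrt (3 * (2 * (b - a)) * X ^+ 2).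
  rewrite [RHS]sqrtrM; first by rewrite sqrtr_sqr ger0_norm.
  by rewrite mulr_ge0 // mulr_ge0 // ltW.
apply: ler_wsqrtr; rewrite !big_ord_recl big_ord0 addr0 /=.
have := sq 0%N isT; have := sq 1%N isT; have := sq 2%N isT.
move: (sqn _) (sqn _) (sqn _) => p q t; lra.
Qed.

(** Repeated integration by parts; all derivatives of a test function are test functions and vanish
    at the end points. *)
Lemma weak_deriv_ex k l : weak_deriv k (emode l) (fun x => ('i%C * (mu l)%:C%C) ^+ k * emode l x).
Proof.
set c : R[i] := 'i%C * (mu l)%:C%C.
split; [exact/in_L2P/(cL2_cont hab)/ccont_ex|exact/in_L2P/cL2_exZ|] => eta te.
have ce := cib_cont (ccont_ex a b l).
have st j : cI (fun x => emode l x * (eta^`(j.+1)%classic x)%:C%C) = - c * cI (fun x => emode l x * (eta^`(j)%classic x)%:C%C).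
  have dj (x : R) : is_derive x 1 (eta^`(j)%classic) (eta^`(j.+1)%classic x).
    by case: te => de _; rewrite derive1nS derive1E; exact/derivableP/de.
  have hj : C1on a b (fun x => (eta^`(j)%classic x)%:C%C) (fun x => (eta^`(j.+1)%classic x)%:C%C).
    by apply: C1on_real; exact: rC1_smooth dj.
  have e0 x : ~~ (a < x < b) -> eta^`(j)%classic x = 0.
    move=> xD; have tj : test_function a b (eta^`(j)%classic).
      elim: (j) => [//|i ih]; rewrite derive1nS; exact: test_derive.
    by case: tj => _ [p [q [ap qb ->]]] //; apply: contra xD => /andP[h1 h2]; apply/andP; split; lra.
  have hM := C1onM (C1on_ex a b l) hj.
  have cc1 := ccontM (ccontM (ccont_cst a b c) (ccont_ex a b l)) (ccont_real a b (eta_cont (k := j) te)).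
  have cc2 := ccontM (ccont_ex a b l) (ccont_real a b (eta_cont (k := j.+1) te)).
  have := cI_ftc hab hM (ccontD cc1 cc2).
  rewrite cID; [|exact: cib_cont|exact: cib_cont].
  rewrite !e0 ?ltxx ?andbF // !mulr0 subrr => h.
  apply/eqP; rewrite mulNr -addr_eq0 addrC; apply/eqP; rewrite -[RHS]h; congr (_ + _).
  rewrite -cIZ; last exact: cib_eta te ce.
  by apply: cI_ext => x _; rewrite mulrA.
have main : cI (fun x => emode l x * (eta^`(k)%classic x)%:C%C) = (- c) ^+ k * cI (fun x => emode l x * (eta x)%:C%C).
  by elim: k => [|j ih]; [rewrite expr0 mul1r|rewrite st ih exprS mulrA].
rewrite -[LHS]/(cI _) main [(- c) ^+ k]exprNn -mulrA; congr (_ * _).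
rewrite -[RHS]/(cI _) -cIZ; last exact: (cib_eta 0 te ce).
by apply: cI_ext => x _; rewrite mulrA.
Qed.

Lemma in_HpD m f f' : in_Hp m f -> in_Hp m f' -> in_Hp m (fun x => f x + f' x).
Proof.
move=> [[h hh] [g hg]] [[h' hh'] [g' hg']]; split.
  by exists (fun k x => h k x + h' k x) => k km; apply: weak_derivD; [exact: hh|exact: hh'].
exists (fun k x => g k x + g' k x) => k km.
have [e c w p] := hg k km; have [e' c' w' p'] := hg' k km; split.
- by move=> k0 x xab; rewrite e ?e'.
- exact: ccontD.
- exact: weak_derivD.
- by rewrite p p'.
Qed.

Lemma in_HpZ m (c : R[i]) f : in_Hp m f -> in_Hp m (fun x => c * f x).
Proof.
move=> [[h hh] [g hg]]; split.
  by exists (fun k x => c * h k x) => k km; apply: weak_derivZ; exact: hh.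
exists (fun k x => c * g k x) => k km.
have [e cc w p] := hg k km; split.
- by move=> k0 x xab; rewrite e.
- exact: ccontM (ccont_cst _ _ _) _.
- exact: weak_derivZ.
- by rewrite p.
Qed.

Lemma in_Hp_ex m l : in_Hp m (emode l).
Proof.
split; first by exists (fun k x => ('i%C * (mu l)%:C%C) ^+ k * emode l x) => k _; exact: weak_deriv_ex.
exists (fun k x => ('i%C * (mu l)%:C%C) ^+ k * emode l x) => k _; split.
- by move=> -> x _; rewrite expr0 mul1r.
- exact: ccontM (ccont_cst _ _ _) (ccont_ex _ _ _).
- exact: weak_deriv_ex.
- by rewrite ex_a ex_b.
Qed.

Lemma in_Hp_sum m r (c : int -> R[i]) : in_Hp m (fun x => \sum_(l <- r) c l * emode l x).
Proof.
elim: r => [|l r ih].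
  have -> : (fun x => \sum_(l <- [::]) c l * emode l x) = (fun x => 0 * emode 0 x).
    by apply/funext => x; rewrite big_nil mul0r.
  exact: in_HpZ (in_Hp_ex _ _).
have -> : (fun x => \sum_(l <- l :: r) c l * emode l x) = (fun x => c l * emode l x + \sum_(l <- r) c l * emode l x).
  by apply/funext => x; rewrite big_cons.
by apply: in_HpD => //; exact: in_HpZ (in_Hp_ex _ _).
Qed.

Lemma in_HpB m f f' : in_Hp m f -> in_Hp m f' -> in_Hp m (fun x => f x - f' x).
Proof.
move=> hf hf'; have := in_HpD hf (in_HpZ (-1) hf').
by have -> : (fun x => f x + -1 * f' x) = (fun x => f x - f' x) by apply/funext => x; rewrite mulN1r.
Qed.

Lemma in_Hp_cont m f : (0 < m)%N -> in_Hp m f -> ccontinuous_on `[a, b] f.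
Proof.
move=> m0 [_ [g hg]]; have [/(_ erefl) e c _ _] := hg 0%N m0.
by apply: ccont_ext c => x xab; apply: e; rewrite in_itv.
Qed.

End sobolev_norms.

(** * Time regularity *)

Section time_regularity.
Context {R : realType} (a b : R) (hab : a < b).

Local Notation leb := (@lebesgue_measure R).
Local Notation mu := (mu a b).
Local Notation cib := (cib a b).
Local Notation cL2 := (cL2 a b).
Local Notation fc := (fc a b).
Local Notation Hnorm := (Hnorm a b).
Local Notation timeC := (timeC a b).
Local Notation timeC1 := (timeC1 a b).
Implicit Types (u : R -> R -> R[i]) (l : int) (S s t e : R) (k m : nat).

Lemma in_Hp_cL2 m f : in_Hp a b m f -> cL2 f.
Proof. by move=> [[g hg] _]; have [] := weak_deriv_cL2 (hg 0%N isT). Qed.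

Lemma cvg0_near (F : set_system R) (h : R -> \bar R) e :
  h s @[s --> F] --> 0%E -> 0 < e -> \forall s \near F, (h s < e%:E)%E.
Proof. by move=> hF e0; have := hF _ (@nbhs_open_ereal_lt R 0 (fun=> e) e0). Qed.

Lemma timeC_delta S m u t e : timeC S m u -> 0 <= t <= S -> 0 < e ->
  exists2 d, 0 < d & forall s, 0 <= s <= S -> `|s - t| < d ->
  (Hnorm m (fun x => u s x - u t x)%R <= e%:E)%E.
Proof.
move=> hu tS e0; have [_ hc] := hu t tS; have := cvg0_near hc e0.
rewrite near_withinE => /nbhs_ballP[d /= d0 hd]; exists d => // s sS st.
by apply: ltW; apply: hd; [rewrite /ball /= distrC|rewrite /= in_itv].
Qed.

Lemma timeC1_delta S m u u' t e : timeC1 S m u u' -> 0 <= t <= S -> 0 < e ->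
  exists2 d, 0 < d & forall s, 0 <= s <= S -> `|s - t| < d -> s != t ->
  (Hnorm m (fun x => ((s - t)^-1)%:C%C * (u s x - u t x) - u' t x)%R <= e%:E)%E.
Proof.
move=> [_ _ hu] tS e0; have := cvg0_near (hu t tS) e0.
rewrite near_withinE => /nbhs_ballP[d /= d0 hd]; exists d => // s sS st nst.
have px : ball t d s by rewrite /ball /= distrC.
by apply: ltW; apply: (hd s px nst); rewrite in_itv.
Qed.

(** [pr] is the real or the imaginary part. Coefficients are Lipschitz in the Sobolev norm by
    [fc_Hnorm], so continuity in time is inherited. *)
Lemma fc_cont S m u l (pr : R[i] -> R) c r : (forall z, `|pr z| <= cnorm z) ->
  (forall z w, pr (z - w) = pr z - pr w) -> timeC S m u -> 0 <= c -> c + r <= S ->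
  {within `[0, r], continuous (fun s => pr (fc (u (c + s)) l))}.
Proof.
move=> prn prB hu c0 crS; have [C C0 hC] := fc_Hnorm hab.
apply/subspace_continuousP => s; rewrite /= in_itv /= => /andP[s0 sr].
apply/cvgrPdist_le => e e0; rewrite near_withinE.
have csS : 0 <= c + s <= S by apply/andP; split; lra.
have C1 : 0 < C + 1 by lra.
have [d d0 hd] := timeC_delta hu csS (divr_gt0 e0 C1).
apply/nbhs_ballP; exists d => // y /=; rewrite /ball /= in_itv /= => sy /andP[y0 yr].
have cyS : 0 <= c + y <= S by apply/andP; split; lra.
have dy : `|c + y - (c + s)| < d by rewrite distrC (_ : _ - _ = s - y) //; ring.
rewrite distrC -prB; apply: le_trans (prn _) _.
rewrite -(fcB hab); [|exact: cL2_cib (in_Hp_cL2 (hu _ _).1)|exact: cL2_cib (in_Hp_cL2 (hu _ _).1)].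
apply: le_trans (hC _ _ l _ (hd _ cyS dy)) _.
by rewrite mulrCA ler_piMr ?(ltW e0) // ler_pdivrMr // mul1r lerDl.
Qed.

(** By linearity the difference quotient of a coefficient is the coefficient of the difference
    quotient, which converges in norm. *)
Lemma fc_derive S m u u' l (pr : R[i] -> R) c s : (forall z, `|pr z| <= cnorm z) ->
  (forall z w, pr (z - w) = pr z - pr w) -> (forall (r : R) z, pr (r%:C%C * z) = r * pr z) ->
  timeC1 S m u u' -> 0 <= c + s <= S -> (exists2 d, 0 < d & forall y, `|y - s| < d -> 0 <= c + y <= S) ->
  is_derive s 1 (fun s => pr (fc (u (c + s)) l)) (pr (fc (u' (c + s)) l)).
Proof.
move=> prn prB prZ hu csS [d1 d10 hd1]; have [C C0 hC] := fc_Hnorm hab; have [h1 h2 _] := hu.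
pose F s := pr (fc (u (c + s)) l).
apply/is_derive1_caratheodory.
exists (fun y => if y == s then pr (fc (u' (c + s)) l) else (F y - F s) / (y - s)); split.
- move=> y; case: eqP => [->|/eqP ys]; first by rewrite !subrr mulr0.
  by rewrite divfK // subr_eq0.
- apply/cvgrPdist_le => e e0; rewrite eqxx.
  have C1 : 0 < C + 1 by lra.
  have [d d0 hd] := timeC1_delta hu csS (divr_gt0 e0 C1).
  apply/nbhs_ballP; exists (Num.min d d1) => [|y]; first by rewrite /= lt_min d0.
  rewrite /ball /= lt_min => /andP[sy sy1].
  case: eqP => [_|/eqP ys]; first by rewrite subrr normr0 ltW.
  rewrite distrC in sy1; have cyS := hd1 y sy1.
  have dy : `|c + y - (c + s)| < d by rewrite distrC (_ : _ - _ = s - y) //; ring.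
  have ny : c + y != c + s by rewrite (inj_eq (addrI c)).
  have cu t : 0 <= t <= S -> cib (u t) by move=> tS; exact: cL2_cib (in_Hp_cL2 (h1 _ tS).1).
  have cu' t : 0 <= t <= S -> cib (u' t) by move=> tS; exact: cL2_cib (in_Hp_cL2 (h2 _ tS).1).
  have -> : (F y - F s) / (y - s) = pr (fc (fun x => ((c + y - (c + s))^-1)%:C%C * (u (c + y) x - u (c + s) x)) l).
    rewrite (fcZ hab); last by apply: cibB; exact: cu.
    rewrite prZ (fcB hab); [|exact: cu|exact: cu].
    rewrite prB mulrC; congr (_^-1 * _); ring.
  rewrite distrC -prB; apply: le_trans (prn _) _.
  rewrite -(fcB hab); [|by apply: cibZ; apply: cibB; exact: cu|exact: cu'].
  apply: le_trans (hC _ _ l _ (hd _ cyS dy ny)) _.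
  by rewrite mulrCA ler_piMr ?(ltW e0) // ler_pdivrMr // mul1r lerDl.
- by rewrite eqxx.
Qed.

Lemma C1on_fc S m u u' l c r : timeC1 S m u u' -> 0 <= c -> c + r <= S ->
  C1on 0 r (fun s => fc (u (c + s)) l) (fun s => fc (u' (c + s)) l).
Proof.
move=> hu c0 crS; have [h1 _ _] := hu.
have hd s : s \in `]0, r[ -> (0 <= c + s <= S) /\ exists2 d, 0 < d & forall y, `|y - s| < d -> 0 <= c + y <= S.
  rewrite in_itv /= => /andP[s0 sr]; split; first by apply/andP; split; lra.
  exists (Num.min s (r - s)); first by rewrite lt_min s0 subr_gt0.
  by move=> y; rewrite lt_min !ltr_norml => /andP[/andP[? ?] /andP[? ?]]; apply/andP; split; lra.
have RB (z w : R[i]) : complex.Re (z - w) = complex.Re z - complex.Re w by rewrite ReD ReN.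
have IB (z w : R[i]) : complex.Im (z - w) = complex.Im z - complex.Im w by rewrite ImD ImN.
have RZ (x : R) (z : R[i]) : complex.Re (x%:C%C * z) = x * complex.Re z by rewrite ReM /= mul0r subr0.
have IZ (x : R) (z : R[i]) : complex.Im (x%:C%C * z) = x * complex.Im z by rewrite ImM /= mul0r addr0.
split; split.
- exact: fc_cont (@Re_le_cnorm R) RB h1 c0 crS.
- by move=> s /hd[s1 s2]; exact: fc_derive (@Re_le_cnorm R) RB RZ hu s1 s2.
- exact: fc_cont (@Im_le_cnorm R) IB h1 c0 crS.
- by move=> s /hd[s1 s2]; exact: fc_derive (@Im_le_cnorm R) IB IZ hu s1 s2.
Qed.

Lemma LinfH_ge0 S m u : (0 <= LinfH a b S m u)%E.
Proof. exact: Lnorm_ge0. Qed.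

(** The essential supremum bounds the norm at almost every time. Continuity in time carries the
    bound to every [t], because each neighbourhood of [t] relative to [[0, S]] has positive
    measure. *)
Lemma LinfH_le S m u t : 0 < S -> timeC S m u -> 0 <= t <= S -> (Hnorm m (u t) <= LinfH a b S m u)%E.
Proof.
move=> S0 hu tS; set B := LinfH _ _ _ _ _.
have B0 : (0 <= B)%E by exact: LinfH_ge0.
have [->|By] := eqVneq B +oo%E; first exact: leey.
have Bf : B \is a fin_num by rewrite ge0_fin_numE // ltey.
rewrite -(fineK Bf); apply/lee_addgt0Pr => e e0; rewrite -EFinD.
have [d d0 hd] := timeC_delta hu tS e0.
have hae : {ae leb, forall s, (`|((fun t => Hnorm m (u t)) \_ `[0%R, S]) s| <= B)%E}.
  have := ess_sup_ge leb (abse \o ((fun t => Hnorm m (u t)) \_ `[0%R, S])).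
  suff -> : ess_sup leb (abse \o ((fun t => Hnorm m (u t)) \_ `[0%R, S])) = B by [].
  (* The sup norm is defined by a case distinction on the measure of the whole line, which is at
     least that of [[0, 1]]. *)
  rewrite /B /LinfH unlock ifT //.
  have : (leb (`[0%R, 1%R]%classic : set R) <= leb [set: R])%E.
    by apply: le_measure; rewrite ?inE //; exact: measurable_itv.
  by apply: lt_le_trans; rewrite lebesgue_measure_itv /= lte_fin ltr01 oppr0 addr0 lte01.
have [s [sS st hs]] : exists s, [/\ 0 <= s <= S, `|s - t| < d &
    (`|((fun t => Hnorm m (u t)) \_ `[0%R, S]) s| <= B)%E].
  apply: contrapT => hn; have [A [mA A0 hA]] := hae.
  pose p := Num.max 0 (t - d / 2); pose q := Num.min S (t + d / 2).
  have pq : p < q by case/andP: tS => t0 t1; rewrite /p /q gt_max !lt_min S0; apply/and3P; split; lra.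
  have sub : (`]p, q[%classic : set R) `<=` A.
    move=> s; rewrite /= in_itv /= /p /q gt_max lt_min => /andP[/andP[s0 s1] /andP[s2 s3]].
    apply: hA => /= hs; apply: hn; exists s; split=> //; first by rewrite !ltW.
    by rewrite ltr_norml; apply/andP; split; lra.
  have : (leb `]p, q[%classic <= leb A)%E by apply: le_measure; rewrite ?inE //; exact: measurable_itv.
  by rewrite [in leRHS]A0 lebesgue_measure_itv /= lte_fin pq -EFinB lee_fin leNgt subr_gt0 pq.
move: hs; rewrite patchE ifT; last by rewrite mem_setE in_itv.
rewrite gee0_abs ?Hnorm_ge0 // -(fineK Bf) => hs.
have := HnormD hab hs (le_trans (HnormN hab m _) (hd s sS st)).
by have -> : (fun x => u s x + - (u s x - u t x)) = u t by apply/funext => x; ring.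
Qed.

Lemma fc_dxx f g m l : (2 <= m)%N -> in_Hp a b m f -> weak_deriv a b 2 f g ->
  fc g l = - (mu l ^+ 2)%:C%C * fc f l.
Proof.
move=> m2 hf hg; have [[g1 hg1] _] := hf.
rewrite (fc_weak_unique hab l hg (hg1 2%N m2)) (fc_derivs hab l _ hf hg1) //; last exact: leq_trans m2.
by rewrite exprMn sqr_i mulN1r -rmorphXn.
Qed.

(** * Differential equations of the Fourier coefficients *)

Section coefficient_odes.
Variables (psi0 : R -> R[i]) (phi0 phi1 : R -> R) (eps S : R).
Variables (psi dpsi : R -> R -> R[i]) (phi dphi ddphi : R -> R -> R).
Hypothesis sol : kgs_solution a b psi0 phi0 phi1 eps S psi dpsi phi dphi ddphi.
Variable m : nat.
Hypothesis m2 : (2 <= m)%N.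
Hypothesis hpsi : forall t, 0 <= t <= S -> in_Hp a b m (psi t).
Hypothesis hphi : forall t, 0 <= t <= S -> in_Hp a b m (ofreal phi t).

Let m0 : (0 < m)%N. Proof. exact: leq_trans m2. Qed.

Lemma ode_psi t l : 0 < t <= S -> fc (dpsi t) l =
  - ('i%C * (mu l ^+ 2)%:C%C * fc (psi t) l) + 'i%C * fc (fun x => ofreal phi t x * psi t x) l.
Proof.
move=> /andP[t0 tS]; have tS' : 0 <= t <= S by rewrite ltW.
have [[_ [_ hd _]] _ [dxxpsi [dxxphi hx]] _] := sol.
have [w _ eq] := hx t (introT andP (conj t0 tS)).
have cw : cib (dxxpsi t) by have [_ h] := weak_deriv_cL2 w; exact: cL2_cib.
have cd : cib (dpsi t) by exact: cL2_cib (in_Hp_cL2 (hd t tS').1).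
have cp : cib (fun x => ofreal phi t x * psi t x).
  by apply: cib_cont; apply: ccontM; apply: in_Hp_cont m0 _; [exact: hphi|exact: hpsi].
have : fc (fun x => 'i%C * dpsi t x + dxxpsi t x + ofreal phi t x * psi t x) l = 0.
  rewrite (fc_ext (v := fun x => 0 * dpsi t x)); first by rewrite (fcZ hab) ?mul0r.
  by move=> x xD; have [-> _] := eq x xD; rewrite mul0r.
rewrite (fcD hab) //; last by apply: cibD => //; exact: cibZ.
rewrite (fcD hab) //; last exact: cibZ.
rewrite (fcZ hab) // (fc_dxx l m2 (hpsi tS') w) => h.
have ii : 'i%C * 'i%C = -1 :> R[i] by rewrite -expr2 sqr_i.
move: h; set A := fc (dpsi t) l; set B := fc (psi t) l; set C := fc (fun x => ofreal phi t x * psi t x) l.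
set M := (mu l ^+ 2)%:C%C; move: A B C M => A B C M h.
have -> : A = - ('i%C * 'i%C) * A by rewrite ii opprK mul1r.
have -> : - ('i%C * 'i%C) * A = - 'i%C * ('i%C * A + - M * B + C) + - ('i%C * M * B) + 'i%C * C by ring.
by rewrite h mulr0 add0r.
Qed.

Lemma ode_phi t l : 0 < eps -> 0 < t <= S ->
  (eps ^+ 2)%:C%C * (fc (ofreal ddphi t) l + (omega a b eps l ^+ 2)%:C%C * fc (ofreal phi t) l)
    = fc (fun x => conjc (psi t x) * psi t x) l.
Proof.
move=> he /andP[t0 tS]; have tS' : 0 <= t <= S by rewrite ltW.
have [_ [_ _ [_ [_ hd _]]] [dxxpsi [dxxphi hx]] _] := sol.
have [_ w eq] := hx t (introT andP (conj t0 tS)).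
have cw : cib (ofreal dxxphi t) by have [_ h] := weak_deriv_cL2 w; exact: cL2_cib.
have cd : cib (ofreal ddphi t) by exact: cL2_cib (in_Hp_cL2 (hd t tS').1).
have cp : cib (ofreal phi t) by exact: cL2_cib (in_Hp_cL2 (hphi tS')).
rewrite [RHS](fc_ext (v := fun x => ((eps ^+ 2)%:C%C * ofreal ddphi t x - ofreal dxxphi t x) + (eps ^- 2)%:C%C * ofreal phi t x)); last first.
  move=> x xD; have [_ e] := eq x xD; rewrite /ofreal -!(rmorphM, rmorphB, rmorphD) /= e.
  by rewrite cnorm_sq; apply: complex_ext; rewrite !(ReM, ImM, Re_conj, Im_conj) /=; ring.
have cz : cib (fun x => (eps ^+ 2)%:C%C * ofreal ddphi t x) by exact: cibZ.
rewrite (fcD hab); [|exact: cibB|exact: cibZ].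
rewrite (fcB hab) // !(fcZ hab) // (fc_dxx l m2 (hphi tS') w).
rewrite -addrA mulrDr; congr (_ + _); rewrite mulrA mulNr opprK -mulrDl; congr (_ * _).
rewrite -!(rmorphM, rmorphD); congr (_%:C)%C.
rewrite /omega; set M := mu l ^+ 2; have M0 : 0 <= M by exact: sqr_ge0.
have hp : 0 <= 1 + M * eps ^+ 2 by rewrite addr_ge0 // (mulr_ge0 M0 (sqr_ge0 _)).
rewrite exprMn sqr_sqrtr //.
by field; rewrite gt_eqF.
Qed.

End coefficient_odes.

End time_regularity.

(** * Interpolation and aliasing errors *)

Section spectral_errors.
Context {R : realType} (a b : R) (hab : a < b).

Local Notation mu := (mu a b).
Local Notation bw := (bw a b).
Local Notation nrm := (nrm a b).
Local Notation emode := (emode a b).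
Local Notation fc := (fc a b).
Local Notation psum := (psum a b).
Local Notation series_to := (series_to a b).
Implicit Types (c d e : int -> R[i]) (f g : R -> R[i]) (l j : int) (r : seq int) (N K m s : nat) (B : R).

Definition sample_vec N f : @vec R N := fun i => f (node a b N i).
Local Notation samples := (@sample_vec).

Let rV (n : nat) : (n%:R^-1 : R[i]) = (n%:R^-1)%:C%C.
Proof. by rewrite -(rmorph_nat (real_complex R)) -fmorphV. Qed.

Lemma dft_le N (v : @vec R N) (M : R) l : (0 < N)%N ->
  (forall j : 'I_N, cnorm (v (inord j)) <= M) -> cnorm (dft a b v l) <= M.
Proof.
move=> N0 hv; have NR : 0 < N%:R :> R by rewrite ltr0n.
rewrite dftE cnormM rV cnorm_real ger0_norm ?invr_ge0 ?ler0n // ler_pdivrMl //.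
apply: le_trans (cnorm_sum _ _ _) _; apply: le_trans (_ : \sum_(j < N) M <= _).
  by apply: ler_sum => j _; rewrite cnormM cnorm_expi mulr1.
by rewrite sumr_const card_ord mulr_natl.
Qed.

Lemma dftB N (u v : @vec R N) l : dft a b (fun i => u i - v i : R[i]) l = dft a b u l - dft a b v l.
Proof.
rewrite !dftE -mulrBr -sumrB; congr (_ * _); apply: eq_bigr => j _; exact: mulrBl.
Qed.

Lemma node_bd N (j : 'I_N) : (0 < N)%N -> a <= node a b N j <= b.
Proof.
move=> N0; have NR : 0 < N%:R :> R by rewrite ltr0n.
have h0 : 0 <= mesh a b N by rewrite /mesh divr_ge0 ?subr_ge0 ?ltW.
rewrite /node lerDl mulr_ge0 //= -lerBrDl /mesh mulrA ler_pdivrMr // [leRHS]mulrC.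
by apply: ler_wpM2r; [rewrite subr_ge0 ltW|rewrite ler_nat ltnW].
Qed.

Lemma dft_psum N K c l : (0 < N)%N ->
  dft a b (samples N (psum K c)) l = \sum_(j <- zr K) c j * (N %| j - l)%Z%:R.
Proof.
move=> N0; have NR : N%:R != 0 :> R[i] by rewrite pnatr_eq0 -lt0n.
rewrite dftE.
transitivity (N%:R^-1 * \sum_(j <- zr K) c j * \sum_(i < N) expi (mu (j - l) * (node a b N i - a))).
  congr (_ * _); under [RHS]eq_bigr do rewrite mulr_sumr.
  rewrite [RHS]exchange_big; apply: eq_bigr => i _; rewrite /sample_vec inord_lt /psum big_distrl /=.
  apply: eq_bigr => j _; rewrite -mulrA; congr (_ * _); by rewrite /emode -expiD muD mulrDl.
rewrite big_distrr; apply: eq_bigr => j _ /=.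
by rewrite sum_expi_node // mulrCA mulKf.
Qed.

Lemma dvdz_lt (N : nat) (x : int) : (N %| x)%Z -> (`|x| < N)%N -> x = 0.
Proof. move=> /dvdzP[q ->] h; have : q = 0 by nia. by move=> ->; rewrite mul0r. Qed.

(** Aliases of [l] outside the band [|j| < N/2]. For [l = - N/2] this includes [l] itself, which
    [tr] sets to 0. *)
Definition far N l j : bool := (N <= 2 * `|j|)%N && (N %| j - l)%Z.

Lemma fold_split N K c l : ~~ odd N -> (0 < N)%N -> (N <= K)%N -> l \in freqs N ->
  \sum_(j <- zr K) c j * (N %| j - l)%Z%:R = tr N c l + \sum_(j <- zr K | far N l j) c j.
Proof.
move=> No N0 NK lN; have ls := freqs_small_even No lN.
rewrite (bigID (fun j => (N <= 2 * `|j|)%N)) /= addrC; congr (_ + _); last first.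
  rewrite [RHS]big_mkcond [LHS]big_mkcond; apply: eq_bigr => j _; rewrite /far.
  by case: ifP => //= _; case: ifP; rewrite ?mulr1 ?mulr0.
have lK : l \in zr K by rewrite mem_zr; lia.
rewrite /tr; case: ifP => h.
  rewrite big_mkcond (bigD1_seq l lK (zr_uniq K)) /= ifT; last by rewrite -ltnNge; lia.
  rewrite subrr dvdz0 mulr1 big1 ?addr0 // => j j2; case: ifP => // j1.
  have [dv|_] := boolP (N %| j - l)%Z; last by rewrite mulr0.
  have /eqP : j - l = 0 by apply: dvdz_lt dv _; lia.
  by rewrite subr_eq0 (negPf j2).
rewrite big1 // => j j1; have [dv|_] := boolP (N %| j - l)%Z; last by rewrite mulr0.
have /eqP : j - l = 0 by apply: dvdz_lt dv _; lia.
by rewrite subr_eq0 => /eqP jl; move: h j1; rewrite jl; lia.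
Qed.

(** Writing [j = l + p N], one has [N gw p <= 4 gw j]. The sum is thus at most [16 / N^2] times a
    sum over distinct [p], which is at most 4. *)
Lemma far_gw N l r : ~~ odd N -> (0 < N)%N -> l \in freqs N -> uniq r ->
  (forall j, j \in r -> far N l j) -> \sum_(j <- r) gw j ^- 2 <= 64 / N%:R ^+ 2 :> R.
Proof.
move=> No N0 lN ur hr; have ls := freqs_small_even No lN.
have NR : 0 < N%:R :> R by rewrite ltr0n.
pose p j := ((j - l) %/ N)%Z.
have pE j : j \in r -> j = l + p j * N.
  by move=> /hr /andP[_ dv]; rewrite /p divzK // addrC subrK.
apply: le_trans (_ : \sum_(j <- r) 16 / N%:R ^+ 2 * gw (p j) ^- 2 <= _).
  rewrite big_seq [leRHS]big_seq; apply: ler_sum => j jr.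
  have [h1 _] := andP (hr j jr); have h2 := pE j jr.
  have h : N%:R * gw (p j) <= 4 * gw j :> R.
    rewrite /gw -[1]/(1%:R) -!natrD -!natrM ler_nat.
    by move: (p j) h2 => q h2; nia.
  have g1 : 0 < gw j :> R by exact: gw_gt0.
  have g2 : 0 < gw (p j) :> R by exact: gw_gt0.
  rewrite [leRHS](_ : _ = ((N%:R * gw (p j)) ^+ 2 / 16)^-1); last by field; rewrite !gt_eqF.
  rewrite lef_pV2 ?posrE ?divr_gt0 ?exprn_gt0 ?mulr_gt0 //.
  rewrite ler_pdivrMr // (_ : gw j ^+ 2 * 16 = (4 * gw j) ^+ 2); last by ring.
  by rewrite ler_sqr ?nnegrE ?mulr_ge0 // ltW.
rewrite -big_distrr /= (_ : 64 / _ = 16 / N%:R ^+ 2 * 4); last by ring.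
apply: ler_wpM2l; first by rewrite divr_ge0 // exprn_ge0 // ltW.
rewrite -(big_map p xpredT (fun q => gw q ^- 2)); apply: sum_gw.
rewrite map_inj_in_uniq // => i j ir jr pij.
by rewrite (pE i ir) (pE j jr) pij.
Qed.

Lemma far_disjoint N (j : int) : (0 < N)%N -> \sum_(l <- freqs N) (far N l j)%:R <= 1 :> R.
Proof.
move=> N0; have [/hasP[l0 l0N h0]|hn] := boolP (has (fun l => far N l j) (freqs N)).
  rewrite (bigD1_seq l0) ?freqs_uniq //= h0 big_seq_cond big1 ?addr0 // => l /andP[lN ll0].
  case hl : (far N l j) => //; exfalso; move: ll0; apply/negP; rewrite negbK.
  have [k kN lk] := freqsP lN; have [k0 k0N lk0] := freqsP l0N.
  move: h0 hl; rewrite /far => /andP[_ d0] /andP[_ d1].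
  have : (N %| l - l0)%Z by rewrite (_ : l - l0 = (j - l0) - (j - l)); [exact: rpredB|ring].
  by rewrite lk lk0 freq_dvd // => /eqP ->.
rewrite big_seq big1 // => l lN; case hl : (far N l j) => //.
by move/hasPn: hn => /(_ l lN); rewrite hl.
Qed.

(** Every alias has [|j| >= N/2], so [m] weights give [(2/N)^m]. One more is spent in Cauchy-Schwarz
    over the aliases of [l] and gives [8/N] by [far_gw]. Alias classes are disjoint, so the squares
    add up to the bound on [c]. *)
Lemma fold_l2 N K s m c B : ~~ odd N -> (0 < N)%N -> hbound (s + m.+1) B c ->
  l2 (freqs N) (fun l => gw l ^+ s * cnorm (\sum_(j <- zr K | far N l j) c j))
    <= 2 ^+ m * 8 * B / N%:R ^+ m.+1.
Proof.
move=> No N0 hB; have NR : 0 < N%:R :> R by rewrite ltr0n.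
have B0 := hbound_ge0 hB.
pose X j := gw j ^+ (s + m.+1) * cnorm (c j).
have gp j : 0 < gw j :> R by exact: gw_gt0.
have X0 j : 0 <= X j by rewrite mulr_ge0 ?cnorm_ge0 // exprn_ge0 // ltW.
pose al := 2 ^+ m / N%:R ^+ m : R.
have al0 : 0 <= al by rewrite divr_ge0 ?exprn_ge0 // ltW.
pose Y l := l2 (seq.filter (far N l) (zr K)) X.
apply: le_trans (_ : l2 (freqs N) (fun l => (al * (8 / N%:R)) * Y l) <= _).
  apply: l2_le_in => l lN; first by rewrite mulr_ge0 ?cnorm_ge0 // exprn_ge0 // ltW.
  have ls := freqs_small_even No lN.
  set r := seq.filter (far N l) (zr K); have rP j : j \in r -> far N l j by rewrite mem_filter => /andP[].
  rewrite -big_filter -/r.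
  apply: le_trans (_ : \sum_(j <- r) al * ((gw j)^-1 * X j) <= _).
    apply: le_trans (ler_wpM2l _ (cnorm_sum _ _ _)) _; first by rewrite exprn_ge0 // ltW.
    rewrite big_distrr /= big_seq [leRHS]big_seq; apply: ler_sum => j jr.
    have /andP[j1 _] := rP j jr; have g1 := gp j.
    rewrite /X !mulrA ler_wpM2r ?cnorm_ge0 //.
    apply: le_trans (_ : gw j ^+ s <= _).
      apply: lerXn2r; rewrite ?nnegrE ?(ltW (gp _)) //.
      by rewrite /gw lerD2l ler_nat; lia.
    rewrite -[al * _ * _]mulrA addnS exprS mulKf ?gt_eqF //.
    rewrite exprD mulrCA ler_peMr ?exprn_ge0 ?(ltW g1) //.
    rewrite /al -expr_div_n -exprMn; apply: exprn_ege1.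
    rewrite mulrAC ler_pdivlMr // mul1r /gw -[1]/(1%:R) -natrD -natrM ler_nat; lia.
  rewrite -big_distrr /= -mulrA ler_wpM2l //.
  apply: le_trans (cauchy_schwarz _ _ _) _; rewrite -/(Y l); apply: ler_wpM2r; first exact: l2_ge0.
  rewrite /l2; under eq_bigr do rewrite exprVn.
  rewrite -[leRHS](ger0_norm (_ : 0 <= 8 / N%:R :> R)) ?divr_ge0 ?(ltW NR) // -sqrtr_sqr; apply: ler_wsqrtr.
  rewrite expr_div_n (_ : 8 ^+ 2 = 64 :> R); last by rewrite -natrX.
  by apply: far_gw No N0 lN _ rP; rewrite filter_uniq ?zr_uniq.
have k0 : 0 <= al * (8 / N%:R) by rewrite mulr_ge0 // divr_ge0 // ltW.
rewrite l2Z // (_ : 2 ^+ m * 8 * B / N%:R ^+ m.+1 = al * (8 / N%:R) * B); last first.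
  by rewrite /al exprS; field; rewrite expf_neq0 gt_eqF.
apply: ler_wpM2l => //; apply: le_trans (hB _ (zr_uniq K)); rewrite /l2; apply: ler_wsqrtr.
rewrite (eq_bigr (fun l => \sum_(j <- zr K) X j ^+ 2 * (far N l j)%:R)); last first.
  move=> l _; rewrite /Y l2_sq big_filter big_mkcond; apply: eq_bigr => j _.
  by case: ifP; rewrite ?mulr1 ?mulr0.
rewrite exchange_big; apply: ler_sum => j _; rewrite -big_distrr /=.
by rewrite ler_piMr ?sqr_ge0 // far_disjoint.
Qed.

(** At fixed [N] only finitely many frequencies occur, so a rate in [K] uniform in [l] is enough to
    pass to the limit; [N] enters the choice of [K] but not the bound. *)
Lemma wn_lim N W c e (ck : nat -> int -> R[i]) (X M : R) : (forall l, 0 <= W l) -> 0 <= M ->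
  (forall K, (N <= K)%N -> wn N W (fun l => ck K l - e l) <= X) ->
  (forall K l, cnorm (c l - ck K l) <= M / K.+1%:R) -> wn N W (fun l => c l - e l) <= X.
Proof.
move=> W0 M0 hX hM; apply/ler_addgt0Pr => t t0.
pose Z := wn N W (fun=> 1 : R[i]).
have Z0 : 0 <= Z by exact: wn_ge0.
have [K0 hK0] := inv_small (mulr_ge0 M0 Z0) t0; pose K := (N + K0)%N.
have q0 : 0 <= M / K.+1%:R by rewrite divr_ge0.
have -> : (fun l => c l - e l) = (fun l => ck K l - e l + (c l - ck K l)) by apply/funext => l; ring.
apply: le_trans (wnD _ _ _ W0) (lerD (hX K (leq_addr _ _)) _).
apply: le_trans (_ : wn N W (fun=> (M / K.+1%:R)%:C%C * 1) <= _).
  apply: wn_le => // k _; apply: ler_wpM2l => //.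
  by rewrite mulr1 cnorm_real (ger0_norm q0) hM.
rewrite wnZ cnorm_real (ger0_norm q0) -/Z; apply: le_trans hK0.
rewrite mulrAC ler_wpM2l ?mulr_ge0 // lef_pV2 ?posrE ?ltr0Sn // ler_nat /K; lia.
Qed.

Lemma interp_error N s m f B (B' : R) : ~~ odd N -> (0 < N)%N -> series_to B' f ->
  hbound (s + m.+1) B (fc f) ->
  wn N (fun l => gw l ^+ s) (fun l => dft a b (samples N f) l - tr N (fc f) l)
    <= 2 ^+ m * 8 * B / N%:R ^+ m.+1.
Proof.
move=> No N0 [cf hf hS] hB.
have W0 l : 0 <= gw l ^+ s :> R by rewrite exprn_ge0 // ltW // gw_gt0.
apply: (wn_lim (ck := fun K => dft a b (samples N (psum K (fc f)))) (M := 2 * B')) => //.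
- by rewrite mulr_ge0 // (hbound_ge0 hf).
- move=> K NK; rewrite wn_freqs; apply: le_trans (fold_l2 K No N0 hB).
  apply: l2_le_in => l lN; first by rewrite mulr_ge0 ?cnorm_ge0.
  by rewrite dft_psum // fold_split // addrAC subrr add0r.
- move=> K l; rewrite -dftB; apply: dft_le => // j; rewrite /sample_vec inord_lt.
  by apply: hS; exact: node_bd.
Qed.

Lemma hbound_mono s s' B c : (s <= s')%N -> hbound s' B c -> hbound s B c.
Proof.
move=> ss hB r ur; apply: le_trans (hB r ur); apply: l2_le => l.
  by rewrite mulr_ge0 ?cnorm_ge0 // exprn_ge0 // ltW // gw_gt0.
by rewrite ler_wpM2r ?cnorm_ge0 // ler_weXn2l // gw_ge1.
Qed.

Lemma hbound_le s B (B' : R) c : B <= B' -> hbound s B c -> hbound s B' c.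
Proof. by move=> BB hB r ur; apply: le_trans (hB r ur) BB. Qed.

Lemma alias_lim m : exists2 C, 0 <= C & forall N B f g, ~~ odd N -> (0 < N)%N ->
  series_to B f -> series_to B g -> hbound (m + 2) B (fc f) -> hbound (m + 2) B (fc g) ->
  nrm N 1 (fun l => tr N (fc (fun x => f x * g x)) l - cconv a b N (tr N (fc f)) (tr N (fc g)) l)
    <= C * B ^+ 2 / N%:R ^+ m.
Proof.
have [C C0 hC] := alias hab m; exists C => // N B f g No N0 sf sg hf hg.
have B0 := hbound_ge0 hf.
apply: (wn_lim (ck := fun K => tr N (zconv K (fc f) (fc g))) (M := 12 * (B * B))).
- by move=> l; exact: bwX_ge0.
- by rewrite !mulr_ge0.
- by move=> K NK; exact: hC.
- move=> K l; rewrite /tr; case: ifP => _; first exact: fc_mul_lim.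
  by rewrite subrr cnorm0 divr_ge0 // !mulr_ge0.
Qed.

Lemma nrm_hbound k : exists2 C, 0 <= C & forall N c B, hbound (2 * k) B c -> nrm N k (tr N c) <= C * B.
Proof.
pose K1 := 1 + mu 1 ^+ 2; have K10 : 0 <= K1 by rewrite addr_ge0 // sqr_ge0.
exists (K1 ^+ k) => [|N c B hB]; first exact: exprn_ge0.
rewrite /nrm wn_freqs; apply: le_trans (_ : l2 (freqs N) (fun l => K1 ^+ k * (gw l ^+ (2 * k) * cnorm (c l))) <= _).
  apply: l2_le => l; first by rewrite mulr_ge0 ?cnorm_ge0 ?bwX_ge0.
  rewrite mulrA; apply: ler_pM; rewrite ?cnorm_ge0 ?bwX_ge0 //; last first.
    by rewrite /tr; case: ifP; rewrite ?cnorm0 ?cnorm_ge0.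
  rewrite exprM -exprMn; apply: lerXn2r; rewrite ?nnegrE ?(ltW (bw_gt0 _ _ _)) ?mulr_ge0 ?sqr_ge0 ?(ltW (gw_gt0 _)) //.
  exact: bw_gw.
rewrite l2Z ?exprn_ge0 // ler_wpM2l ?exprn_ge0 // hB //; exact: freqs_uniq.
Qed.

Lemma trig_freqs N c x : trig a b N c x = \sum_(l <- freqs N) c l * emode l x.
Proof.
by rewrite /freqs big_map -[iota 0 N]/(iota 0 N) /trig -(big_mkord xpredT (fun k => c (freq N k) * expi (mu (freq N k) * (x - a)))) /index_iota subn0.
Qed.

(** On the grid band the coefficients of the difference are the discrete error; where [tr] vanishes
    they contain the tail of [f], and there [1 <= 2 gw / N] converts [s] derivatives into [N^-s]. *)
Lemma trig_error s : exists2 C, 0 <= C & forall N m f B V, (0 < N)%N -> (4 <= m)%N ->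
  in_Hp a b m f -> hbound (s + 2) B (fc f) ->
  (Hnorm a b 2 (fun x => f x - trig a b N V x)%R
    <= (C * (nrm N 1 (fun l => V l - tr N (fc f) l) + B / N%:R ^+ s))%:E)%E.
Proof.
have [C C0 hC] := Hp_Hnorm2_le hab.
pose K1 := 1 + mu 1 ^+ 2; have K10 : 0 <= K1 by rewrite addr_ge0 // sqr_ge0.
have K21 : 1 <= 1 + K1 * 2 ^+ s by rewrite lerDl mulr_ge0 // exprn_ge0.
exists (C * (1 + K1 * 2 ^+ s)) => [|N m f B V N0 m4 hf hB]; first by rewrite mulr_ge0 // (le_trans _ K21).
have NR : 0 < N%:R :> R by rewrite ltr0n.
have B0 := hbound_ge0 hB.
have tE : trig a b N V = (fun x => \sum_(l <- freqs N) V l * emode l x) by apply/funext => x; exact: trig_freqs.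
have hF : in_Hp a b m (fun x => f x - trig a b N V x).
  by rewrite tE; apply: in_HpB => //; exact: in_Hp_sum.
rewrite -mulrA; apply: hC m4 hF _ => r ur.
have cf : cib a b f by exact: cL2_cib (in_Hp_cL2 hf).
have fE l : fc (fun x => f x - trig a b N V x) l = (fc f l - tr N (fc f) l) - (if l \in freqs N then V l - tr N (fc f) l else 0).
  rewrite (fcB hab) //; last by rewrite tE; exact: cib_cont (ccont_sum a b _ _).
  rewrite tE (fc_sum hab) ?freqs_uniq //; case: ifP => lN; first by rewrite opprB addrA subrK.
  by rewrite /tr ifF ?subr0 //; apply/negbTE; apply: contraFN lN; exact: mem_freqs.
set X := nrm N 1 _; have X0 : 0 <= X by exact: wn_ge0.
apply: le_trans (_ : X + K1 * 2 ^+ s * (B / N%:R ^+ s) <= _); last first.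
  rewrite mulrDr; apply: lerD; first by rewrite ler_peMl.
  by apply: ler_wpM2r; [rewrite divr_ge0 // exprn_ge0 // ltW|rewrite lerDr].
apply: le_trans (_ : l2 r (fun l => (if l \in freqs N then bw l * cnorm (V l - tr N (fc f) l) else 0)
    + bw l * cnorm (fc f l - tr N (fc f) l)) <= _).
  apply: l2_le => l; first by rewrite mulr_ge0 ?cnorm_ge0 // ltW // bw_gt0.
  rewrite fE; set A := fc f l - _; set E := V l - _; clearbody A E.
  case: ifP => _; last by rewrite subr0 add0r.
  by rewrite [leRHS]addrC -mulrDr; apply: ler_wpM2l (cnormB A E); rewrite ltW // bw_gt0.
apply: le_trans (l2D _ _ _) (lerD _ _).
  rewrite /X /nrm wn_freqs /l2; apply: ler_wsqrtr.
  rewrite (bigID (fun l => l \in freqs N)) /= [X in _ + X]big1 ?addr0; last by move=> l /negPf ->; rewrite expr0n.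
  rewrite -big_filter big_seq (eq_bigr (fun l => (bw l ^+ 1 * cnorm (V l - tr N (fc f) l)) ^+ 2)); last first.
    by move=> l; rewrite mem_filter => /andP[-> _]; rewrite expr1.
  rewrite -big_seq; apply: sum_subset; [by rewrite filter_uniq|by move=> l; rewrite mem_filter => /andP[]|by move=> l; exact: sqr_ge0].
have k0 : 0 <= K1 * 2 ^+ s / N%:R ^+ s by rewrite divr_ge0 ?mulr_ge0 ?exprn_ge0 // ltW.
apply: le_trans (_ : l2 r (fun l => K1 * 2 ^+ s / N%:R ^+ s * (gw l ^+ (s + 2) * cnorm (fc f l))) <= _); last first.
  by rewrite l2Z // mulrA [leRHS]mulrAC ler_wpM2l // hB.
apply: l2_le => l; first by rewrite mulr_ge0 ?cnorm_ge0 // ltW // bw_gt0.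
have g0 : 0 < gw l :> R by exact: gw_gt0.
rewrite /tr; case: ifP => h.
  by rewrite subrr cnorm0 mulr0 mulr_ge0 // mulr_ge0 ?cnorm_ge0 // exprn_ge0 // ltW.
rewrite subr0 mulrA ler_wpM2r ?cnorm_ge0 //.
apply: le_trans (_ : K1 * gw l ^+ 2 <= _); first exact: bw_gw.
rewrite [leRHS](_ : _ = K1 * gw l ^+ 2 * (2 ^+ s / N%:R ^+ s * gw l ^+ s)); last by rewrite exprD; ring.
apply: ler_peMr; first by rewrite mulr_ge0 // sqr_ge0.
rewrite -expr_div_n -exprMn; apply: exprn_ege1.
by rewrite mulrAC ler_pdivlMr // mul1r /gw -[1]/(1%:R) -natrD -natrM ler_nat; lia.
Qed.

(** At [- N/2], which grid conjugation maps to itself, both sides are 0 thanks to the strict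
    truncation; elsewhere the reflection is a true change of sign. *)
Lemma cj_tr N c k : ~~ odd N -> (0 < N)%N -> (k < N)%N ->
  cj a b N (tr N c) (freq N k) = tr N (fun l => conjc (c (- l))) (freq N k).
Proof.
move=> No N0 kN; rewrite cjE //; case: k kN => [|k] kN.
  have hz : (`|freq N 0| * 2 < N)%N = false by apply/negbTE; rewrite /freq -leqNgt; lia.
  by rewrite /refl /tr hz conjc0.
have -> : freq N (refl N k.+1) = - freq N k.+1 by rewrite /freq /refl; lia.
by rewrite /tr abszN; case: ifP => //; rewrite conjc0.
Qed.

Lemma real_coef_fc N (f : R -> R) : ~~ odd N -> (0 < N)%N -> cib a b (fun x => (f x)%:C%C) ->
  real_coef a b N (tr N (fc (fun x => (f x)%:C%C))).
Proof.
move=> No N0 cf k kN; rewrite cj_tr // /tr; case: ifP => // _.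
rewrite -(fc_conj hab) //; apply: fc_ext => x _; by apply: complex_ext; rewrite ?Re_conj ?Im_conj /= ?oppr0.
Qed.

End spectral_errors.

(** * Conjugation, truncation and sampled initial data *)

Section assembly_lemmas.
Context {R : realType} (a b : R) (hab : a < b).

Local Notation mu := (mu a b).
Local Notation bw := (bw a b).
Local Notation nrm := (nrm a b).
Local Notation fc := (fc a b).
Implicit Types (c d : int -> R[i]) (f : R -> R[i]) (N K m s : nat) (B : R).

Lemma hbound_refl s B c : hbound s B c -> hbound s B (fun l => conjc (c (- l))).
Proof.
move=> hB r ur; apply: le_trans (hB [seq - l | l <- r] _); last by rewrite map_inj_uniq //; exact: oppr_inj.
rewrite /l2 big_map le_eqVlt; apply/orP; left; apply/eqP; congr Num.sqrt; apply: eq_bigr => l _.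
by rewrite cnorm_conj /gw abszN.
Qed.

Lemma ccont_conj f : ccontinuous_on `[a, b] f -> ccontinuous_on `[a, b] (fun x => conjc (f x)).
Proof.
move=> [h1 h2]; split.
  by have -> : (fun x => complex.Re (conjc (f x))) = (fun x => complex.Re (f x)) by apply/funext => x; rewrite Re_conj.
have -> : (fun x => complex.Im (conjc (f x))) = (fun x => - complex.Im (f x)) by apply/funext => x; rewrite Im_conj.
by move=> x; apply: cvgN; exact: h2.
Qed.

Lemma psum_conj K c x : conjc (psum a b K c x) = psum a b K (fun l => conjc (c (- l))) x.
Proof.
rewrite /psum conjc_sum.
rewrite [RHS](eq_bigr (fun l => conjc (c (- l)) * conjc (emode a b (- l) x))); last first.
  by move=> l _; rewrite -exN opprK.
rewrite -[RHS](big_map (fun l => - l) xpredT (fun l => conjc (c l) * conjc (emode a b l x))).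
rewrite (eq_bigr (fun l => conjc (c l) * conjc (emode a b l x))); last by move=> l _; rewrite conjcM.
apply: perm_big; apply: uniq_perm; rewrite ?(map_inj_uniq oppr_inj) ?zr_uniq //.
move=> l; rewrite mem_zr; apply/idP/mapP => [h|[j]]; last by rewrite mem_zr => h ->; rewrite abszN.
by exists (- l); rewrite ?opprK // mem_zr abszN.
Qed.

Lemma series_to_conj B f : series_to a b B f ->
  series_to a b B (fun x => conjc (f x)) /\ fc (fun x => conjc (f x)) = (fun l => conjc (fc f (- l))).
Proof.
move=> [cf hB hS]; have e : fc (fun x => conjc (f x)) = (fun l => conjc (fc f (- l))).
  by apply/funext => l; rewrite (fc_conj hab) //; exact: cib_cont.
split=> //; split; first exact: ccont_conj.
  by rewrite e; exact: hbound_refl.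
move=> K x xab; rewrite e -psum_conj -(cnorm_conj (_ - _)) conjcD conjcK.
have cN (z : R[i]) : conjc (- conjc z) = - z by apply: complex_ext; rewrite !(Re_conj, Im_conj, ReN, ImN) ?opprK.
by rewrite cN; exact: hS.
Qed.

Lemma C1on_tr N (A D : R) (c c' : R -> int -> R[i]) l :
  C1on A D (fun t => c t l) (fun t => c' t l) -> C1on A D (fun t => tr N (c t) l) (fun t => tr N (c' t) l).
Proof. by move=> h; rewrite /tr; case: (`|l| * 2 < N)%N => //; exact: C1on_cst. Qed.

Lemma hbound_scale s B c (x : R) : 0 < x -> hbound s (B / x) c -> hbound s B (fun l => x%:C%C * c l).
Proof.
move=> x0 hB r ur; apply: le_trans (_ : x * (B / x) <= _); last by rewrite mulrC divfK // gt_eqF.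
apply: le_trans (ler_wpM2l (ltW x0) (hB r ur)); rewrite -l2Z ?(ltW x0) //.
rewrite /l2 le_eqVlt; apply/orP; left; apply/eqP; congr Num.sqrt; apply: eq_bigr => l _.
by rewrite cnormM cnorm_real gtr0_norm // mulrCA.
Qed.

Lemma wn_le_scale N (W W' : int -> R) (m : int -> R[i]) (k : R) c : (forall l, 0 <= W l) -> 0 <= k ->
  (forall l, W l * cnorm (m l) <= k * W' l) -> wn N W (fun l => m l * c l) <= k * wn N W' c.
Proof.
move=> W0 k0 h; have -> : k * wn N W' c = wn N W' (fun l => k%:C%C * c l) by rewrite wnZ cnorm_real ger0_norm.
apply: wn_le => // j _; rewrite !cnormM cnorm_real (ger0_norm k0) !mulrA [W' _ * k]mulrC.
by rewrite ler_wpM2r ?cnorm_ge0.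
Qed.

(** In the half-wave the time derivative carries [eps^2], which cancels the [eps^-2] of its bound,
    while [phi] carries [kap <= bw], one more power of the weight, covered by its [m0 + 4]
    derivatives. The interpolation error gains one power of [N] beyond its parameter and is
    therefore applied with [m0 - 1]. *)
Lemma initial_error N (eps : R) (m0 : nat) (B : R) (phi dphi psi : R -> R[i]) (V W U : int -> R[i]) sg :
  ~~ odd N -> (0 < N)%N -> 0 < eps <= 1 -> (0 < m0)%N -> sg ^+ 2 = 1 ->
  series_to a b B phi -> series_to a b (B / eps ^+ 2) dphi -> series_to a b B psi ->
  hbound (m0 + 4) B (fc phi) -> hbound (m0 + 4) (B / eps ^+ 2) (fc dphi) -> hbound (m0 + 2) B (fc psi) ->
  V =1 dft a b (@sample_vec R a b N phi) -> W =1 dft a b (@sample_vec R a b N dphi) ->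
  U =1 dft a b (@sample_vec R a b N psi) ->
  let E := 2 ^+ m0 * 8 * B / N%:R ^+ m0 in
  let k := 1 + mu 1 ^+ 2 in
  nrm N 1 (eta a b eps sg (fun l => V l - tr N (fc phi) l) (fun l => W l - tr N (fc dphi) l)) <= (k + k ^+ 2) * E /\
  nrm N 1 (fun l => U l - tr N (fc psi) l) <= k * E.
Proof.
move=> No N0 /andP[e0 e1] m00 hsg s1 s2 s3 h1 h2 h3 hV hW hU E k.
have B0 := hbound_ge0 h1; have e2 : 0 < eps ^+ 2 by rewrite exprn_gt0.
have k0 : 0 <= k by rewrite addr_ge0 // sqr_ge0.
have NR : 0 < N%:R :> R by rewrite ltr0n.
have fE (C : R) : 0 <= C -> 2 ^+ m0.-1 * 8 * C / N%:R ^+ m0.-1.+1 <= 2 ^+ m0 * 8 * C / N%:R ^+ m0.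
  move=> C0; rewrite prednK // -!mulrA ler_wpM2r ?mulr_ge0 ?invr_ge0 ?exprn_ge0 ?(ltW NR) //.
  by rewrite ler_weXn2l ?leq_pred // ler1n.
have gwb l : bw l <= k * gw l ^+ 2 by exact: bw_gw.
have b0 l : 0 <= bw l by rewrite ltW // bw_gt0.
have i3 : wn N (fun l => gw l ^+ 2) (fun l => U l - tr N (fc psi) l) <= E.
  have -> : (fun l => U l - tr N (fc psi) l) = (fun l => dft a b (@sample_vec R a b N psi) l - tr N (fc psi) l).
    by apply/funext => l; rewrite hU.
  apply: le_trans (fE B B0); apply: (interp_error hab No N0 s3).
  by rewrite prednK // addnC.
have i1 : wn N (fun l => gw l ^+ 4) (fun l => V l - tr N (fc phi) l) <= E.
  have -> : (fun l => V l - tr N (fc phi) l) = (fun l => dft a b (@sample_vec R a b N phi) l - tr N (fc phi) l).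
    by apply/funext => l; rewrite hV.
  apply: le_trans (fE B B0); apply: (interp_error hab No N0 s1).
  by rewrite prednK // addnC.
have i2 : wn N (fun l => gw l ^+ 2) (fun l => W l - tr N (fc dphi) l) <= E / eps ^+ 2.
  have -> : (fun l => W l - tr N (fc dphi) l) = (fun l => dft a b (@sample_vec R a b N dphi) l - tr N (fc dphi) l).
    by apply/funext => l; rewrite hW.
  rewrite /E mulrAC -[2 ^+ m0 * 8 * B / _]mulrA.
  have B2 : 0 <= B / eps ^+ 2 by rewrite divr_ge0 // ltW.
  apply: le_trans (fE _ B2); apply: (interp_error hab No N0 s2).
  by rewrite prednK // addnC; apply: hbound_mono h2; rewrite leq_add2l.
have W1 l : 0 <= bw l ^+ 1 by rewrite expr1.
split; last first.
  apply: le_trans (_ : k * wn N (fun l => gw l ^+ 2) (fun l => U l - tr N (fc psi) l) <= _); last exact: ler_wpM2l.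
  have := @wn_le_scale N (fun l => bw l ^+ 1) (fun l => gw l ^+ 2) (fun=> 1) k (fun l => U l - tr N (fc psi) l) W1 k0.
  have c1 : cnorm (1 : R[i]) = 1 by rewrite -(@expi0 R) cnorm_expi.
  have -> : (fun l => 1 * (U l - tr N (fc psi) l)) = (fun l => U l - tr N (fc psi) l) by apply/funext => l; rewrite mul1r.
  by apply=> l; rewrite c1 mulr1 expr1.
apply: le_trans (wnD _ _ _ W1) _; rewrite mulrDl; apply: lerD.
  apply: le_trans (_ : (k * eps ^+ 2) * (E / eps ^+ 2) <= _); last first.
    by rewrite -mulrA [eps ^+ 2 * _]mulrC divfK ?gt_eqF.
  apply: le_trans (_ : (k * eps ^+ 2) * wn N (fun l => gw l ^+ 2) (fun l => W l - tr N (fc dphi) l) <= _); last first.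
    by rewrite ler_wpM2l // mulr_ge0 // ltW.
  apply: wn_le_scale => //; first by rewrite mulr_ge0 // ltW.
  by move=> l; rewrite cnorm_real gtr0_norm // expr1 mulrAC ler_wpM2r // ltW.
apply: le_trans (_ : k ^+ 2 * wn N (fun l => gw l ^+ 4) (fun l => V l - tr N (fc phi) l) <= _); last first.
  by rewrite ler_wpM2l // sqr_ge0.
apply: wn_le_scale => //; first exact: sqr_ge0.
move=> l; rewrite cnormM cnorm_i mul1r cnorm_real normrM.
have -> : `|sg| = 1 by apply/eqP; rewrite -sqr_norm_eq1 // hsg.
rewrite mul1r gtr0_norm ?kap_gt0 // expr1.
have kb : kap a b eps l <= bw l.
  apply: le_trans (_ : kap a b eps l ^+ 2 <= _).
    by rewrite expr2 ler_peMl ?kap_ge1 // ltW // kap_gt0.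
  rewrite kap_sq /bw lerD2l ler_piMr ?sqr_ge0 // expr_le1 // ltW //.
apply: le_trans (_ : (k * gw l ^+ 2) * (k * gw l ^+ 2) <= _); last by rewrite le_eqVlt; apply/orP; left; apply/eqP; ring.
apply: ler_pM => //; first by rewrite ltW // kap_gt0.
exact: le_trans kb (gwb l).
Qed.

End assembly_lemmas.

(** * The error estimate *)

Section error_estimate.
Context {R : realType} (a b T : R) (m0 : nat) (psi0 : R -> R[i]) (phi0 phi1 : R -> R).
Variables (psi dpsi ddpsi : R -> R -> R -> R[i]) (phi dphi ddphi : R -> R -> R -> R).
Hypotheses (hab : a < b) (hT : 0 < T) (hm0 : (4 <= m0)%N).
Hypothesis hsol : forall eps : R, 0 < eps <= 1 ->
  kgs_solution a b psi0 phi0 phi1 eps T (psi eps) (dpsi eps) (phi eps) (dphi eps) (ddphi eps).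
Hypothesis hA : assumption_A a b T m0 psi dpsi ddpsi phi dphi.

Local Notation fc := (fc a b).
Local Notation nrm := (nrm a b).
Local Notation Hnorm := (Hnorm a b).
Implicit Types (eps tau t : R) (N n : nat).

Lemma regular eps t : 0 < eps <= 1 -> 0 <= t <= T ->
  [/\ in_Hp a b (m0 + 4) (ofreal (phi eps) t), in_Hp a b (m0 + 4) (ofreal (dphi eps) t),
      in_Hp a b (m0 + 2) (psi eps t) & in_Hp a b m0 (dpsi eps t)].
Proof.
move=> he ht; have [[h1 h2 _] h3 [_ h4 _] _] := hA.1 eps he.
by split; [exact: (h1 t ht).1|exact: (h2 t ht).1|exact: (h3 t ht).1|exact: (h4 t ht).1].
Qed.

Lemma Hnorm_bounds eps t : 0 < eps <= 1 -> 0 <= t <= T ->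
  [/\ (Hnorm (m0 + 4) (ofreal (phi eps) t) <= LinfH a b T (m0 + 4) (ofreal (phi eps)))%E,
      (Hnorm (m0 + 4) (ofreal (dphi eps) t) <= LinfH a b T (m0 + 4) (ofreal (dphi eps)))%E,
      (Hnorm (m0 + 2) (psi eps t) <= LinfH a b T (m0 + 2) (psi eps))%E &
      (Hnorm m0 (dpsi eps t) <= LinfH a b T m0 (dpsi eps))%E].
Proof.
move=> he ht; have [[h1 h2 _] h3 [_ h4 _] _] := hA.1 eps he.
by split; apply: LinfH_le.
Qed.

(** All summands of the uniform bound are nonnegative, so each is at most [M]; [LinfH_le] makes this
    pointwise in time, and [Hnorm_hbound] transfers it to coefficients. *)
Lemma coefficient_bounds : exists B : R, forall eps t, 0 < eps <= 1 -> 0 <= t <= T ->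
  [/\ hbound (m0 + 4) B (fc (ofreal (phi eps) t)), hbound (m0 + 4) (B / eps ^+ 2) (fc (ofreal (dphi eps) t)),
      hbound (m0 + 2) B (fc (psi eps t)) & hbound m0 B (fc (dpsi eps t))].
Proof.
have [M hM] := hA.2.
have p4 : (0 < m0 + 4)%N by rewrite addn_gt0 orbT.
have p2 : (0 < m0 + 2)%N by rewrite addn_gt0 orbT.
have p0 : (0 < m0)%N by exact: leq_trans hm0.
have [C1 C10 hC1] := Hnorm_hbound hab p4; have [C2 C20 hC2] := Hnorm_hbound hab p2.
have [C3 C30 hC3] := Hnorm_hbound hab p0.
exists ((C1 + C2 + C3) * M) => eps t he ht.
have [r1 r2 r3 r4] := regular he ht; have [b1 b2 b3 b4] := Hnorm_bounds he ht.
have [e0 _] := andP he; have e2 : 0 < eps ^+ 2 by rewrite exprn_gt0.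
have e2E : (0 <= (eps ^+ 2)%:E)%E by rewrite lee_fin ltW.
have L0 m u : (0 <= LinfH a b T m u)%E by exact: LinfH_ge0.
have eL m u : (0 <= (eps ^+ 2)%:E * LinfH a b T m u)%E by exact: mule_ge0.
have [h1 h2] := hM eps he.
have M1 := le_trans b1 (le_trans (leeDl _ (eL _ _)) h1).
have M2 := le_trans (lee_wpmul2l e2E b2) (le_trans (leeDr _ (L0 _ _)) h1).
have h2' := le_trans (leeDl _ (eL _ _)) h2.
have M3 := le_trans b3 (le_trans (leeDl _ (L0 _ _)) h2').
have M4 := le_trans b4 (le_trans (leeDr _ (L0 _ _)) h2').
have M0 : 0 <= M by rewrite -lee_fin; exact: le_trans (Hnorm_ge0 _ _ _ _) M1.
have {}M2 : (Hnorm (m0 + 4) (ofreal (dphi eps) t) <= (M / eps ^+ 2)%:E)%E.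
  by rewrite EFinM lee_pdivlMr // muleC.
have c1 : C1 * M <= (C1 + C2 + C3) * M by rewrite ler_wpM2r //; lra.
have c2 : C2 * M <= (C1 + C2 + C3) * M by rewrite ler_wpM2r //; lra.
have c3 : C3 * M <= (C1 + C2 + C3) * M by rewrite ler_wpM2r //; lra.
split.
- exact: hbound_le c1 (hC1 _ _ r1 M1).
- apply: hbound_le (hC1 _ _ r2 M2); rewrite mulrA ler_wpM2r ?invr_ge0 // ltW //.
- exact: hbound_le c2 (hC2 _ _ r3 M3).
- exact: hbound_le c3 (hC3 _ _ r4 M4).
Qed.

Lemma in_Hp_le m m' f : (m <= m')%N -> in_Hp a b m' f -> in_Hp a b m f.
Proof.
move=> mm [[g hg] [g' hg']]; split; first by exists g => j jm; apply: hg; exact: leq_trans jm mm.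
by exists g' => j jm; apply: hg'; exact: leq_trans jm mm.
Qed.

Lemma mti_real eps tau N n : ~~ odd N ->
  real_vec (Phi (mti_fp a b psi0 phi0 phi1 eps tau N n)) /\
  real_vec (dPhi (mti_fp a b psi0 phi0 phi1 eps tau N n)).
Proof.
move=> No; case: n => [|n]; last exact: step_real.
by split=> j; apply: complex_ext; rewrite ?Re_conj ?Im_conj /= ?oppr0.
Qed.

(** The disjunction on [e] covers both error bounds, and also the smaller of the two, in one
    statement. The smallness condition on [K] is later turned into thresholds for [h] and [tau]. *)
Lemma discrete_error : exists K : R, 0 < K /\ forall eps tau N n,
  0 < eps <= 1 -> 0 < tau <= 1 -> (0 < N)%N -> ~~ odd N -> K * (N%:R ^- m0 + tau) <= 1 ->
  n%:R * tau <= T -> forall e : R,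
  e = K * (tau ^+ 2 / eps ^+ 2 + N%:R ^- m0) \/ e = K * (eps ^+ 2 + N%:R ^- m0) ->
  let t := n%:R * tau in
  [/\ (Hnorm 2 (fun x => (phi eps t x)%:C%C - phiI a b psi0 phi0 phi1 eps tau N n x)%R <= e%:E)%E,
      (Hnorm 2 (fun x => psi eps t x - psiI a b psi0 phi0 phi1 eps tau N n x)%R <= e%:E)%E &
      ((eps ^+ 2)%:E * Hnorm 2 (fun x => (dphi eps t x)%:C%C - dphiI a b psi0 phi0 phi1 eps tau N n x)%R <= e%:E)%E].
Proof.
have n8 : (2 * 4 <= m0 + 4)%N by lia.
have n6 : (2 * 3 <= m0 + 2)%N by lia.
have n24 : (2 <= m0 + 4)%N by lia.
have m2 : (2 <= m0 + 2)%N by lia.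
have m04 : (4 <= m0 + 4)%N by lia.
have m02 : (4 <= m0 + 2)%N by lia.
have s42 : (m0 + 2 <= m0 + 4)%N by lia.
have [B hB] := coefficient_bounds.
have B0 : 0 <= B.
  have h1 : 0 < (1 : R) <= 1 by rewrite ltr01 lexx.
  have h2 : 0 <= (0 : R) <= T by rewrite lexx ltW.
  by have [h _ _ _] := hB _ _ h1 h2; exact: hbound_ge0 h.
pose k := 1 + mu a b 1 ^+ 2; have k0 : 0 <= k by rewrite addr_ge0 // sqr_ge0.
(* Bound for the initial distance in units of [N^-m0]: two half-waves and psi, from [initial_error].
   The added 1 ensures [C0 >= 1], so that [N^-m0 <= dl]. *)
pose C0 := (2 * (k + k ^+ 2) + k) * (2 ^+ m0 * 8 * B) + 1.
have X0 : 0 <= 2 ^+ m0 * 8 * B by rewrite !mulr_ge0 // exprn_ge0.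
have C01 : 1 <= C0 by rewrite /C0 lerDr mulr_ge0 // addr_ge0 // mulr_ge0 // addr_ge0 // sqr_ge0.
(* Parameter type of the convergence argument; its last clause says [dl <= 1]. *)
pose Q := {q : R * R * nat | [/\ 0 < q.1.1 <= 1, 0 < q.1.2 <= 1, (0 < q.2)%N, ~~ odd q.2 & C0 / q.2%:R ^+ m0 <= 1]}.
pose E (q : Q) : R := (proj1_sig q).1.1; pose S (q : Q) : R := (proj1_sig q).1.2; pose N (q : Q) : nat := (proj1_sig q).2.
have hE q : 0 < E q <= 1 by case: q => q [].
have hS q : 0 < S q <= 1 by case: q => q [].
have hN q : (0 < N q)%N by case: q => q [].
have hNo q : ~~ odd (N q) by case: q => q [].
pose dl q := C0 / (N q)%:R ^+ m0.
have NR q : 0 < (N q)%:R ^+ m0 :> R by rewrite exprn_gt0 // ltr0n.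
have hdl q : 0 <= dl q <= 1.
  by rewrite /dl divr_ge0 ?(le_trans ler01 C01) ?(ltW (NR q)) //=; case: q => q [].
pose u q t := tr (N q) (fc (psi (E q) t)); pose u' q t := tr (N q) (fc (dpsi (E q) t)).
pose v q t := tr (N q) (fc (ofreal (phi (E q)) t)); pose w q t := tr (N q) (fc (ofreal (dphi (E q)) t)).
pose w' q t := tr (N q) (fc (ofreal (ddphi (E q)) t)).
(* [al] and [be] are defined as the defects of truncation and aliasing, so that the truncated
   equations hold by construction. *)
pose al q t l := tr (N q) (fc (fun x => ofreal (phi (E q)) t x * psi (E q) t x)) l - cconv a b (N q) (v q t) (u q t) l.
pose be q t l := tr (N q) (fc (fun x => conjc (psi (E q) t x) * psi (E q) t x)) l
  - cconv a b (N q) (cj a b (N q) (u q t)) (u q t) l.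
pose st q n := mti_fp a b psi0 phi0 phi1 (E q) (S q) (N q) n.
pose V q n := dft a b (Phi (st q n)); pose W q n := dft a b (dPhi (st q n)); pose U q n := dft a b (Psi (st q n)).
have ser q t : 0 <= t <= T -> [/\ series_to a b B (ofreal (phi (E q)) t),
    series_to a b (B / E q ^+ 2) (ofreal (dphi (E q)) t) & series_to a b B (psi (E q) t)].
  move=> ht; have [r1 r2 r3 r4] := regular (hE q) ht; have [h1 h2 h3 h4] := hB _ _ (hE q) ht.
  split.
  - exact: (in_Hp_series hab n24 r1 (hbound_mono n24 h1)).
  - exact: (in_Hp_series hab n24 r2 (hbound_mono n24 h2)).
  - exact: (in_Hp_series hab m2 r3 (hbound_mono m2 h3)).
have Du q j c : (j < N q)%N -> 0 <= c -> c + S q <= T ->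
    C1on 0 (S q) (fun s => u q (c + s) (freq (N q) j)) (fun s => u' q (c + s) (freq (N q) j)).
  move=> _ c0 cT; apply: (@C1on_tr _ _ _ _ (fun s => fc (psi (E q) (c + s))) (fun s => fc (dpsi (E q) (c + s)))).
  by have [_ _ h _] := hA.1 _ (hE q); exact: C1on_fc h c0 cT.
have Dv q j c : (j < N q)%N -> 0 <= c -> c + S q <= T ->
    C1on 0 (S q) (fun s => v q (c + s) (freq (N q) j)) (fun s => w q (c + s) (freq (N q) j)).
  move=> _ c0 cT; apply: (@C1on_tr _ _ _ _ (fun s => fc (ofreal (phi (E q)) (c + s))) (fun s => fc (ofreal (dphi (E q)) (c + s)))).
  by have [h _ _ _] := hA.1 _ (hE q); exact: C1on_fc h c0 cT.
have Dw q j c : (j < N q)%N -> 0 <= c -> c + S q <= T ->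
    C1on 0 (S q) (fun s => w q (c + s) (freq (N q) j)) (fun s => w' q (c + s) (freq (N q) j)).
  move=> _ c0 cT; apply: (@C1on_tr _ _ _ _ (fun s => fc (ofreal (dphi (E q)) (c + s))) (fun s => fc (ofreal (ddphi (E q)) (c + s)))).
  by have [_ [_ _ [_ h]] _ _] := hsol (hE q); exact: C1on_fc h c0 cT.
have hps q t : 0 <= t <= T -> in_Hp a b (m0 + 2) (psi (E q) t).
  by move=> ht; have [] := regular (hE q) ht.
have hph q t : 0 <= t <= T -> in_Hp a b (m0 + 2) (ofreal (phi (E q)) t).
  by move=> ht; have [h _ _ _] := regular (hE q) ht; apply: in_Hp_le h; rewrite leq_add2l.
have ODEu q j t : (j < N q)%N -> 0 < t < T -> let l := freq (N q) j in
    u' q t l = - ('i%C * (mu a b l ^+ 2)%:C%C * u q t l) + 'i%C * cconv a b (N q) (v q t) (u q t) l + 'i%C * al q t l.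
  move=> _ /andP[t0 tT] l; have tT' : 0 < t <= T by rewrite t0 ltW.
  rewrite /al -addrA -mulrDr [cconv _ _ _ _ _ _ + _]addrC subrK.
  rewrite /u' /u /tr; case: ifP => _; last by rewrite !mulr0 oppr0 addr0.
  by rewrite (ode_psi hab (hsol (hE q)) m2 (hps q) (hph q) l tT').
have ODEv q j t : (j < N q)%N -> 0 < t < T -> let l := freq (N q) j in
    (E q ^+ 2)%:C%C * (w' q t l + (omega a b (E q) l ^+ 2)%:C%C * v q t l)
      = cconv a b (N q) (cj a b (N q) (u q t)) (u q t) l + be q t l.
  move=> _ /andP[t0 tT] l; have tT' : 0 < t <= T by rewrite t0 ltW.
  rewrite /be [RHS]addrC subrK /w' /v /tr; case: ifP => _; last by rewrite !mulr0 addr0 mulr0.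
  have [e0 _] := andP (hE q).
  by rewrite (ode_phi hab (hsol (hE q)) m2 (hph q) l e0 tT').
have nb j f : (forall q t, 0 <= t <= T -> hbound (2 * j) B (f q t)) -> bd a b T N j (fun q t => tr (N q) (f q t)) (fun=> 1).
  move=> hf; have [C C00 hC] := nrm_hbound hab j.
  exists (C * B) => [|q t ht]; first exact: mulr_ge0.
  by rewrite mulr1; apply: hC; exact: hf.
have bv : bd a b T N 4 v (fun=> 1).
  apply: nb => q t ht; have [h _ _ _] := hB _ _ (hE q) ht; exact: hbound_mono h.
have bw4 : bd a b T N 4 (fun q t l => (E q ^+ 2)%:C%C * w q t l) (fun=> 1).
  have e : (fun q t l => (E q ^+ 2)%:C%C * w q t l) =
      (fun q t => tr (N q) (fun l => (E q ^+ 2)%:C%C * fc (ofreal (dphi (E q)) t) l)).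
    apply/funext => q; apply/funext => t; apply/funext => l; rewrite /w /tr.
    by case: ifP => // _; rewrite mulr0.
  rewrite e; apply: nb => q t ht; have [_ h _ _] := hB _ _ (hE q) ht.
  have [e0 _] := andP (hE q).
  by apply: hbound_scale; [rewrite exprn_gt0|exact: hbound_mono h].
have bu : bd a b T N 3 u (fun=> 1).
  apply: nb => q t ht; have [_ _ h _] := hB _ _ (hE q) ht; exact: hbound_mono h.
have bu' : bd a b T N 2 u' (fun=> 1).
  apply: nb => q t ht; have [_ _ _ h] := hB _ _ (hE q) ht; exact: hbound_mono h.
have [Ca Ca0 hCa] := alias_lim hab m0.
have dl_le (x : R) q : 0 <= x -> x / (N q)%:R ^+ m0 <= x * dl q.
  by move=> x0; rewrite /dl; apply: ler_wpM2l => //; rewrite -[leLHS]mul1r ler_wpM2r // invr_ge0 ltW.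
have bal : bd a b T N 1 al dl.
  exists (Ca * B ^+ 2) => [|q t ht]; first by rewrite mulr_ge0 // sqr_ge0.
  have [s1 _ s3] := ser q t ht; have [h1 _ h3 _] := hB _ _ (hE q) ht.
  apply: le_trans (dl_le _ q _); last by rewrite mulr_ge0 // sqr_ge0.
  by apply: (hCa (N q)) => //; apply: hbound_mono h1; rewrite leq_add2l.
have bbe : bd a b T N 1 be dl.
  exists (Ca * B ^+ 2) => [|q t ht]; first by rewrite mulr_ge0 // sqr_ge0.
  have [s1 _ s3] := ser q t ht; have [h1 _ h3 _] := hB _ _ (hE q) ht.
  have [sc fcc] := series_to_conj hab s3.
  apply: le_trans (dl_le _ q _); last by rewrite mulr_ge0 // sqr_ge0.
  apply: le_trans (hCa (N q) B _ _ (hNo q) (hN q) sc s3 _ h3); last by rewrite fcc; exact: hbound_refl.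
  rewrite /nrm le_eqVlt; apply/orP; left; apply/eqP; apply: wn_eq => j jN; congr (_ - _).
  apply: cconv_ext => // i iN; rewrite /u cj_tr // fcc //.
have v_real q t : 0 <= t <= T -> real_coef a b (N q) (v q t).
  move=> ht; apply: real_coef_fc => //; have [h _ _ _] := regular (hE q) ht.
  exact: cL2_cib (in_Hp_cL2 h).
have w_real q t : 0 <= t <= T -> real_coef a b (N q) (w q t).
  move=> ht; apply: real_coef_fc => //; have [_ h _ _] := regular (hE q) ht.
  exact: cL2_cib (in_Hp_cL2 h).
have num_U q n j : (j < N q)%N ->
    U q n.+1 (freq (N q) j) = cU1 a b (E q) (S q) (N q) (V q n) (W q n) (U q n) (freq (N q) j).
  by move=> jN; exact: step_U.
have num_eta q n j sg : sg ^+ 2 = 1 -> (j < N q)%N -> let l := freq (N q) j in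
    eta a b (E q) sg (V q n.+1) (W q n.+1) l = expi (sg * omega a b (E q) l * S q) * eta a b (E q) sg (V q n) (W q n) l
   + PP a b (E q) l sg (S q) * csq a b (N q) (U q n) l + QQ a b (E q) l sg (S q) * cre a b (S q) (N q) (V q n) (U q n) l.
  move=> hsg jN l; have [e0 _] := andP (hE q); have [r1 r2] := mti_real (E q) (S q) n (hNo q).
  exact: step_eta.
have dist0 q : edist a b N E S u v w V W U q 0%N <= dl q.
  have h0 : 0 <= (0 : R) <= T by rewrite lexx ltW.
  have [s1 s2 s3] := ser q 0 h0; have [h1 h2 h3 _] := hB _ _ (hE q) h0.
  have [_ _ _ ini] := hsol (hE q).
  have eV : V q 0%N =1 dft a b (@sample_vec R a b (N q) (ofreal (phi (E q)) 0)).
    move=> l; apply: dft_ext => j; rewrite /= /sample_vec /ofreal inord_lt.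
    by have [_ -> _] := ini _ (node_bd hab j (hN q)).
  have eW : W q 0%N =1 dft a b (@sample_vec R a b (N q) (ofreal (dphi (E q)) 0)).
    move=> l; apply: dft_ext => j; rewrite /= /sample_vec /ofreal inord_lt.
    by have [_ _ ->] := ini _ (node_bd hab j (hN q)).
  have eU : U q 0%N =1 dft a b (@sample_vec R a b (N q) (psi (E q) 0)).
    move=> l; apply: dft_ext => j; rewrite /= /sample_vec inord_lt.
    by have [-> _ _] := ini _ (node_bd hab j (hN q)).
  have p0 : (0 < m0)%N by exact: leq_trans hm0.
  have g sg (hsg : sg ^+ 2 = 1) := initial_error hab (hNo q) (hN q) (hE q) p0 hsg s1 s2 s3 h1 h2 h3 eV eW eU.
  have sg1 : (1 : R) ^+ 2 = 1 by rewrite expr1n.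
  have sg2 : (-1 : R) ^+ 2 = 1 by rewrite sqrrN expr1n.
  have [g1 g3] := g 1 sg1; have [g2 _] := g (-1) sg2.
  rewrite /edist mul0r; apply: le_trans (lerD (lerD g1 g2) g3) _.
  rewrite -/k /dl /C0 mulrDl -subr_ge0 (_ : _ - _ = 1 / (N q)%:R ^+ m0); first by rewrite divr_ge0 // ltW.
  by ring.
have [C [Cp conv]] := convergence hab hT hNo hN hS hE hdl Du Dv Dw ODEu ODEv bv bw4 bu bu' bal bbe v_real w_real num_U num_eta dist0.
have [Ct Ct0 hCt] := trig_error hab m0.
(* The sum of everything [K] has to dominate: [C0] for [dl <= 1], [C C0] and [C] for the condition
   of [convergence], and [Ct (C C0 + C + B)] for the final error. *)
pose K := C * C0 + C + C0 + Ct * (C * C0 + C + B) + 1.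
have CC0 : 0 <= C * C0 by rewrite mulr_ge0 ?(ltW Cp) // (le_trans ler01).
have CtB : 0 <= Ct * (C * C0 + C + B) by rewrite mulr_ge0 // !addr_ge0 // ltW.
have Kp : 0 < K by rewrite /K; lra.
exists K; split=> // eps tau N1 n he htau N10 N1o hK nT e hee t.
have NR1 : 0 < N1%:R ^+ m0 :> R by rewrite exprn_gt0 // ltr0n.
have iN : 0 <= N1%:R ^- m0 :> R by rewrite invr_ge0 ltW.
have [tau0 _] := andP htau; have [eps0 _] := andP he; have eps2 : 0 < eps ^+ 2 by rewrite exprn_gt0.
have tt : 0 <= t <= T by rewrite nT andbT mulr_ge0 // ltW.
have hq : C0 / N1%:R ^+ m0 <= 1.
  apply: le_trans hK; apply: ler_pM => //; [exact: le_trans C01|rewrite /K; lra|by rewrite lerDl ltW].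
pose q : Q := exist _ (eps, tau, N1) (And5 he htau N10 N1o hq).
have hc : C * (dl q + S q) <= 1.
  apply: le_trans hK; rewrite /dl /S /N /= mulrDr mulrDr; apply: lerD.
    by rewrite mulrA ler_wpM2r // /K; lra.
  by rewrite ler_wpM2r ?(ltW tau0) // /K; lra.
have [d1 d2] := conv q hc n nT.
set D := edist _ _ _ _ _ _ _ _ _ _ _ _ _ in d1 d2.
have te0 : 0 <= tau ^+ 2 / eps ^+ 2 by rewrite divr_ge0 ?sqr_ge0 // ltW.
have D0 : Ct * (D + B / N1%:R ^+ m0) <= e.
  have step x : 0 <= x -> D <= C * (x + dl q) -> Ct * (D + B / N1%:R ^+ m0) <= K * (x + N1%:R ^- m0).
    move=> x0 hD; rewrite /dl /N /= in hD.
    apply: le_trans (_ : Ct * (C * (x + C0 / N1%:R ^+ m0) + B / N1%:R ^+ m0) <= _).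
      by rewrite ler_wpM2l // lerD2r.
    apply: le_trans (_ : Ct * (C * C0 + C + B) * (x + N1%:R ^- m0) <= _); last first.
      by rewrite ler_wpM2r ?addr_ge0 // /K; lra.
    rewrite -mulrA ler_wpM2l // -subr_ge0.
    rewrite (_ : _ - _ = (C * C0 + B) * x + C * N1%:R ^- m0); last by ring.
    by rewrite addr_ge0 // mulr_ge0 ?addr_ge0 // ltW.
  by case: hee => ->; apply: step => //; rewrite ltW.
have [h1 h2 h3 _] := hB _ _ he tt; have [r1 r2 r3 _] := regular he tt.
have nn c : 0 <= nrm N1 1 c by exact: wn_ge0.
have nV := nrm_eta_V a b eps N1 1 (fun l => V q n l - v q t l) (fun l => W q n l - w q t l).
have nW := nrm_eta_W a b eps N1 1 (fun l => V q n l - v q t l) (fun l => W q n l - w q t l).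
have DV : nrm N1 1 (fun l => V q n l - v q t l) <= D.
  by apply: le_trans nV _; rewrite /D /edist lerDl.
have DW : nrm N1 1 (fun l => (eps ^+ 2)%:C%C * (W q n l - w q t l)) <= D.
  by apply: le_trans nW _; rewrite /D /edist lerDl.
have DU : nrm N1 1 (fun l => U q n l - u q t l) <= D.
  by rewrite /D /edist lerDr addr_ge0.
split.
- apply: le_trans (hCt N1 _ _ B (V q n) N10 m04 r1 (hbound_mono s42 h1)) _; rewrite lee_fin.
  exact: le_trans (ler_wpM2l Ct0 (lerD DV (lexx _))) D0.
- apply: le_trans (hCt N1 _ _ B (U q n) N10 m02 r3 h3) _; rewrite lee_fin.
  exact: le_trans (ler_wpM2l Ct0 (lerD DU (lexx _))) D0.
- have e2E : (0 <= (eps ^+ 2)%:E)%E by rewrite lee_fin ltW.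
  apply: le_trans (lee_wpmul2l e2E (hCt N1 _ _ _ (W q n) N10 m04 r2 (hbound_mono s42 h2))) _.
  rewrite -EFinM lee_fin; apply: le_trans D0; rewrite mulrCA ler_wpM2l // mulrDr; apply: lerD.
    by move: DW; rewrite /nrm wnZ cnorm_real gtr0_norm.
  by rewrite mulrA [eps ^+ 2 * _]mulrC divfK ?gt_eqF.
Qed.

End error_estimate.

Lemma Hnorm_perturb (R : realType) (a b : R) (hab : a < b) m (f g : R -> R[i]) (e : R) :
  (Hnorm a b m (fun x => f x - g x)%R <= e%:E)%E -> (Hnorm a b m g <= Hnorm a b m f + e%:E)%E.
Proof.
move=> he; have f0 := Hnorm_ge0 a b m f.
have [->|fy] := eqVneq (Hnorm a b m f) +oo%E; first by rewrite addye // leey.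
have ff : Hnorm a b m f \is a fin_num by rewrite ge0_fin_numE // ltey.
have hf : (Hnorm a b m f <= (fine (Hnorm a b m f))%:E)%E by rewrite fineK.
have := HnormD hab hf (le_trans (HnormN hab m _) he); rewrite EFinD fineK //.
by have -> : (fun t => f t + - (f t - g t)) = g by apply/funext => x; ring.
Qed.

Lemma min_le_tau (R : realType) (eps tau : R) : 0 < eps -> 0 < tau ->
  Num.min (tau ^+ 2 / eps ^+ 2) (eps ^+ 2) <= tau.
Proof.
move=> e0 t0; have e2 : 0 < eps ^+ 2 by rewrite exprn_gt0.
rewrite ge_min; have [_|h] := leP (eps ^+ 2) tau; first by rewrite orbT.
by rewrite ler_pdivrMr // expr2 ler_wpM2l ?(ltW t0) // ltW.
Qed.

Local Close Scope classical_set_scope.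

Theorem theorem4p1 (R : realType) (a b T : R) (m0 : nat)
    (psi0 : R -> R[i]) (phi0 phi1 : R -> R)
    (psi dpsi ddpsi : R -> R -> R -> R[i]) (phi dphi ddphi : R -> R -> R -> R)
    (hab : a < b) (hT : 0 < T) (hm0 : (4 <= m0)%N)
    (hTmax : forall eps : R, 0 < eps <= 1 ->
      (T%:E < max_existence_time a b psi0 phi0 phi1 eps)%E)
    (hsol : forall eps : R, 0 < eps <= 1 ->
      kgs_solution a b psi0 phi0 phi1 eps T
        (psi eps) (dpsi eps) (phi eps) (dphi eps) (ddphi eps))
    (hA : assumption_A a b T m0 psi dpsi ddpsi phi dphi) :
  exists h0 tau0 C : R,
    [/\ 0 < h0 <= 1, 0 < tau0 <= 1, 0 < C &
     forall (eps tau : R) (N n : nat),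
       0 < eps <= 1 -> 0 < tau <= tau0 ->
       (0 < N)%N -> ~~ odd N -> 0 < mesh a b N <= h0 ->
       n%:R <= T / tau ->
       let h := mesh a b N in
       let err := mti_error a b psi0 phi0 phi1 eps tau N
                    (psi eps) (phi eps) (dphi eps) n in
       [/\ (err <= (C * (h ^+ m0 + tau ^+ 2 / eps ^+ 2))%:E)%E,
           (err <= (C * (h ^+ m0 + eps ^+ 2))%:E)%E,
           [/\ (Hnorm a b 2 (phiI a b psi0 phi0 phi1 eps tau N n)
                  <= C_phi a b T m0 phi dphi + 1)%E,
               (Hnorm a b 2 (psiI a b psi0 phi0 phi1 eps tau N n)
                  <= C_psi a b T m0 psi + 1)%E &
               (Hnorm a b 2 (dphiI a b psi0 phi0 phi1 eps tau N n)
                  <= (eps ^- 2)%:E * (C_phi a b T m0 phi dphi + 1))%E] &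
           (err <= (C * (h ^+ m0
                         + Num.min (tau ^+ 2 / eps ^+ 2) (eps ^+ 2)))%:E)%E /\
           C * (h ^+ m0 + Num.min (tau ^+ 2 / eps ^+ 2) (eps ^+ 2))
             <= C * (h ^+ m0 + tau)]].
Proof.
have [K [K0 core]] := discrete_error hab hT hm0 hsol hA.
have L0 : 0 < b - a by rewrite subr_gt0.
pose D := (b - a) ^- m0; have D0 : 0 < D by rewrite invr_gt0 exprn_gt0.
have KD : 0 < 2 * K * D by rewrite !mulr_gt0.
have K2 : 0 < 2 * K by rewrite mulr_gt0.
(* [D] converts [N^-m0] into [D h^m0]. The thresholds make [K D h] and [K tau] at most 1/2 each, and
   the factor 3 counts the three norms in the error. *)
exists (Num.min 1 (2 * K * D)^-1), (Num.min 1 (2 * K)^-1), (3 * K * (1 + D)).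
have C0 : 0 < 3 * K * (1 + D) by rewrite !mulr_gt0 // addr_gt0.
split=> //.
- by rewrite lt_min ltr01 invr_gt0 KD ge_min lexx.
- by rewrite lt_min ltr01 invr_gt0 K2 ge_min lexx.
move=> eps tau N n he /andP[tau0]; rewrite le_min => /andP[tau1 tauK] N0 No /andP[mh0].
rewrite le_min => /andP[mh1 mhK] hn h err; rewrite -/h in mh0 mh1 mhK.
have [e0 e1] := andP he; have eps2 : 0 < eps ^+ 2 by rewrite exprn_gt0.
have XE : N%:R ^- m0 = D * h ^+ m0.
  rewrite /D /h /mesh expr_div_n mulrA mulVf ?mul1r // expf_neq0 // gt_eqF //.
have hm : h ^+ m0 <= h.
  by rewrite -[leRHS]expr1; apply: ler_wiXn2l => //; [exact: ltW|exact: leq_trans hm0].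
have hX0 : 0 <= h ^+ m0 by rewrite exprn_ge0 // ltW.
have small : K * (N%:R ^- m0 + tau) <= 1.
  rewrite XE mulrDr (_ : 1 = 2^-1 + 2^-1); last by field.
  apply: lerD.
    apply: le_trans (_ : K * D * h <= _); first by rewrite mulrA ler_wpM2l // mulr_ge0 // ltW.
    by move: mhK; rewrite -div1r ler_pdivlMr //; lra.
  by move: tauK; rewrite -div1r ler_pdivlMr //; lra.
have htau : 0 < tau <= 1 by rewrite tau0.
have nT : n%:R * tau <= T by rewrite -ler_pdivlMr.
have t0 : 0 <= n%:R * tau <= T by rewrite nT mulr_ge0 // ltW.
have te0 : 0 <= tau ^+ 2 / eps ^+ 2 by rewrite divr_ge0 ?sqr_ge0 // ltW.
have bound x : 0 <= x -> K * (x + N%:R ^- m0) <= K * (1 + D) * (h ^+ m0 + x).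
  move=> x0; rewrite XE -mulrA ler_wpM2l ?(ltW K0) // -subr_ge0.
  rewrite (_ : _ - _ = h ^+ m0 + D * x); last by ring.
  by rewrite addr_ge0 // mulr_ge0 // ltW.
have total x : 0 <= x -> (x = tau ^+ 2 / eps ^+ 2 \/ x = eps ^+ 2) ->
    (err <= (3 * K * (1 + D) * (h ^+ m0 + x))%:E)%E.
  move=> x0 hx; have [|c1 c2 c3] := core eps tau N n he htau N0 No small nT (K * (x + N%:R ^- m0)).
    by case: hx => ->; [left|right].
  apply: le_trans (leeD (leeD c1 c2) c3) _; rewrite -!EFinD lee_fin.
  have := bound x x0; lra.
(* The bounds on the numerical solution use the smaller of the two errors: it is at most [tau],
   hence [K (mi + N^-m0) <= 1] by the choice of the thresholds. *)
pose mi := Num.min (tau ^+ 2 / eps ^+ 2) (eps ^+ 2).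
have hmi : mi = tau ^+ 2 / eps ^+ 2 \/ mi = eps ^+ 2.
  by rewrite /mi minElt; case: ifP => _; [left|right].
have mi0 : 0 <= mi by rewrite /mi le_min te0 ltW.
have mit : mi <= tau by exact: min_le_tau.
have [|c1 c2 c3] := core eps tau N n he htau N0 No small nT (K * (mi + N%:R ^- m0)).
  by case: hmi => ->; [left|right].
have em1 : K * (mi + N%:R ^- m0) <= 1.
  by apply: le_trans small; rewrite ler_wpM2l ?(ltW K0) // addrC lerD2l.
have [b1 b2 b3 _] := Hnorm_bounds hab hT hA he t0.
have up1 : (maxe (LinfH a b T (m0 + 4) (ofreal (phi eps)))
     ((eps ^+ 2)%:E * LinfH a b T (m0 + 4) (ofreal (dphi eps))) <= C_phi a b T m0 phi dphi)%E.
  by apply: ereal_sup_ubound; exists eps.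
have up2 : (LinfH a b T (m0 + 2) (psi eps) <= C_psi a b T m0 psi)%E.
  by apply: ereal_sup_ubound; exists eps.
have m24 : (2 <= m0 + 4)%N by rewrite addnC.
have m22 : (2 <= m0 + 2)%N by rewrite leq_addl.
split; [exact: total (or_introl erefl)|exact: total (ltW eps2) (or_intror erefl)| |]; last first.
  by split; [exact: total|rewrite ler_wpM2l ?(ltW C0) // lerD2l].
split.
- apply: le_trans (Hnorm_perturb hab c1) _; apply: leeD; last by rewrite lee_fin.
  apply: le_trans (Hnorm_mono _ _ _ m24) (le_trans b1 (le_trans _ up1)).
  by rewrite le_max lexx.
- apply: le_trans (Hnorm_perturb hab c2) _; apply: leeD; last by rewrite lee_fin.
  exact: le_trans (Hnorm_mono _ _ _ m22) (le_trans b3 up2).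
- have c3' : (Hnorm a b 2 (fun x => (dphi eps (n%:R * tau) x)%:C%C - dphiI a b psi0 phi0 phi1 eps tau N n x)%R
      <= (K * (mi + N%:R ^- m0) / eps ^+ 2)%:E)%E.
    by rewrite EFinM lee_pdivlMr // muleC.
  have i0 : (0 <= (eps ^- 2)%:E)%E by rewrite lee_fin invr_ge0 ltW.
  have Cp0 : (0 <= C_phi a b T m0 phi dphi)%E.
    by apply: le_trans up1; rewrite le_max LinfH_ge0.
  apply: le_trans (Hnorm_perturb hab c3') _; rewrite ge0_muleDr //; apply: leeD.
    apply: le_trans (Hnorm_mono _ _ _ m24) (le_trans b2 _).
    rewrite muleC lee_pdivlMr // muleC; apply: le_trans up1.
    by rewrite le_max lexx orbT.
  by rewrite mule1 lee_fin -[leRHS]mul1r ler_wpM2r // invr_ge0 ltW.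
Qed.
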